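(* Let $\alpha\in(0,1)$ and let $\pi_\alpha\propto\exp(-V_\alpha)$ on $\mathbb{R}^d$ with $V_\alpha(x)=(1+\|x\|^2)^{\alpha/2}$. Let $q\in[2,\infty)$ and $0<\varepsilon\le q^{-1}$. (i) There is a constant $C_{\alpha,q}$ depending only on $\alpha,q$ such that, for the Langevin diffusion with target $\pi_\alpha$ started from $\rho_0$ with $R_\infty(\rho_0\,\|\,\pi_\alpha)<\infty$, the law $\rho_T$ at time $T$ satisfies $R_q(\rho_T\,\|\,\pi_\alpha)\le\varepsilon$ whenever $$T\ge C_{\alpha,q}\inf_{\gamma\in(0,2\alpha]}\Big\{\Big(d^{\frac2\gamma(2-2\alpha+\gamma)}+R_\infty(\rho_0\,\|\,\pi_\alpha)^{\frac{2-2\alpha+\gamma}{\alpha}}\Big)\big(R_q(\rho_0\,\|\,\pi_\alpha)+\ln(1/\varepsilon)\big)+\ln(1/\varepsilon)^{\frac{2-\alpha+\gamma}{\alpha}}\Big\}.$$ (ii) Let $\mu_0$ satisfy $R_\infty(\mu_0\,\|\,\pi_\alpha)<\infty$, let $T$, $m$, $\hat\pi_\alpha$ be as defined in the context, and assume $m,T,R_2(\mu_0\,\|\,\hat\pi_\alpha)\ge1$. Then, for a suitable sufficiently small step size $h>0$, the law $\mu_N$ of LMC with target $\pi_\alpha$ and initial law $\mu_0$ after $N$ iterations satisfies $R_q(\mu_N\,\|\,\pi_\alpha)\le\varepsilon$ with $$N=\tilde\Theta_{\alpha,q}\left(\frac{\big(d^{4/\alpha}+R_\infty(\mu_0\,\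|\,\pi_\alpha)^{4/\alpha}\big)R_{2q-1}(\mu_0\,\|\,\pi_\alpha)^2\,d}{\varepsilon}\max\left\{1,\frac{\sqrt{\varepsilon\,R_2(\mu_0\,\|\,\hat\pi_\alpha)}}{d}\right\}\right).$$
   Context: Langevin diffusion for $\pi\propto e^{-V}$: $\mathrm{d}X_t=-\nabla V(X_t)\,\mathrm{d}t+\sqrt2\,\mathrm{d}B_t$, $\rho_t$ the law of $X_t$. Langevin Monte Carlo (LMC) with step size $h>0$: $x_{k+1}=x_k-h\nabla V(x_k)+\sqrt{2h}\,\xi_k$, with $(\xi_k)$ i.i.d. standard Gaussian vectors independent of $x_0\sim\mu_0$; $\mu_k$ is the law of $x_k$. Rényi divergence: for $1<q<\infty$, $R_q(\rho\,\|\,\pi)=\frac1{q-1}\ln\big\|\frac{\mathrm{d}\rho}{\mathrm{d}\pi}\big\|_{L^q(\pi)}^q$ if $\rho\ll\pi$ and $+\infty$ otherwise; $R_\infty(\rho\,\|\,\pi)=\ln\|\mathrm{d}\rho/\mathrm{d}\pi\|_{L^\infty(\pi)}$. Quantities in (ii): $m:=\frac12\inf\{R:\pi_\alpha(\|x\|\ge R)\le\frac12\}$; $\delta_0:=\exp((2q-1)R_\infty(\mu_0\,\|\,\pi_\alpha))$; $T:=(2q-1)\{\beta(\frac1{4\delta_0})R_{2q-1}(\mu_0\,\|\,\pi_\alpha)+\beta(\frac{\varepsilon}{8\delta_0})\ln(\frac2\varepsilon)\}$, where $\beta(r)=\inf_{\gamma\in(0,2\alpha]}C_\alpha\big(d^{\frac{2(2-2\alpha+\gamma)}{\gamma}}+\ln(r^{-1})^{\frac{2-2\alpha+\gamma}{\alpha}}\big)$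 and $C_\alpha$ is a constant depending only on $\alpha$ for which this $\beta$ is a weak Poincaré weight for $\pi_\alpha$, i.e. $\operatorname{Var}_{\pi_\alpha}(f)\le\beta(r)\mathbb{E}_{\pi_\alpha}[\|\nabla f\|^2]+r(\sup f-\inf f)^2$ for all $f\in\mathcal{C}^\infty(\mathbb{R}^d)$, $r>0$ (with $\ln(r^{-1})$ read as $\max\{\ln(r^{-1}),0\}$ when $r>1$); and $\hat\pi_\alpha(x)\propto\exp\big(-V_\alpha(x)-\frac1{6144T}\max\{\|x\|-2m,0\}^2\big)$. $N=\tilde\Theta_{\alpha,q}(A)$ means that $N$ equals $A$ up to multiplicative constants depending only on $\alpha,q$ and polylogarithmic factors (in the quantities $d$, $1/\varepsilon$ and the initial divergences). All probability measures have Lebesgue densities.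
   Formalization: In (ii), R_{2q-1}(μ₀‖π_α) in the order of N is replaced by max{1, R_{2q-1}(μ₀‖π_α)}, since for divergences of order ε the displayed order tends to 0 and would force N = 0; R_2(μ₀‖π̂_α) is also assumed finite, as otherwise the order is infinite. *)

(* Defs.v *)
(* MathComp-Analysis *)
From HB Require Import structures.
From mathcomp Require Import all_boot all_order all_algebra.
From mathcomp Require Import all_classical all_reals all_analysis.
From mathcomp Require Import measurable_realfun.

Set Implicit Arguments.
Unset Strict Implicit.
Unset Printing Implicit Defensive.

Import Order.TTheory GRing.Theory Num.Theory.
Import numFieldNormedType.Exports.

Local Open Scope classical_set_scope.
Local Open Scope ring_scope.
Local Open Scope charge_scope.

(* The Borel sigma-algebra of R^n, as the product sigma-algebra. *)
Section measurable_rV.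
Context {R : realType} {n : nat}.

Definition rV_coor (i : 'I_n) (x : 'rV[R]_n) : R := x ord0 i.

Let rV_set0 : g_sigma_preimage rV_coor set0.
Proof. exact: sigma_algebra0. Qed.

Let rV_setC A : g_sigma_preimage rV_coor A -> g_sigma_preimage rV_coor (~` A).
Proof. exact: sigma_algebraC. Qed.

Let rV_bigcup (F : _^nat) : (forall i, g_sigma_preimage rV_coor (F i)) ->
  g_sigma_preimage rV_coor (\bigcup_i (F i)).
Proof. exact: sigma_algebra_bigcup. Qed.

HB.instance Definition _ := @isMeasurable.Build
  (measure_tuple_display default_measure_display)
  'rV[R]_n (g_sigma_preimage rV_coor) rV_set0 rV_setC rV_bigcup.
End measurable_rV.

Section measurable_rV_lemmas.
Context {R : realType}.

Lemma measurable_coor n (i : 'I_n) : measurable_fun [set: 'rV[R]_n] (rV_coor i).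
Proof.
move=> _ Y mY; rewrite setTI; apply: sub_sigma_algebra => /=.
rewrite -bigcup_seq/=; exists i => /=; first by rewrite mem_index_enum.
by exists Y => //; rewrite setTI.
Qed.

Lemma measurable_fun_coorP d (T : measurableType d) n (f : T -> 'rV[R]_n) :
  measurable_fun [set: T] f <->
  forall i, measurable_fun [set: T] (rV_coor i \o f).
Proof.
split=> [mf i|mf]; first exact: measurableT_comp (measurable_coor i) mf.
move=> _ A mA; rewrite setTI.
have : g_sigma_preimage (fun i => rV_coor i \o f) (f @^-1` A).
  by rewrite g_sigma_preimage_comp; exists A => //; rewrite setTI.
apply: smallest_sub; first exact: sigma_algebra_measurable.
rewrite -bigcup_seq => B [i _ [C mC <-]].
exact: mf.
Qed.

Definition rV_cons n (p : measurableTypeR R * 'rV[R]_n) : 'rV[R]_n.+1 :=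
  row_mx (const_mx p.1 : 'rV_1) p.2.

Definition rV_uncons n (v : 'rV[R]_n.+1) : measurableTypeR R * 'rV[R]_n :=
  (v ord0 ord0, @rsubmx R 1 1 n v).

Lemma rV_consK n : cancel (@rV_cons n) (@rV_uncons n).
Proof.
move=> [x v]; rewrite /rV_uncons /rV_cons /= row_mxKr; congr pair.
by rewrite mxE; case: splitP => // j _; rewrite mxE.
Qed.

Lemma rV_unconsK n : cancel (@rV_uncons n) (@rV_cons n).
Proof.
move=> v; rewrite /rV_uncons /rV_cons /=.
rewrite -[RHS](@hsubmxK R 1 1 n).
suff -> : const_mx (v ord0 ord0) = @lsubmx R 1 1 n v by [].
by apply/rowP => i; rewrite !mxE (ord1 i) lshift0 ord1.
Qed.

Lemma measurable_rV_cons n : measurable_fun [set: _] (@rV_cons n).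
Proof.
apply/measurable_fun_coorP => i.
have [->|[j ->]] : i = ord0 \/ exists j, i = rshift 1 j.
  case: (unliftP ord0 i) => [j ->|->]; last by left.
  by right; exists j; exact/val_inj.
- rewrite (_ : _ \o _ = fst) //; apply/funext => -[x v] /=.
  by have [] := rV_consK (x, v).
- rewrite (_ : _ \o _ = rV_coor j \o snd).
    by apply: measurableT_comp => //; exact: measurable_coor.
  apply/funext => -[x v] /=.
  exact: (@row_mxEr _ 1 1 n (const_mx x) v).
Qed.

Lemma measurable_rV_uncons n : measurable_fun [set: _] (@rV_uncons n).
Proof.
apply/measurable_fun_pairP; split => /=.
  exact: (measurable_coor (ord0 : 'I_n.+1)).
apply/measurable_fun_coorP => i.
rewrite (_ : _ \o _ = rV_coor (rshift 1 i : 'I_n.+1)).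
  exact: measurable_coor.
by apply/funext => v; rewrite /rV_coor /= mxE.
Qed.

End measurable_rV_lemmas.

Section lebesgue_rV.
Context {R : realType}.

Section step.
Context {n : nat} (mu : {sigma_finite_measure set 'rV[R]_n -> \bar R}).

Definition lebesgue_rV_step : set 'rV[R]_n.+1 -> \bar R :=
  pushforward (@lebesgue_measure R \x mu)%E (@rV_cons R n).

HB.instance Definition _ := Measure.copy lebesgue_rV_step
  (measure_function_pushforward__canonical__measure_function_Measure
    (@lebesgue_measure R \x mu)%E (@measurable_rV_cons R n)).

Let sigma_finite_lebesgue_rV_step : sigma_finite setT lebesgue_rV_step.
Proof.
have /sigma_finiteP[F [FT ndF Foo]] := sigma_finiteT (@lebesgue_measure R).
have /sigma_finiteP[G [GT ndG Goo]] := sigma_finiteT mu.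
exists (fun i => @rV_uncons R n @^-1` (F i `*` G i)).
  rewrite -preimage_bigcup (_ : \bigcup_i _ = setT) ?preimage_setT//.
  apply/seteqP; split=> // -[x y] _.
  have [i _ Fx] : (\bigcup_i F i) x by rewrite -FT.
  have [j _ Gy] : (\bigcup_i G i) y by rewrite -GT.
  exists (maxn i j) => //; split => /=.
    by move: x Fx; exact/subsetPset/ndF/leq_maxl.
  by move: y Gy; exact/subsetPset/ndG/leq_maxr.
move=> i; have [mF Fi] := Foo i; have [mG Gi] := Goo i; split.
  rewrite -[X in measurable X]setTI; apply: measurable_rV_uncons => //.
  exact: measurableX.
rewrite /lebesgue_rV_step /pushforward -comp_preimage.
rewrite (_ : _ \o _ = id); last by apply/funext => p /=; rewrite rV_consK.
rewrite preimage_id product_measure1E//.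
by rewrite lte_mul_pinfty// ge0_fin_numE.
Qed.

HB.instance Definition _ := @Measure_isSigmaFinite.Build _ _ _
  lebesgue_rV_step sigma_finite_lebesgue_rV_step.
End step.

Fixpoint lebesgue_rV (n : nat) : {sigma_finite_measure set 'rV[R]_n -> \bar R} :=
  match n with
  | 0 => @dirac _ 'rV[R]_0 0 R
  | n'.+1 => lebesgue_rV_step (lebesgue_rV n')
  end.

End lebesgue_rV.

Section euclidean.
Context {R : realType} {n : nat}.

(* The library norm `|x| on 'rV[R]_n is the sup norm. *)
Definition enorm (x : 'rV[R]_n) : R := Num.sqrt (\sum_(i < n) x ord0 i ^+ 2).

Definition partial (i : 'I_n) (f : 'rV[R]_n -> R) (x : 'rV[R]_n) : R :=
  'D_(delta_mx ord0 i) f x.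

Definition grad (f : 'rV[R]_n -> R) (x : 'rV[R]_n) : 'rV[R]_n :=
  \row_(i < n) partial i f x.

Fixpoint Ck (k : nat) (f : 'rV[R]_n -> R) : Prop :=
  continuous f /\
  if k is k'.+1 then forall i : 'I_n,
    (forall x, derivable f x (delta_mx ord0 i)) /\ Ck k' (partial i f)
  else True.

Definition smooth (f : 'rV[R]_n -> R) : Prop := forall k, Ck k f.

Lemma measurable_enorm : measurable_fun [set: 'rV[R]_n] enorm.
Proof.
apply: (measurableT_comp (continuous_measurable_fun (@sqrt_continuous R))).
apply: measurable_sum => i.
exact: (measurable_funX 2 (measurable_coor i)).
Qed.

End euclidean.

Section gibbs.
Context {R : realType} {n : nat} (V : {mfun 'rV[R]_n >-> R}).
Local Open Scope ereal_scope.

Definition gibbs_mass : set 'rV[R]_n -> \bar R :=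
  fun A => \int[lebesgue_rV n]_(x in A) (expR (- V x))%:E.

Let gibbs_mass0 : gibbs_mass set0 = 0.
Proof. exact: integral_set0. Qed.

Let gibbs_mass_ge0 A : 0 <= gibbs_mass A.
Proof. by apply: integral_ge0 => x _; rewrite lee_fin expR_ge0. Qed.

Let gibbs_mass_sigma_additive : semi_sigma_additive gibbs_mass.
Proof.
apply: semi_sigma_additive_nng_induced => [|x]; last by rewrite lee_fin expR_ge0.
apply/measurable_EFinP; apply: measurableT_comp => //.
exact: measurable_funN.
Qed.

HB.instance Definition _ := isMeasure.Build _ _ _
  gibbs_mass gibbs_mass0 gibbs_mass_ge0 gibbs_mass_sigma_additive.

(* The probability measure with density proportional to exp(-V); the Dirac mass
   is only the default value when exp(-V) is not integrable. *)
Definition gibbs : probability 'rV[R]_n R :=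
  mnormalize gibbs_mass (@dirac _ 'rV[R]_n 0%R R).

End gibbs.

Section potentials.
Context {R : realType} (n : nat).

Definition V_alpha (a : R) (x : 'rV[R]_n) : R := (1 + enorm x ^+ 2) `^ (a / 2).

Lemma measurable_V_alpha a : measurable_fun [set: 'rV[R]_n] (V_alpha a).
Proof.
apply: (@measurableT_comp _ _ _ _ _ _ (@powR R ^~ (a / 2)) _
  (fun x : 'rV[R]_n => 1 + enorm x ^+ 2)); first exact: measurable_powR.
apply: measurable_funD => //.
exact: (measurable_funX 2 measurable_enorm).
Qed.

HB.instance Definition _ a :=
  isMeasurableFun.Build _ _ _ _ (V_alpha a) (measurable_V_alpha a).

Definition V_hat (a T m : R) (x : 'rV[R]_n) : R :=
  V_alpha a x + (6144 * T)^-1 * Num.max (enorm x - 2 * m) 0 ^+ 2.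

Lemma measurable_V_hat a T m : measurable_fun [set: 'rV[R]_n] (V_hat a T m).
Proof.
apply: measurable_funD; first exact: measurable_V_alpha.
apply: measurable_funM => //.
apply: (measurable_funX 2).
apply: measurable_maxr => //.
apply: measurable_funB => //.
exact: measurable_enorm.
Qed.

HB.instance Definition _ a T m :=
  isMeasurableFun.Build _ _ _ _ (V_hat a T m) (measurable_V_hat a T m).

End potentials.

Arguments V_alpha {R} n a x.
Arguments V_hat {R} n a T m x.

Section renyi.
Context {d} {X : measurableType d} {R : realType}.
Variables (rho pi : probability X R).
Local Open Scope ereal_scope.

Let density : X -> \bar R := 'd (charge_of_finite_measure rho) '/d pi.

Definition renyi (q : R) : \bar R :=
  if `[< rho `<< pi >]
  then ((q - 1)^-1)%:E * lne ('N[pi]_q%:E[density] `^ q)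
  else +oo.

Definition renyi_infty : \bar R :=
  if `[< rho `<< pi >] then lne ('N[pi]_+oo[density]) else +oo.

End renyi.

Section processes.
Context {R : realType} {n : nat} {d} {Omega : measurableType d}.
Variable P : probability Omega R.
Local Open Scope ereal_scope.

Definition has_law (X : {RV P >-> 'rV[R]_n}) (mu : probability 'rV[R]_n R) :=
  forall A, measurable A -> distribution P X A = mu A.

(* Independent increments whose coordinates are independent centered Gaussians
   of standard deviation sqrt(t - s). *)
Definition brownian_motion (B : R -> {RV P >-> 'rV[R]_n}) : Prop :=
  [/\ {ae P, forall w, B 0%R w = 0%R},
      forall (k : nat) (t : nat -> R) (A : 'I_k -> 'I_n -> set R),
        (0 <= t 0%N)%R -> (forall j, (t j < t j.+1)%R) ->
        (forall j i, measurable (A j i)) ->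
        P [set w | forall j i, A j i ((B (t j.+1) w - B (t j) w)%R ord0 i)] =
        \prod_(j < k) \prod_(i < n)
          normal_prob 0 (Num.sqrt (t j.+1 - t j)) (A j i) &
      {ae P, forall w, {within [set t | (0 <= t)%R], continuous (B ^~ w)}}].

Definition independent_of_process
    (X : {RV P >-> 'rV[R]_n}) (B : R -> {RV P >-> 'rV[R]_n}) : Prop :=
  forall (k : nat) (t : 'I_k -> R) (A : set 'rV[R]_n) (C : 'I_k -> set 'rV[R]_n),
    (forall j, (0 <= t j)%R) -> measurable A -> (forall j, measurable (C j)) ->
    P [set w | A (X w) /\ forall j, C j (B (t j) w)] =
    P [set w | A (X w)] * P [set w | forall j, C j (B (t j) w)].

(* X is a continuous solution of dX = - grad V(X) dt + sqrt 2 dB started from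
   rho0; as the noise is additive, the equation in integral form is pathwise. *)
Definition langevin_diffusion (V : 'rV[R]_n -> R) (rho0 : probability 'rV[R]_n R)
    (B X : R -> {RV P >-> 'rV[R]_n}) : Prop :=
  [/\ brownian_motion B, has_law (X 0%R) rho0, independent_of_process (X 0%R) B,
      {ae P, forall w, {within [set t | (0 <= t)%R], continuous (X ^~ w)}} &
      {ae P, forall w, forall (t : R) (i : 'I_n), (0 <= t)%R ->
        (X t w ord0 i = X 0 w ord0 i
          - \int[lebesgue_measure]_(s in `[0, t]) grad V (X s w) ord0 i
          + Num.sqrt 2 * B t w ord0 i)%R}].

(* The second clause is the joint law of (x 0, xi 0, xi 1, ...): x 0 ~ mu0, each
   xi k has independent N(0, 1) coordinates, and all these are independent. *)
Definition langevin_monte_carlo (V : 'rV[R]_n -> R) (h : R)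
    (mu0 : probability 'rV[R]_n R) (xi x : nat -> {RV P >-> 'rV[R]_n}) : Prop :=
  [/\ has_law (x 0%N) mu0,
      forall (k : nat) (A : set 'rV[R]_n) (C : 'I_k -> 'I_n -> set R),
        measurable A -> (forall j i, measurable (C j i)) ->
        P [set w | A (x 0%N w) /\ forall j i, C j i (xi j w ord0 i)] =
        mu0 A * \prod_(j < k) \prod_(i < n) normal_prob 0 1 (C j i) &
      forall k w, x k.+1 w =
        (x k w - h *: grad V (x k w) + Num.sqrt (2 * h) *: xi k w)%R].

End processes.

Section corollary_quantities.
Context {R : realType}.

Definition pi_alpha (n : nat) (a : R) : probability 'rV[R]_n R := gibbs (V_alpha n a).

Definition beta (a C : R) (n : nat) (r : R) : R :=
  inf [set C * (n%:R `^ (2 * (2 - 2 * a + g) / g)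
                + Num.max (ln r^-1) 0 `^ ((2 - 2 * a + g) / a))
      | g in `]0, 2 * a]].

Definition weak_poincare_weight n (pi : probability 'rV[R]_n R) (b : R -> R) :=
  forall (f : 'rV[R]_n -> R) (r : R), smooth f -> 0 < r ->
  ('V_pi[f] <= (b r)%:E * 'E_pi[fun x => (enorm (grad f x) ^+ 2)%R]
     + r%:E * (ereal_sup (range (EFin \o f)) - ereal_inf (range (EFin \o f))) ^+ 2)%E.

Definition m_alpha (n : nat) (a : R) : R :=
  2^-1 * inf [set r : R | (pi_alpha n a [set x | (r <= enorm x)%R] <= (2^-1)%:E)%E].

Section initial.
Variables (n : nat) (a q eps C : R) (mu0 : probability 'rV[R]_n R).

Definition Rinf : R := fine (renyi_infty mu0 (pi_alpha n a)).
Definition Rq (p : R) : R := fine (renyi mu0 (pi_alpha n a) p).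

Definition diffusion_time : R :=
  inf [set (n%:R `^ (2 / g * (2 - 2 * a + g)) + Rinf `^ ((2 - 2 * a + g) / a))
             * (Rq q + ln eps^-1)
           + ln eps^-1 `^ ((2 - a + g) / a)
      | g in `]0, 2 * a]].

Definition delta0 : R := expR ((2 * q - 1) * Rinf).

Definition T_lmc : R :=
  (2 * q - 1) * (beta a C n (4 * delta0)^-1 * Rq (2 * q - 1)
                 + beta a C n (eps / (8 * delta0)) * ln (2 / eps)).

Definition pi_hat : probability 'rV[R]_n R := gibbs (V_hat n a T_lmc (m_alpha n a)).

Definition R2_hat : \bar R := renyi mu0 pi_hat 2.

(* The order of the number of LMC iterations.  As usual in multi-parameter
   asymptotic notation, the divergence R_(2q-1) is taken bounded below: it is
   replaced by max(1, R_(2q-1)), which changes nothing when R_(2q-1) >= 1.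
   (Without this the expression could tend to 0 as R_(2q-1) does, while a
   positive number of iterations is still needed.) *)
Definition lmc_order : R :=
  (n%:R `^ (4 / a) + Rinf `^ (4 / a)) * Num.max 1 (Rq (2 * q - 1)) ^+ 2 * n%:R
  / eps * Num.max 1 (Num.sqrt (eps * fine R2_hat) / n%:R).

(* Polylogarithmic factors are powers of this quantity, which is at least ln 3
   when 1 <= n and eps <= 1 / 2. *)
Definition log_factor : R :=
  ln (n%:R + eps^-1 + Rinf + Rq (2 * q - 1) + fine R2_hat).

End initial.

(* N = Theta~(A), with constant K and polylogarithmic factor L^p *)
Definition same_order (K L : R) (p : nat) (N A : R) : Prop :=
  N <= K * L ^+ p * A /\ A <= K * L ^+ p * N.

End corollary_quantities.

(* Main.v *)
(** Both parts follow from one estimate on LMC.  If [u] is the density of the law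
    of an iterate with respect to pi, the next density is [y |-> \int K(y,x) u(x) dx]
    with [K(y,x) = exp(V(y) - V(x))] times a Gaussian density.  Symmetrising the
    Gaussian increment shows that [K(y,.)] has mass at most [1 + O(h^2 n^2)]: hence
    the densities remain bounded by [exp(1 + R_oo)], and by Jensen's inequality with
    remainder each step decreases [\int u^q dpi] by the local variance of [f = u^(q/2)].

    This variance controls the gradient of a Gaussian smoothing of [f], for which a
    weak Poincare inequality is proved directly: away from the sphere where
    [x . grad V(x)] is about [n], by a Lyapunov function (differentiate the dilations
    [l |-> \int l^n Q(l x) dx], a constant function); near this sphere, by
    comparison of exp(-V) with the tangent Gaussian, whose Poincare inequality comes
    from rotating a pair of independent copies in small steps.  The tail term is
    absorbed by the bound on the densities, and the resulting linear recursion gives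
    [\int u_N^q dpi <= 1 + eps] as soon as [N h] is of order
    [(n^(2/a - 1) + (n + R_oo + ln(1/eps))^(2/a - 2)) (R_q + ln(1/eps))] and
    [h] is small.

    For the diffusion, the Euler scheme driven by its own Brownian motion is an LMC
    with step [T/N] which converges pathwise; the laws converge setwise because their
    densities are uniformly bounded, and Young's inequality passes the bound on the
    q-th moment to the limit. *)
Require Import Defs.
From HB Require Import structures.
From mathcomp Require Import all_boot all_order all_algebra.
From mathcomp Require Import all_classical all_reals all_analysis.
From mathcomp Require Import measurable_realfun ess_sup_inf ring lra.
Set Implicit Arguments.
Unset Strict Implicit.
Unset Printing Implicit Defensive.
Import Order.TTheory GRing.Theory Num.Theory.
Import numFieldNormedType.Exports.
Local Open Scope classical_set_scope.
Local Open Scope ring_scope.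
Local Open Scope charge_scope.

(** * Lebesgue measure on R^n *)

(** The measure pi is not invariant under LMC, so densities relative to pi obey no maximum
    principle: the excess mass of K(y,.) enters both the sup bound and the moment. An excess of
    order h would add up to a factor exponential in T = N h; one of order h^2 n^2 adds up to T^2 n^2
    / N, which is small for N large. Hence the expansion along pairs y + w, y - w. No regularity of
    the density is propagated. The local variance lost in a step controls h times the squared
    gradient of a smoothing at scale h, which is regular enough for the Poincare argument; comparing
    f with its smoothing is again paid by the local variance. The moment contracts at rate h / S,
    with S the weight in the weak Poincare inequality. One needs h n^2 S <= eps and T >= S (R_q +
    ln(1/eps)) up to constants, and h = T / N turns this into a lower bound on N, at most of order
    T^2 n^2 / eps. So N may be taken exactly of the order in (ii), whose power 4 / a is the square
    of the bound (n + R_oo)^(2/a) of S n, up to logarithms. *)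

Section lebesgue_affine.
Context {R : realType}.
Local Notation mu := (@lebesgue_measure R).

Let aff (s a : R) (x : measurableTypeR R) : measurableTypeR R := s * x + a.

Let measurable_aff s a : measurable_fun setT (aff s a).
Proof. by apply: measurable_funD => //; apply: measurable_funM. Qed.

Let aff_meas s a : {measure set (measurableTypeR R) -> \bar R} :=
  measure_function_pushforward__canonical__measure_function_Measure
    mu (measurable_aff s a).

Lemma lebesgue_measure_affine (s a : R) (A : set (measurableTypeR R)) :
  s != 0 -> measurable A ->
  mu A = mscale `|s|%:nng (aff_meas s a) A.
Proof.
move=> s0; apply: lebesgue_measure_unique => X [[u v]] /= uv <-.
rewrite /mscale /= /pushforward.
have [sp|sn|s00] := ltgtP 0 s; last by rewrite -s00 eqxx in s0.
- pose J : set R := `](u - a) / s, (v - a) / s]%classic.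
  transitivity (`|s|%:E * mu J)%E; last first.
    congr (_ * mu _)%E; apply/esym/seteqP; split=> x /=; rewrite !in_itv/= /aff => /andP[h1 h2]; apply/andP; rewrite ?bnd_simp.
      by rewrite ltr_pdivrMr// ler_pdivlMr// (mulrC x) ltrBlDr lerBrDr; split.
    by move: h1 h2; rewrite ?bnd_simp ltr_pdivrMr// ler_pdivlMr// (mulrC x) ltrBlDr lerBrDr; split.
  rewrite /J !lebesgue_measure_itv/= !lte_fin ltr_pM2r ?invr_gt0// ltrD2r.
  case: ifPn => //; rewrite ?mule0// => _.
  rewrite -EFinM; congr EFin; rewrite gtr0_norm//; field; exact: s0.
(* For [s < 0] the preimage of []u, v]] is closed on the left and open on the right; only its length
   matters. *)
- pose J : set R := `[(v - a) / s, (u - a) / s[%classic.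
  transitivity (`|s|%:E * mu J)%E; last first.
    congr (_ * mu _)%E; apply/esym/seteqP; split=> x /=; rewrite !in_itv/= /aff => /andP[h1 h2]; apply/andP; rewrite ?bnd_simp.
      by rewrite ler_ndivrMr// ltr_ndivlMr// (mulrC x) lerBrDr ltrBlDr; split.
    by move: h1 h2; rewrite ?bnd_simp ler_ndivrMr// ltr_ndivlMr// (mulrC x) lerBrDr ltrBlDr; split.
  rewrite /J !lebesgue_measure_itv/= !lte_fin ltr_nM2r ?invr_lt0// ltrD2r.
  case: ifPn => //; rewrite ?mule0// => _.
  rewrite -EFinM; congr EFin; rewrite ltr0_norm//; field; exact: s0.
Qed.

Lemma lebesgue_integral_affine (s a : R) (F : R -> \bar R) :
  s != 0 -> measurable_fun setT F -> (forall x, 0 <= F x)%E ->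
  (\int[mu]_x F x = `|s|%:E * \int[mu]_x F (s * x + a)%R)%E.
Proof.
move=> s0 mF F0.
rewrite (@eq_measure_integral _ _ _ _ (mscale `|s|%:nng (aff_meas s a))); last first.
  by move=> A mA _; exact: lebesgue_measure_affine.
by rewrite ge0_integral_mscale//= ge0_integral_pushforward.
Qed.
End lebesgue_affine.

Section lebesgue_rV_theory.
Context {R : realType}.
Local Notation mu := (@lebesgue_measure R).

Lemma ge0_integral_rVS n (F : 'rV[R]_n.+1 -> \bar R) :
  measurable_fun setT F -> (forall x, 0 <= F x)%E ->
  (\int[lebesgue_rV n.+1]_x F x =
   \int[mu]_t \int[lebesgue_rV n]_x F (rV_cons (t, x)))%E.
Proof.
move=> mF F0; rewrite /=.
rewrite ge0_integral_pushforward//=; last exact: measurable_rV_cons.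
rewrite preimage_setT fubini_tonelli1//=.
by apply: measurableT_comp => //; exact: measurable_rV_cons.
Qed.

Lemma ge0_integral_rV0 (F : 'rV[R]_0 -> \bar R) :
  measurable_fun setT F -> (\int[lebesgue_rV 0]_x F x = F 0%R)%E.
Proof. by move=> mF; rewrite /= integral_dirac// diracT mul1e. Qed.

Lemma rV0E (x y : 'rV[R]_0) : x = y.
Proof. by apply/rowP => -[]. Qed.

Lemma measurable_scale n (s : R) : measurable_fun setT (fun x : 'rV[R]_n => s *: x).
Proof.
apply/measurable_fun_coorP => i.
rewrite (_ : _ \o _ = (fun x => s * rV_coor i x)).
  by apply: measurable_funM => //; exact: measurable_coor.
by apply/funext => x; rewrite /rV_coor /= mxE.
Qed.

Lemma measurable_add d (T : measurableType d) n (f g : T -> 'rV[R]_n) :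
  measurable_fun setT f -> measurable_fun setT g ->
  measurable_fun setT (fun x => f x + g x).
Proof.
move=> mf mg; apply/measurable_fun_coorP => i.
rewrite (_ : _ \o _ = (fun x => rV_coor i (f x) + rV_coor i (g x))).
  by apply: measurable_funD; apply: (measurableT_comp (measurable_coor i)).
by apply/funext => x; rewrite /rV_coor /= mxE.
Qed.

Lemma measurable_scalerV d (T : measurableType d) n (f : T -> R) (g : T -> 'rV[R]_n) :
  measurable_fun setT f -> measurable_fun setT g ->
  measurable_fun setT (fun x => f x *: g x).
Proof.
move=> mf mg; apply/measurable_fun_coorP => i.
rewrite (_ : _ \o _ = (fun x => f x * rV_coor i (g x))).
  by apply: measurable_funM => //; apply: (measurableT_comp (measurable_coor i)).
by apply/funext => x; rewrite /rV_coor /= mxE.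
Qed.

Lemma measurable_opp d (T : measurableType d) n (g : T -> 'rV[R]_n) :
  measurable_fun setT g -> measurable_fun setT (fun x => - g x).
Proof.
move=> mg; rewrite (_ : (fun x => - g x) = (fun x => -1 *: g x)).
  exact: measurable_scalerV.
by apply/funext => x; rewrite scaleN1r.
Qed.

(** By Tonelli the first coordinate is split off, and each coordinate contributes one factor
    [|s|]. *)
Lemma ge0_integral_rV_affine n (s : R) (a : 'rV[R]_n) (F : 'rV[R]_n -> \bar R) :
  s != 0 -> measurable_fun setT F -> (forall x, 0 <= F x)%E ->
  (\int[lebesgue_rV n]_x F x =
   (`|s| ^+ n)%:E * \int[lebesgue_rV n]_x F (s *: x + a)%R)%E.
Proof.
move=> s0; elim: n a F => [|n IH] a F mF F0.
  rewrite !ge0_integral_rV0//; last first.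
    apply: measurableT_comp => //; apply: measurable_add => //; exact: measurable_scale.
  by rewrite expr0 mul1e; congr F; exact: rV0E.
have mFa : measurable_fun setT (fun x : 'rV[R]_n.+1 => F (s *: x + a)).
  by apply: measurableT_comp => //; apply: measurable_add => //; exact: measurable_scale.
rewrite !ge0_integral_rVS//.
have mFt t : measurable_fun setT (fun x : 'rV[R]_n => F (rV_cons (t, x))).
  by apply: measurableT_comp => //; apply: measurableT_comp; [exact: measurable_rV_cons|].
rewrite (lebesgue_integral_affine (a ord0 ord0) s0); first last.
- by move=> t; apply: integral_ge0.
- have := @measurable_fun_fubini_tonelli_F _ _ _ _ R (lebesgue_rV n) (fun z => F (rV_cons z)).
  by apply => //; apply: measurableT_comp => //; exact: measurable_rV_cons.
rewrite exprSr EFinM -muleA muleCA; congr (_ * _)%E.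
rewrite -ge0_integralZl//; first last.
- by move=> t _; apply: integral_ge0.
- have := @measurable_fun_fubini_tonelli_F _ _ _ _ R (lebesgue_rV n)
      (fun z => F (s *: (rV_cons z) + a)).
  by apply => //; apply: measurableT_comp mFa _; exact: measurable_rV_cons.
apply: eq_integral => t _.
rewrite (IH (@rsubmx R 1 1 n a))//; congr (_ * _)%E.
apply: eq_integral => x _; congr F.
apply/rowP => i; rewrite !mxE.
case: splitP => j /= ij; rewrite !mxE.
  by rewrite ord1; congr (_ + a _ _); apply/val_inj; rewrite /= ij ord1.
by congr (_ + a _ _); apply/val_inj; rewrite /= ij.
Qed.

Lemma ge0_integral_rV_translate n (a : 'rV[R]_n) (F : 'rV[R]_n -> \bar R) :
  measurable_fun setT F -> (forall x, 0 <= F x)%E ->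
  (\int[lebesgue_rV n]_x F (x + a)%R = \int[lebesgue_rV n]_x F x)%E.
Proof.
move=> mF F0; rewrite [RHS](ge0_integral_rV_affine a (oner_neq0 R))//.
by rewrite normr1 expr1n mul1e; apply: eq_integral => x _; rewrite scale1r.
Qed.

Lemma ge0_integral_rV_opp n (F : 'rV[R]_n -> \bar R) :
  measurable_fun setT F -> (forall x, 0 <= F x)%E ->
  (\int[lebesgue_rV n]_x F (- x)%R = \int[lebesgue_rV n]_x F x)%E.
Proof.
move=> mF F0; have N1 : -1 != 0 :> R by rewrite oppr_eq0 oner_neq0.
rewrite [RHS](ge0_integral_rV_affine 0 N1)//.
rewrite normrN normr1 expr1n mul1e; apply: eq_integral => x _.
by rewrite scaleN1r addr0.
Qed.

Lemma ge0_integral_rV_prod n (f : 'I_n -> R -> R) :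
  (forall i, measurable_fun setT (f i)) -> (forall i x, 0 <= f i x) ->
  (\int[lebesgue_rV n]_x (\prod_(i < n) f i (x ord0 i))%:E =
   \prod_(i < n) \int[mu]_x (f i x)%:E)%E.
Proof.
elim: n f => [|n IH] f mf f0.
  rewrite ge0_integral_rV0 ?big_ord0//.
  apply/measurable_EFinP.
  by rewrite (_ : (fun=> _) = cst 1)//; apply/funext => x; rewrite big_ord0.
have mP m (g : 'I_m -> R -> R) : (forall i, measurable_fun setT (g i)) ->
    measurable_fun setT (fun x : 'rV[R]_m => (\prod_(i < m) g i (x ord0 i))%:E).
  move=> mg; apply/measurable_EFinP.
  apply: measurable_prod => i _.
  exact: (measurableT_comp (mg i) (measurable_coor i)).
rewrite ge0_integral_rVS//; [|exact: mP|]; last first.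
  by move=> x; rewrite lee_fin; apply: prodr_ge0.
rewrite big_ord_recl -ge0_integralZr//; first last.
- by apply: prode_ge0 => i _; apply: integral_ge0 => x _; rewrite lee_fin.
- by move=> x _; rewrite lee_fin.
- by apply/measurable_EFinP; exact: mf.
apply: eq_integral => t _.
rewrite -IH// -ge0_integralZl//; last 3 first.
- have := mP n (fun i => f (lift ord0 i)). apply => i. exact: mf.
- by move=> x _; rewrite lee_fin; apply: prodr_ge0.
- by rewrite lee_fin.
  apply: eq_integral => x _; rewrite -EFinM big_ord_recl; congr (_ * _)%:E.
    by congr (f _ _); exact: (congr1 fst (rV_consK (t, x))).
  apply: eq_bigr => i _; congr f.
  transitivity ((rV_uncons (rV_cons (t, x))).2 ord0 i); last by rewrite rV_consK.
  by rewrite [RHS]mxE; congr (rV_cons _ _ _); exact/val_inj.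
Qed.

End lebesgue_rV_theory.

(** * Integrability, Euclidean norm and Gaussian densities *)

Section integrability.
Context {d : measure_display} {T : measurableType d} {R : realType}.
Variable mu : {measure set T -> \bar R}.
Implicit Types F G : T -> R.

Definition itg F := mu.-integrable setT (EFin \o F).

Lemma itg_meas F : itg F -> measurable_fun setT F.
Proof. by move=> /integrableP[/measurable_EFinP]. Qed.

Lemma itg_dom G F : measurable_fun setT F -> itg G ->
  (forall x, `|F x| <= G x) -> itg F.
Proof.
move=> mF iG FG; apply: (le_integrable _ _ _ iG) => //; first exact/measurable_EFinP.
by move=> x _ /=; rewrite lee_fin (le_trans (FG x))// ler_norm.
Qed.

Lemma itg_le F (c : R) : measurable_fun setT F -> (forall x, 0 <= F x) ->
  (\int[mu]_x (F x)%:E <= c%:E)%E -> itg F.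
Proof.
move=> mF F0 Fc; apply/integrableP; split; first exact/measurable_EFinP.
under eq_integral do rewrite /= ger0_norm//.
by rewrite (le_lt_trans Fc)// ltry.
Qed.

Lemma itgK F : itg F -> (\int[mu]_x F x)%:E = (\int[mu]_x (F x)%:E)%E.
Proof. by move=> iF; rewrite /Rintegral fineK//; exact: integrable_fin_num. Qed.

Lemma itgD F G : itg F -> itg G -> itg (fun x => F x + G x).
Proof. by move=> iF iG; exact: (integrableD measurableT iF iG). Qed.

Lemma itgZ (c : R) F : itg F -> itg (fun x => c * F x).
Proof. by move=> iF; exact: (integrableZl measurableT c iF). Qed.

Lemma itgN F : itg F -> itg (fun x => - F x).
Proof.
move=> /(itgZ (-1)); rewrite (_ : (fun x => -1 * F x) = (fun x => - F x))//.
by apply/funext => x; rewrite mulN1r.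
Qed.

Lemma itgB F G : itg F -> itg G -> itg (fun x => F x - G x).
Proof. by move=> iF /itgN; exact: itgD. Qed.

Lemma itg_norm F : itg F -> itg (fun x => `|F x|).
Proof.
move=> iF; apply: (@le_integrable _ _ _ mu setT measurableT _ (EFin \o F)) => //.
  apply/measurable_EFinP; apply: measurableT_comp => //; exact: itg_meas.
by move=> x _ /=; rewrite normr_id.
Qed.

Lemma RintD F G : itg F -> itg G ->
  \int[mu]_x (F x + G x) = \int[mu]_x F x + \int[mu]_x G x.
Proof. by move=> iF iG; rewrite RintegralD. Qed.

Lemma RintB F G : itg F -> itg G ->
  \int[mu]_x (F x - G x) = \int[mu]_x F x - \int[mu]_x G x.
Proof. by move=> iF iG; rewrite RintegralB. Qed.

Lemma RintZ (c : R) F : itg F ->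
  \int[mu]_x (c * F x) = c * \int[mu]_x F x.
Proof. by move=> iF; rewrite RintegralZl. Qed.

Lemma le_Rint F G : itg F -> itg G -> (forall x, F x <= G x) ->
  \int[mu]_x F x <= \int[mu]_x G x.
Proof. by move=> iF iG FG; apply: le_Rintegral. Qed.

Lemma Rint_ge0 F : (forall x, 0 <= F x) -> 0 <= \int[mu]_x F x.
Proof. by move=> F0; apply: Rintegral_ge0. Qed.

Lemma norm_Rint_le F G : itg F -> itg G -> (forall x, `|F x| <= G x) ->
  `|\int[mu]_x F x| <= \int[mu]_x G x.
Proof.
move=> iF iG FG; apply: (le_trans (le_normr_Rintegral _ iF)) => //.
by apply: le_Rint => //; exact: itg_norm.
Qed.

Lemma ge0_intZl (c : R) F : measurable_fun setT F -> (forall x, 0 <= F x) -> 0 <= c ->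
  (\int[mu]_x (c * F x)%:E = c%:E * \int[mu]_x (F x)%:E)%E.
Proof.
move=> mF F0 c0; under eq_integral do rewrite EFinM.
by rewrite ge0_integralZl_EFin//; [move=> x _; rewrite lee_fin|exact/measurable_EFinP].
Qed.

Lemma ge0_intD F G : measurable_fun setT F -> measurable_fun setT G ->
  (forall x, 0 <= F x) -> (forall x, 0 <= G x) ->
  (\int[mu]_x (F x + G x)%:E = \int[mu]_x (F x)%:E + \int[mu]_x (G x)%:E)%E.
Proof.
move=> mF mG F0 G0; under eq_integral do rewrite EFinD.
apply: ge0_integralD => //.
- by move=> x _; rewrite lee_fin.
- exact/measurable_EFinP.
- by move=> x _; rewrite lee_fin.
- exact/measurable_EFinP.
Qed.

Lemma ge0_int_le F G : measurable_fun setT F -> measurable_fun setT G ->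
  (forall x, 0 <= F x) -> (forall x, F x <= G x) ->
  (\int[mu]_x (F x)%:E <= \int[mu]_x (G x)%:E)%E.
Proof.
move=> mF mG F0 FG; apply: ge0_le_integral => //.
- by move=> x _; rewrite lee_fin.
- exact/measurable_EFinP.
- exact/measurable_EFinP.
- by move=> x _; rewrite lee_fin.
Qed.

Lemma eq_Rint F G : (forall x, F x = G x) -> \int[mu]_x F x = \int[mu]_x G x.
Proof. by move=> FG; apply: eq_Rintegral => x _; exact: FG. Qed.

End integrability.

Section euclid.
Context {R : realType} {n : nat}.
Implicit Types x y z : 'rV[R]_n.

Definition dotp x y : R := \sum_(i < n) x ord0 i * y ord0 i.
Definition sqn x : R := dotp x x.

Lemma dotpC x y : dotp x y = dotp y x.
Proof. by apply: eq_bigr => i _; rewrite mulrC. Qed.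

Lemma dotpDr x y z : dotp x (y + z) = dotp x y + dotp x z.
Proof. by rewrite -big_split/=; apply: eq_bigr => i _; rewrite mxE mulrDr. Qed.

Lemma dotpZr a x y : dotp x (a *: y) = a * dotp x y.
Proof. by rewrite mulr_sumr; apply: eq_bigr => i _; rewrite mxE mulrCA. Qed.

Lemma dotpNr x y : dotp x (- y) = - dotp x y.
Proof. by rewrite -scaleN1r dotpZr mulN1r. Qed.

Lemma dotpDl x y z : dotp (x + y) z = dotp x z + dotp y z.
Proof. by rewrite dotpC dotpDr !(dotpC z). Qed.

Lemma dotpZl a x y : dotp (a *: x) y = a * dotp x y.
Proof. by rewrite dotpC dotpZr dotpC. Qed.

Lemma dotpNl x y : dotp (- x) y = - dotp x y.
Proof. by rewrite dotpC dotpNr dotpC. Qed.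

Definition dotpE := (dotpDr, dotpDl, dotpZr, dotpZl, dotpNr, dotpNl).

Lemma dotp0 x : dotp x 0 = 0.
Proof. by rewrite -(scale0r x) dotpZr mul0r. Qed.

Lemma sqn_ge0 x : 0 <= sqn x.
Proof. by apply: sumr_ge0 => i _; rewrite -expr2 sqr_ge0. Qed.

Lemma sqnD x y : sqn (x + y) = sqn x + 2 * dotp x y + sqn y.
Proof. by rewrite /sqn !dotpE (dotpC y x); ring. Qed.

Lemma sqnZ a x : sqn (a *: x) = a ^+ 2 * sqn x.
Proof. by rewrite /sqn !dotpE; ring. Qed.

Lemma sqnN x : sqn (- x) = sqn x.
Proof. by rewrite /sqn !dotpE opprK. Qed.

Lemma enorm_sqn x : enorm x = Num.sqrt (sqn x).
Proof. by congr Num.sqrt; apply: eq_bigr => i _; rewrite expr2. Qed.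

Lemma enorm_ge0 x : 0 <= enorm x.
Proof. exact: sqrtr_ge0. Qed.

Lemma enormK x : enorm x ^+ 2 = sqn x.
Proof. by rewrite enorm_sqn sqr_sqrtr// sqn_ge0. Qed.

Lemma dotp_sqr_le x y : dotp x y ^+ 2 <= sqn x * sqn y.
Proof.
have [y0|y0] := eqVneq (sqn y) 0.
  suff -> : dotp x y = 0 by rewrite expr0n mulr_ge0// sqn_ge0.
  have/eqP : y == 0.
    apply/eqP/rowP => i; rewrite mxE.
    have /eqP := y0; rewrite /sqn/dotp psumr_eq0; last by move=> j _; rewrite -expr2 sqr_ge0.
    move=> /allP/(_ i); rewrite mem_index_enum => /(_ isT)/= /eqP/eqP.
    by rewrite mulf_eq0 orbb => /eqP.
  by move=> ->; rewrite dotp0.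
have yp : 0 < sqn y by rewrite lt_neqAle eq_sym y0 sqn_ge0.
have := sqn_ge0 (sqn y *: x - dotp x y *: y).
rewrite /sqn !dotpE -/(sqn x) -/(sqn y) (dotpC y x) => H.
have {H} : 0 <= sqn y * (sqn x * sqn y - dotp x y ^+ 2) by move: H; congr (0 <= _); ring.
by rewrite pmulr_rge0// subr_ge0.
Qed.

Lemma dotp_le x y : `|dotp x y| <= enorm x * enorm y.
Proof.
rewrite -(ler_pXn2r (n := 2))// ?nnegrE ?mulr_ge0 ?enorm_ge0//.
by rewrite real_normK ?num_real// exprMn !enormK dotp_sqr_le.
Qed.

Lemma enormD x y : enorm (x + y) <= enorm x + enorm y.
Proof.
rewrite -(ler_pXn2r (n := 2))// ?nnegrE ?addr_ge0 ?enorm_ge0//.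
have := le_trans (ler_norm _) (dotp_le x y).
by rewrite enormK sqrrD !enormK sqnD; lra.
Qed.

Lemma enormZ a x : enorm (a *: x) = `|a| * enorm x.
Proof. by rewrite !enorm_sqn sqnZ sqrtrM ?sqr_ge0// sqrtr_sqr. Qed.

Lemma enormN x : enorm (- x) = enorm x.
Proof. by rewrite !enorm_sqn sqnN. Qed.

Lemma enormB x y : enorm (x - y) = enorm (y - x).
Proof. by rewrite -enormN opprB. Qed.

Lemma enorm0 : enorm (0 : 'rV[R]_n) = 0.
Proof. by rewrite enorm_sqn /sqn dotp0 sqrtr0. Qed.

Lemma enorm_le_sqn x c : 0 <= c -> (enorm x <= c) = (sqn x <= c ^+ 2).
Proof. by move=> c0; rewrite -enormK ler_pXn2r// nnegrE enorm_ge0. Qed.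

Context {d : measure_display} {T : measurableType d}.

Lemma measurable_dotp (f g : T -> 'rV[R]_n) :
  measurable_fun setT f -> measurable_fun setT g ->
  measurable_fun setT (fun t => dotp (f t) (g t)).
Proof.
move=> mf mg; apply: measurable_sum => i; apply: measurable_funM.
  exact: (measurableT_comp (measurable_coor i) mf).
exact: (measurableT_comp (measurable_coor i) mg).
Qed.

Lemma measurable_enormf (f : T -> 'rV[R]_n) :
  measurable_fun setT f -> measurable_fun setT (fun t => enorm (f t)).
Proof. by move=> mf; apply: (measurableT_comp measurable_enorm mf). Qed.

Lemma measurable_expRf (f : T -> R) :
  measurable_fun setT f -> measurable_fun setT (fun t => expR (f t)).
Proof. by move=> mf; apply: measurableT_comp. Qed.

Lemma measurable_powRf (f : T -> R) e :
  measurable_fun setT f -> measurable_fun setT (fun t => f t `^ e).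
Proof. by move=> mf; apply: (measurableT_comp (measurable_powR e) mf). Qed.

Lemma measurable_sub (f g : T -> 'rV[R]_n) :
  measurable_fun setT f -> measurable_fun setT g ->
  measurable_fun setT (fun t => f t - g t).
Proof. by move=> mf mg; apply: measurable_add => //; exact: measurable_opp. Qed.

Lemma measurable_sqn (f : T -> 'rV[R]_n) :
  measurable_fun setT f -> measurable_fun setT (fun t => sqn (f t)).
Proof. by move=> mf; exact: measurable_dotp. Qed.

Lemma measurable_normrf (f : T -> R) :
  measurable_fun setT f -> measurable_fun setT (fun t => `|f t|).
Proof. by move=> mf; apply: measurableT_comp. Qed.

Lemma measurable_id_ : measurable_fun setT (fun t : T => t).
Proof. exact: measurable_id. Qed.

End euclid.

(** * Syntax-directed measurability proofs *)

Section measurability_rules.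
Context {d : measure_display} {T : measurableType d} {R : realType}.
Implicit Types f g : T -> R.

Lemma m_add f g : measurable_fun setT f -> measurable_fun setT g ->
  measurable_fun setT (fun t => f t + g t).
Proof. by move=> ? ?; exact: measurable_funD. Qed.

Lemma m_mul f g : measurable_fun setT f -> measurable_fun setT g ->
  measurable_fun setT (fun t => f t * g t).
Proof. by move=> ? ?; exact: measurable_funM. Qed.

Lemma m_opp f : measurable_fun setT f -> measurable_fun setT (fun t => - f t).
Proof. by move=> ?; apply: measurableT_comp. Qed.

Lemma m_exp f k : measurable_fun setT f -> measurable_fun setT (fun t => f t ^+ k).
Proof. by move=> ?; exact: measurable_funX. Qed.

Lemma m_EFin f : measurable_fun setT f -> measurable_fun setT (fun t => (f t)%:E).
Proof. by move=> ?; exact/measurable_EFinP. Qed.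

Lemma m_prod (I : finType) (h : I -> T -> R) : (forall i, measurable_fun setT (h i)) ->
  measurable_fun setT (fun t => \prod_i h i t).
Proof. by move=> mh; apply: measurable_prod => i _. Qed.

Lemma m_sum (I : finType) (h : I -> T -> R) : (forall i, measurable_fun setT (h i)) ->
  measurable_fun setT (fun t => \sum_i h i t).
Proof. by move=> mh; apply: measurable_sum. Qed.

Lemma m_comp d1 d2 (T1 : measurableType d1) (T2 : measurableType d2)
    (f : T1 -> T2) (g : T -> T1) :
  measurable_fun setT f -> measurable_fun setT g -> measurable_fun setT (fun t => f (g t)).
Proof. by move=> mf mg; exact: (measurableT_comp mf mg). Qed.

End measurability_rules.

(** [mes] follows the syntax of the function. The two hooks are redefined once new functions are
    available, so that it recognises them as well. *)
Ltac mes_leaf2 := fail.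
Ltac mes_leaf := fail.
Ltac mes := lazymatch goal with
  | |- measurable_fun _ (fun u => u) => exact: measurable_id
  | |- measurable_fun _ (fun _ => ?c) => exact: measurable_cst
  | |- measurable_fun ?D (@GRing.add _ ?c) => change (measurable_fun D (fun u => c + u)); mes
  | |- measurable_fun ?D (@GRing.mul _ ?c) => change (measurable_fun D (fun u => c * u)); mes
  | |- measurable_fun _ (fun u => fst u) => exact: measurable_fst
  | |- measurable_fun _ (fun u => snd u) => exact: measurable_snd
  | |- measurable_fun _ (fun u => EFin (@?f u)) => apply: (@m_EFin _ _ _ f); mes
  | |- measurable_fun _ (fun u => @GRing.add _ (@?f u) (@?g u)) =>
      first [apply: (@m_add _ _ _ f g) | apply: (@measurable_add _ _ _ _ f g)]; mes
  | |- measurable_fun _ (fun u => @GRing.opp _ (@?f u)) =>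
      first [apply: (@m_opp _ _ _ f) | apply: (@measurable_opp _ _ _ _ f)]; mes
  | |- measurable_fun _ (fun u => @GRing.mul _ (@?f u) (@?g u)) => apply: (@m_mul _ _ _ f g); mes
  | |- measurable_fun _ (fun u => @GRing.scale _ _ (@?f u) (@?g u)) =>
      apply: (@measurable_scalerV _ _ _ _ f g); mes
  | |- measurable_fun _ (fun u => @GRing.exp _ (@?f u) _) => apply: (@m_exp _ _ _ f); mes
  | |- measurable_fun _ (fun u => expR (@?f u)) => apply: (@measurable_expRf _ _ _ f); mes
  | |- measurable_fun _ (fun u => powR (@?f u) _) => apply: (@measurable_powRf _ _ _ f); mes
  | |- measurable_fun _ (fun u => @Num.norm _ _ (@?f u)) => apply: (@measurable_normrf _ _ _ f); mes
  | |- measurable_fun _ (fun u => dotp (@?f u) (@?g u)) => apply: (@measurable_dotp _ _ _ _ f g); mes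
  | |- measurable_fun _ (fun u => sqn (@?f u)) => apply: (@measurable_sqn _ _ _ _ f); mes
  | |- measurable_fun _ (fun u => enorm (@?f u)) => apply: (@measurable_enormf _ _ _ _ f); mes
  | |- _ => first [ mes_leaf
      | lazymatch goal with |- measurable_fun _ ?g' =>
          match goal with H : measurable_fun _ ?g |- _ => constr_eq g g'; exact: H end end
      | lazymatch goal with |- measurable_fun _ (fun u => ?g' (@?f u)) =>
          match goal with H : measurable_fun _ ?g |- _ =>
            constr_eq g g'; apply: (m_comp (g := f) H); mes end end
      | idtac ]
  end.

Lemma bernoulli_le {R : realType} (x : R) n : 0 <= x <= 1 -> 1 - n%:R * x <= (1 - x) ^+ n.
Proof.
move=> /andP[x0 x1]; elim: n => [|n IH]; first by rewrite mul0r subr0 expr0.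
rewrite exprS; apply: (le_trans _ (ler_wpM2l _ IH)); last by rewrite subr_ge0.
rewrite -natr1; have : 0 <= n%:R * x ^+ 2 by rewrite mulr_ge0 ?ler0n ?sqr_ge0.
by nra.
Qed.

(** * Gaussian densities under exponential tilts and changes of variance *)

Section gaussian.
Context {R : realType} {n : nat}.
Local Notation lam := (@lebesgue_rV R n).
Implicit Types (w v : 'rV[R]_n) (t h : R).

(** The heat kernel at time [t], of variance [2 * t] in each coordinate, so that [gaus h] is the
    density of the noise [sqrt(2h) xi] of one LMC step. The lock keeps the product from being
    unfolded. *)
Definition gaus t w : R :=
  locked (\prod_(i < n) normal_pdf 0 (Num.sqrt (2 * t)) (w ord0 i)).

Lemma gaus_prod t w : gaus t w = \prod_(i < n) normal_pdf 0 (Num.sqrt (2 * t)) (w ord0 i).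
Proof. by rewrite /gaus -lock. Qed.

Lemma gausE t w : 0 < t ->
  gaus t w = normal_peak (Num.sqrt (2 * t)) ^+ n * expR (- (sqn w / (4 * t))).
Proof.
move=> t0; have s0 : Num.sqrt (2 * t) != 0 by rewrite sqrtr_eq0 -ltNge mulr_gt0.
rewrite gaus_prod; under eq_bigr do rewrite normal_pdfE//.
rewrite big_split/= prodr_const card_ord; congr (_ * _).
rewrite /sqn /dotp mulr_suml -sumrN expR_sum; apply: eq_bigr => i _.
rewrite /normal_fun subr0 sqr_sqrtr ?mulr_ge0// ?ltW//; congr expR.
by rewrite mulNr expr2; congr (- (_ / _)); rewrite -mulr_natl; ring.
Qed.

Lemma gaus_ge0 t w : 0 <= gaus t w.
Proof. by rewrite gaus_prod; apply: prodr_ge0 => i _; exact: normal_pdf_ge0. Qed.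

Lemma measurable_gaus t : measurable_fun setT (gaus t).
Proof.
rewrite (_ : gaus t = fun w => \prod_(i < n) normal_pdf 0 (Num.sqrt (2 * t)) (w ord0 i)).
  apply: measurable_prod => i _.
  exact: (measurableT_comp (measurable_normal_pdf 0 (Num.sqrt (2 * t))) (measurable_coor i)).
by apply/funext => w; rewrite gaus_prod.
Qed.

Lemma integral_gaus t : 0 < t -> (\int[lam]_w (gaus t w)%:E = 1)%E.
Proof.
move=> t0; have s0 : Num.sqrt (2 * t) != 0 by rewrite sqrtr_eq0 -ltNge mulr_gt0.
under eq_integral do rewrite gaus_prod.
rewrite (ge0_integral_rV_prod (f := fun=> normal_pdf 0 (Num.sqrt (2 * t)))); [|by move=> i; exact: measurable_normal_pdf|
  by move=> i x; exact: normal_pdf_ge0].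
by rewrite big1// => i _; rewrite integral_normal_pdf.
Qed.

Lemma itg_gaus t : 0 < t -> itg lam (gaus t).
Proof.
move=> t0; apply: (@itg_le _ _ _ _ _ 1); [exact: measurable_gaus|exact: gaus_ge0|].
by rewrite integral_gaus.
Qed.

Lemma Rint_gaus t : 0 < t -> \int[lam]_w gaus t w = 1.
Proof. by move=> t0; rewrite /Rintegral integral_gaus. Qed.

Lemma gausN t w : 0 < t -> gaus t (- w) = gaus t w.
Proof. by move=> t0; rewrite !gausE// sqnN. Qed.

(** Completing the square turns the exponential tilt into a translation by [h *: v]. *)
Lemma gaus_exp_dot h v : 0 < h ->
  (\int[lam]_w (gaus h w * expR (2^-1 * dotp w v))%:E = (expR (h * sqn v / 4))%:E)%E.
Proof.
move=> h0; transitivity (\int[lam]_w (expR (h * sqn v / 4) * gaus h (w + (- (h *: v))))%:E)%E.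
  apply: eq_integral => w _; congr EFin.
  rewrite [RHS]mulrC !gausE// -!mulrA -!expRD; congr (_ * expR _).
  by rewrite /sqn !dotpE (dotpC v w); field; rewrite gt_eqF.
have mg : measurable_fun setT (fun w => gaus h (w - h *: v)).
  by apply: (measurableT_comp (measurable_gaus h)); mes.
rewrite ge0_intZl ?expR_ge0//; last by move=> w; exact: gaus_ge0.
rewrite (ge0_integral_rV_translate (- (h *: v)) (F := fun w => (gaus h w)%:E)).
- by rewrite integral_gaus// mule1.
- by apply/measurable_EFinP; exact: measurable_gaus.
- by move=> w; rewrite lee_fin gaus_ge0.
Qed.

Lemma normal_peak_ratio (s t : R) : 0 < s -> 0 < t ->
  normal_peak (Num.sqrt (2 * s)) = Num.sqrt (t / s) * normal_peak (Num.sqrt (2 * t)).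
Proof.
move=> s0 t0; rewrite /normal_peak !sqr_sqrtr ?mulr_ge0 ?ltW//.
rewrite -!sqrtrV ?mulrn_wge0 ?mulr_ge0 ?pi_ge0 ?ltW// -sqrtrM ?divr_ge0 ?ltW//.
congr (Num.sqrt _); move: (@pi_gt0 R); move: (pi : R) => p p0; field.
by rewrite (gt_eqF p0) (gt_eqF s0) (gt_eqF t0).
Qed.

(* The weight exp(|w|^2/(8hn)) dominates every polynomial and every exponential
   of |w| at scale sqrt(hn), and only widens the Gaussian by a factor 1+O(1/n). *)
Lemma gaus_exp_sqn h : (0 < n)%N -> 0 < h ->
  (\int[lam]_w (gaus h w * expR (sqn w / (8 * h * n%:R)))%:E <= 2%:E)%E.
Proof.
move=> n0 h0; have nR : 0 < n%:R :> R by rewrite ltr0n.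
have n1 : 1 <= n%:R :> R by rewrite ler1n.
pose c : R := 1 - (2 * n%:R)^-1.
have c0 : 2^-1 <= c.
  by rewrite /c lerBrDl -lerBrDr; rewrite (_ : 1 - 2^-1 = 2^-1); [rewrite lef_pV2 ?posrE ?mulr_gt0//; lra|field].
have cp : 0 < c by apply: lt_le_trans c0; rewrite invr_gt0.
pose t := h / c; have t0 : 0 < t by rewrite divr_gt0.
have n21 : 0 < 2 * n%:R - 1 :> R by lra.
rewrite (_ : (\int[_]_w _)%E = (\int[lam]_w ((Num.sqrt (t / h)) ^+ n * gaus t w)%:E)%E); last first.
  apply: eq_integral => w _; congr EFin.
  rewrite !gausE// (normal_peak_ratio h0 t0) exprMn -!mulrA -expRD; congr (_ * (_ * expR _)).
  by rewrite /t /c; field; rewrite (gt_eqF nR) (gt_eqF h0) (gt_eqF n21).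
rewrite ge0_intZl ?exprn_ge0//; [|exact: measurable_gaus|by move=> w; exact: gaus_ge0].
rewrite integral_gaus// mule1 lee_fin.
have -> : t / h = c^-1 by rewrite /t; field; rewrite !gt_eqF.
have cn : 2^-1 <= c ^+ n.
  have -> : 2^-1 = 1 - n%:R * (2 * n%:R)^-1 :> R by field; rewrite gt_eqF.
  apply: bernoulli_le.
  have i0 : 0 < (2 * n%:R)^-1 :> R by rewrite invr_gt0 mulr_gt0.
  by rewrite (ltW i0)/=; move: c0; rewrite /c; lra.
rewrite -(ler_pXn2r (n := 2))// ?nnegrE ?exprn_ge0// exprAC sqr_sqrtr ?invr_ge0 ?(ltW cp)//.
rewrite exprVn (@le_trans _ _ 2)//; last by rewrite ler_eXnr// ler1n.
by rewrite -[leRHS]invrK lef_pV2// posrE ?invr_gt0// exprn_gt0.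
Qed.

(** Narrowing the variance by the factor n/(n+1) leaves a spare weight exp(-|w|^2/(4hn)), which
    absorbs exp(2|w|) at the price exp(4hn). The normalisations differ only by (1 + 1/n)^(n/2) <=
    exp(1/2). *)
Lemma gaus_shrink h w : (0 < n)%N -> 0 < h ->
  gaus (h * n%:R / (n%:R + 1)) w * expR (2 * enorm w) <=
  expR (2^-1 + 4 * h * n%:R) * gaus h w.
Proof.
move=> n0 h0; have nR : 0 < n%:R :> R by rewrite ltr0n.
have np : 0 < n%:R + 1 :> R by rewrite addr_gt0.
set t := h * n%:R / (n%:R + 1); have t0 : 0 < t by rewrite divr_gt0// mulr_gt0.
rewrite !gausE// (normal_peak_ratio t0 h0) exprMn.
have -> : h / t = 1 + n%:R^-1 by rewrite /t; field; rewrite !gt_eqF.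
set P := normal_peak _ ^+ n; have P0 : 0 <= P by rewrite exprn_ge0// normal_peak_ge0.
have E1 : Num.sqrt (1 + n%:R^-1) ^+ n <= expR (2^-1 : R).
  rewrite -(ler_pXn2r (n := 2))// ?nnegrE ?exprn_ge0 ?expR_ge0// exprAC sqr_sqrtr; last first.
    by rewrite addr_ge0// invr_ge0 ltW.
  rewrite -expRM_natl (_ : 2%:R * 2^-1 = n%:R * n%:R^-1 :> R); last by field; rewrite gt_eqF.
  have i0 : 0 <= n%:R^-1 :> R by rewrite invr_ge0 ltW.
  by rewrite expRM_natl; apply: lerXn2r; rewrite ?nnegrE ?expR_ge0 ?addr_ge0 ?expR_ge1Dx.
have E2 : expR (- (sqn w / (4 * t))) * expR (2 * enorm w) <=
    expR (4 * h * n%:R) * expR (- (sqn w / (4 * h))).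
  rewrite -!expRD ler_expR -enormK.
  have : 0 <= (enorm w - 4 * h * n%:R) ^+ 2 / (4 * h * n%:R).
    by rewrite divr_ge0 ?sqr_ge0// !mulr_ge0 ?ltW.
  rewrite -(subr_ge0 (_ + _)); congr (0 <= _).
  by rewrite /t; field; rewrite !gt_eqF.
rewrite expRD.
have := ler_pM _ _ E1 E2; rewrite !mulr_ge0 ?expR_ge0 ?exprn_ge0// => /(_ isT isT) H.
rewrite [leLHS](_ : _ = P * (Num.sqrt (1 + n%:R^-1) ^+ n * (expR (- (sqn w / (4 * t))) * expR (2 * enorm w)))); last by ring.
rewrite [leRHS](_ : _ = P * (expR 2^-1 * (expR (4 * h * n%:R) * expR (- (sqn w / (4 * h)))))); last by ring.
exact: ler_wpM2l.
Qed.

End gaussian.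

(** * The potential along a line *)

Section real_derivatives.
Context {R : realType}.
Implicit Types (f g : R -> R) (x c e a b : R).

Lemma drvc x c : is_derive x 1 (fun _ : R => c) 0.
Proof. exact: is_derive_cst. Qed.

Lemma drvid x : is_derive x 1 (fun y : R => y) 1.
Proof. exact: is_derive_id. Qed.

Lemma drvD f g x a b : is_derive x 1 f a -> is_derive x 1 g b ->
  is_derive x 1 (fun y => f y + g y) (a + b).
Proof. by move=> ? ?; exact: is_deriveD. Qed.

Lemma drvN f x a : is_derive x 1 f a -> is_derive x 1 (fun y => - f y) (- a).
Proof. by move=> ?; exact: is_deriveN. Qed.

Lemma drvM f g x a b : is_derive x 1 f a -> is_derive x 1 g b ->
  is_derive x 1 (fun y => f y * g y) (a * g x + f x * b).
Proof.
move=> ? ?; apply: (@is_derive_eq _ _ _ _ _ _ _ _ (is_deriveM _ _)) => //.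
by rewrite addrC !/GRing.scale/= (mulrC a).
Qed.

Lemma drv_comp f g x a b : is_derive x 1 g b -> is_derive (g x) 1 f a ->
  is_derive x 1 (fun y => f (g y)) (a * b).
Proof. by move=> dg df; exact: (is_derive1_comp df dg). Qed.

Lemma drvX f n x a : is_derive x 1 f a ->
  is_derive x 1 (fun y => f y ^+ n.+1) (n.+1%:R * f x ^+ n * a).
Proof. move=> df; elim: n => [|n IH].
  rewrite (_ : (fun _ => _) = f); last by apply/funext => y; rewrite expr1.
  by rewrite expr0 mulr1 mul1r.
rewrite (_ : (fun _ => _) = (fun y => f y * f y ^+ n.+1)); last first.
  by apply/funext => y; rewrite exprS.
apply: (@is_derive_eq _ _ _ _ _ _ _ _ (drvM df IH)).
by rewrite -(natr1 n.+1) !exprS; ring. Qed.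

Lemma drvpow f x a e : is_derive x 1 f a -> 0 < f x ->
  is_derive x 1 (fun y => f y `^ e) (e * f x `^ (e - 1) * a).
Proof. by move=> Hf f0; apply: (@drv_comp (fun t => t `^ e)) => //; exact: is_derive1_powR. Qed.

Lemma drvexp f x a : is_derive x 1 f a ->
  is_derive x 1 (fun y => expR (f y)) (expR (f x) * a).
Proof. by move=> Hf; exact: drv_comp. Qed.

Lemma drv_eq f x a b : is_derive x 1 f a -> a = b -> is_derive x 1 f b.
Proof. by move=> ? <-. Qed.

(** Applied repeatedly, it turns a bound on a high derivative into a Taylor bound. The factor
    1/(k+1) that integration would give is dropped. *)
Lemma mvt_le f g (M : R) k : (forall x, is_derive x 1 f (g x)) -> f 0 = 0 ->
  (forall x, 0 <= x <= 1 -> `|g x| <= M * x ^+ k) ->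
  forall x, 0 <= x <= 1 -> `|f x| <= M * x ^+ k.+1.
Proof.
move=> df f0 gM x /andP[x0 x1].
have [c] := @MVT_segment R f g 0 x x0 (fun y _ => df y)
  (derivable_within_continuous (fun y _ => @ex_derive _ _ _ _ _ _ _ (df y))).
rewrite in_itv/= => /andP[c0 cx]; rewrite f0 !subr0 => ->.
have c01 : 0 <= c <= 1 by rewrite c0 (le_trans cx).
have M0 : 0 <= M * c ^+ k by apply: le_trans (gM c c01).
rewrite normrM (ger0_norm x0) exprSr mulrA ler_wpM2r//.
apply: (le_trans (gM c c01)).
(* The sign of [M] is not assumed: it is read off from the bound at [c], or at 1 when [c ^+ k]
   vanishes. *)
have [ck0|ck0] := eqVneq (c ^+ k) 0.
  have {}M0 : 0 <= M * 1 ^+ k.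
    by apply: le_trans (gM 1 _); rewrite ?normr_ge0// ler01 lexx.
  by rewrite ck0 mulr0 mulr_ge0 ?exprn_ge0//; rewrite expr1n mulr1 in M0.
have M1 : 0 <= M by move: M0; rewrite pmulr_lge0// lt_neqAle eq_sym ck0 exprn_ge0.
by rewrite ler_wpM2l// lerXn2r.
Qed.

End real_derivatives.

Ltac drv := lazymatch goal with
  | |- is_derive _ _ (fun _ => ?c) _ => apply: drvc
  | |- is_derive _ _ (fun y => y) _ => apply: drvid
  | |- is_derive _ _ (fun y => @GRing.add _ (@?f y) (@?g y)) _ => eapply (@drvD _ f g); [drv|drv]
  | |- is_derive _ _ (fun y => @GRing.opp _ (@?f y)) _ => eapply (@drvN _ f); drv
  | |- is_derive _ _ (fun y => @GRing.mul _ (@?f y) (@?g y)) _ => eapply (@drvM _ f g); [drv|drv]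
  | |- is_derive _ _ (fun y => @GRing.exp _ (@?f y) _) _ => eapply (@drvX _ f); drv
  | |- is_derive _ _ (fun y => powR (@?f y) _) _ => eapply (@drvpow _ f); [drv|idtac]
  | |- is_derive _ _ (fun y => expR (@?f y)) _ => eapply (@drvexp _ f); drv
  | |- _ => idtac end.

(* Along the line s |-> y + s w one has 1 + |y + s w|^2 = A + B s + w2 s^2,
   w2 = |w|^2; all bounds below are uniform in A and B. *)
Section line_bounds.
Context {R : realType}.
Variables (c : R) (c0 : 0 <= c) (c1 : c <= 2^-1).
Implicit Types (A B C s om : R).

Definition lP A B C s : R := A + B * s + C * s ^+ 2.
Definition lD B C s : R := B + 2 * C * s.
Definition lW A B C e s : R := lP A B C s `^ e.
Definition lv A B C s : R := lW A B C c s.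
Definition lv1 A B C s : R := c * lW A B C (c - 1) s * lD B C s.
Definition lv2 A B C s : R := c * (c - 1) * lW A B C (c - 2) s * lD B C s ^+ 2
  + c * lW A B C (c - 1) s * (2 * C).
Definition lv3 A B C s : R :=
  c * (c - 1) * (c - 2) * lW A B C (c - 3) s * lD B C s ^+ 3
  + 3 * c * (c - 1) * lW A B C (c - 2) s * lD B C s * (2 * C).
Definition lv4 A B C s : R :=
  c * (c - 1) * (c - 2) * (c - 3) * lW A B C (c - 4) s * lD B C s ^+ 4
  + 6 * c * (c - 1) * (c - 2) * lW A B C (c - 3) s * lD B C s ^+ 2 * (2 * C)
  + 3 * c * (c - 1) * lW A B C (c - 2) s * (2 * C) ^+ 2.
(** With [c = a / 2] this is |grad V|^2 / 4 along the line (see [line_q]); writing |x|^2 as (1 +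
    |x|^2) - 1 gives the difference of two powers. *)
Definition lq A B C s : R := c ^+ 2 * (lW A B C (2 * c - 1) s - lW A B C (2 * c - 2) s).
Definition lq1 A B C s : R := c ^+ 2 * (((2 * c - 1) * lW A B C (2 * c - 2) s
  - (2 * c - 2) * lW A B C (2 * c - 3) s) * lD B C s).
Definition lq2 A B C s : R := c ^+ 2 * (((2 * c - 1) * (2 * c - 2) * lW A B C (2 * c - 3) s
  - (2 * c - 2) * (2 * c - 3) * lW A B C (2 * c - 4) s) * lD B C s ^+ 2
  + ((2 * c - 1) * lW A B C (2 * c - 2) s
  - (2 * c - 2) * lW A B C (2 * c - 3) s) * (2 * C)).
(** The trapezoidal approximation of the increment of [lv] on [0, s], minus this increment. It is of
    third order in the direction of the line. *)
Definition lrho A B C s : R := lv A B C 0 - lv A B C s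
  + 2^-1 * s * lv1 A B C s + 2^-1 * s * lv1 A B C 0.

Section deriv.
Variables (A B C : R) (P1 : forall s, 1 <= lP A B C s).

Lemma d_lP s : is_derive s 1 (lP A B C) (lD B C s).
Proof. eapply drv_eq; first by rewrite /lP; drv.
by rewrite /lD /=; ring. Qed.

Lemma d_lD s : is_derive s 1 (lD B C) (2 * C).
Proof. eapply drv_eq; first by rewrite /lD; drv.
by rewrite /=; ring. Qed.

Lemma d_lW e s : is_derive s 1 (lW A B C e) (e * lW A B C (e - 1) s * lD B C s).
Proof. by apply: drvpow; [exact: d_lP|exact: lt_le_trans (P1 s)]. Qed.

Let e12 : 1 + 1 = 2 :> R. Proof. by ring. Qed.
Let e23 : 2 + 1 = 3 :> R. Proof. by ring. Qed.
Let e34 : 3 + 1 = 4 :> R. Proof. by ring. Qed.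

Let eqe (e s k l : R) : k + 1 = l -> lW A B C (e - k - 1) s = lW A B C (e - l) s.
Proof. by move=> <-; congr (lW _ _ _ _ _); ring. Qed.

Lemma d_lv s : is_derive s 1 (lv A B C) (lv1 A B C s).
Proof. exact: d_lW. Qed.

Lemma d_lv1 s : is_derive s 1 (lv1 A B C) (lv2 A B C s).
Proof.
eapply drv_eq; first by rewrite /lv1; drv; first [exact: d_lW|exact: d_lD].
by rewrite /lv2 ?(eqe c s e12) /=; ring.
Qed.

Lemma d_lv2 s : is_derive s 1 (lv2 A B C) (lv3 A B C s).
Proof.
eapply drv_eq; first by rewrite /lv2; drv; first [exact: d_lW|exact: d_lD].
by rewrite /lv3 ?(eqe c s e12) ?(eqe c s e23)/=; ring.
Qed.

Lemma d_lv3 s : is_derive s 1 (lv3 A B C) (lv4 A B C s).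
Proof.
eapply drv_eq; first by rewrite /lv3; drv; first [exact: d_lW|exact: d_lD].
by rewrite /lv4 ?(eqe c s e23) ?(eqe c s e34)/=; ring.
Qed.

Lemma d_lq s : is_derive s 1 (lq A B C) (lq1 A B C s).
Proof.
eapply drv_eq; first by rewrite /lq; drv; first [exact: d_lW|exact: d_lD].
by rewrite /lq1 ?(eqe (2 * c) s e12) ?(eqe (2 * c) s e23)/=; ring.
Qed.

Lemma d_lq1 s : is_derive s 1 (lq1 A B C) (lq2 A B C s).
Proof.
eapply drv_eq; first by rewrite /lq1; drv; first [exact: d_lW|exact: d_lD].
by rewrite /lq2 ?(eqe (2 * c) s e23) ?(eqe (2 * c) s e34)/=; ring.
Qed.

Variables (om : R) (om0 : 0 <= om) (omC : om ^+ 2 = C) (BAC : B ^+ 2 <= 4 * A * C).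

Lemma lW_ge0 e s : 0 <= lW A B C e s. Proof. exact: powR_ge0. Qed.

Lemma lW_le1 e s : e <= 0 -> lW A B C e s <= 1.
Proof. by move=> e0; rewrite -[leRHS](powRr0 (lP A B C s)) ler_powR. Qed.

Lemma lW_mul k e f s : e + k%:R = f -> lP A B C s ^+ k * lW A B C e s = lW A B C f s.
Proof.
move=> <-; rewrite /lW addrC powRD; last by apply/implyP => _; rewrite gt_eqF// (lt_le_trans _ (P1 s)).
by rewrite powR_mulrn// (le_trans _ (P1 s)).
Qed.

(** The difference of the two sides is the discriminant B^2 - 4AC. So a factor [lD] is worth [om]
    times a square root of [lP], and the negative powers [lW] absorb the latter; this makes all
    derivative bounds uniform in the base point. *)
Lemma lD_sqr s : lD B C s ^+ 2 <= 4 * lP A B C s * om ^+ 2.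
Proof. by rewrite omC /lD /lP; move: BAC; rewrite !expr2 => H; nra. Qed.

Lemma lD_le s : `|lD B C s| <= 2 * lP A B C s * om.
Proof.
have p0 : 0 <= lP A B C s by rewrite (le_trans _ (P1 s)).
rewrite -(ler_pXn2r (n := 2))// ?nnegrE ?mulr_ge0// real_normK ?num_real//.
apply: (le_trans (lD_sqr s)); rewrite !exprMn ler_wpM2r ?sqr_ge0//.
by have := P1 s; nra.
Qed.

Local Notation W := (lW A B C).
Local Notation D := (lD B C).

Let P0 s : 0 < lP A B C s.
Proof. exact: lt_le_trans (P1 s). Qed.

Lemma lWD1 e s : 2 * e + 1 <= 0 -> `|W e s * D s| <= 2 * om.
Proof.
move=> e1; rewrite -(ler_pXn2r (n := 2))// ?nnegrE ?mulr_ge0// real_normK ?num_real//.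
rewrite exprMn; apply: (le_trans (ler_wpM2l (sqr_ge0 _) (lD_sqr s))).
rewrite [leLHS](_ : _ = (lP A B C s ^+ 1 * W e s) * W e s * (2 * om) ^+ 2); last by ring.
rewrite (@lW_mul 1 e (e + 1))// ler_piMl ?sqr_ge0// /lW -powRD; last first.
  by apply/implyP => _; rewrite gt_eqF.
by rewrite (_ : e + 1 + e = 2 * e + 1) ?lW_le1//; ring.
Qed.

Lemma lWD2 e s : e + 1 <= 0 -> `|W e s * D s ^+ 2| <= 4 * om ^+ 2.
Proof.
move=> e1; rewrite ger0_norm; last by rewrite mulr_ge0 ?lW_ge0 ?sqr_ge0.
apply: (le_trans (ler_wpM2l (lW_ge0 _ _) (lD_sqr s))).
rewrite [leLHS](_ : _ = (lP A B C s ^+ 1 * W e s) * (4 * om ^+ 2)); last by ring.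
rewrite (@lW_mul 1 e (e + 1))//.
by apply: ler_piMl; rewrite ?mulr_ge0 ?sqr_ge0 ?lW_le1.
Qed.

Lemma lWD3 e s : e + 2 <= 0 -> `|W e s * D s ^+ 3| <= 8 * om ^+ 3.
Proof.
move=> e1; rewrite normrM (ger0_norm (lW_ge0 _ _)) normrX exprS real_normK ?num_real//.
have := ler_pM (normr_ge0 _) (sqr_ge0 _) (lD_le s) (lD_sqr s).
move=> /(ler_wpM2l (lW_ge0 e s)) /le_trans; apply.
rewrite [leLHS](_ : _ = (lP A B C s ^+ 2 * W e s) * (8 * om ^+ 3)); last by ring.
rewrite (@lW_mul 2 e (e + 2))//.
by apply: ler_piMl; rewrite ?mulr_ge0 ?exprn_ge0 ?lW_le1.
Qed.

Lemma lWD4 e s : e + 2 <= 0 -> `|W e s * D s ^+ 4| <= 16 * om ^+ 4.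
Proof.
move=> e1; rewrite ger0_norm; last by rewrite mulr_ge0 ?lW_ge0 ?exprn_even_ge0.
rewrite (exprM _ 2 2).
have := ler_pM (sqr_ge0 _) (sqr_ge0 _) (lD_sqr s) (lD_sqr s).
rewrite -expr2 => /(ler_wpM2l (lW_ge0 e s)) /le_trans; apply.
rewrite [leLHS](_ : _ = (lP A B C s ^+ 2 * W e s) * (16 * om ^+ 4)); last by ring.
rewrite (@lW_mul 2 e (e + 2))//.
by apply: ler_piMl; rewrite ?mulr_ge0 ?exprn_ge0 ?lW_le1.
Qed.

Lemma normM_le (x y a b : R) : `|x| <= a -> `|y| <= b -> `|x * y| <= a * b.
Proof. by move=> xa yb; rewrite normrM ler_pM. Qed.

Let cc : `|c| <= 2^-1. Proof. by rewrite ger0_norm. Qed.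
Ltac clra := have ? := c0; have ? := c1; lra.
Let cc1 : `|c - 1| <= 1. Proof. by rewrite ler_norml; apply/andP; split; clra. Qed.
Let cc2 : `|c - 2| <= 2. Proof. by rewrite ler_norml; apply/andP; split; clra. Qed.
Let cc3 : `|c - 3| <= 3. Proof. by rewrite ler_norml; apply/andP; split; clra. Qed.
Let k3 : `|3| <= 3 :> R. Proof. by rewrite ger0_norm. Qed.
Let k6 : `|6| <= 6 :> R. Proof. by rewrite ger0_norm. Qed.
Let kC : `|2 * C| <= 2 * om ^+ 2. Proof. by rewrite -omC ger0_norm ?mulr_ge0 ?sqr_ge0. Qed.
Let W1 e s : e <= 0 -> `|W e s| <= 1.
Proof. by move=> e0; rewrite ger0_norm ?lW_ge0 ?lW_le1. Qed.

Lemma lv1_le s : `|lv1 A B C s| <= om.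
Proof.
rewrite /lv1 -mulrA; have c' : 2 * (c - 1) + 1 <= 0 by clra.
by apply: (le_trans (normM_le cc (lWD1 s c'))); rewrite mulrA mulVf ?mul1r.
Qed.

Lemma lv3_le s : `|lv3 A B C s| <= 14 * om ^+ 3.
Proof.
have h3 : c - 3 + 2 <= 0 by clra.
have h1 : 2 * (c - 2) + 1 <= 0 by clra.
have H1 := normM_le (normM_le (normM_le cc cc1) cc2) (lWD3 s h3).
have H2 := normM_le (normM_le (normM_le (normM_le k3 cc) cc1) (lWD1 s h1)) kC.
apply: (@le_trans _ _ (_ + _)); last first.
  apply: (le_trans (lerD H1 H2)); have := exprn_ge0 3 om0; nra.
by rewrite /lv3; apply: le_trans (ler_normD _ _); rewrite le_eqVlt; apply/orP; left; apply/eqP;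
  congr `|_|; ring.
Qed.

Lemma lv4_le s : `|lv4 A B C s| <= 102 * om ^+ 4.
Proof.
have h4 : c - 4 + 2 <= 0 by clra.
have h3 : c - 3 + 1 <= 0 by clra.
have h2 : c - 2 <= 0 by clra.
have H1 := normM_le (normM_le (normM_le (normM_le cc cc1) cc2) cc3) (lWD4 s h4).
have H2 := normM_le (normM_le (normM_le (normM_le (normM_le k6 cc) cc1) cc2) (lWD2 s h3)) kC.
have H3 := normM_le (normM_le (normM_le (normM_le k3 cc) cc1) (W1 s h2)) (normM_le kC kC).
apply: (@le_trans _ _ (_ + _ + _)); last first.
  apply: (le_trans (lerD (lerD H1 H2) H3)); have := exprn_ge0 4 om0; nra.
apply: le_trans (lerD (ler_normD _ _) (lexx _)); apply: le_trans (ler_normD _ _).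
by rewrite /lv4 le_eqVlt; apply/orP; left; apply/eqP; congr `|_|; ring.
Qed.

Let qq : `|c ^+ 2| <= 4^-1.
Proof. by have ? := c0; have ? := c1; rewrite ger0_norm ?sqr_ge0//; nra. Qed.
Let q1 : `|2 * c - 1| <= 1. Proof. by rewrite ler_norml; apply/andP; split; clra. Qed.
Let q2 : `|2 * c - 2| <= 2. Proof. by rewrite ler_norml; apply/andP; split; clra. Qed.
Let q3 : `|2 * c - 3| <= 3. Proof. by rewrite ler_norml; apply/andP; split; clra. Qed.

Lemma lq1_le s : `|lq1 A B C s| <= 3 / 2 * om.
Proof.
have h1 : 2 * (2 * c - 2) + 1 <= 0 by clra.
have h2 : 2 * (2 * c - 3) + 1 <= 0 by clra.
have H1 := normM_le q1 (lWD1 s h1); have H2 := normM_le q2 (lWD1 s h2).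
have H3 := normM_le qq (le_trans (ler_normB _ _) (lerD H1 H2)).
apply: (@le_trans _ _ (4^-1 * (1 * (2 * om) + 2 * (2 * om)))); last by lra.
apply: le_trans H3; rewrite /lq1 le_eqVlt; apply/orP; left; apply/eqP; congr `|_|; ring.
Qed.

Lemma lq2_le s : `|lq2 A B C s| <= 10 * om ^+ 2.
Proof.
have h1 : 2 * c - 3 + 1 <= 0 by clra.
have h2 : 2 * c - 4 + 1 <= 0 by clra.
have h3 : 2 * c - 2 <= 0 by clra.
have h4 : 2 * c - 3 <= 0 by clra.
have H1 := normM_le (normM_le q1 q2) (lWD2 s h1); have H2 := normM_le (normM_le q2 q3) (lWD2 s h2).
have H3 := normM_le q1 (W1 s h3); have H4 := normM_le q2 (W1 s h4).
have H5 := normM_le (le_trans (ler_normB _ _) (lerD H3 H4)) kC.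
have H6 := le_trans (ler_normB _ _) (lerD H1 H2).
have H7 := normM_le qq (le_trans (ler_normD _ _) (lerD H6 H5)).
have -> : lq2 A B C s = c ^+ 2 * ((2 * c - 1) * (2 * c - 2) * (W (2 * c - 3) s * D s ^+ 2)
  - (2 * c - 2) * (2 * c - 3) * (W (2 * c - 4) s * D s ^+ 2)
  + ((2 * c - 1) * W (2 * c - 2) s - (2 * c - 2) * W (2 * c - 3) s) * (2 * C)).
  by rewrite /lq2; ring.
by apply: (le_trans H7); have := sqr_ge0 om; lra.
Qed.

Lemma lv_diff : `|lv A B C 1 - lv A B C 0| <= om.
Proof.
have := @mvt_le R (fun s => lv A B C s - lv A B C 0) (lv1 A B C) om 0.
move=> /(_ _ _ _ 1); rewrite expr1 mulr1; apply.
- by move=> x; eapply drv_eq; [drv; exact: d_lv|ring].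
- by rewrite subrr.
- by move=> x _; exact: lv1_le.
- by rewrite ler01 lexx.
Qed.

Lemma lq_diff : `|lq A B C 1 - lq A B C 0| <= 3 / 2 * om.
Proof.
have := @mvt_le R (fun s => lq A B C s - lq A B C 0) (lq1 A B C) (3 / 2 * om) 0.
move=> /(_ _ _ _ 1); rewrite expr1 mulr1; apply.
- by move=> x; eapply drv_eq; [drv; exact: d_lq|ring].
- by rewrite subrr.
- by move=> x _; exact: lq1_le.
- by rewrite ler01 lexx.
Qed.

Definition lrho1 s := 2^-1 * (lv1 A B C 0 - lv1 A B C s) + 2^-1 * s * lv2 A B C s.

Lemma d_lrho s : is_derive s 1 (lrho A B C) (lrho1 s).
Proof.
eapply drv_eq; first by rewrite /lrho; drv; first [exact: d_lv|exact: d_lv1].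
by rewrite /lrho1; field.
Qed.

Lemma d_lrho1 s : is_derive s 1 lrho1 (2^-1 * s * lv3 A B C s).
Proof.
eapply drv_eq; first by rewrite /lrho1; drv; first [exact: d_lv1|exact: d_lv2].
by field.
Qed.

Lemma lrho0 : lrho A B C 0 = 0.
Proof. by rewrite /lrho; ring. Qed.

Lemma lrho10 : lrho1 0 = 0.
Proof. by rewrite /lrho1; ring. Qed.

Lemma lrho_le : `|lrho A B C 1| <= 7 * om ^+ 3.
Proof.
have H : forall x, 0 <= x <= 1 -> `|lrho1 x| <= 7 * om ^+ 3 * x ^+ 2.
  apply: (mvt_le d_lrho1 lrho10) => x /andP[x0 x1].
  rewrite expr1 normrM ger0_norm ?mulr_ge0//.
  by have := ler_wpM2l x0 (lv3_le x); lra.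
have := mvt_le d_lrho lrho0 H; move=> /(_ 1); rewrite expr1n mulr1; apply.
by rewrite ler01 lexx.
Qed.

End deriv.

Section symmetric.
Variables (A B C : R) (P1 : forall s, 1 <= lP A B C s).
Variables (om : R) (om0 : 0 <= om) (omC : om ^+ 2 = C) (BAC : B ^+ 2 <= 4 * A * C).

Let P1N s : 1 <= lP A (- B) C s.
Proof. by have := P1 (- s); rewrite /lP sqrrN mulrN mulNr. Qed.
Let BACN : (- B) ^+ 2 <= 4 * A * C. Proof. by rewrite sqrrN. Qed.

Let W0 e : lW A (- B) C e 0 = lW A B C e 0.
Proof. by rewrite /lW /lP !mulr0. Qed.

Let D0 : lD (- B) C 0 = - lD B C 0.
Proof. by rewrite /lD; ring. Qed.

(** Reversing the direction changes the sign of [B]. Odd derivatives at 0 cancel in the sum, so the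
    third-order error disappears and the fourth derivative decides. *)
Lemma lrho_sym : `|lrho A B C 1 + lrho A (- B) C 1| <= 102 * om ^+ 4.
Proof.
have H3 : forall x, 0 <= x <= 1 -> `|lv3 A B C x + lv3 A (- B) C x| <= 204 * om ^+ 4 * x ^+ 1.
  apply: (@mvt_le _ (fun x => lv3 A B C x + lv3 A (- B) C x) (fun x => lv4 A B C x + lv4 A (- B) C x)).
  - by move=> x; drv; exact: d_lv3.
  - by rewrite /lv3 !W0 !D0; ring.
  - move=> x _; rewrite expr0 mulr1; apply: (le_trans (ler_normD _ _)).
    apply: (le_trans (lerD (lv4_le P1 om0 omC BAC x) (lv4_le P1N om0 omC BACN x))).
    by have := exprn_ge0 4 om0; lra.
have H2 : forall x, 0 <= x <= 1 -> `|lrho1 A B C x + lrho1 A (- B) C x| <= 102 * om ^+ 4 * x ^+ 3.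
  apply: (@mvt_le _ (fun x => lrho1 A B C x + lrho1 A (- B) C x) (fun x => 2^-1 * x * lv3 A B C x + 2^-1 * x * lv3 A (- B) C x)).
  - by move=> x; drv; exact: d_lrho1.
  - by rewrite !lrho10 addr0.
  - move=> x x01; have /andP[x0 x1] := x01; rewrite -mulrDr normrM ger0_norm ?mulr_ge0//.
    by have := ler_wpM2l x0 (H3 x x01); rewrite expr1 expr2; lra.
have := @mvt_le R (fun x => lrho A B C x + lrho A (- B) C x) _ _ _ _ _ H2.
move=> /(_ _ _ 1); rewrite expr1n mulr1; apply.
- by move=> x; drv; exact: d_lrho.
- by rewrite !lrho0 addr0.
- by rewrite ler01 lexx.
Qed.

Lemma lq_sym : `|lq A B C 1 + lq A (- B) C 1 - 2 * lq A B C 0| <= 20 * om ^+ 2.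
Proof.
have H2 : forall x, 0 <= x <= 1 -> `|lq1 A B C x + lq1 A (- B) C x| <= 20 * om ^+ 2 * x ^+ 1.
  apply: (@mvt_le _ (fun x => lq1 A B C x + lq1 A (- B) C x) (fun x => lq2 A B C x + lq2 A (- B) C x)).
  - by move=> x; drv; exact: d_lq1.
  - by rewrite /lq1 !W0 !D0; ring.
  - move=> x _; rewrite expr0 mulr1; apply: (le_trans (ler_normD _ _)).
    apply: (le_trans (lerD (lq2_le P1 om0 omC BAC x) (lq2_le P1N om0 omC BACN x))).
    by have := exprn_ge0 2 om0; lra.
have := @mvt_le R (fun x => lq A B C x + lq A (- B) C x - 2 * lq A B C 0) _ _ _ _ _ H2.
move=> /(_ _ _ 1); rewrite expr1n mulr1; apply.
- by move=> x; eapply drv_eq; [drv; exact: d_lq|ring].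
- by rewrite /lq !W0; ring.
- by rewrite ler01 lexx.
Qed.
End symmetric.
End line_bounds.

(** * The kernel of one LMC step *)

Section exp_bounds.
Context {R : realType}.
Implicit Types x a : R.

Lemma expR_sub1_le x : expR x - 1 <= x * expR x.
Proof.
have : (1 - x) * expR x <= expR (- x) * expR x.
  by rewrite ler_wpM2r ?expR_ge0// expR_ge1Dx.
by rewrite -expRD addNr expR0; lra.
Qed.

Lemma norm_expR_sub1_le x : `|expR x - 1| <= `|x| * expR `|x|.
Proof.
have [x0|x0] := leP 0 x.
  rewrite (ger0_norm x0) ger0_norm ?expR_sub1_le//.
  by rewrite subr_ge0 -[leLHS]expR0 ler_expR.
rewrite ler0_norm; last by rewrite subr_le0 -[leRHS]expR0 ler_expR ltW.
rewrite ltr0_norm// opprB.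
have h1 := expR_ge1Dx x; have h2 : 1 <= expR (- x) by rewrite -[leLHS]expR0 ler_expR; lra.
by nra.
Qed.

Lemma expR_taylor2 x : expR x <= 1 + x + x ^+ 2 * expR `|x|.
Proof.
have h1 := expR_sub1_le x.
have h2 : x * (expR x - 1) <= `|x| * (`|x| * expR `|x|).
  by apply: (le_trans (ler_norm _)); rewrite normrM ler_wpM2l// norm_expR_sub1_le.
by rewrite mulrA -expr2 real_normK ?num_real// in h2; lra.
Qed.

Lemma sqr_le_expR x : 0 <= x -> x ^+ 2 <= 4 * expR x.
Proof.
move=> x0; have h := expR_ge1Dx (x / 2).
have -> : expR x = expR (x / 2) ^+ 2 by rewrite expr2 -expRD; congr expR; field.
by have := expR_gt0 (x / 2); nra.
Qed.

Lemma expR_odd_le a : `|expR (- a) - expR a| <= 2 * `|a| * expR `|a|.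
Proof.
rewrite (_ : _ - _ = (expR (- a) - 1) - (expR a - 1)); last by ring.
apply: (le_trans (ler_normB _ _)).
apply: (le_trans (lerD (norm_expR_sub1_le _) (norm_expR_sub1_le _))).
by rewrite normrN; lra.
Qed.

(** Expand exp(b1) and exp(b2) to second order. The linear terms combine into exp(a) (b1 + b2) + b1
    (exp(-a) - exp(a)): the sum b1 + b2 is small by symmetry, and the other term is a product of two
    small quantities. The exponent [4 * om + 1] collects [om / 2] from [a], [2 * om + 1] from the
    [b]s and [3 / 2 * om] to absorb a factor om^2. *)
Lemma expR_sym_le (a b1 b2 om h t : R) :
  0 <= om -> 0 <= h -> h <= 1 -> 0 <= t -> t <= 1 -> `|a| <= om / 2 ->
  `|b1| <= 7 * om ^+ 3 + 3 / 2 * h * om -> `|b2| <= 7 * om ^+ 3 + 3 / 2 * h * om ->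
  `|b1| <= 2 * om + 1 -> `|b2| <= 2 * om + 1 ->
  `|b1 + b2| <= 102 * om ^+ 4 + 20 * h * om ^+ 2 ->
  t * (expR (- a) * expR b1 + expR a * expR b2) <=
  t * (expR (- a) + expR a) + 1400 * (om ^+ 4 + h ^+ 2) * expR (4 * om + 1).
Proof.
move=> om0 h0 h1 t0 t1 ha hb1 hb2 hc1 hc2 hb.
have Ea : expR `|a| <= expR (om / 2) by rewrite ler_expR.
have Eb b : `|b| <= 2 * om + 1 -> expR `|b| <= expR (2 * om + 1) by rewrite ler_expR.
set e1 := expR (om / 2) in Ea *; set e2 := expR (2 * om + 1) in Eb *.
have e1_ge1 : 1 <= e1 by rewrite -[leLHS]expR0 ler_expR; lra.
have ea : expR a <= e1 by apply: le_trans Ea; rewrite ler_expR ler_norm.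
have eNa : expR (- a) <= e1 by apply: le_trans Ea; rewrite ler_expR -normrN ler_norm.
set M := 7 * om ^+ 3 + 3 / 2 * h * om in hb1 hb2.
have M0 : 0 <= M by apply: le_trans hb1; rewrite normr_ge0.
have sqM b : `|b| <= M -> `|b| <= 2 * om + 1 -> b ^+ 2 * expR `|b| <= M ^+ 2 * e2.
  move=> bM bm; apply: ler_pM; rewrite ?sqr_ge0 ?expR_ge0 ?Eb//.
  by rewrite -real_normK ?num_real// lerXn2r ?nnegrE.
have T1 : expR (- a) * expR b1 <= expR (- a) * (1 + b1) + e1 * (M ^+ 2 * e2).
  apply: (le_trans (ler_wpM2l (expR_ge0 _) (expR_taylor2 b1))); rewrite mulrDr lerD2l.
  by apply: ler_pM; [exact: expR_ge0|rewrite mulr_ge0 ?sqr_ge0 ?expR_ge0|done|exact: sqM].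
have T2 : expR a * expR b2 <= expR a * (1 + b2) + e1 * (M ^+ 2 * e2).
  apply: (le_trans (ler_wpM2l (expR_ge0 _) (expR_taylor2 b2))); rewrite mulrDr lerD2l.
  by apply: ler_pM; [exact: expR_ge0|rewrite mulr_ge0 ?sqr_ge0 ?expR_ge0|done|exact: sqM].
have T3 : expR (- a) * b1 + expR a * b2 <= e1 * (102 * om ^+ 4 + 20 * h * om ^+ 2) + M * (om * e1).
  rewrite (_ : _ + _ = expR a * (b1 + b2) + b1 * (expR (- a) - expR a)); last by ring.
  apply: lerD; apply: (le_trans (ler_norm _)); rewrite normrM.
    by apply: ler_pM => //; rewrite ger0_norm ?expR_ge0.
  apply: ler_pM => //; apply: (le_trans (expR_odd_le a)).
  by apply: ler_pM; rewrite ?mulr_ge0 ?expR_ge0//; lra.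
have S : expR (- a) * expR b1 + expR a * expR b2 <= (expR (- a) + expR a) +
   1400 * (om ^+ 4 + h ^+ 2) * expR (4 * om + 1).
  suff : e1 * (102 * om ^+ 4 + 20 * h * om ^+ 2) + M * (om * e1) + 2 * (e1 * (M ^+ 2 * e2)) <=
      1400 * (om ^+ 4 + h ^+ 2) * expR (4 * om + 1).
    move: T1 T2 T3; rewrite !mulrDr !mulr1; lra.
  have -> : expR (4 * om + 1) = e1 * e2 * expR (3 / 2 * om).
    by rewrite /e1 /e2 -!expRD; congr expR; field.
  set e3 := expR (3 / 2 * om).
  have e2_ge1 : 1 <= e2 by rewrite -[leLHS]expR0 ler_expR; lra.
  have e3_ge1 : 1 <= e3 by rewrite -[leLHS]expR0 ler_expR; lra.
  have ome : om ^+ 2 <= 4 * e3.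
    by apply: (le_trans (sqr_le_expR om0)); rewrite ler_pM2l// ler_expR; lra.
  have hom : 2 * (h * om ^+ 2) <= h ^+ 2 + om ^+ 4.
    by have := sqr_ge0 (h - om ^+ 2); rewrite sqrrB -(exprM om 2 2) /= -mulr_natr; lra.
  set Q := om ^+ 4 + h ^+ 2; have Q0 : 0 <= Q by rewrite /Q addr_ge0 ?sqr_ge0// exprn_ge0.
  have U1 : 102 * om ^+ 4 + 20 * h * om ^+ 2 + M * om <= 120 * Q.
    rewrite /M /Q; have := sqr_ge0 h.
    have -> : (7 * om ^+ 3 + 3 / 2 * h * om) * om = 7 * om ^+ 4 + 3 / 2 * (h * om ^+ 2) by ring.
    by move: hom; have := exprn_ge0 4 om0; lra.
  have U2 : M ^+ 2 <= 400 * Q * e3.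
    apply: (@le_trans _ _ ((2 * 49 * om ^+ 4 + 2 * (9 / 4) * h ^+ 2) * om ^+ 2)).
      rewrite /M; have := sqr_ge0 (7 * om ^+ 3 - 3 / 2 * h * om).
      move=> H; rewrite -subr_ge0; apply: (le_trans H); rewrite le_eqVlt; apply/orP; left; apply/eqP; by field.
    apply: (@le_trans _ _ (100 * Q * om ^+ 2)).
      by rewrite ler_wpM2r ?sqr_ge0// /Q; have := sqr_ge0 h; have := exprn_ge0 4 om0; lra.
    by have := ler_wpM2l (mulr_ge0 (ler0n R 100) Q0) ome; lra.
  apply: (@le_trans _ _ (e1 * (120 * Q) + 2 * (e1 * (400 * Q * e3 * e2)))).
    apply: lerD; last by rewrite ler_pM2l// ler_wpM2l ?expR_ge0// ler_wpM2r ?expR_ge0.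
    rewrite (_ : _ + _ = e1 * (102 * om ^+ 4 + 20 * h * om ^+ 2 + M * om)); last by ring.
    by rewrite ler_wpM2l ?expR_ge0.
  have : e1 * (120 * Q) * 1 <= e1 * (120 * Q) * (e2 * e3).
    by rewrite ler_wpM2l ?mulr_ge0 ?expR_ge0//; nra.
  have : 0 <= e1 * e2 * e3 * Q by rewrite !mulr_ge0 ?expR_ge0.
  by rewrite -/Q; lra.
have E0 : 0 <= 1400 * (om ^+ 4 + h ^+ 2) * expR (4 * om + 1).
  apply: mulr_ge0; last exact: expR_ge0.
  by apply: mulr_ge0; [exact: ler0n|rewrite addr_ge0 ?sqr_ge0 ?exprn_ge0].
apply: (le_trans (ler_wpM2l t0 S)); rewrite mulrDr lerD2l.
by rewrite -[leRHS]mul1r ler_wpM2r.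
Qed.

End exp_bounds.

Lemma dist_le1 {R : realType} (x y : R) : 0 <= x <= 4^-1 -> 0 <= y <= 4^-1 -> `|x - y| <= 1.
Proof. by move=> /andP[? ?] /andP[? ?]; rewrite ler_norml; apply/andP; split; lra. Qed.

Lemma norm_scale_le {R : realType} (h x c : R) : 0 <= h -> `|x| <= c -> `|h * x| <= h * c.
Proof. by move=> h0 xc; rewrite normrM ger0_norm// ler_wpM2l. Qed.

(** The constant of [expR_sym_le], locked so that the numeral is never unfolded. *)
Definition CW {R : realType} : R := locked 1400.
Lemma CWE {R : realType} : CW = 1400 :> R. Proof. by rewrite /CW -lock. Qed.
Lemma CW_ge0 {R : realType} : 0 <= CW :> R. Proof. by rewrite CWE ler0n. Qed.

Section kernel.
Context {R : realType} {n : nat}.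
Variables (a : R) (a0 : 0 < a) (a1 : a < 1).
Local Notation lam := (@lebesgue_rV R n).
Local Notation c := (a / 2).
Implicit Types (x y w : 'rV[R]_n) (h : R).

Definition pp x : R := 1 + sqn x.
(** The closed form of the gradient of V; [grad_V] identifies it with [grad (V_alpha n a)]. *)
Definition gV x : 'rV[R]_n := (a * pp x `^ (c - 1)) *: x.
(* Transition density of one LMC step (x - h grad V(x) plus a centered Gaussian of
   variance 2h), from x to y, conjugated by exp(-V) so that it acts on densities
   with respect to pi. *)
Definition K h y x : R :=
  locked (expR (V_alpha n a y - V_alpha n a x) * gaus h (y - (x - h *: gV x))).

Lemma KE h y x :
  K h y x = expR (V_alpha n a y - V_alpha n a x) * gaus h (y - (x - h *: gV x)).
Proof. by rewrite /K -lock. Qed.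

Lemma pp_ge1 x : 1 <= pp x.
Proof. by rewrite lerDl sqn_ge0. Qed.

Lemma pp_gt0 x : 0 < pp x.
Proof. exact: lt_le_trans (pp_ge1 x). Qed.

Lemma V_alphaE x : V_alpha n a x = pp x `^ c.
Proof. by rewrite /V_alpha enormK. Qed.

Let c0 : 0 <= c. Proof. by rewrite divr_ge0// ltW. Qed.
Let c1 : c <= 2^-1. Proof. by rewrite ler_piMl ?invr_ge0// ltW. Qed.

Let lA y := 1 + sqn y.
Let lB y w := 2 * dotp y w.
Let lC w := sqn w.

Lemma lineP y w s : lP (lA y) (lB y w) (lC w) s = pp (y + s *: w).
Proof. by rewrite /lP /pp sqnD sqnZ dotpZr /lA /lB /lC; ring. Qed.

Lemma line_ge1 y w s : 1 <= lP (lA y) (lB y w) (lC w) s.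
Proof. by rewrite lineP pp_ge1. Qed.

Lemma line_BAC y w : lB y w ^+ 2 <= 4 * lA y * lC w.
Proof.
rewrite /lA /lB /lC; have := dotp_sqr_le y w; have := sqn_ge0 w.
rewrite exprMn; lra.
Qed.

Lemma line_v y w s : lv c (lA y) (lB y w) (lC w) s = V_alpha n a (y + s *: w).
Proof. by rewrite V_alphaE /lv /lW lineP. Qed.

Lemma line_v1 y w s : lv1 c (lA y) (lB y w) (lC w) s = dotp w (gV (y + s *: w)).
Proof.
rewrite /lv1 /lW lineP /gV dotpZr dotpDr dotpZr (dotpC w y) /lD /lB /lC -/(sqn w); by field.
Qed.

Lemma line_q y w s : lq c (lA y) (lB y w) (lC w) s = sqn (gV (y + s *: w)) / 4.
Proof.
rewrite /lq /lW lineP; set z := y + s *: w.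
have -> : pp z `^ (2 * c - 1) = pp z * pp z `^ (2 * c - 2).
  rewrite (_ : 2 * c - 1 = 1 + (2 * c - 2)); last by ring.
  rewrite powRD; last by apply/implyP => _; rewrite gt_eqF// pp_gt0.
  by rewrite powRr1 ?ltW ?pp_gt0.
have -> : pp z `^ (2 * c - 2) = (pp z `^ (c - 1)) ^+ 2.
  rewrite expr2 -powRD; last by apply/implyP => _; rewrite gt_eqF// pp_gt0.
  by congr (_ `^ _); ring.
rewrite /gV sqnZ (_ : sqn z = pp z - 1); last by rewrite /pp; ring.
by field.
Qed.

Lemma line_BN y w : lB y (- w) = - lB y w.
Proof. by rewrite /lB dotpNr mulrN. Qed.

Lemma line_CN w : lC (- w) = lC w.
Proof. by rewrite /lC sqnN. Qed.

(** Expanding the square in the Gaussian yields the cross term w . grad V(y + w) / 2. Adding and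
    subtracting w . grad V(y) / 2 completes V(y) - V(y + w) to the trapezoidal error [lrho]; what
    remains is linear in [w], up to the term of order [h]. *)
Lemma K_line h y w : 0 < h -> K h y (y + w) =
  gaus h w * expR (lrho c (lA y) (lB y w) (lC w) 1 - 2^-1 * dotp w (gV y)
    - h * lq c (lA y) (lB y w) (lC w) 1).
Proof.
move=> h0; rewrite /lrho !line_v !line_v1 line_q scale0r addr0 scale1r KE !gausE// mulrCA -!mulrA -!expRD.
congr (_ * expR _).
rewrite (_ : y - _ = h *: gV (y + w) - w); last by apply/rowP => i; rewrite !mxE; ring.
move: (gV (y + w)) (gV y) => g g0.
by rewrite /sqn !dotpE (dotpC g w); field; rewrite gt_eqF.
Qed.

Lemma K_ge0 h y x : 0 <= K h y x.
Proof. by rewrite KE mulr_ge0 ?expR_ge0 ?gaus_ge0. Qed.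

Lemma lq_bnd y w s : 0 <= lq c (lA y) (lB y w) (lC w) s <= 4^-1.
Proof.
apply/andP; split; first by rewrite line_q divr_ge0 ?sqn_ge0.
rewrite /lq; apply: (@le_trans _ _ (4^-1 * 1)); last by rewrite mulr1.
apply: ler_pM; rewrite ?sqr_ge0//.
- rewrite subr_ge0 /lW ler_powR ?line_ge1//; lra.
- have ? := c0; have ? := c1; nra.
- have c' : 2 * c - 1 <= 0 by have ? := c1; lra.
  by rewrite lerBlDr (le_trans (lW_le1 (line_ge1 y w) s c'))// lerDl lW_ge0.
Qed.

Lemma gV_le1 x : enorm (gV x) <= 1.
Proof.
have /andP[_] := lq_bnd x 0 0; rewrite line_q scaler0 addr0 => H.
by rewrite enorm_le_sqn// expr1n; lra.
Qed.

Lemma V_lip x y : `|V_alpha n a x - V_alpha n a y| <= enorm (x - y).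
Proof.
have := lv_diff c0 c1 (line_ge1 y (x - y)) (enorm_ge0 _) (enormK _) (line_BAC y (x - y)).
by rewrite !line_v scale0r addr0 scale1r (addrC y) subrK.
Qed.

(** As V is 1-Lipschitz, the exponent of the kernel is at least -2|w| - 1/4; [gaus_shrink] trades
    exp(-2|w|) for the narrower Gaussian. The constant 5 covers 1/4 + 1/2 + 4hn. *)
Lemma K_ge h y w : (0 < n)%N -> 0 < h -> h * n%:R <= 1 ->
  expR (-5) * gaus (h * n%:R / (n%:R + 1)) w <= K h y (y + w).
Proof.
move=> n0 h0 hn; have n1 : 1 <= n%:R :> R by rewrite ler1n.
have h1 : h <= 1 by apply: le_trans hn; rewrite ler_peMr// ltW.
apply: (@le_trans _ _ (gaus h w * expR (- (2 * enorm w) - 4^-1))).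
  have := ler_wpM2l (expR_ge0 (- (2 * enorm w) - 4^-1 - 2^-1 - 4 * h * n%:R)) (gaus_shrink w n0 h0).
  rewrite mulrCA -expRD => H.
  apply: (@le_trans _ _ (gaus (h * n%:R / (n%:R + 1)) w * expR (- 4^-1 - 2^-1 - 4 * h * n%:R))).
    by rewrite mulrC ler_wpM2l ?gaus_ge0// ler_expR; lra.
  apply: le_trans (le_trans H _); first by rewrite ler_wpM2l ?gaus_ge0// ler_expR; lra.
  by rewrite mulrA -expRD mulrC ler_wpM2l ?gaus_ge0// ler_expR; lra.
rewrite K_line// ler_wpM2l ?gaus_ge0// ler_expR.
rewrite /lrho !line_v !line_v1 scale0r addr0 scale1r.
have /andP[q0 q1] := lq_bnd y w 1.
have := V_lip (y + w) y; rewrite (_ : y + w - y = w) => [/ler_normlP[H1 H2]|]; last by rewrite addrAC subrr add0r.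
have := lv1_le c0 c1 (line_ge1 y w) (enorm_ge0 w) (enormK w) (line_BAC y w) 1.
rewrite line_v1 scale1r => /ler_normlP[H3 H4].
have := enorm_ge0 w.
move: H1 H2 H3 H4 q0 q1; nra.
Qed.

(** One factor [CW] comes from [expR_sym_le]; the other only bounds 1025 = 256 * 4 + 1, and 65
    bounds 64hn + 1, both in [int_weight_le]. *)
Definition CK : R := CW ^+ 2 * expR 65.

(** The factor exp(-h |grad V(y)|^2 / 4) is kept exactly, because the Gaussian integrals of the two
    linear tilts are both exp(h |grad V(y)|^2 / 4): in [K_mass_le] they cancel and only the
    remainder contributes to the excess mass. *)
Lemma K_sym_le h y w : 0 < h -> h <= 1 ->
  K h y (y + w) + K h y (y - w) <=
  expR (- (h * (sqn (gV y) / 4))) *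
    (gaus h w * expR (2^-1 * dotp w (- gV y)) + gaus h w * expR (2^-1 * dotp w (gV y)))
  + gaus h w * (CW * (enorm w ^+ 4 + h ^+ 2) * expR (4 * enorm w + 1)).
Proof.
move=> h0 h1; rewrite !K_line// gausN// line_BN line_CN dotpNl dotpNr.
set om := enorm w.
have P1 := line_ge1 y w; have om0 : 0 <= om := enorm_ge0 w.
have omC : om ^+ 2 = lC w := enormK w; have BAC := line_BAC y w.
have PN1 : forall s, 1 <= lP (lA y) (- lB y w) (lC w) s.
  by move=> s; rewrite -line_BN -(line_CN w) line_ge1.
have BACN : (- lB y w) ^+ 2 <= 4 * lA y * lC w by rewrite sqrrN.
set r1 := lrho c (lA y) (lB y w) (lC w) 1.
set r2 := lrho c (lA y) (- lB y w) (lC w) 1.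
set q1 := lq c (lA y) (lB y w) (lC w) 1.
set q2 := lq c (lA y) (- lB y w) (lC w) 1.
have Eq0 : sqn (gV y) / 4 = lq c (lA y) (lB y w) (lC w) 0 by rewrite line_q scale0r addr0.
have Eq0N : sqn (gV y) / 4 = lq c (lA y) (- lB y w) (lC w) 0.
  by rewrite -line_BN -(line_CN w) line_q scale0r addr0.
set q0 := sqn (gV y) / 4 in Eq0 Eq0N *.
set d := 2^-1 * dotp w (gV y).
have Hd : `|d| <= om / 2.
  rewrite /d normrM ger0_norm// mulrC ler_wpM2r// (le_trans (dotp_le _ _))//.
  by rewrite ler_piMr// gV_le1.
have R1 := lrho_le c0 c1 P1 om0 omC BAC; have R2 := lrho_le c0 c1 PN1 om0 omC BACN.
have Q1 := lq_diff c0 c1 P1 om0 omC BAC; have Q2 := lq_diff c0 c1 PN1 om0 omC BACN.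
have RS := lrho_sym c0 c1 P1 om0 omC BAC; have QS := lq_sym c0 c1 P1 om0 omC BAC.
rewrite -Eq0 -/q1 in Q1; rewrite -Eq0N -/q2 in Q2; rewrite -/r1 -/r2 in R1 R2 RS.
rewrite -/q1 -/q2 -Eq0 in QS.
have L1 : `|r1| <= 2 * om.
  have V1 := lv_diff c0 c1 P1 om0 omC BAC.
  have V2 := lv1_le c0 c1 P1 om0 omC BAC 1; have V3 := lv1_le c0 c1 P1 om0 omC BAC 0.
  move: V1 V2 V3; rewrite /r1 /lrho !ler_norml => /andP[? ?] /andP[? ?] /andP[? ?].
  by apply/andP; split; lra.
have L2 : `|r2| <= 2 * om.
  have V1 := lv_diff c0 c1 PN1 om0 omC BACN.
  have V2 := lv1_le c0 c1 PN1 om0 omC BACN 1; have V3 := lv1_le c0 c1 PN1 om0 omC BACN 0.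
  move: V1 V2 V3; rewrite /r2 /lrho !ler_norml => /andP[? ?] /andP[? ?] /andP[? ?].
  by apply/andP; split; lra.
have B0 := lq_bnd y w 0; have B1 := lq_bnd y w 1; have B2 := lq_bnd y (- w) 1.
rewrite line_BN line_CN -/q2 in B2; rewrite -/q1 in B1; rewrite -Eq0 in B0.
clearbody r1 r2 q1 q2 q0.
have h0' := ltW h0.
have := @expR_sym_le R d (r1 - h * (q1 - q0)) (r2 - h * (q2 - q0)) om h (expR (- (h * q0)))
   om0 h0' h1 (expR_ge0 _) _ Hd.
have hq0 : 0 <= h * q0 by rewrite mulr_ge0//; case/andP: B0.
have hQ1 : `|h * (q1 - q0)| <= 3 / 2 * h * om.
  by rewrite (_ : 3 / 2 * h * om = h * (3 / 2 * om)); [exact: norm_scale_le|ring].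
have hQ2 : `|h * (q2 - q0)| <= 3 / 2 * h * om.
  by rewrite (_ : 3 / 2 * h * om = h * (3 / 2 * om)); [exact: norm_scale_le|ring].
have hB1 : `|h * (q1 - q0)| <= 1.
  rewrite normrM ger0_norm// -[leRHS]mulr1; apply: ler_pM => //.
  exact: dist_le1.
have hB2 : `|h * (q2 - q0)| <= 1.
  rewrite normrM ger0_norm// -[leRHS]mulr1; apply: ler_pM => //.
  exact: dist_le1.
have hQS : `|h * (q1 + q2 - 2 * q0)| <= 20 * h * om ^+ 2.
  by rewrite (_ : 20 * h * om ^+ 2 = h * (20 * om ^+ 2)); [exact: norm_scale_le|ring].
have E1 : expR (- (h * q0)) <= 1 by rewrite -[leRHS]expR0 ler_expR oppr_le0.
move=> /(_ E1 (le_trans (ler_normB _ _) (lerD R1 hQ1)) (le_trans (ler_normB _ _) (lerD R2 hQ2))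
  (le_trans (ler_normB _ _) (lerD L1 hB1)) (le_trans (ler_normB _ _) (lerD L2 hB2))).
have -> : r1 - h * (q1 - q0) + (r2 - h * (q2 - q0)) = (r1 + r2) - h * (q1 + q2 - 2 * q0) by ring.
move=> /(_ (le_trans (ler_normB _ _) (lerD RS hQS))).
rewrite -CWE => /(ler_wpM2l (gaus_ge0 h w)).
rewrite -!expRD !mulrDr -!expRD => H.
apply: le_trans (le_trans H _); rewrite le_eqVlt; apply/orP; left; apply/eqP.
  by congr (_ * expR _ + _ * expR _); rewrite /d; ring.
by rewrite mulrN -/d !expRD; ring.
Qed.


Lemma measurable_pp d (T : measurableType d) (f : T -> 'rV[R]_n) :
  measurable_fun setT f -> measurable_fun setT (fun u => pp (f u)).
Proof. by move=> mf; rewrite /pp; mes. Qed.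

Lemma measurable_gV d (T : measurableType d) (f : T -> 'rV[R]_n) :
  measurable_fun setT f -> measurable_fun setT (fun u => gV (f u)).
Proof. by move=> mf; rewrite /gV; mes; apply: measurable_pp. Qed.

Lemma measurable_Vf d (T : measurableType d) (f : T -> 'rV[R]_n) :
  measurable_fun setT f -> measurable_fun setT (fun u => V_alpha n a (f u)).
Proof. by move=> mf; exact: (measurableT_comp (measurable_V_alpha a) mf). Qed.

Lemma measurable_gausf d (T : measurableType d) t (f : T -> 'rV[R]_n) :
  measurable_fun setT f -> measurable_fun setT (fun u => gaus t (f u)).
Proof. by move=> mf; exact: (measurableT_comp (measurable_gaus t) mf). Qed.

Lemma measurable_K d (T : measurableType d) h (f g : T -> 'rV[R]_n) :
  measurable_fun setT f -> measurable_fun setT g ->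
  measurable_fun setT (fun u => K h (f u) (g u)).
Proof.
move=> mf mg; under eq_fun do rewrite KE; apply: m_mul.
  by mes; apply: measurable_Vf.
by apply: measurable_gausf; mes; apply: measurable_gV.
Qed.

Ltac mes_leaf ::= lazymatch goal with
  | |- measurable_fun _ (fun u => gaus ?t (@?f u)) => apply: (measurable_gausf t (f := f)); mes
  | |- measurable_fun _ (gaus _) => exact: measurable_gaus
  | |- measurable_fun _ (fun u => V_alpha _ _ (@?f u)) => apply: (@measurable_Vf _ _ _ _ _ f); mes
  | |- measurable_fun _ (fun u => gV _ (@?f u)) => apply: (@measurable_gV _ _ _ _ _ f); mes
  | |- measurable_fun _ (fun u => pp (@?f u)) => apply: (measurable_pp (f := f)); mes
  | |- measurable_fun _ (fun u => K _ _ (@?f u) (@?g u)) => apply: (@measurable_K _ _ _ _ _ _ f g); mes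
  | |- _ => mes_leaf2
  end.

Lemma int_weight_le h : (0 < n)%N -> 0 < h -> h * n%:R <= 1 ->
  (\int[lam]_w (gaus h w * (CW * (enorm w ^+ 4 + h ^+ 2) * expR (4 * enorm w + 1)))%:E
   <= (2 * CK * h ^+ 2 * n%:R ^+ 2)%:E)%E.
Proof.
move=> n0 h0 hn; have n1 : 1 <= n%:R :> R by rewrite ler1n.
have nR : 0 < n%:R :> R by rewrite ltr0n.
have hn0 : 0 < h * n%:R by rewrite mulr_gt0.
have B w : gaus h w * (CW * (enorm w ^+ 4 + h ^+ 2) * expR (4 * enorm w + 1)) <=
  CK * h ^+ 2 * n%:R ^+ 2 * (gaus h w * expR (sqn w / (8 * h * n%:R))).
  rewrite [leRHS]mulrCA ler_wpM2l ?gaus_ge0// -enormK; set om := enorm w.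
  (* Half of the exponent available in [gaus_exp_sqn]: one copy of [z] pays for the polynomial, the
     other for exp(4 om). *)
  set z := om ^+ 2 / (16 * (h * n%:R)).
  have z0 : 0 <= z by rewrite divr_ge0 ?sqr_ge0// mulr_ge0// ltW.
  have omz : om ^+ 2 = 16 * (h * n%:R) * z by rewrite /z; field; rewrite !gt_eqF.
  have -> : om ^+ 2 / (8 * h * n%:R) = z + z by rewrite /z; field; rewrite !gt_eqF.
  have E4 : 4 * om + 1 <= z + 65.
    have : 0 <= (om - 32 * (h * n%:R)) ^+ 2 / (16 * (h * n%:R)).
      by rewrite divr_ge0 ?sqr_ge0// mulr_ge0// ltW.
    have -> : (om - 32 * (h * n%:R)) ^+ 2 / (16 * (h * n%:R)) = z - 4 * om + 64 * (h * n%:R).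
      by rewrite /z; field; rewrite !gt_eqF.
    by move: hn; lra.
  have O4 : om ^+ 4 + h ^+ 2 <= CW * h ^+ 2 * n%:R ^+ 2 * expR z.
    have -> : om ^+ 4 = 256 * (h ^+ 2 * n%:R ^+ 2) * z ^+ 2.
      by rewrite (exprM om 2 2) omz; ring.
    have h2 : h ^+ 2 <= h ^+ 2 * n%:R ^+ 2 * expR z.
      rewrite -mulrA ler_peMr ?sqr_ge0// -[leLHS]mul1r ler_pM ?exprn_ege1//.
      by rewrite -[leLHS]expR0 ler_expR.
    have hh : 0 <= h ^+ 2 * n%:R ^+ 2 by rewrite mulr_ge0 ?sqr_ge0.
    rewrite -[CW * _ * _]mulrA -[CW * _ * _]mulrA.
    move: (h ^+ 2 * n%:R ^+ 2) hh h2 (sqr_le_expR z0) => H hh.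
    move: (h ^+ 2) => H' h2 hz.
    by have := ler_wpM2l hh hz; have := mulr_ge0 hh (expR_ge0 z); rewrite CWE; lra.
  rewrite /CK; apply: (@le_trans _ _ (CW * (CW * h ^+ 2 * n%:R ^+ 2 * expR z) * expR (z + 65))).
    apply: ler_pM; [|exact: expR_ge0| |by rewrite ler_expR].
      by apply: mulr_ge0; [exact: CW_ge0|rewrite addr_ge0 ?sqr_ge0 ?exprn_even_ge0].
    by apply: ler_wpM2l => //; exact: CW_ge0.
  by rewrite le_eqVlt; apply/orP; left; apply/eqP; rewrite !expRD; ring.
have mg := @measurable_gausf _ _ h _ measurable_id_.
have CK0 : 0 <= CK * h ^+ 2 * n%:R ^+ 2.
  by rewrite /CK; do 3 (apply: mulr_ge0; rewrite ?sqr_ge0 ?expR_ge0//).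
apply: le_trans (ge0_int_le _ _ _ _ B) _.
- by mes.
- by mes.
- by move=> w; rewrite !mulr_ge0 ?gaus_ge0 ?CW_ge0 ?expR_ge0 ?addr_ge0 ?sqr_ge0 ?exprn_even_ge0.
rewrite ge0_intZl//; [|by mes|by move=> w; rewrite mulr_ge0 ?gaus_ge0 ?expR_ge0].
apply: le_trans (lee_wpmul2l _ (gaus_exp_sqn n0 h0)) _; first by rewrite lee_fin.
by rewrite -EFinM lee_fin; lra.
Qed.

(* Symmetrising w |-> -w removes the odd third-order term of the expansion, so
   the backward kernel has mass 1 + O(h^2 n^2) rather than 1 + O(h^(3/2)). *)
Lemma K_mass_le h y : (0 < n)%N -> 0 < h -> h * n%:R <= 1 ->
  (\int[lam]_x (K h y x)%:E <= (1 + CK * h ^+ 2 * n%:R ^+ 2)%:E)%E.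
Proof.
move=> n0 h0 hn; have n1 : 1 <= n%:R :> R by rewrite ler1n.
have h1 : h <= 1 by apply: le_trans hn; rewrite ler_peMr// ltW.
have mK : measurable_fun setT (fun x => K h y x) by apply: measurable_K; mes.
have mK1 : measurable_fun setT (fun x => K h y (y + x)) by apply: measurable_K; mes.
have mK2 : measurable_fun setT (fun x => K h y (y - x)) by apply: measurable_K; mes.
have E1 : (\int[lam]_w (K h y (y + w))%:E = \int[lam]_x (K h y x)%:E)%E.
  apply: etrans (ge0_integral_rV_translate y (F := fun x => (K h y x)%:E) _ _).
  - by apply: eq_integral => x _; rewrite addrC.
  - exact: (m_EFin mK).
  - by move=> x; rewrite lee_fin K_ge0.
have K0 x : (0 <= (K h y (y + x))%:E)%E by rewrite lee_fin K_ge0.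
have E2 : (\int[lam]_w (K h y (y - w))%:E = \int[lam]_x (K h y x)%:E)%E.
  by have T := ge0_integral_rV_opp (m_EFin mK1) K0; move: (etrans T E1).
have mg := @measurable_gausf _ _ h _ measurable_id_.
have H : (\int[lam]_x (K h y x)%:E + \int[lam]_x (K h y x)%:E <=
   (2 + 2 * CK * h ^+ 2 * n%:R ^+ 2)%:E)%E.
  have E12 := etrans (ge0_intD lam mK1 mK2 (fun x => K_ge0 h y (y + x)) (fun x => K_ge0 h y (y - x)))
    (f_equal2 (fun u v : \bar R => (u + v)%E) E1 E2).
  rewrite -E12; clear K0 E1 E2 E12 mK.
  apply: le_trans (ge0_int_le _ _ _ _ (fun w => K_sym_le y w h0 h1)) _.
  - exact: (m_add mK1 mK2).
  - by mes.
  - by move=> w; rewrite addr_ge0 ?K_ge0.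
  rewrite ge0_intD; [|by mes|by mes| |]; last 2 first.
  - by move=> w; rewrite !(mulr_ge0, addr_ge0) ?gaus_ge0 ?expR_ge0.
  - by move=> w; rewrite !mulr_ge0 ?gaus_ge0 ?CW_ge0 ?expR_ge0 ?addr_ge0 ?sqr_ge0 ?exprn_even_ge0.
  rewrite EFinD; apply: leeD; last exact: int_weight_le.
  clear mK1 mK2.
  rewrite ge0_intZl ?expR_ge0//; [|by mes|by move=> w; rewrite !(mulr_ge0, addr_ge0) ?gaus_ge0 ?expR_ge0].
  rewrite ge0_intD; [|by mes|by mes| |]; last 2 first.
  - by move=> w; rewrite mulr_ge0 ?gaus_ge0 ?expR_ge0.
  - by move=> w; rewrite mulr_ge0 ?gaus_ge0 ?expR_ge0.
  rewrite !gaus_exp_dot// sqnN -EFinD -EFinM lee_fin mulrDr -expRD mulrA addNr expR0; lra.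
clear mK mK1 mK2 E1 E2 K0 mg.
have I0 : (0 <= \int[lam]_x (K h y x)%:E)%E.
  by apply: integral_ge0 => x _; rewrite lee_fin K_ge0.
move: I0 H; move: (\int[lam]_x (K h y x)%:E)%E => -[r| |]//= _.
by rewrite -EFinD !lee_fin; lra.
Qed.

End kernel.

(** * Decay of the q-th moment in one step *)

Section fubini.
Context {R : realType} {n m : nat}.
Local Notation lam := (@lebesgue_rV R n).
Local Notation lam' := (@lebesgue_rV R m).
Variables (H : 'rV[R]_n * 'rV[R]_m -> R) (mH : measurable_fun setT H) (H0 : forall p, 0 <= H p).

Lemma tonelli : (\int[lam]_y \int[lam']_x (H (y, x))%:E = \int[lam']_x \int[lam]_y (H (y, x))%:E)%E.
Proof.
apply: (@fubini_tonelli _ _ _ _ _ lam lam' (fun p => (H p)%:E)).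
  exact: m_EFin.
by move=> p; rewrite lee_fin.
Qed.

Lemma m_eint : measurable_fun setT (fun y => \int[lam']_x (H (y, x))%:E)%E.
Proof.
apply: (measurable_fun_fubini_tonelli_F (m2 := lam') (fun p => (H p)%:E)).
- exact: m_EFin.
- by move=> p; rewrite lee_fin.
Qed.

Lemma m_Rint : measurable_fun setT (fun y => \int[lam']_x H (y, x)).
Proof. by apply: (m_comp (f := @fine R)) m_eint; exact: fine_measurable. Qed.

End fubini.

(** * Weighted variances and Jensen's inequality *)

Section jensen.
Context {d : measure_display} {T : measurableType d} {R : realType}.
Variable mu : {measure set T -> \bar R}.

(** This is Young's inequality for the product of [z] and 1, with exponents r and r/(r-1). *)
Lemma powR_bernoulli (z r : R) : 0 <= z -> 1 <= r -> 1 + r * (z - 1) <= z `^ r.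
Proof.
move=> z0 r1; have r0 : 0 < r by lra.
have [->|rn1] := eqVneq r 1; first by rewrite powRr1//; lra.
have r1' : 1 < r by rewrite lt_neqAle eq_sym rn1.
have s0 : 0 < r - 1 by lra.
have E : r^-1 + (r / (r - 1))^-1 = 1 by field; rewrite !gt_eqF.
have := @conjugate_powR R z 1 r (r / (r - 1)) z0 ler01 r0 (divr_gt0 r0 s0) E.
rewrite mulr1 powR1 mul1r => /(ler_wpM2l (ltW r0)).
rewrite mulrDr mulrCA mulfV ?gt_eqF// mulr1.
by rewrite (_ : r * (r / (r - 1))^-1 = r - 1); [lra|field; rewrite !gt_eqF].
Qed.

Lemma powR_tangent (x t r : R) : 0 <= x -> 0 < t -> 1 <= r ->
  t `^ r + r * t `^ (r - 1) * (x - t) <= x `^ r.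
Proof.
move=> x0 t0 r1; have z0 : 0 <= x / t by rewrite divr_ge0// ltW.
have := ler_wpM2l (powR_ge0 t r) (powR_bernoulli z0 r1).
rewrite -(powRM _ (ltW t0) z0) (mulrC t) divfK ?gt_eqF//; apply: le_trans.
have -> : t `^ r = t * t `^ (r - 1) by rewrite mulr_powRB1// ?ltW//; lra.
by rewrite le_eqVlt; apply/orP; left; apply/eqP; field; rewrite gt_eqF.
Qed.

Variables (k : T -> R).
Hypothesis (ik : itg mu k) (k0 : forall x, 0 <= k x).

Lemma itg_weight (v : T -> R) (B : R) : measurable_fun setT v -> (forall x, `|v x| <= B) ->
  itg mu (fun x => k x * v x).
Proof.
move=> mv vB; apply: (@itg_dom _ _ _ _ (fun x => B * k x)).
- by apply: m_mul => //; exact: (itg_meas ik).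
- exact: itgZ.
- by move=> x; rewrite normrM (ger0_norm (k0 x)) mulrC ler_wpM2r.
Qed.

Lemma weighted_var (f : T -> R) (B b : R) : measurable_fun setT f -> (forall x, `|f x| <= B) ->
  \int[mu]_x (k x * (f x - b) ^+ 2) =
  \int[mu]_x (k x * f x ^+ 2) - 2 * b * \int[mu]_x (k x * f x) + b ^+ 2 * \int[mu]_x k x.
Proof.
move=> mf fB.
have B0 (x : T) : 0 <= B by apply: le_trans _ (fB x).
have i1 : itg mu (fun x => k x * f x) by exact: itg_weight fB.
have i2 : itg mu (fun x => k x * f x ^+ 2).
  apply: (@itg_weight _ (B ^+ 2)); first exact: m_exp.
  by move=> x; rewrite normrX lerXn2r ?nnegrE ?(B0 x).
rewrite -(RintZ _ i1) -(RintZ _ ik) -RintB//; [|exact: itgZ].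
rewrite -RintD; [|by apply: itgB => //; exact: itgZ|exact: itgZ].
by apply: eq_Rint => x; ring.
Qed.

Lemma weighted_var_min (f : T -> R) (B b : R) : measurable_fun setT f -> (forall x, `|f x| <= B) ->
  0 < \int[mu]_x k x ->
  \int[mu]_x (k x * (f x - (\int[mu]_x (k x * f x)) / \int[mu]_x k x) ^+ 2) <=
  \int[mu]_x (k x * (f x - b) ^+ 2).
Proof.
move=> mf fB kp; rewrite !(weighted_var _ mf fB).
set k1 := \int[mu]_x k x in kp *; set m := \int[mu]_x (k x * f x).
rewrite -!addrA lerD2l -subr_ge0.
have : 0 <= k1 * (b - m / k1) ^+ 2 by rewrite mulr_ge0 ?sqr_ge0// ltW.
move=> H; apply: (le_trans H); rewrite le_eqVlt; apply/orP; left; apply/eqP; field; by rewrite gt_eqF.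
Qed.

Variables (u : T -> R) (M : R).
Hypothesis (mu_ : measurable_fun setT u) (u0 : forall x, 0 <= u x) (uM : forall x, u x <= M).

Lemma itg_pow (r : R) : 0 <= r -> itg mu (fun x => k x * u x `^ r).
Proof.
move=> r0; apply: (@itg_weight _ (M `^ r)); first exact: measurable_powRf.
move=> x; rewrite ger0_norm ?powR_ge0// ge0_ler_powR ?nnegrE//.
exact: le_trans (u0 x) (uM x).
Qed.

Lemma itg_lin : itg mu (fun x => k x * u x).
Proof. by apply: (@itg_weight _ M) => // x; rewrite ger0_norm. Qed.

(** Integrate the tangent of x^r at the mean of [u] under [k]. The weight is not normalised, since
    K(y,.) has mass different from 1; hence the power of the mass. *)
Lemma jensen_powR (r : R) : 1 <= r -> 0 < \int[mu]_x k x ->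
  (\int[mu]_x (k x * u x)) `^ r <= (\int[mu]_x k x) `^ (r - 1) * \int[mu]_x (k x * u x `^ r).
Proof.
move=> r1 kp; have r0 : 0 < r by lra.
set k1 := \int[mu]_x k x in kp *; set m := \int[mu]_x (k x * u x).
have m0 : 0 <= m by apply: Rint_ge0 => x; rewrite mulr_ge0.
have i0 : 0 <= \int[mu]_x (k x * u x `^ r).
  by apply: Rint_ge0 => x; rewrite mulr_ge0// powR_ge0.
have [->|mn0] := eqVneq m 0; first by rewrite powR0 ?gt_eqF// mulr_ge0 ?powR_ge0.
have mp : 0 < m by rewrite lt_neqAle eq_sym mn0.
pose t := m / k1; have t0 : 0 < t by rewrite divr_gt0.
have : \int[mu]_x ((t `^ r - r * t `^ (r - 1) * t) * k x + r * t `^ (r - 1) * (k x * u x))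
    <= \int[mu]_x (k x * u x `^ r).
  apply: le_Rint => [||x].
  - by apply: itgD; apply: itgZ => //; exact: itg_lin.
  - by apply: itg_pow; rewrite ltW.
  have := ler_wpM2l (k0 x) (powR_tangent (u0 x) t0 r1); apply: le_trans.
  by rewrite le_eqVlt; apply/orP; left; apply/eqP; ring.
rewrite RintD; [|exact: itgZ|by apply: itgZ; exact: itg_lin].
rewrite !RintZ//; last exact: itg_lin.
rewrite -/k1 -/m (_ : _ + _ = k1 * t `^ r); last by rewrite /t; field; rewrite gt_eqF.
move=> /(ler_wpM2l (powR_ge0 k1 (r - 1))); apply: le_trans.
rewrite mulrA (mulrC _ k1) mulr_powRB1 ?(ltW kp)// -powRM ?(ltW kp) ?(ltW t0)//.
by rewrite /t mulrC divfK// gt_eqF.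
Qed.

End jensen.

(** * Gaussian smoothing and local variance *)

Section smoothing.
Context {R : realType} {n : nat}.
Local Notation lam := (@lebesgue_rV R n).
Implicit Types (x y w : 'rV[R]_n) (f : 'rV[R]_n -> R).

Definition gsm t f y : R := \int[lam]_x (gaus t (x - y) * f x).
Definition gvar t f y : R := \int[lam]_x (gaus t (x - y) * (f x - gsm t f y) ^+ 2).

Lemma m_gauss2 d (T : measurableType d) t (f g : T -> 'rV[R]_n) :
  measurable_fun setT f -> measurable_fun setT g ->
  measurable_fun setT (fun u => gaus t (f u - g u)).
Proof. by move=> mf mg; apply: measurable_gausf; exact: measurable_sub. Qed.

Lemma itg_gausB t y : 0 < t -> itg lam (fun x => gaus t (x - y)).
Proof.
move=> t0; apply: (@itg_le _ _ _ _ _ 1).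
- by apply: measurable_gausf; mes.
- by move=> x; exact: gaus_ge0.
- rewrite (ge0_integral_rV_translate (- y) (F := fun x => (gaus t x)%:E)).
  + by rewrite integral_gaus.
  + exact: (m_EFin (measurable_gaus t)).
  + by move=> x; rewrite lee_fin gaus_ge0.
Qed.

Lemma Rint_gausB t y : 0 < t -> \int[lam]_x gaus t (x - y) = 1.
Proof.
move=> t0; rewrite /Rintegral (ge0_integral_rV_translate (- y) (F := fun x => (gaus t x)%:E)).
- by rewrite integral_gaus.
- exact: (m_EFin (measurable_gaus t)).
- by move=> x; rewrite lee_fin gaus_ge0.
Qed.

Variables (t : R) (t0 : 0 < t) (f : 'rV[R]_n -> R) (B : R).
Hypothesis (mf : measurable_fun setT f) (f0 : forall x, 0 <= f x) (fB : forall x, f x <= B).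

Let fB' x : `|f x| <= B. Proof. by rewrite ger0_norm. Qed.

Lemma gvar_min y b : gvar t f y <= \int[lam]_x (gaus t (x - y) * (f x - b) ^+ 2).
Proof.
have := @weighted_var_min _ _ _ lam (fun x => gaus t (x - y)) (itg_gausB y t0) (fun x => gaus_ge0 _ _) f B b mf fB'.
by rewrite Rint_gausB// divr1 => /(_ ltr01).
Qed.

Lemma gvarE y b : \int[lam]_x (gaus t (x - y) * (f x - b) ^+ 2) = gvar t f y + (gsm t f y - b) ^+ 2.
Proof.
rewrite /gvar !(@weighted_var _ _ _ lam (fun x => gaus t (x - y)) (itg_gausB y t0) (fun x => gaus_ge0 _ _) f B _ mf fB').
by rewrite Rint_gausB// -/(gsm t f y); ring.
Qed.

Lemma gsm_ge0 y : 0 <= gsm t f y.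
Proof. by apply: Rint_ge0 => x; rewrite mulr_ge0// gaus_ge0. Qed.

Lemma itg_gsm y : itg lam (fun x => gaus t (x - y) * f x).
Proof. exact: (itg_weight (itg_gausB y t0) (fun x => gaus_ge0 _ _) mf fB'). Qed.

Lemma gsm_le y : gsm t f y <= B.
Proof.
rewrite -[leRHS]mulr1 -(Rint_gausB y t0) -RintZ; last exact: itg_gausB.
apply: le_Rint => [||x]; [exact: itg_gsm|exact/itgZ/itg_gausB|].
by rewrite mulrC ler_wpM2r ?gaus_ge0.
Qed.

Lemma gvar_ge0 y : 0 <= gvar t f y.
Proof. by apply: Rint_ge0 => x; rewrite mulr_ge0 ?gaus_ge0 ?sqr_ge0. Qed.

Lemma measurable_gsm : measurable_fun setT (gsm t f).
Proof.
apply: (@m_Rint R n n (fun p => gaus t (p.2 - p.1) * f p.2)).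
- apply: m_mul; first by apply: m_gauss2; mes.
  by apply: m_comp mf _; mes.
- by move=> p; rewrite mulr_ge0 ?gaus_ge0.
Qed.

Lemma measurable_gvar : measurable_fun setT (gvar t f).
Proof.
apply: (@m_Rint R n n (fun p => gaus t (p.2 - p.1) * (f p.2 - gsm t f p.1) ^+ 2)).
- apply: m_mul; first by apply: m_gauss2; mes.
  apply: m_exp; apply: m_add; first by apply: m_comp mf _; mes.
  by apply: m_opp; apply: m_comp measurable_gsm _; mes.
- by move=> p; rewrite mulr_ge0 ?gaus_ge0 ?sqr_ge0.
Qed.

End smoothing.

(** * One LMC step acting on densities *)

Section one_step.
Context {R : realType} {n : nat}.
Variables (a : R) (a0 : 0 < a) (a1 : a < 1) (n0 : (0 < n)%N).
Local Notation lam := (@lebesgue_rV R n).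
Implicit Types (x y w : 'rV[R]_n) (f u v : 'rV[R]_n -> R).

Definition eV x : R := expR (- V_alpha n a x).

Lemma eV_ge0 x : 0 <= eV x. Proof. exact: expR_ge0. Qed.

Lemma eV_gt0 x : 0 < eV x. Proof. exact: expR_gt0. Qed.

Lemma measurable_eVf d (T : measurableType d) (f : T -> 'rV[R]_n) :
  measurable_fun setT f -> measurable_fun setT (fun s => eV (f s)).
Proof. by move=> mf; rewrite /eV; mes; apply: measurable_Vf. Qed.

Lemma measurable_eV : measurable_fun setT eV.
Proof. by apply: measurable_eVf; mes. Qed.

Ltac mes_leaf2 ::= lazymatch goal with
  | |- measurable_fun _ (fun u => eV (@?f u)) => apply: (measurable_eVf (f := f)); mes
  | |- measurable_fun _ eV => exact: measurable_eV
  end.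

Lemma eV_shift x y : eV x * expR (- enorm (x - y)) <= eV y.
Proof.
rewrite -expRD ler_expR; have := V_lip a0 a1 y x; rewrite enormB => /(le_trans (ler_norm _)).
by lra.
Qed.

Section smoothing_cost.
Variables (t : R) (t0 : 0 < t) (tn : t * n%:R <= 1).
Variables (f : 'rV[R]_n -> R) (B b : R).
Hypothesis (mf : measurable_fun setT f) (f0 : forall x, 0 <= f x) (fB : forall x, f x <= B).

Let t' := t * n%:R / (n%:R + 1).
Let t'0 : 0 < t'.
Proof. by rewrite /t' divr_gt0// ?mulr_gt0 ?ltr0n// addr_gt0 ?ltr0n. Qed.

Lemma gaus_tilt w : expR (-5) * gaus t' w <= gaus t w * expR (- (2 * enorm w)).
Proof.
have := ler_wpM2l (expR_ge0 (- 5 - 2 * enorm w)) (gaus_shrink w n0 t0); rewrite -/t'.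
have -> : expR (-5 - 2 * enorm w) * (gaus t' w * expR (2 * enorm w)) = expR (-5) * gaus t' w.
  rewrite mulrCA -expRD mulrC; congr (expR _ * _); ring.
move=> /le_trans; apply; rewrite mulrA -expRD mulrC ler_wpM2l ?gaus_ge0// ler_expR.
by have := tn; lra.
Qed.

(** Since V is 1-Lipschitz, moving from [x] to [y] costs at most exp(-|x - y|), which the narrower
    Gaussian of [gaus_tilt] absorbs. *)
Lemma eV_conv_ge x : ((expR (-5) * eV x)%:E <= \int[lam]_y (eV y * gaus t (x - y))%:E)%E.
Proof.
have P y : expR (-5) * eV x * gaus t' (y - x) <= eV y * gaus t (x - y).
  have := ler_pM (mulr_ge0 (eV_ge0 x) (expR_ge0 _)) (mulr_ge0 (expR_ge0 _) (gaus_ge0 _ _))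
    (eV_shift x y) (gaus_tilt (x - y)).
  rewrite -(opprB x y) gausN// => H.
  rewrite -(ler_pM2r (expR_gt0 (- (enorm (x - y))))); apply: le_trans (le_trans _ H) _.
    by rewrite le_eqVlt; apply/orP; left; apply/eqP; ring.
  rewrite mulrA; apply: ler_wpM2l; first by rewrite mulr_ge0 ?eV_ge0 ?gaus_ge0.
  by rewrite ler_expR lerN2 ler_peMl ?enorm_ge0// ler1n.
have := ge0_int_le lam _ _ _ P.
rewrite ge0_intZl ?mulr_ge0 ?expR_ge0//; first last.
- by move=> y; exact: gaus_ge0.
- by apply: m_gauss2; mes.
rewrite (ge0_integral_rV_translate (- x) (F := fun z => (gaus t' z)%:E)); first last.
- by move=> z; rewrite lee_fin gaus_ge0.
- exact: (m_EFin (measurable_gaus t')).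
rewrite integral_gaus// mule1; apply.
- by mes; apply: m_gauss2; mes.
- by mes; [exact: measurable_eV|apply: m_gauss2; mes].
- by move=> y; rewrite !mulr_ge0 ?expR_ge0 ?gaus_ge0.
Qed.

(** The local second moment of [f] about [b] splits into local variance plus squared bias ([gvarE]).
    Integrated against exp(-V) and with the integrals exchanged, it becomes the integral of (f -
    b)^2 against the smoothed exp(-V), bounded below by [eV_conv_ge]. *)
Lemma smoothing_cost :
  ((expR (-5))%:E * \int[lam]_x ((f x - b) ^+ 2 * eV x)%:E <=
   \int[lam]_y (gvar t f y * eV y)%:E + \int[lam]_y ((gsm t f y - b) ^+ 2 * eV y)%:E)%E.
Proof.
have mg := measurable_gsm t mf f0; have mv := measurable_gvar t mf f0.
have me := measurable_eV.
rewrite -ge0_intD; first last.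
- by move=> y; rewrite mulr_ge0 ?sqr_ge0 ?eV_ge0.
- by move=> y; rewrite mulr_ge0 ?gvar_ge0 ?eV_ge0.
- by mes.
- by mes.
rewrite -ge0_intZl ?expR_ge0//; first last.
- by move=> y; rewrite mulr_ge0 ?sqr_ge0 ?eV_ge0.
- by mes.
clear mg mv me.
have mfb : measurable_fun setT (fun x => (f x - b) ^+ 2) by mes.
have mgf y : measurable_fun setT (fun x => gaus t (x - y) * (f x - b) ^+ 2).
  by apply: m_mul mfb; apply: m_gauss2; mes.
have gf0 y x : 0 <= gaus t (x - y) * (f x - b) ^+ 2 by rewrite mulr_ge0 ?gaus_ge0 ?sqr_ge0.
have bnd x : `|(f x - b) ^+ 2| <= (B + `|b|) ^+ 2.
  have h : `|f x - b| <= B + `|b|.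
    by apply: (le_trans (ler_normB _ _)); rewrite lerD2r ger0_norm ?fB.
  by rewrite normrX lerXn2r ?nnegrE ?normr_ge0// (le_trans (normr_ge0 _) h).
have E1 y : (gvar t f y * eV y + (gsm t f y - b) ^+ 2 * eV y)%:E =
    (\int[lam]_x (eV y * (gaus t (x - y) * (f x - b) ^+ 2))%:E)%E.
  rewrite -mulrDl -(@gvarE _ _ t t0 f B)// mulrC EFinM itgK; last first.
    exact: (itg_weight (itg_gausB y t0) (fun x => gaus_ge0 _ _) mfb bnd).
  exact: esym (ge0_intZl _ (mgf y) (gf0 y) (eV_ge0 y)).
have E2 x : ((expR (-5) * ((f x - b) ^+ 2 * eV x))%:E <=
    \int[lam]_y (eV y * (gaus t (x - y) * (f x - b) ^+ 2))%:E)%E.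
  have -> : (\int[lam]_y (eV y * (gaus t (x - y) * (f x - b) ^+ 2))%:E =
      ((f x - b) ^+ 2)%:E * \int[lam]_y (eV y * gaus t (x - y))%:E)%E.
    rewrite -ge0_intZl; first by apply: eq_integral => y _; congr EFin; ring.
    - by apply: m_mul; [exact: measurable_eV|apply: m_gauss2; mes].
    - by move=> y; rewrite mulr_ge0 ?eV_ge0 ?gaus_ge0.
    - exact: sqr_ge0.
  rewrite mulrCA EFinM; apply: lee_wpmul2l; first by rewrite lee_fin sqr_ge0.
  exact: eV_conv_ge.
rewrite [leRHS](_ : _ = (\int[lam]_y \int[lam]_x (eV y * (gaus t (x - y) * (f x - b) ^+ 2))%:E)%E); last first.
  by apply: eq_integral => y _; exact: E1.
clear E1 mgf bnd gf0.
pose H (p : 'rV[R]_n * 'rV[R]_n) := eV p.1 * (gaus t (p.2 - p.1) * (f p.2 - b) ^+ 2).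
have mH : measurable_fun setT H.
  apply: m_mul; first by apply: measurable_eVf; mes.
  by apply: m_mul; [apply: m_gauss2; mes|apply: m_comp mfb _; mes].
have H0 p : 0 <= H p by rewrite /H mulr_ge0 ?eV_ge0// mulr_ge0 ?gaus_ge0 ?sqr_ge0.
rewrite (tonelli mH H0) /H /=; apply: ge0_le_integral.
- exact: measurableT.
- by move=> x _; rewrite lee_fin; apply: mulr_ge0 (expR_ge0 _) (mulr_ge0 (sqr_ge0 _) (eV_ge0 x)).
- apply: m_EFin; apply: m_mul; first exact: measurable_cst.
  by apply: m_mul mfb _; exact: measurable_eV.
- apply: (@m_eint _ _ _ (fun p => H (p.2, p.1))); first by apply: m_comp mH _; exact: measurable_swap.
  by move=> p; exact: H0.
- by move=> x _; exact: E2.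
Qed.
End smoothing_cost.

Variables (h : R) (h0 : 0 < h) (hn : h * n%:R <= 1).
Local Notation K := (K a h).
Let h' := h * n%:R / (n%:R + 1).
Let h'0 : 0 < h'.
Proof. by rewrite /h' divr_gt0// ?mulr_gt0 ?ltr0n// addr_gt0 ?ltr0n. Qed.

(* Excess mass of the backward kernel [K y]. *)
Definition dl : R := CK * h ^+ 2 * n%:R ^+ 2.
Definition step u y : R := \int[lam]_x (K y x * u x).

Lemma dl_ge0 : 0 <= dl.
Proof. by rewrite /dl /CK; do 3 (apply: mulr_ge0; rewrite ?sqr_ge0 ?expR_ge0//). Qed.

Lemma itgK_ y : itg lam (K y).
Proof.
apply: (@itg_le _ _ _ _ _ (1 + dl)); [by apply: measurable_K; mes|by move=> x; exact: K_ge0|].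
exact: K_mass_le.
Qed.

Lemma kmass_le y : \int[lam]_x K y x <= 1 + dl.
Proof. by rewrite -lee_fin itgK ?K_mass_le//; exact: itgK_. Qed.

Lemma K_ge' y x : expR (-5) * gaus h' (x - y) <= K y x.
Proof. by have := K_ge a0 a1 y (x - y) n0 h0 hn; rewrite (addrC y) subrK. Qed.

Lemma kmass_ge y : expR (-5) <= \int[lam]_x K y x.
Proof.
rewrite -[leLHS]mulr1 -[X in _ * X](Rint_gausB y h'0) -RintZ; last exact: itg_gausB.
by apply: le_Rint; [exact/itgZ/itg_gausB|exact: itgK_|exact: K_ge'].
Qed.

Lemma kmass_gt0 y : 0 < \int[lam]_x K y x.
Proof. exact: lt_le_trans (expR_gt0 _) (kmass_ge y). Qed.

Variables (u : 'rV[R]_n -> R) (M : R).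
Hypothesis (mu : measurable_fun setT u) (u0 : forall x, 0 <= u x) (uM : forall x, u x <= M).

Let M0 : 0 <= M. Proof. exact: le_trans (u0 0) (uM 0). Qed.

Lemma step_ge0 y : 0 <= step u y.
Proof. by apply: Rint_ge0 => x; rewrite mulr_ge0 ?K_ge0. Qed.

Lemma itg_Ku y : itg lam (fun x => K y x * u x).
Proof. exact: (itg_lin (itgK_ y) (fun x => K_ge0 _ _ _ _) mu u0 uM). Qed.

Lemma step_le y : step u y <= (1 + dl) * M.
Proof.
apply: le_trans (ler_wpM2r M0 (kmass_le y)); rewrite mulrC -RintZ; last exact: itgK_.
apply: le_Rint; [exact: itg_Ku|exact/itgZ/itgK_|].
by move=> x; rewrite mulrC ler_wpM2r ?K_ge0.
Qed.

Lemma measurable_step : measurable_fun setT (step u).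
Proof.
apply: (@m_Rint R n n (fun p => K p.1 p.2 * u p.2)).
- apply: m_mul; first by apply: measurable_K; mes.
  by apply: m_comp mu _; mes.
- by move=> p; rewrite mulr_ge0 ?K_ge0.
Qed.

(** Jensen's inequality is applied only to the power q/2, and the square is then expanded exactly:
    the loss is the variance of u^(q/2) under K(y,.), which dominates a Gaussian variance by
    [K_ge']. In exp(-5q), a part exp(-5(q-1)) bounds the power of the mass and exp(-5) comes from
    [K_ge']. *)
Lemma step_pow (q : R) y : 2 <= q ->
  step u y `^ q + expR (- (5 * q)) * gvar h' (fun x => u x `^ (q / 2)) y <=
  (1 + dl) `^ (q - 1) * \int[lam]_x (K y x * u x `^ q).
Proof.
move=> q2; set f := fun x => u x `^ (q / 2).
have q0 : 0 <= q by lra.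
have r1 : 1 <= q / 2 by lra.
have q10 : 0 <= q - 1 by lra.
have f0 x : 0 <= f x by exact: powR_ge0.
have mf : measurable_fun setT f by exact: measurable_powRf.
have fB x : `|f x| <= M `^ (q / 2).
  by rewrite ger0_norm// ge0_ler_powR ?nnegrE// divr_ge0.
have ff x : f x ^+ 2 = u x `^ q.
  by rewrite /f -powR_mulrn ?powR_ge0// -powRrM; congr (_ `^ _); field.
have kp := kmass_gt0 y; set k := \int[lam]_x K y x in kp.
have iK := itgK_ y; have K0 := fun x => K_ge0 a h y x.
have J := jensen_powR iK K0 mu u0 uM r1 kp; rewrite -/(step u y) -/k in J.
set m := \int[lam]_x (K y x * u x `^ (q / 2)) in J.
have m0 : 0 <= m by apply: Rint_ge0 => x; rewrite mulr_ge0 ?K_ge0 ?powR_ge0.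
have W := weighted_var iK K0 (m / k) mf fB; rewrite -/k in W.
set b := m / k in W; set S := \int[lam]_x (K y x * (f x - b) ^+ 2) in W.
have Em : \int[lam]_x (K y x * f x) = m by [].
rewrite Em in W.
have E2 : \int[lam]_x (K y x * f x ^+ 2) = \int[lam]_x (K y x * u x `^ q).
  by apply: eq_Rint => x; rewrite ff.
rewrite E2 in W; set I := \int[lam]_x (K y x * u x `^ q) in W *.
have I0 : 0 <= I by apply: Rint_ge0 => x; rewrite mulr_ge0 ?K_ge0 ?powR_ge0.
(* An identity: [S] is the variance that Jensen's inequality with exponent [q] would discard. *)
have mk : m ^+ 2 = k * (I - S) by rewrite W /b; field; rewrite gt_eqF.
have L1 : step u y `^ q <= k `^ (q - 1) * (I - S).
  have -> : step u y `^ q = (step u y `^ (q / 2)) ^+ 2.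
    by rewrite -powR_mulrn ?powR_ge0// -powRrM; congr (_ `^ _); field.
  have -> : k `^ (q - 1) = (k `^ (q / 2 - 1)) ^+ 2 * k.
    rewrite -powR_mulrn ?powR_ge0// -powRrM -[X in _ * X](powRr1 (ltW kp)) -powRD; last first.
      by apply/implyP => _; rewrite gt_eqF.
    by congr (_ `^ _); field.
  rewrite -mulrA -mk -exprMn lerXn2r ?nnegrE ?powR_ge0 ?mulr_ge0 ?powR_ge0//.
have kq1 : k `^ (q - 1) <= (1 + dl) `^ (q - 1).
  apply: (ge0_ler_powR q10); rewrite ?nnegrE; [exact: ltW|by rewrite addr_ge0 ?dl_ge0|exact: kmass_le].
have kq2 : expR (- (5 * (q - 1))) <= k `^ (q - 1).
  have -> : expR (- (5 * (q - 1))) = expR (-5) `^ (q - 1) by rewrite -expRM; congr expR; ring.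
  apply: (ge0_ler_powR q10); rewrite ?nnegrE; [exact: expR_ge0|exact: ltW|exact: kmass_ge].
have SG : expR (-5) * gvar h' f y <= S.
  apply: (le_trans (ler_wpM2l (expR_ge0 _) (@gvar_min _ _ h' h'0 f _ mf f0 (fun x => le_trans (ler_norm _) (fB x)) y b))).
  have ig : itg lam (fun x => gaus h' (x - y) * (f x - b) ^+ 2).
    apply: (itg_weight (itg_gausB y h'0) (fun x => gaus_ge0 _ _) (B := (M `^ (q / 2) + `|b|) ^+ 2)); first by mes.
    move=> x; rewrite normrX lerXn2r ?nnegrE ?addr_ge0 ?powR_ge0//.
    by apply: (le_trans (ler_normB _ _)); rewrite lerD2r.
  rewrite -RintZ//; apply: le_Rint; first exact: itgZ.
    apply: (itg_weight iK K0 (B := (M `^ (q / 2) + `|b|) ^+ 2)); first by mes.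
    move=> x; rewrite normrX lerXn2r ?nnegrE ?addr_ge0 ?powR_ge0//.
    by apply: (le_trans (ler_normB _ _)); rewrite lerD2r.
  by move=> x; rewrite mulrA ler_wpM2r ?sqr_ge0 ?K_ge'.
have G0 : 0 <= gvar h' f y by exact: gvar_ge0.
have H1 := ler_pM (expR_ge0 _) (mulr_ge0 (expR_ge0 _) G0) kq2 SG.
rewrite mulrA -expRD (_ : - (5 * (q - 1)) + -5 = - (5 * q)) in H1; last by ring.
apply: (le_trans (lerD L1 H1)); rewrite mulrBr subrK.
exact: (ler_wpM2r I0 kq1).
Qed.

(** The conjugation by exp(-V) in [K] cancels, so testing the new density against [phi] amounts to
    moving the old one by an LMC step. With [phi = 1] this is conservation of mass, with an
    indicator it is the law of the next iterate. *)
Lemma step_adjoint (phi : 'rV[R]_n -> R) : measurable_fun setT phi -> (forall x, 0 <= phi x) ->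
  (\int[lam]_y (phi y * (eV y * step u y))%:E =
   \int[lam]_x ((eV x * u x)%:E * \int[lam]_y (phi y * gaus h (y - (x - h *: gV a x)))%:E))%E.
Proof.
move=> mphi phi0; have me := measurable_eV.
pose H (p : 'rV[R]_n * 'rV[R]_n) := phi p.1 * eV p.1 * (K p.1 p.2 * u p.2).
have mH : measurable_fun setT H.
  apply: m_mul; first by apply: m_mul; [apply: m_comp mphi _; mes|apply: m_comp me _; mes].
  by apply: m_mul; [apply: measurable_K; mes|apply: m_comp mu _; mes].
have H0 p : 0 <= H p by rewrite /H !mulr_ge0 ?eV_ge0 ?K_ge0.
transitivity (\int[lam]_y \int[lam]_x (H (y, x))%:E)%E.
  apply: eq_integral => y _; rewrite /H /= mulrA EFinM itgK; last exact: itg_Ku.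
  rewrite -ge0_intZl; first last.
  - by rewrite mulr_ge0 ?eV_ge0.
  - by move=> x; rewrite mulr_ge0 ?K_ge0.
  - by apply: m_mul => //; apply: measurable_K; mes.
  - by [].
rewrite (tonelli mH H0); apply: eq_integral => x _.
rewrite -ge0_intZl; first last.
- by rewrite mulr_ge0 ?eV_ge0.
- by move=> y; rewrite mulr_ge0 ?gaus_ge0.
- by apply: m_mul => //; apply: m_gauss2; mes.
apply: eq_integral => y _; rewrite /H /= KE; congr EFin.
have -> : expR (V_alpha n a y - V_alpha n a x) = eV x / eV y.
  by rewrite expRD mulrC /eV -expRN opprK.
have := eV_gt0 y; move: (gaus _ _) (phi y) (eV x) (u x) (eV y) => r1 r2 r3 r4 r5 r50.
by field; rewrite gt_eqF.
Qed.

Lemma gaus_center_int z t : 0 < t -> (\int[lam]_y (gaus t (y - z))%:E = 1)%E.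
Proof.
move=> t0; rewrite (ge0_integral_rV_translate (- z) (F := fun x => (gaus t x)%:E)).
- by rewrite integral_gaus.
- exact: (m_EFin (measurable_gaus t)).
- by move=> x; rewrite lee_fin gaus_ge0.
Qed.

Lemma step_mass : (\int[lam]_y (eV y * step u y)%:E = \int[lam]_x (eV x * u x)%:E)%E.
Proof.
have := @step_adjoint (fun=> 1) (measurable_cst _) (fun _ => ler01).
under eq_integral do rewrite mul1r; move=> ->.
apply: eq_integral => x _; under eq_integral do rewrite mul1r.
by rewrite gaus_center_int// mule1.
Qed.

End one_step.

(** * Gradient of a Gaussian smoothing *)

Section signed_fubini.
Context {R : realType} {n m : nat}.
Local Notation lam' := (@lebesgue_rV R m).

Lemma m_Rint_signed (H : 'rV[R]_n * 'rV[R]_m -> R) : measurable_fun setT H ->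
  (forall y, itg lam' (fun x => H (y, x))) ->
  measurable_fun setT (fun y => \int[lam']_x H (y, x)).
Proof.
move=> mH iH.
have mN : measurable_fun setT (fun p => `|H p|) by apply: measurable_normrf.
rewrite (_ : (fun y => _) = (fun y => \int[lam']_x (H (y, x) + `|H (y, x)|) - \int[lam']_x `|H (y, x)|)).
  apply: m_add; last apply: m_opp.
    apply: (@m_Rint _ _ _ (fun p => H p + `|H p|)); first exact: m_add.
    by move=> p; have := ler_norm (- H p); rewrite normrN; lra.
  by apply: (@m_Rint _ _ _ (fun p => `|H p|)).
apply/funext => y; rewrite -RintB; first by apply: eq_Rint => x; ring.
- by apply: itgD => //; exact: itg_norm.
- exact: itg_norm.
Qed.
End signed_fubini.

Lemma norm_sub_le {R : realType} (p r B : R) :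
  0 <= p -> p <= B -> 0 <= r -> r <= B -> `|p - r| <= B.
Proof. by move=> *; rewrite ler_norml; apply/andP; split; lra. Qed.

Lemma Rint_shift {R : realType} {n : nat} (F : 'rV[R]_n -> R) y :
  measurable_fun setT F -> (forall x, 0 <= F x) ->
  \int[lebesgue_rV n]_x F (x - y) = \int[lebesgue_rV n]_x F x.
Proof.
move=> mF F0; rewrite /Rintegral.
have H (x : 'rV[R]_n) : (0 <= (F x)%:E)%E by rewrite lee_fin.
by have := ge0_integral_rV_translate (- y) (m_EFin mF) H => ->.
Qed.

Section smoothing_gradient.
Context {R : realType} {n : nat}.
Variable n0 : (0 < n)%N.
Local Notation lam := (@lebesgue_rV R n).
Implicit Types (x y w v : 'rV[R]_n).
Variables (t : R) (t0 : 0 < t).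

Let nR : 0 < n%:R :> R. Proof. by rewrite ltr0n. Qed.

Lemma itg_gaus_exp (c : R) y : itg lam (fun x => gaus t (x - y) * expR (c * enorm (x - y))).
Proof.
pose C := expR (2 * t * n%:R * c ^+ 2).
have P w : gaus t w * expR (c * enorm w) <= C * (gaus t w * expR (sqn w / (8 * t * n%:R))).
  rewrite mulrCA ler_wpM2l ?gaus_ge0// -expRD ler_expR -enormK.
  have : 0 <= (enorm w - 4 * t * n%:R * c) ^+ 2 / (8 * t * n%:R).
    by rewrite divr_ge0 ?sqr_ge0// !mulr_ge0// ltW.
  have -> : (enorm w - 4 * t * n%:R * c) ^+ 2 / (8 * t * n%:R) =
    enorm w ^+ 2 / (8 * t * n%:R) - c * enorm w + 2 * t * n%:R * c ^+ 2.
    by field; rewrite !gt_eqF.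
  lra.
apply: (@itg_le _ _ _ _ _ (C * 2)).
- by apply: m_mul; [apply: m_gauss2; mes|mes].
- by move=> x; rewrite mulr_ge0 ?gaus_ge0 ?expR_ge0.
- rewrite (ge0_integral_rV_translate (- y) (F := fun x => (gaus t x * expR (c * enorm x))%:E)).
  + apply: le_trans (ge0_int_le lam _ _ _ P) _.
    * by apply: m_mul; [exact: measurable_gaus|mes].
    * by apply: m_mul; [mes|apply: m_mul; [exact: measurable_gaus|mes]].
    * by move=> x; rewrite mulr_ge0 ?gaus_ge0 ?expR_ge0.
    rewrite ge0_intZl ?expR_ge0//; first last.
    * by move=> x; rewrite mulr_ge0 ?gaus_ge0 ?expR_ge0.
    * by apply: m_mul; [exact: measurable_gaus|mes].
    by rewrite EFinM; apply: lee_wpmul2l; [rewrite lee_fin expR_ge0|exact: gaus_exp_sqn].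
  + by apply: m_EFin; apply: m_mul; [exact: measurable_gaus|mes].
  + by move=> x; rewrite lee_fin mulr_ge0 ?gaus_ge0 ?expR_ge0.
Qed.

(** The exact value is 2t|v|^2, but a bound suffices. It follows from the exponential moments
    [gaus_exp_dot] and 2 + x^2 <= exp(x) + exp(-x), with [k] chosen so that these moments equal e;
    then 2e - 2 <= 6. *)
Lemma gaus_moment2 v : \int[lam]_w (gaus t w * dotp w v ^+ 2) <= 6 * t * sqn v.
Proof.
have [v0|v0] := eqVneq (sqn v) 0.
  rewrite v0 mulr0 -[leRHS](_ : \int[lam]_w (0 * gaus t w) = 0); last first.
    by rewrite RintZ ?mul0r//; exact: itg_gaus.
  rewrite le_eqVlt; apply/orP; left; apply/eqP/eq_Rint => w.
  suff -> : dotp w v ^+ 2 = 0 by rewrite mulr0 mul0r.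
  by apply/eqP; rewrite eq_le sqr_ge0 andbT -[leRHS](mulr0 (sqn w)) -v0 dotp_sqr_le.
have vp : 0 < sqn v by rewrite lt_neqAle eq_sym v0 sqn_ge0.
pose k := 2 / Num.sqrt (t * sqn v).
have tv : 0 < t * sqn v by rewrite mulr_gt0.
have k0 : 0 < k by rewrite divr_gt0// sqrtr_gt0.
have kk : k ^+ 2 * (t * sqn v) = 4.
  by rewrite /k expr_div_n sqr_sqrtr ?(ltW tv)//; field; rewrite (gt_eqF t0) (gt_eqF vp).
have Pt (x : R) : 2 + x ^+ 2 <= expR x + expR (- x).
  pose f (y : R) : R := expR y + expR (- y) - 2 - y ^+ 2.
  suff : 0 <= f x by rewrite /f; lra.
  have wlog_ : forall z, 0 <= z -> 0 <= f z.
    move=> z z0.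
    pose g1 (y : R) : R := expR y - expR (- y) - 2 * y.
    have d1 (y : R) : is_derive y 1 f (g1 y).
      by eapply drv_eq; [rewrite /f; drv|rewrite /g1 /=; ring].
    have d2 (y : R) : is_derive y 1 g1 (expR y + expR (- y) - 2).
      by eapply drv_eq; [rewrite /g1; drv|rewrite /=; ring].
    have g2 (y : R) : 0 <= expR y + expR (- y) - 2.
      have := sqr_ge0 (expR (y / 2) - expR (- (y / 2))).
      rewrite sqrrB -expRD subrr expR0 !expr2 -!expRD => H.
      have E1 : y / 2 + y / 2 = y by field.
      have E2 : - (y / 2) + - (y / 2) = - y by field.
      by move: H; rewrite E1 E2 mulr2n; lra.
    have g1_ge0 (y : R) : 0 <= y -> 0 <= g1 y.
      move=> y0; have [c0 _] := @MVT_segment R g1 _ 0 y y0 (fun s _ => d2 s)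
        (derivable_within_continuous (fun s _ => @ex_derive _ _ _ _ _ _ _ (d2 s))).
      have -> : g1 0 = 0 by rewrite /g1 oppr0; ring.
      by rewrite !subr0 => ->; rewrite mulr_ge0.
    have [c0] := @MVT_segment R f _ 0 z z0 (fun s _ => d1 s)
        (derivable_within_continuous (fun s _ => @ex_derive _ _ _ _ _ _ _ (d1 s))).
    rewrite in_itv/= => /andP[c00 _].
    have -> : f 0 = 0 by rewrite /f oppr0 expR0; ring.
    by rewrite !subr0 => ->; rewrite mulr_ge0// g1_ge0.
  have [x0|x0] := leP 0 x; first exact: wlog_.
  have := wlog_ (- x); rewrite /f opprK sqrrN oppr_ge0 ltW// => /(_ isT); lra.
have i1 : itg lam (fun w => gaus t w * expR (2^-1 * dotp w (k *: v))).
  apply: (@itg_le _ _ _ _ _ (expR (t * sqn (k *: v) / 4))).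
  - by apply: m_mul; [exact: measurable_gaus|mes].
  - by move=> w; rewrite mulr_ge0 ?gaus_ge0 ?expR_ge0.
  - by rewrite gaus_exp_dot.
have i2 : itg lam (fun w => gaus t w * expR (2^-1 * dotp w (- (k *: v)))).
  apply: (@itg_le _ _ _ _ _ (expR (t * sqn (- (k *: v)) / 4))).
  - by apply: m_mul; [exact: measurable_gaus|mes].
  - by move=> w; rewrite mulr_ge0 ?gaus_ge0 ?expR_ge0.
  - by rewrite gaus_exp_dot.
have B w : gaus t w * dotp w v ^+ 2 <= 4 / k ^+ 2 *
   (gaus t w * expR (2^-1 * dotp w (k *: v)) + gaus t w * expR (2^-1 * dotp w (- (k *: v))) - 2 * gaus t w).
  rewrite [leRHS](_ : _ = gaus t w * (4 / k ^+ 2 * (expR (2^-1 * dotp w (k *: v)) + expR (2^-1 * dotp w (- (k *: v))) - 2))); last by ring.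
  apply: ler_wpM2l; first exact: gaus_ge0.
  have := Pt (2^-1 * dotp w (k *: v)); rewrite dotpNr mulrN dotpZr.
  rewrite -lerBrDl => /(ler_wpM2l (divr_ge0 (ler0n R 4) (sqr_ge0 k))).
  apply: le_trans; rewrite le_eqVlt; apply/orP; left; apply/eqP.
  by field; rewrite gt_eqF.
have iB : itg lam (fun w => 4 / k ^+ 2 *
   (gaus t w * expR (2^-1 * dotp w (k *: v)) + gaus t w * expR (2^-1 * dotp w (- (k *: v))) - 2 * gaus t w)).
  by apply: itgZ; apply: itgB; [exact: itgD|apply: itgZ; exact: itg_gaus].
apply: (@le_trans _ _ (\int[lam]_w (4 / k ^+ 2 *
   (gaus t w * expR (2^-1 * dotp w (k *: v)) + gaus t w * expR (2^-1 * dotp w (- (k *: v))) - 2 * gaus t w)))).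
  apply: le_Rint => //.
  apply: itg_dom iB _; first by apply: m_mul; [exact: measurable_gaus|mes].
  by move=> w; rewrite ger0_norm; [exact: B|rewrite mulr_ge0 ?gaus_ge0 ?sqr_ge0].
rewrite RintZ; last by apply: itgB; [exact: itgD|apply: itgZ; exact: itg_gaus].
rewrite RintB; [|exact: itgD|apply: itgZ; exact: itg_gaus].
rewrite RintD// RintZ; last exact: itg_gaus.
rewrite Rint_gaus// /Rintegral !gaus_exp_dot//= sqnN sqnZ.
have -> : t * (k ^+ 2 * sqn v) / 4 = 1 by rewrite (_ : _ / 4 = k ^+ 2 * (t * sqn v) / 4); [rewrite kk divff|ring].
have -> : 6 * t * sqn v = 4 / k ^+ 2 * 6.
  by rewrite -kk; field; rewrite gt_eqF.
apply: ler_wpM2l; first by rewrite divr_ge0 ?sqr_ge0.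
have e2 : expR (2^-1) <= 2 :> R.
  have := expR_sub1_le (2^-1 : R); lra.
have -> : expR 1 = expR (2^-1) ^+ 2 :> R by rewrite expr2 -expRD; congr expR; field.
by have := expR_gt0 (2^-1 : R); nra.
Qed.

Variables (f : 'rV[R]_n -> R) (B : R).
Hypothesis (mf : measurable_fun setT f) (f0 : forall x, 0 <= f x) (fB : forall x, f x <= B).

(** The gradient of [gsm t f] obtained by differentiating the Gaussian. Subtracting the constant
    [gsm t f y] does not change the integral, the Gaussian being even, and makes the local variance
    appear in [ggrad_le]. *)
Definition ggrad y : 'rV[R]_n :=
  \row_(i < n) \int[lam]_x (gaus t (x - y) * ((x - y) ord0 i * (f x - gsm t f y) / (2 * t))).

Let B0 : 0 <= B. Proof. exact: le_trans (f0 0) (fB 0). Qed.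

Let fg y x : `|f x - gsm t f y| <= B.
Proof.
have h1 := gsm_ge0 t f0 y; have h2 := gsm_le t0 mf f0 fB y.
by have h3 := f0 x; have h4 := fB x; exact: norm_sub_le.
Qed.

Lemma coor_le_enorm w i : `|w ord0 i| <= enorm w.
Proof.
rewrite -(ler_pXn2r (n := 2))// ?nnegrE ?enorm_ge0// real_normK ?num_real// enormK.
rewrite /sqn /dotp (bigD1 i)//= -expr2 lerDl sumr_ge0// => j _.
by rewrite -expr2 sqr_ge0.
Qed.

Lemma itg_gaus_lin y v : itg lam (fun x => gaus t (x - y) * (dotp (x - y) v * (f x - gsm t f y) / (2 * t))).
Proof.
apply: (@itg_dom _ _ _ _ (fun x => enorm v * B / (2 * t) * (gaus t (x - y) * expR (1 * enorm (x - y))))).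
- by apply: m_mul; [apply: m_gauss2; mes|mes].
- by apply: itgZ; exact: itg_gaus_exp.
- move=> x; rewrite normrM (ger0_norm (gaus_ge0 _ _)) mulrCA ler_wpM2l ?gaus_ge0//.
  rewrite !normrM (@ger0_norm _ (2 * t)^-1); last by rewrite invr_ge0 mulr_ge0// ltW.
  rewrite (_ : _ * expR _ = (enorm v * expR (1 * enorm (x - y)) * B / (2 * t))); last by ring.
  rewrite ler_wpM2r ?invr_ge0 ?mulr_ge0 ?(ltW t0)//; apply: ler_pM => //.
  apply: (le_trans (dotp_le _ _)); rewrite mulrC ler_wpM2l ?enorm_ge0// mul1r.
  by apply: le_trans (expR_ge1Dx _); rewrite lerDr.
Qed.

Lemma dotp_delta w i : dotp w (delta_mx ord0 i) = w ord0 i.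
Proof.
rewrite /dotp (bigD1 i)//= mxE !eqxx mulr1 big1 ?addr0// => j ji.
by rewrite mxE (negbTE ji) andbF mulr0.
Qed.

Lemma ggradE y v : dotp (ggrad y) v =
  \int[lam]_x (gaus t (x - y) * (dotp (x - y) v * (f x - gsm t f y) / (2 * t))).
Proof.
have ii i : itg lam (fun x => gaus t (x - y) * ((x - y) ord0 i * (f x - gsm t f y) / (2 * t))).
  have := itg_gaus_lin y (delta_mx ord0 i); congr (itg lam _).
  by apply/funext => x; rewrite dotp_delta.
have S (r : seq 'I_n) : itg lam (fun x => \sum_(i <- r) v ord0 i * (gaus t (x - y) * ((x - y) ord0 i * (f x - gsm t f y) / (2 * t)))) /\
  \int[lam]_x (\sum_(i <- r) v ord0 i * (gaus t (x - y) * ((x - y) ord0 i * (f x - gsm t f y) / (2 * t)))) =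
  \sum_(i <- r) v ord0 i * \int[lam]_x (gaus t (x - y) * ((x - y) ord0 i * (f x - gsm t f y) / (2 * t))).
  elim: r => [|i r [IH1 IH2]].
    split; last first.
      rewrite big_nil; under eq_Rint do rewrite big_nil.
      by rewrite -[X in Rintegral _ _ X](_ : (fun x => 0 * gaus t x) = _) ?RintZ ?mul0r//; [exact: itg_gaus|apply/funext => x; rewrite mul0r].
    rewrite (_ : (fun x => _) = (fun x => 0 * gaus t x)); first by apply: itgZ; exact: itg_gaus.
    by apply/funext => x; rewrite big_nil mul0r.
  split.
    rewrite (_ : (fun x => _) = (fun x => v ord0 i * (gaus t (x - y) * ((x - y) ord0 i * (f x - gsm t f y) / (2 * t))) + \sum_(i <- r) v ord0 i * (gaus t (x - y) * ((x - y) ord0 i * (f x - gsm t f y) / (2 * t))))).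
      by apply: itgD => //; exact: itgZ.
    by apply/funext => x; rewrite big_cons.
  under eq_Rint do rewrite big_cons.
  by rewrite RintD//; [rewrite RintZ// IH2 big_cons|exact: itgZ].
have [_ E] := S (index_enum 'I_n).
rewrite /dotp; under eq_bigr do rewrite mxE mulrC.
rewrite -E; apply: eq_Rint => x.
rewrite mulr_suml mulr_suml mulr_sumr; apply: eq_bigr => i _; ring.
Qed.

(** Pair the gradient with itself and separate the two factors by Young's inequality, weighted so
    that the second moment [gaus_moment2] returns half of |G|^2, which is absorbed on the left. *)
Lemma ggrad_le y : sqn (ggrad y) <= 3 / (2 * t) * gvar t f y.
Proof.
set G := ggrad y; have [G0|G0] := eqVneq (sqn G) 0.
  by rewrite G0 mulr_ge0 ?gvar_ge0// divr_ge0// mulr_ge0// ltW.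
have Gp : 0 < sqn G by rewrite lt_neqAle eq_sym G0 sqn_ge0.
have E : dotp G G = \int[lam]_x (gaus t (x - y) * (dotp (x - y) G * (f x - gsm t f y) / (2 * t))) := ggradE y G.
have iv : itg lam (fun x => gaus t (x - y) * (f x - gsm t f y) ^+ 2).
  apply: (itg_weight (itg_gausB y t0) (fun x => gaus_ge0 _ _) (B := B ^+ 2)); first by mes.
  by move=> x; rewrite normrX lerXn2r ?nnegrE.
have im : itg lam (fun x => gaus t (x - y) * dotp (x - y) G ^+ 2).
  apply: (@itg_dom _ _ _ _ (fun x => 4 * sqn G * (gaus t (x - y) * expR (1 * enorm (x - y))))).
  - by apply: m_mul; [apply: m_gauss2; mes|mes].
  - by apply: itgZ; exact: itg_gaus_exp.
  - move=> x; rewrite ger0_norm; last by rewrite mulr_ge0 ?gaus_ge0 ?sqr_ge0.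
    rewrite [leRHS]mulrCA; apply: ler_wpM2l; first exact: gaus_ge0.
    apply: (le_trans (dotp_sqr_le _ _)).
    rewrite mulrC (mulrC 4) -mulrA; apply: ler_wpM2l; first exact: sqn_ge0.
    by rewrite -enormK mul1r; exact: sqr_le_expR (enorm_ge0 _).
have M2 : \int[lam]_x (gaus t (x - y) * dotp (x - y) G ^+ 2) <= 6 * t * sqn G.
  have <- : \int[lam]_w (gaus t w * dotp w G ^+ 2) = \int[lam]_x (gaus t (x - y) * dotp (x - y) G ^+ 2).
    rewrite /Rintegral; congr fine.
    have := @ge0_integral_rV_translate R n (- y) (fun w => (gaus t w * dotp w G ^+ 2)%:E).
    move=> -> //.
    - by apply: m_EFin; apply: m_mul; [exact: measurable_gaus|mes].
    - by move=> x; rewrite lee_fin mulr_ge0 ?gaus_ge0 ?sqr_ge0.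
  exact: gaus_moment2.
(* A B / (2t) <= A^2 / (12t) + 3 B^2 / (4t) *)
have P x : gaus t (x - y) * (dotp (x - y) G * (f x - gsm t f y) / (2 * t)) <=
   (12 * t)^-1 * (gaus t (x - y) * dotp (x - y) G ^+ 2) + 3 / (4 * t) * (gaus t (x - y) * (f x - gsm t f y) ^+ 2).
  have := mulr_ge0 (gaus_ge0 t (x - y)) (sqr_ge0 (dotp (x - y) G - 3 * (f x - gsm t f y))).
  have t12 : 0 <= (12 * t)^-1 by rewrite invr_ge0 mulr_ge0// ltW.
  move=> /(mulr_ge0 t12) H; rewrite -subr_ge0; apply: (le_trans H).
  by rewrite le_eqVlt; apply/orP; left; apply/eqP; field; rewrite gt_eqF.
have := le_Rint (itg_gaus_lin y G) (itgD (itgZ _ im) (itgZ _ iv)) P.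
rewrite -E RintD; [|exact: itgZ|exact: itgZ].
rewrite !RintZ// -/(gvar t f y) -/(sqn G).
have t12 : 0 <= (12 * t)^-1 by rewrite invr_ge0 mulr_ge0// ltW.
move=> H; have := ler_wpM2l t12 M2.
have -> : (12 * t)^-1 * (6 * t * sqn G) = sqn G / 2 by field; rewrite gt_eqF.
have -> : 3 / (2 * t) * gvar t f y = 2 * (3 / (4 * t) * gvar t f y) by field; rewrite gt_eqF.
by move: H; lra.
Qed.

Lemma gvar_le y : gvar t f y <= B ^+ 2.
Proof.
apply: (le_trans (gvar_min t0 mf f0 fB y 0)).
rewrite -[leRHS]mulr1 -[X in _ * X](Rint_gausB y t0) -RintZ; last exact: itg_gausB.
have P x : gaus t (x - y) * (f x - 0) ^+ 2 <= B ^+ 2 * gaus t (x - y).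
  rewrite mulrC ler_wpM2r ?gaus_ge0// subr0.
  by apply: lerXn2r; rewrite ?nnegrE; [exact: f0|exact: B0|exact: fB].
apply: le_Rint => //; last by apply: itgZ; exact: itg_gausB.
apply: (@itg_dom _ _ _ _ (fun x => B ^+ 2 * gaus t (x - y))).
- by apply: m_mul; [apply: m_gauss2; mes|mes].
- by apply: itgZ; exact: itg_gausB.
- by move=> x; rewrite ger0_norm// mulr_ge0 ?gaus_ge0 ?sqr_ge0.
Qed.

Definition ggrad_max : R := Num.sqrt (3 / (2 * t) * B ^+ 2).

Lemma ggrad_bounded y : enorm (ggrad y) <= ggrad_max.
Proof.
have h : 0 <= 3 / (2 * t) by rewrite divr_ge0// mulr_ge0// ltW.
rewrite enorm_sqn ler_sqrt; last by rewrite mulr_ge0// sqr_ge0.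
by apply: (le_trans (ggrad_le y)); rewrite ler_wpM2l// gvar_le.
Qed.

(** The coefficient of |v|^2 when the Gaussian density ratio under a shift [v] is expanded to first
    order; its growth in |w| is only exponential, hence integrable. *)
Definition gsm_rem w : R := 4 * expR (2 * ((2 * enorm w + 1) / (4 * t))) + (4 * t)^-1.

Lemma gsm_rem_ge0 w : 0 <= gsm_rem w.
Proof. by rewrite addr_ge0 ?mulr_ge0 ?expR_ge0 ?invr_ge0 ?mulr_ge0 ?(ltW t0). Qed.

Lemma itg_gsm_rem y : itg lam (fun x => gaus t (x - y) * gsm_rem (x - y)).
Proof.
rewrite (_ : (fun x => _) = (fun x => 4 * expR (2 * (1 / (4 * t))) * (gaus t (x - y) * expR (t^-1 * enorm (x - y))) +
  (4 * t)^-1 * gaus t (x - y))).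
  apply: itgD; apply: itgZ; [exact: itg_gaus_exp|exact: itg_gausB].
apply/funext => x; rewrite /gsm_rem.
have -> : expR (2 * ((2 * enorm (x - y) + 1) / (4 * t))) = expR (2 * (1 / (4 * t))) * expR (t^-1 * enorm (x - y)).
  by rewrite -expRD; congr expR; field; rewrite gt_eqF.
ring.
Qed.

Lemma exp_rem_le w v : enorm v <= 1 ->
  `|expR (dotp w v / (2 * t) - sqn v / (4 * t)) - 1 - dotp w v / (2 * t)| <= sqn v * gsm_rem w.
Proof.
move=> v1; set s := dotp w v / (2 * t); set r := sqn v / (4 * t).
have v0 := enorm_ge0 v; have w0 := enorm_ge0 w.
have t4 : 0 < (4 * t)^-1 by rewrite invr_gt0 mulr_gt0.
have r0 : 0 <= r by rewrite divr_ge0 ?sqn_ge0// mulr_ge0// ltW.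
set L := (2 * enorm w + 1) / (4 * t).
have L0 : 0 <= L by rewrite /L mulr_ge0 ?(ltW t4)//; lra.
have sr : `|s - r| <= enorm v * L.
  apply: (le_trans (ler_normB _ _)); rewrite (ger0_norm r0).
  have h1 : `|s| <= enorm v * (2 * enorm w / (4 * t)).
    rewrite /s normrM (@ger0_norm _ (2 * t)^-1); last by rewrite invr_ge0 mulr_ge0// ltW.
    rewrite (_ : _ * (_ / _) = (enorm w * enorm v) / (2 * t)); last by field; rewrite gt_eqF.
    by rewrite ler_wpM2r ?dotp_le// invr_ge0 mulr_ge0// ltW.
  have h2 : r <= enorm v * (1 / (4 * t)).
    by rewrite /r -enormK expr2 -mulrA ler_wpM2l// ler_wpM2r// ltW.
  by apply: (le_trans (lerD h1 h2)); rewrite -mulrDr -mulrDl.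
have sr1 : `|s - r| <= L by apply: (le_trans sr); rewrite ler_piMl.
have lo := expR_ge1Dx (s - r); have up := expR_taylor2 (s - r).
have sq : (s - r) ^+ 2 * expR `|s - r| <= sqn v * (4 * expR (2 * L)).
  have -> : expR (2 * L) = expR L * expR L by rewrite -expRD; congr expR; ring.
  have -> : sqn v * (4 * (expR L * expR L)) = (enorm v ^+ 2 * (4 * expR L)) * expR L by rewrite enormK; ring.
  apply: ler_pM; rewrite ?sqr_ge0 ?expR_ge0 ?ler_expR//.
  apply: (@le_trans _ _ (enorm v ^+ 2 * L ^+ 2)).
    rewrite -exprMn -[leLHS]real_normK ?num_real//.
    by rewrite !expr2; apply: ler_pM => //; exact: normr_ge0.
  by rewrite ler_wpM2l ?sqr_ge0 ?sqr_le_expR.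
have rE : r = sqn v * (4 * t)^-1 by [].
rewrite /gsm_rem -/L mulrDr -rE ler_norml; apply/andP; split.
  have : 0 <= sqn v * (4 * expR (2 * L)) by rewrite !mulr_ge0 ?sqn_ge0 ?expR_ge0.
  lra.
lra.
Qed.

Definition gsm_C : R := B * (\int[lam]_w (gaus t w * gsm_rem w)) + B + ggrad_max.

Lemma gsm_C_ge0 : 0 <= gsm_C.
Proof.
rewrite /gsm_C !addr_ge0 ?sqrtr_ge0// mulr_ge0// Rint_ge0// => w.
by rewrite mulr_ge0 ?gaus_ge0 ?gsm_rem_ge0.
Qed.

(** For |v| <= 1 the ratio of the shifted Gaussian to the original is expanded under the integral.
    For |v| > 1 boundedness of the smoothing and of its gradient suffices, because |v| <= |v|^2. The
    constant is uniform in the base point. *)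
Lemma gsm_taylor y v : `|gsm t f (y + v) - gsm t f y - dotp (ggrad y) v| <= gsm_C * sqn v.
Proof.
have I0 : 0 <= \int[lam]_w (gaus t w * gsm_rem w).
  by apply: Rint_ge0 => w; rewrite mulr_ge0 ?gaus_ge0 ?gsm_rem_ge0.
have gm0 : 0 <= ggrad_max by exact: sqrtr_ge0.
have [v1|v1] := leP (enorm v) 1; last first.
  have v2 : 1 <= sqn v by rewrite -enormK exprn_ege1// ltW.
  have vv : enorm v <= sqn v by rewrite -enormK expr2 ler_peMl ?enorm_ge0// ltW.
  have h1 : `|gsm t f (y + v) - gsm t f y| <= B * sqn v.
    apply: (@le_trans _ _ B); last by rewrite ler_peMr.
    have h1 := gsm_ge0 t f0 y; have h2 := gsm_le t0 mf f0 fB y.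
    have h3 := gsm_ge0 t f0 (y + v); have h4 := gsm_le t0 mf f0 fB (y + v).
    exact: norm_sub_le.
  have h2 : `|dotp (ggrad y) v| <= ggrad_max * sqn v.
    apply: (le_trans (dotp_le _ _)); apply: ler_pM; rewrite ?enorm_ge0//.
    exact: ggrad_bounded.
  apply: (le_trans (ler_normB _ _)); apply: (le_trans (lerD h1 h2)).
  rewrite /gsm_C -mulrDl ler_wpM2r ?sqn_ge0//.
  by rewrite -addrA lerDr mulr_ge0.
have sv := sqn_ge0 v.
set g := gsm t f y.
have i1 : itg lam (fun x => gaus t (x - (y + v)) * (f x - g)).
  by apply: (itg_weight (itg_gausB (y + v) t0) (fun x => gaus_ge0 _ _) (B := B)); [mes|exact: fg].
have i2 : itg lam (fun x => gaus t (x - y) * (f x - g)).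
  by apply: (itg_weight (itg_gausB y t0) (fun x => gaus_ge0 _ _) (B := B)); [mes|exact: fg].
have E z : \int[lam]_x (gaus t (x - z) * (f x - g)) = gsm t f z - g.
  rewrite -[g in RHS]mulr1 -(Rint_gausB z t0) -RintZ; last exact: itg_gausB.
  rewrite /gsm -RintB; first by apply: eq_Rint => x; ring.
    exact: itg_gsm t0 f B mf f0 fB z.
  by apply: itgZ; exact: itg_gausB.
have E0 : \int[lam]_x (gaus t (x - y) * (f x - g)) = 0 by rewrite E subrr.
rewrite -[gsm t f (y + v) - g]E ggradE -/g.
rewrite -RintB//; last exact: itg_gaus_lin.
rewrite -[X in `|X|]subr0 -E0 -RintB//; last by apply: itgB => //; exact: itg_gaus_lin.
have P x : gaus t (x - (y + v)) * (f x - g) - gaus t (x - y) * (dotp (x - y) v * (f x - g) / (2 * t))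
    - gaus t (x - y) * (f x - g) = gaus t (x - y) *
    (expR (dotp (x - y) v / (2 * t) - sqn v / (4 * t)) - 1 - dotp (x - y) v / (2 * t)) * (f x - g).
  have -> : gaus t (x - (y + v)) = gaus t (x - y) * expR (dotp (x - y) v / (2 * t) - sqn v / (4 * t)).
    rewrite opprD addrA !gausE// -mulrA -expRD; congr (_ * expR _).
    by move: (x - y) => w; rewrite sqnD sqnN dotpNr; field; rewrite gt_eqF.
  ring.
under eq_Rint do rewrite P.
apply: (@le_trans _ _ (\int[lam]_x (sqn v * B * (gaus t (x - y) * gsm_rem (x - y))))).
  apply: norm_Rint_le.
  - have := itgB (itgB i1 (itg_gaus_lin y v)) i2; congr (itg lam _).
    by apply/funext => x; rewrite P.
  - by apply: itgZ; exact: itg_gsm_rem.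
  - move=> x; rewrite !normrM (ger0_norm (gaus_ge0 _ _)).
    rewrite (_ : _ * (_ * gsm_rem _) = gaus t (x - y) * (sqn v * gsm_rem (x - y)) * B); last by ring.
    apply: ler_pM; rewrite ?mulr_ge0 ?gaus_ge0// ?fg//.
    by apply: ler_wpM2l; [exact: gaus_ge0|exact: exp_rem_le].
rewrite RintZ; last exact: itg_gsm_rem.
rewrite (_ : \int[lam]_x (gaus t (x - y) * gsm_rem (x - y)) = \int[lam]_w (gaus t w * gsm_rem w)); last first.
  apply: (Rint_shift (F := fun w => gaus t w * gsm_rem w)).
  - by apply: m_mul; [exact: measurable_gaus|rewrite /gsm_rem; mes].
  - by move=> x; rewrite mulr_ge0 ?gaus_ge0 ?gsm_rem_ge0.
rewrite -mulrA mulrC ler_wpM2r// /gsm_C -addrA lerDl addr_ge0//.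
Qed.

Lemma measurable_ggrad : measurable_fun setT ggrad.
Proof.
have mg := measurable_gsm t mf f0.
apply/measurable_fun_coorP => i.
rewrite (_ : _ \o _ = fun y => \int[lam]_x (gaus t (x - y) * ((x - y) ord0 i * (f x - gsm t f y) / (2 * t)))); last first.
  by apply/funext => y; rewrite /rV_coor /= mxE.
apply: (@m_Rint_signed R n n (fun p => gaus t (p.2 - p.1) * ((p.2 - p.1) ord0 i * (f p.2 - gsm t f p.1) / (2 * t)))).
- apply: m_mul; first by apply: m_gauss2; mes.
  apply: m_mul; last exact: measurable_cst.
  apply: m_mul.
    by apply: (m_comp (measurable_coor i)); apply: measurable_sub; mes.
  by apply: m_add; [apply: m_comp mf _; mes|apply: m_opp; apply: m_comp mg _; mes].
- move=> y /=; have := itg_gaus_lin y (delta_mx ord0 i); congr (itg lam _).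
  by apply/funext => x; rewrite dotp_delta.
Qed.

End smoothing_gradient.

(** * The Gaussian Poincare inequality by rotations *)

Section scalar_bounds.
Context {R : realType}.

Lemma sum_sqr_le (J : nat) (d : nat -> R) :
  (\sum_(j < J) d j) ^+ 2 <= J%:R * \sum_(j < J) d j ^+ 2.
Proof.
have H (b : R) k : 2 * b * \sum_(j < k) d j - k%:R * b ^+ 2 <= \sum_(j < k) d j ^+ 2.
  elim: k => [|k IH]; first by rewrite !big_ord0; lra.
  rewrite !big_ord_recr /=; have := sqr_ge0 (d k - b).
  move: IH; set S := \sum_(j < k) d j; set Q := \sum_(j < k) d j ^+ 2; set e := d k.
  rewrite (_ : k.+1%:R = k%:R + 1 :> R); last by rewrite natr1.
  by move: (k%:R : R) => kk; lra.
case: J => [|J]; first by rewrite !big_ord0 mul0r expr0n.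
have J0 : 0 < J.+1%:R :> R by rewrite ltr0n.
have := H ((\sum_(j < J.+1) d j) / J.+1%:R) J.+1.
set S := \sum_(j < J.+1) d j; set Q := \sum_(j < J.+1) d j ^+ 2.
have -> : 2 * (S / J.+1%:R) * S - J.+1%:R * (S / J.+1%:R) ^+ 2 = S ^+ 2 / J.+1%:R by field; rewrite gt_eqF.
by rewrite ler_pdivrMr// mulrC.
Qed.

Lemma sum_sqr_tele (J : nat) (F : nat -> R) :
  (F J - F 0%N) ^+ 2 <= J%:R * \sum_(j < J) (F j.+1 - F j) ^+ 2.
Proof.
apply: (le_trans _ (sum_sqr_le J (fun j => F j.+1 - F j))).
by rewrite -(big_mkord xpredT (fun j => F j.+1 - F j)) telescope_sumr.
Qed.

Lemma weighted_var_min1 d (T : measurableType d) (mu : {measure set T -> \bar R}) (k f : T -> R) (B b : R) :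
  itg mu k -> (forall x, 0 <= k x) -> \int[mu]_x k x = 1 ->
  measurable_fun setT f -> (forall x, `|f x| <= B) ->
  \int[mu]_x (k x * (f x - \int[mu]_x (k x * f x)) ^+ 2) <= \int[mu]_x (k x * (f x - b) ^+ 2).
Proof.
move=> ik k0 k1 mf fB; have := @weighted_var_min _ _ _ mu k ik k0 f B b mf fB.
by rewrite k1 divr1 => /(_ ltr01).
Qed.

Lemma ge0_int_sum_const d (T : measurableType d) (mu : {measure set T -> \bar R}) (F : nat -> T -> R) (c : \bar R) J :
  (forall j, measurable_fun setT (F j)) -> (forall j x, 0 <= F j x) ->
  (forall j, (j < J)%N -> (\int[mu]_x (F j x)%:E)%E = c) ->
  (\int[mu]_x (\sum_(j < J) F j x)%:E = (J%:R)%:E * c)%E.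
Proof.
move=> mF F0; elim: J => [_|J IH E].
  rewrite mul0e; under eq_integral do rewrite big_ord0.
  by rewrite integral0.
have c0 : (0 <= c)%E by rewrite -(E J)//; apply: integral_ge0 => x _; rewrite lee_fin.
under eq_integral do rewrite big_ord_recr.
rewrite (ge0_intD mu (F := fun x => \sum_(j < J) F j x) (measurable_sum _ (fun j : 'I_J => mF j)) (mF J) _ (F0 J)); last first.
  by move=> x; apply: sumr_ge0 => j _; exact: F0.
rewrite E// IH; last by move=> j jJ; apply: E; exact: ltnW.
by rewrite -[X in (_ + X)%E]mul1e -ge0_muleDl ?lee_fin// -EFinD natr1.
Qed.

Lemma sin_cos_small (th : R) : 0 <= th <= 1 -> `|sin th| <= th /\ `|cos th - 1| <= th ^+ 2.
Proof.
move=> th01; have S (y : R) : 0 <= y <= 1 -> `|sin y| <= 1 * y ^+ 1.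
  apply: (@mvt_le _ _ cos) => //; first exact: sin0.
  by move=> z _; rewrite expr0 mulr1 ler_norml cos_le1 cos_geN1.
split; first by have := S _ th01; rewrite mul1r expr1.
have := @mvt_le _ (fun y => cos y - 1) (fun y => - sin y) 1 1 _ _ _ _ th01.
rewrite mul1r; apply.
- by move=> y; eapply drv_eq; [apply: is_deriveB|]; rewrite ?subr0.
- by rewrite cos0 subrr.
- by move=> y y01; rewrite normrN; exact: S.
Qed.

End scalar_bounds.

Lemma eq_int {R : realType} d (T : measurableType d) (mu : {measure set T -> \bar R}) (F G : T -> R) :
  (forall x, F x = G x) -> (\int[mu]_x (F x)%:E = \int[mu]_x (G x)%:E)%E.
Proof. by move=> FG; apply: eq_integral => x _; rewrite FG. Qed.

Section rotation.
Context {R : realType} {n : nat}.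
Local Notation lam := (@lebesgue_rV R n).
Local Notation lam2 := (lam \x lam)%E.
Implicit Types (H : 'rV[R]_n * 'rV[R]_n -> R).

Lemma int2E H : measurable_fun setT H -> (forall p, 0 <= H p) ->
  (\int[lam2]_p (H p)%:E = \int[lam]_x \int[lam]_y (H (x, y))%:E)%E.
Proof.
move=> mH H0; rewrite fubini_tonelli1//; exact: m_EFin.
Qed.

Lemma m_pair d (T : measurableType d) (f g : T -> 'rV[R]_n) :
  measurable_fun setT f -> measurable_fun setT g -> measurable_fun setT (fun u => (f u, g u)).
Proof. by move=> mf mg; exact/measurable_fun_pairP. Qed.

Lemma int2_shear1 (s : R) H : measurable_fun setT H -> (forall p, 0 <= H p) ->
  (\int[lam2]_p (H (p.1 + s *: p.2, p.2))%:E = \int[lam2]_p (H p)%:E)%E.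
Proof.
move=> mH H0.
have mH' : measurable_fun setT (fun p : 'rV[R]_n * 'rV[R]_n => H (p.1 + s *: p.2, p.2)).
  by apply: m_comp mH _; apply: m_pair; mes.
rewrite (int2E mH' (fun p => H0 _)) (int2E mH H0) (tonelli mH' (fun p => H0 _)) (tonelli mH H0).
apply: eq_integral => y _ /=.
apply: (ge0_integral_rV_translate (s *: y) (F := fun x => (H (x, y))%:E)).
- by apply: m_EFin; apply: m_comp mH _; apply: m_pair; mes.
- by move=> x; rewrite lee_fin.
Qed.

Lemma int2_shear2 (s : R) H : measurable_fun setT H -> (forall p, 0 <= H p) ->
  (\int[lam2]_p (H (p.1, p.2 + s *: p.1))%:E = \int[lam2]_p (H p)%:E)%E.
Proof.
move=> mH H0.
have mH' : measurable_fun setT (fun p : 'rV[R]_n * 'rV[R]_n => H (p.1, p.2 + s *: p.1)).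
  by apply: m_comp mH _; apply: m_pair; mes.
rewrite (int2E mH' (fun p => H0 _)) (int2E mH H0); apply: eq_integral => x _ /=.
apply: (ge0_integral_rV_translate (s *: x) (F := fun y => (H (x, y))%:E)).
- by apply: m_EFin; apply: m_comp mH _; apply: m_pair; mes.
- by move=> y; rewrite lee_fin.
Qed.

Definition rot (c s : R) (p : 'rV[R]_n * 'rV[R]_n) : 'rV[R]_n * 'rV[R]_n :=
  (c *: p.1 + s *: p.2, c *: p.2 - s *: p.1).

Lemma measurable_rot c s : measurable_fun setT (rot c s).
Proof. by apply: m_pair; mes. Qed.

(* A rotation is a product of three shears. *)
Lemma int2_rot (c s : R) H : c ^+ 2 + s ^+ 2 = 1 -> 0 <= c ->
  measurable_fun setT H -> (forall p, 0 <= H p) ->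
  (\int[lam2]_p (H (rot c s p))%:E = \int[lam2]_p (H p)%:E)%E.
Proof.
move=> cs c0 mH H0; have c1 : 0 < 1 + c by lra.
(* The tangent of half the angle, the usual shear coefficient; [c >= 0] keeps it finite. *)
pose k := s / (1 + c).
have mH1 : measurable_fun setT (fun p : 'rV[R]_n * 'rV[R]_n => H (p.1 + k *: p.2, p.2)).
  by apply: m_comp mH _; apply: m_pair; mes.
have mH2 : measurable_fun setT (fun p : 'rV[R]_n * 'rV[R]_n => H (p.1 + k *: (p.2 + (- s) *: p.1), p.2 + (- s) *: p.1)).
  by apply: m_comp mH _; apply: m_pair; mes.
rewrite -(int2_shear1 k mH H0) -(int2_shear2 (- s) mH1 (fun p => H0 _)) /=.
rewrite -(int2_shear1 k mH2 (fun p => H0 _)) /=.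
apply: eq_integral => -[x y] _ /=; congr (H _)%:E.
have cs' : s ^+ 2 = (1 - c) * (1 + c) by rewrite mulrDr mulrBl; nra.
have ck : 1 - k * s = c by rewrite /k mulrAC -expr2 cs' mulfK ?gt_eqF// subKr.
have k2 : k * (1 + c) = s by rewrite /k divfK// gt_eqF.
rewrite /rot /=; congr pair; apply/rowP => i; rewrite !mxE.
  transitivity ((1 - k * s) * x ord0 i + k * (1 + (1 - k * s)) * y ord0 i); last by ring.
  by rewrite ck k2.
transitivity ((1 - k * s) * y ord0 i - s * x ord0 i); last by ring.
by rewrite ck.
Qed.

Lemma rot_comp c s c' s' p : rot c' s' (rot c s p) = rot (c' * c - s' * s) (s' * c + c' * s) p.
Proof. by rewrite /rot /=; congr pair; apply/rowP => i; rewrite !mxE; ring. Qed.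

Lemma gaus_rot t c s p : 0 < t -> c ^+ 2 + s ^+ 2 = 1 ->
  gaus t (rot c s p).1 * gaus t (rot c s p).2 = gaus t p.1 * gaus t p.2.
Proof.
move=> t0 cs; rewrite !gausE// /rot /=.
rewrite !(mulrACA _ (expR _)) -!expRD; congr (_ * expR _).
have -> : sqn (c *: p.1 + s *: p.2) = c ^+ 2 * sqn p.1 + 2 * c * s * dotp p.1 p.2 + s ^+ 2 * sqn p.2.
  by rewrite sqnD !sqnZ !dotpE; ring.
have -> : sqn (c *: p.2 - s *: p.1) = c ^+ 2 * sqn p.2 - 2 * c * s * dotp p.1 p.2 + s ^+ 2 * sqn p.1.
  by rewrite sqnD sqnN !sqnZ !dotpE (dotpC p.2); ring.
have -> : s ^+ 2 = 1 - c ^+ 2 by rewrite -cs; ring.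
by field; rewrite gt_eqF.
Qed.

End rotation.

Section gaussian_poincare.
Context {R : realType} {n : nat}.
Variable n0 : (0 < n)%N.
Local Notation lam := (@lebesgue_rV R n).
Local Notation lam2 := (lam \x lam)%E.
Implicit Types (x y : 'rV[R]_n).
Variables (t s : R) (t0 : 0 < t) (s0 : 0 < s).
Variables (f : 'rV[R]_n -> R) (B : R).
Hypothesis (mf : measurable_fun setT f) (f0 : forall x, 0 <= f x) (fB : forall x, f x <= B).
Local Notation g := (gsm t f).
Local Notation Gm := (ggrad t f).

Let mg : measurable_fun setT g. Proof. exact: measurable_gsm. Qed.
Let mG : measurable_fun setT Gm. Proof. exact: measurable_ggrad. Qed.

Definition jump c d (p : 'rV[R]_n * 'rV[R]_n) : R :=
  gaus s p.1 * gaus s p.2 * (g (rot c d p).1 - g p.1) ^+ 2.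

Lemma jump_ge0 c d p : 0 <= jump c d p.
Proof. by rewrite /jump mulr_ge0 ?sqr_ge0// mulr_ge0 ?gaus_ge0. Qed.

Lemma measurable_jump c d : measurable_fun setT (jump c d).
Proof.
apply: m_mul.
  by apply: m_mul; (apply: m_comp; [exact: measurable_gaus|mes]).
apply: m_exp; apply: m_add.
  by apply: m_comp mg _; apply: (m_comp measurable_fst); exact: measurable_rot.
by apply: m_opp; apply: m_comp mg _; mes.
Qed.

Definition far (p : 'rV[R]_n * 'rV[R]_n) : R := gaus s p.1 * gaus s p.2 * (g p.2 - g p.1) ^+ 2.

(* Rotating (x, y) into (y, -x) in J equal steps. *)
Lemma far_le (J : nat) : (0 < J)%N ->
  (\int[lam2]_p (far p)%:E <=
   (J%:R ^+ 2)%:E * \int[lam2]_p (jump (cos (pi / (2 * J%:R))) (sin (pi / (2 * J%:R))) p)%:E)%E.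
Proof.
move=> J0; have JR : 0 < J%:R :> R by rewrite ltr0n.
set th := pi / (2 * J%:R).
have th0 : 0 < th by rewrite divr_gt0 ?pi_gt0// mulr_gt0.
pose X (j : nat) (p : 'rV[R]_n * 'rV[R]_n) := (rot (cos (th *+ j)) (sin (th *+ j)) p).1.
pose D (j : nat) p := gaus s p.1 * gaus s p.2 * (g (X j.+1 p) - g (X j p)) ^+ 2.
have D0 j p : 0 <= D j p by rewrite /D mulr_ge0 ?sqr_ge0// mulr_ge0 ?gaus_ge0.
have mX j : measurable_fun setT (X j) by apply: (m_comp measurable_fst); exact: measurable_rot.
have mD j : measurable_fun setT (D j).
  apply: m_mul.
    by apply: m_mul; (apply: m_comp; [exact: measurable_gaus|mes]).
  by apply: m_exp; apply: m_add; [apply: m_comp mg _; exact: mX|apply: m_opp; apply: m_comp mg _; exact: mX].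
(* By rotation invariance every increment has the law of the first one. For [j < J] the angle stays
   below pi/2, so its cosine has the sign required by [int2_rot]. *)
have E j : (j < J)%N -> (\int[lam2]_p (D j p)%:E = \int[lam2]_p (jump (cos th) (sin th) p)%:E)%E.
  move=> jJ; have cs : cos (th *+ j) ^+ 2 + sin (th *+ j) ^+ 2 = 1 by exact: cos2Dsin2.
  have cj : 0 <= cos (th *+ j).
    apply/ltW/cos_gt0_pihalf; apply/andP; split.
      by rewrite (@lt_le_trans _ _ 0) ?oppr_lt0 ?divr_gt0 ?pi_gt0// mulrn_wge0// ltW.
    rewrite -mulr_natr /th (_ : _ * _ = pi / 2 * (j%:R / J%:R)); last by field; rewrite gt_eqF.
    by rewrite gtr_pMr ?divr_gt0 ?pi_gt0// ltr_pdivrMr// mul1r ltr_nat.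
  apply: (etrans _ (int2_rot cs cj (measurable_jump (cos th) (sin th)) (@jump_ge0 (cos th) (sin th)))).
  have DE p : D j p = jump (cos th) (sin th) (rot (cos (th *+ j)) (sin (th *+ j)) p).
    rewrite /D /jump (gaus_rot p s0 cs) rot_comp /X.
    rewrite (_ : cos (th *+ j.+1) = cos th * cos (th *+ j) - sin th * sin (th *+ j)); last by rewrite mulrS cosD.
    by rewrite (_ : sin (th *+ j.+1) = sin th * cos (th *+ j) + cos th * sin (th *+ j)); last by rewrite mulrS sinD.
  exact: eq_int.
have P p : far p <= J%:R * \sum_(j < J) D j p.
  rewrite (_ : \sum_(j < J) D j p = gaus s p.1 * gaus s p.2 * \sum_(j < J) (g (X j.+1 p) - g (X j p)) ^+ 2); last by rewrite mulr_sumr.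
  rewrite /far [leRHS]mulrCA; apply: ler_wpM2l; first by rewrite mulr_ge0 ?gaus_ge0.
  have XJ : X J p = p.2.
    rewrite /X /rot /= -mulr_natr (_ : th * J%:R = pi / 2); last by rewrite /th; field; rewrite gt_eqF.
    by rewrite cos_pihalf sin_pihalf scale0r scale1r add0r.
  have X0 : X 0 p = p.1 by rewrite /X /rot /= mulr0n cos0 sin0 scale0r scale1r addr0.
  by have := sum_sqr_tele J (fun j => g (X j p)); rewrite /= XJ X0.
have S := ge0_int_sum_const mD D0 E.
apply: le_trans (ge0_int_le lam2 _ _ _ P) _.
- apply: m_mul.
    by apply: m_mul; (apply: m_comp; [exact: measurable_gaus|mes]).
  by apply: m_exp; apply: m_add; [apply: m_comp mg _; mes|apply: m_opp; apply: m_comp mg _; mes].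
- by apply: m_mul; [exact: measurable_cst|apply: measurable_sum => j; exact: mD].
- by move=> p; rewrite /far mulr_ge0 ?sqr_ge0// mulr_ge0 ?gaus_ge0.
rewrite ge0_intZl; first last.
- exact: ltW.
- by move=> p; apply: sumr_ge0 => j _; exact: D0.
- by apply: measurable_sum => j; exact: mD.
by rewrite S muleA -EFinM -expr2.
Qed.

Let Gb := ggrad_max t B.
Let C := @gsm_C R n t B.
Let E2 : R := \int[lam]_x (gaus s x * expR (2 * enorm x)).
(** The constants are 3 * 4 and 3 * 256: the factor 3 splits a square of three terms in
    [jump_le]. *)
Let M : R := 12 * Gb ^+ 2 + 768 * C ^+ 2.

Let M0 : 0 <= M.
Proof. exact: (addr_ge0 (mulr_ge0 (ler0n R 12) (sqr_ge0 Gb)) (mulr_ge0 (ler0n R 768) (sqr_ge0 C))). Qed.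

Lemma sqn_le_exp x : sqn x <= 4 * expR (enorm x).
Proof. by rewrite -enormK; apply: sqr_le_expR; exact: enorm_ge0. Qed.

(** A rotation by a small angle moves x by th y up to order th^2. The leading term of the squared
    increment is th^2 (y . grad g(x))^2; the rest is of order th^4, with exponential weights that
    the Gaussian integrates. *)
Lemma jump_le (th : R) p : 0 <= th <= 1 -> jump (cos th) (sin th) p <=
  3 * th ^+ 2 * (gaus s p.1 * gaus s p.2 * dotp p.2 (Gm p.1) ^+ 2) +
  th ^+ 4 * M * ((gaus s p.1 * expR (2 * enorm p.1)) * (gaus s p.2 * expR (2 * enorm p.2))).
Proof.
case: p => x y th01 /=; have [Hs Hc] := sin_cos_small th01.
have {th01}[th0 th1] := andP th01.
rewrite /jump /rot /=; set c := cos th in Hc *; set d := sin th in Hs *.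
have -> : c *: x + d *: y = x + ((c - 1) *: x + d *: y) by apply/rowP => i; rewrite !mxE; ring.
set v := (c - 1) *: x + d *: y.
have T := gsm_taylor n0 t0 mf f0 fB x v; rewrite -/C in T.
have Dv : dotp (Gm x) v = (c - 1) * dotp x (Gm x) + d * dotp y (Gm x).
  by rewrite /v dotpDr !dotpZr !(dotpC (Gm x)).
have Hb : dotp x (Gm x) ^+ 2 <= 4 * expR (enorm x) * Gb ^+ 2.
  apply: (le_trans (dotp_sqr_le _ _)); apply: ler_pM; rewrite ?sqn_ge0//; first exact: sqn_le_exp.
  rewrite -enormK; apply: lerXn2r; rewrite ?nnegrE ?enorm_ge0//; first exact: sqrtr_ge0.
  exact: (ggrad_bounded n0 t0 mf f0 fB x).
have d2 : d ^+ 2 <= th ^+ 2 by rewrite -[d ^+ 2]real_normK ?num_real//; apply: lerXn2r; rewrite ?nnegrE.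
have c2 : (c - 1) ^+ 2 <= th ^+ 4.
  rewrite -[leLHS]real_normK ?num_real// (_ : th ^+ 4 = (th ^+ 2) ^+ 2); last by ring.
  by apply: lerXn2r; rewrite ?nnegrE// sqr_ge0.
have th42 : th ^+ 4 <= th ^+ 2.
  rewrite (_ : th ^+ 4 = th ^+ 2 * th ^+ 2); last by ring.
  by rewrite ler_piMr ?sqr_ge0// expr_le1.
have ex1 : 1 <= expR (enorm x) by rewrite -expR0 ler_expR enorm_ge0.
have ey1 : 1 <= expR (enorm y) by rewrite -expR0 ler_expR enorm_ge0.
have Sv : sqn v <= 16 * th ^+ 2 * (expR (enorm x) * expR (enorm y)).
  have : sqn v <= 2 * ((c - 1) ^+ 2 * sqn x + d ^+ 2 * sqn y).
    have := sqn_ge0 ((c - 1) *: x - d *: y).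
    by rewrite /v !sqnD sqnN !sqnZ !dotpE; lra.
  move=> H; apply: (le_trans H).
  have A1 : (c - 1) ^+ 2 * sqn x <= th ^+ 2 * (4 * (expR (enorm x) * expR (enorm y))).
    apply: ler_pM; rewrite ?sqr_ge0 ?sqn_ge0//; first exact: le_trans c2 th42.
    apply: (le_trans (sqn_le_exp x)); rewrite ler_pM2l// ler_peMr// expR_ge0//.
  have A2 : d ^+ 2 * sqn y <= th ^+ 2 * (4 * (expR (enorm x) * expR (enorm y))).
    apply: ler_pM; rewrite ?sqr_ge0 ?sqn_ge0//.
    apply: (le_trans (sqn_le_exp y)); rewrite ler_pM2l// ler_peMl// expR_ge0//.
  by move: A1 A2; lra.
have C0 : 0 <= C by exact: gsm_C_ge0.
have Hr : (g (x + v) - g x - dotp (Gm x) v) ^+ 2 <= 256 * C ^+ 2 * th ^+ 4 * (expR (2 * enorm x) * expR (2 * enorm y)).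
  rewrite -[leLHS]real_normK ?num_real//.
  apply: (@le_trans _ _ ((C * (16 * th ^+ 2 * (expR (enorm x) * expR (enorm y)))) ^+ 2)).
    apply: lerXn2r; rewrite ?nnegrE//.
      by rewrite !mulr_ge0 ?expR_ge0 ?sqr_ge0.
    by apply: (le_trans T); rewrite ler_wpM2l.
  by rewrite (mulrC 2 (enorm x)) (mulrC 2 (enorm y)) !expRM_natr -subr_ge0 le_eqVlt; apply/orP; left; apply/eqP; ring.
have gg0 : 0 <= gaus s x * gaus s y by rewrite mulr_ge0 ?gaus_ge0.
have -> : th ^+ 4 * M * (gaus s x * expR (2 * enorm x) * (gaus s y * expR (2 * enorm y))) =
  gaus s x * gaus s y * (th ^+ 4 * M * (expR (2 * enorm x) * expR (2 * enorm y))) by ring.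
rewrite [3 * th ^+ 2 * _]mulrCA -mulrDr ler_wpM2l// {gg0}.
have e2 : expR (enorm x) <= expR (2 * enorm x) * expR (2 * enorm y).
  by rewrite -expRD ler_expR; apply: le_trans (_ : 2 * enorm x <= _); rewrite ?lerDl ?ler_peMl ?mulr_ge0 ?enorm_ge0 ?ler1n.
have B1 : (c - 1) ^+ 2 * dotp x (Gm x) ^+ 2 <= th ^+ 4 * (4 * Gb ^+ 2 * (expR (2 * enorm x) * expR (2 * enorm y))).
  apply: ler_pM; rewrite ?sqr_ge0//; apply: (le_trans Hb).
  by rewrite mulrAC ler_wpM2l// mulr_ge0// sqr_ge0.
have B2 : d ^+ 2 * dotp y (Gm x) ^+ 2 <= th ^+ 2 * dotp y (Gm x) ^+ 2 by rewrite ler_wpM2r ?sqr_ge0.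
move: Hr B1 B2; rewrite Dv /M.
set P := dotp x (Gm x); set Q := dotp y (Gm x).
set W := g (x + v) - g x; set e := expR _ * expR _.
have Q3 (u1 u2 u3 : R) : (u1 + u2 + u3) ^+ 2 <= 3 * (u1 ^+ 2 + u2 ^+ 2 + u3 ^+ 2).
  by have := sqr_ge0 (u1 - u2); have := sqr_ge0 (u1 - u3); have := sqr_ge0 (u2 - u3); lra.
have := Q3 ((c - 1) * P) (d * Q) (W - ((c - 1) * P + d * Q)).
rewrite !exprMn (_ : _ + _ + _ = W); last by ring.
move=> H1 H2 H3 H4; apply: (le_trans H1); lra.
Qed.

Lemma itg_gauss_exp : itg lam (fun x => gaus s x * expR (2 * enorm x)).
Proof. by have := itg_gaus_exp n0 s0 2 0; rewrite (_ : (fun x => _) = (fun x => gaus s x * expR (2 * enorm x)))//; apply/funext => x; rewrite subr0. Qed.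

Let g0 x : 0 <= g x. Proof. exact: gsm_ge0. Qed.
Let gB x : g x <= B. Proof. exact: gsm_le. Qed.
Let gNB x : `|g x| <= B. Proof. by rewrite ger0_norm. Qed.
Let mgs : measurable_fun setT (@gaus R n s). Proof. exact: measurable_gaus. Qed.

Lemma itg_gaus_ggrad : itg lam (fun x => gaus s x * sqn (Gm x)).
Proof.
apply: (@itg_weight _ _ _ lam (@gaus R n s) (@itg_gaus R n s s0) (fun x => gaus_ge0 s x) (fun x => sqn (Gm x)) (Gb ^+ 2)).
  by mes.
move=> x; rewrite ger0_norm ?sqn_ge0// -enormK; apply: lerXn2r; rewrite ?nnegrE ?enorm_ge0//; first exact: sqrtr_ge0.
exact: (ggrad_bounded n0 t0 mf f0 fB x).
Qed.

(** For fixed x, the second moment of g about g(x) is at least its variance. The exact identity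
    would give twice the variance. *)
Lemma far_ge : ((\int[lam]_x (gaus s x * (g x - \int[lam]_y (gaus s y * g y)) ^+ 2))%:E <= \int[lam2]_p (far p)%:E)%E.
Proof.
set Va := \int[lam]_x _.
have mfar : measurable_fun setT far.
  apply: m_mul; first by apply: m_mul; (apply: m_comp; [exact: measurable_gaus|mes]).
  by apply: m_exp; apply: m_add; [apply: m_comp mg _; mes|apply: m_opp; apply: m_comp mg _; mes].
have far0 p : 0 <= far p by rewrite /far mulr_ge0 ?sqr_ge0// mulr_ge0 ?gaus_ge0.
rewrite int2E//.
have Va0 : 0 <= Va by apply: Rint_ge0 => x; rewrite mulr_ge0 ?gaus_ge0 ?sqr_ge0.
have -> : (Va%:E = \int[lam]_x (Va * gaus s x)%:E)%E.
  rewrite (ge0_intZl lam mgs (fun x => gaus_ge0 s x) Va0).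
  by rewrite integral_gaus// mule1.
apply: ge0_le_integral => //.
- by move=> x _; rewrite lee_fin mulr_ge0// gaus_ge0.
- by apply: m_EFin; apply: m_mul; [exact: measurable_cst|exact: mgs].
- exact: (m_eint mfar far0).
move=> x _; rewrite /far /=.
rewrite (eq_integral (fun y => (gaus s x * (gaus s y * (g y - g x) ^+ 2))%:E)); last by move=> y _; rewrite mulrA.
have mq : measurable_fun setT (fun y => gaus s y * (g y - g x) ^+ 2).
  by apply: m_mul mgs _; apply: m_exp; apply: m_add; [exact: mg|mes].
have q0 y : 0 <= gaus s y * (g y - g x) ^+ 2 by rewrite mulr_ge0 ?gaus_ge0 ?sqr_ge0.
rewrite (ge0_intZl lam mq q0 (gaus_ge0 s x)).
rewrite mulrC EFinM lee_wpmul2l ?lee_fin ?gaus_ge0//.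
rewrite -itgK.
  rewrite lee_fin.
  exact: (@weighted_var_min1 _ _ _ lam (@gaus R n s) g B (g x) (@itg_gaus R n s s0) (fun x => gaus_ge0 s x) (@Rint_gaus R n s s0) mg gNB).
apply: (@itg_weight _ _ _ lam (@gaus R n s) (@itg_gaus R n s s0) (fun x => gaus_ge0 s x) (fun y => (g y - g x) ^+ 2) (B ^+ 2)).
  by apply: m_exp; apply: m_add; [exact: mg|mes].
move=> y; rewrite ger0_norm ?sqr_ge0// -real_normK ?num_real//; apply: lerXn2r; rewrite ?nnegrE//.
  exact: le_trans (gNB x).
exact: norm_sub_le (g0 _) (gB _) (g0 _) (gB _).
Qed.

(** With J steps of angle th, J th = pi/2 < 2: the leading term is J^2 * 3 th^2 * 6 s <= 72 s times
    the Dirichlet integral, and the remainder is of order 1/J. The sharp constant would be 2 s. *)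
Lemma gaussian_poincare :
  \int[lam]_x (gaus s x * (g x - \int[lam]_y (gaus s y * g y)) ^+ 2) <=
  72 * s * \int[lam]_x (gaus s x * sqn (Gm x)).
Proof.
set Va := \int[lam]_x _; set D := \int[lam]_x (gaus s x * sqn _).
have E20 : 0 <= E2 by apply: Rint_ge0 => x; rewrite mulr_ge0 ?gaus_ge0 ?expR_ge0.
have mA : measurable_fun setT (fun p : 'rV[R]_n * 'rV[R]_n => gaus s p.1 * gaus s p.2 * dotp p.2 (Gm p.1) ^+ 2).
  apply: m_mul; first by apply: m_mul; (apply: m_comp; [exact: measurable_gaus|mes]).
  by apply: m_exp; apply: measurable_dotp; [mes|apply: m_comp mG _; mes].
have A0 (p : 'rV[R]_n * 'rV[R]_n) : 0 <= gaus s p.1 * gaus s p.2 * dotp p.2 (Gm p.1) ^+ 2.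
  by rewrite mulr_ge0 ?sqr_ge0// mulr_ge0 ?gaus_ge0.
have IA : (\int[lam2]_p (gaus s p.1 * gaus s p.2 * dotp p.2 (Gm p.1) ^+ 2)%:E <= (6 * s * D)%:E)%E.
  rewrite int2E//=.
  have s6 : 0 <= 6 * s by rewrite mulr_ge0// ltW.
  rewrite EFinM /D (itgK itg_gaus_ggrad) -(ge0_intZl lam (itg_meas itg_gaus_ggrad) _ s6); last first.
    by move=> x; rewrite mulr_ge0 ?gaus_ge0 ?sqn_ge0.
  apply: ge0_le_integral => //.
  - by move=> x _; apply: integral_ge0 => y _; rewrite lee_fin; exact: (A0 (x, y)).
  - exact: (m_eint mA A0).
  - by apply: m_EFin; apply: m_mul; [exact: measurable_cst|exact: (itg_meas itg_gaus_ggrad)].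
  move=> x _.
  rewrite (eq_integral (fun y => (gaus s x * (gaus s y * dotp y (Gm x) ^+ 2))%:E)); last by move=> y _; rewrite mulrA.
  have mq : measurable_fun setT (fun y => gaus s y * dotp y (Gm x) ^+ 2).
    by apply: m_mul mgs _; mes.
  have q0 y : 0 <= gaus s y * dotp y (Gm x) ^+ 2 by rewrite mulr_ge0 ?gaus_ge0 ?sqr_ge0.
  rewrite (ge0_intZl lam mq q0 (gaus_ge0 s x)) mulrCA EFinM.
  rewrite lee_wpmul2l ?lee_fin ?gaus_ge0// -itgK; first by rewrite lee_fin; exact: gaus_moment2.
  apply: (@itg_dom _ _ _ _ (fun y => 4 * sqn (Gm x) * (gaus s y * expR (2 * enorm y)))) => //.
    exact/itgZ/itg_gauss_exp.
  move=> y; rewrite (ger0_norm (q0 y)) [leRHS]mulrCA; apply: ler_wpM2l; first exact: gaus_ge0.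
  apply: (le_trans (dotp_sqr_le _ _)); rewrite mulrC [leRHS]mulrAC [leRHS]mulrC ler_wpM2l ?sqn_ge0//.
  apply: (le_trans (sqn_le_exp y)); rewrite ler_pM2l// ler_expR; have := enorm_ge0 y; lra.
pose q2 (x : 'rV[R]_n) := gaus s x * expR (2 * enorm x).
have mq2 : measurable_fun setT q2 := itg_meas itg_gauss_exp.
have q20 x : 0 <= q2 x by rewrite mulr_ge0 ?gaus_ge0 ?expR_ge0.
have mQ : measurable_fun setT (fun p : 'rV[R]_n * 'rV[R]_n => q2 p.1 * q2 p.2).
  by apply: m_mul; apply: m_comp mq2 _; mes.
have Q0 (p : 'rV[R]_n * 'rV[R]_n) : 0 <= q2 p.1 * q2 p.2 by rewrite mulr_ge0.
have IQ : (\int[lam2]_p (q2 p.1 * q2 p.2)%:E = (E2 ^+ 2)%:E)%E.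
  have E2E : (E2%:E = \int[lam]_x (q2 x)%:E)%E := itgK itg_gauss_exp.
  rewrite int2E//= expr2 EFinM [X in (_ = _ * X)%E]E2E -(ge0_intZl lam mq2 q20 E20).
  by apply: eq_integral => x _; rewrite (ge0_intZl lam mq2 q20 (q20 x)) -E2E -EFinM mulrC.
have main (J : nat) : (1 < J)%N -> Va <= 72 * s * D + 16 * M * E2 ^+ 2 / J%:R.
  move=> J1; have J0 : (0 < J)%N by exact: ltnW.
  have JR : 2 <= J%:R :> R by rewrite ler_nat.
  have JR0 : 0 < J%:R :> R by rewrite ltr0n.
  set th : R := pi / (2 * J%:R).
  have Jth : J%:R * th = pi / 2 by rewrite /th; field; rewrite gt_eqF.
  have pi2 : pi / 2 < 2 :> R := pihalf_lt2 R.
  have th0 : 0 <= th by rewrite divr_ge0 ?pi_ge0// mulr_ge0.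
  have th1 : th <= 1 by have := Jth; have := pi2; nra.
  have th01 : 0 <= th <= 1 by rewrite th0 th1.
  have H := far_ge; rewrite -/Va in H.
  have {}H := le_trans H (far_le J0).
  have c1 : 0 <= 3 * th ^+ 2 by rewrite mulr_ge0 ?sqr_ge0.
  have c2 : 0 <= th ^+ 4 * M by rewrite mulr_ge0// exprn_ge0.
  have H2 := ge0_int_le lam2 (measurable_jump (cos th) (sin th)) _ (jump_ge0 _ _) (fun p => jump_le p th01).
  have {}H2 : (\int[lam2]_p (jump (cos th) (sin th) p)%:E <= (3 * th ^+ 2 * (6 * s * D) + th ^+ 4 * M * E2 ^+ 2)%:E)%E.
    have mA' := m_mul (measurable_cst (3 * th ^+ 2)) mA.
    have mQ' := m_mul (measurable_cst (th ^+ 4 * M)) mQ.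
    apply: (le_trans (H2 (m_add mA' mQ'))).
    rewrite (ge0_intD lam2 mA' mQ' (fun p => mulr_ge0 c1 (A0 p)) (fun p => mulr_ge0 c2 (Q0 p))).
    rewrite (ge0_intZl lam2 mA A0 c1) (ge0_intZl lam2 mQ Q0 c2) IQ EFinD leeD//.
      by rewrite [leRHS]EFinM lee_wpmul2l// lee_fin.
  have J2 : (0 <= (J%:R ^+ 2)%:E :> \bar R)%E by rewrite lee_fin sqr_ge0.
  have {}H := le_trans H (lee_wpmul2l J2 H2).
  rewrite -EFinM lee_fin in H; apply: (le_trans H).
  have D0 : 0 <= D by apply: Rint_ge0 => x; rewrite mulr_ge0 ?gaus_ge0 ?sqn_ge0.
  have Jt0 : 0 <= J%:R * th by rewrite mulr_ge0// ltW.
  have sq4 : (J%:R * th) ^+ 2 <= 4.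
    rewrite (_ : 4 = 2 ^+ 2); last by ring.
    by apply: lerXn2r; rewrite ?nnegrE// Jth ltW.
  rewrite mulrDr; apply: lerD.
    rewrite [leLHS](_ : _ = (J%:R * th) ^+ 2 * (18 * (s * D))); last by ring.
    rewrite (_ : 72 * s * D = 4 * (18 * (s * D))); last by ring.
    by apply: ler_wpM2r => //; rewrite !mulr_ge0// ltW.
  rewrite ler_pdivlMr//.
  rewrite [leLHS](_ : _ = ((J%:R * th) ^+ 2 * (J%:R * th * th)) * (M * E2 ^+ 2)); last by ring.
  rewrite -[leRHS]mulrA; apply: ler_wpM2r; first by rewrite mulr_ge0// sqr_ge0.
  have : J%:R * th * th <= 2 * 1 by apply: ler_pM => //; rewrite Jth ltW.
  move=> H3; rewrite (_ : 16 = 4 * 4); last by ring.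
  by apply: ler_pM => //; [exact: sqr_ge0|rewrite mulr_ge0|lra].
apply/ler_addgt0Pr => e e0.
have [J HJ] : exists J : nat, 16 * M * E2 ^+ 2 / e < J%:R.
  by exists (Num.truncn (16 * M * E2 ^+ 2 / e)).+1; exact: truncnS_gt.
have J2 : (1 < J.+2)%N by [].
apply: (le_trans (main _ J2)); rewrite lerD2l ler_pdivrMr ?ltr0n//.
rewrite -ler_pdivrMl// mulrC; apply: ltW; apply: (lt_le_trans HJ); rewrite ler_nat.
by rewrite -addn2 leq_addr.
Qed.

End gaussian_poincare.

(** * The Lyapunov inequality *)

Section integrability.
Context {R : realType} {n : nat}.
Variables (a : R) (a0 : 0 < a) (a1 : a < 1).
Local Notation lam := (@lebesgue_rV R n).
Local Notation V := (V_alpha n a).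
Local Notation eV := (@eV R n a).
Implicit Types (x y : 'rV[R]_n).

Lemma V_le_pp x : V x <= pp x.
Proof.
rewrite V_alphaE -[leRHS]powRr1; last exact/ltW/pp_gt0.
by apply: ler_powR; [exact: pp_ge1|have := a1; lra].
Qed.

Lemma V_ge1 x : 1 <= V x.
Proof.
rewrite V_alphaE -[leLHS](powRr0 (pp x)); apply: ler_powR; first exact: pp_ge1.
by rewrite divr_ge0// ltW.
Qed.

Lemma int_cauchy : (\int[@lebesgue_measure R]_z ((1 + z ^+ 2)^-1)%:E <= pi%:E)%E.
Proof.
have := @ge0_symfun_integralT R (fun z : R => (oneDsqr z)^-1).
rewrite (_ : [set x | 0 <= x] = `[0%R, +oo[%classic); last by rewrite set_itvcy.
rewrite integral0y_oneDsqr => -> //.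
- by rewrite -EFinM lee_fin mulrC divfK.
- exact: continuous_oneDsqrV.
- by move=> x; rewrite /= /oneDsqr sqrrN.
Qed.

Lemma prod_le_pp x : \prod_(i < n) (1 + x ord0 i ^+ 2) <= pp x ^+ n.
Proof.
have -> : pp x ^+ n = \prod_(i < n) pp x by rewrite prodr_const card_ord.
apply: ler_prod => i _.
rewrite addr_ge0 ?sqr_ge0//= lerD2l -enormK -[leLHS]real_normK ?num_real//.
by apply: lerXn2r; rewrite ?nnegrE ?enorm_ge0//; exact: coor_le_enorm.
Qed.

Lemma pow_le_exp (k v : R) m : 0 < k -> 0 <= v -> (0 < m)%N -> v ^+ m <= (m%:R / k) ^+ m * expR (k * v).
Proof.
move=> k0 v0 m0; have mR : 0 < m%:R :> R by rewrite ltr0n.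
have -> : k * v = (k * v / m%:R) * m%:R by rewrite divfK// gt_eqF.
rewrite expRM_natr -exprMn; apply: lerXn2r; rewrite ?nnegrE ?mulr_ge0 ?expR_ge0 ?divr_ge0 ?invr_ge0//; try exact: ltW.
apply: (@le_trans _ _ (m%:R / k * (k * v / m%:R))); first by rewrite le_eqVlt; apply/orP; left; apply/eqP; field; rewrite !gt_eqF.
rewrite ler_wpM2l ?divr_ge0 ?invr_ge0//; try exact: ltW.
by apply: (le_trans _ (expR_ge1Dx _)); rewrite lerDr.
Qed.

Lemma pp_pow_exp (k : R) (m : nat) : 0 < k -> exists C, 0 <= C /\ forall x, pp x ^+ m <= C * expR (k * V x).
Proof.
(* The power [pp ^+ m] equals V^(2m/a), and [M] is an integer at least 2m/a. *)
move=> k0; pose M := (Num.truncn (m%:R / (a / 2))).+1.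
have HM : m%:R / (a / 2) <= M%:R by apply: ltW; exact: truncnS_gt.
exists ((M%:R / k) ^+ M); split; first by rewrite exprn_ge0// divr_ge0// ltW.
move=> x; apply: (le_trans _ (pow_le_exp k0 (le_trans ler01 (V_ge1 x)) _)) => //.
rewrite V_alphaE -!powR_mulrn ?powR_ge0//; last exact/ltW/pp_gt0.
rewrite -powRrM; apply: ler_powR; first exact: pp_ge1.
by rewrite mulrC -ler_pdivrMr// divr_gt0.
Qed.

(** Compare with a product of Cauchy densities: the product of the 1 + x_i^2 is at most [pp ^+ n],
    and exp(-kV) beats every power of [pp]. *)
Lemma itg_pp_exp (k : R) (m : nat) : 0 < k -> itg lam (fun x => pp x ^+ m * expR (- (k * V x))).
Proof.
move=> k0; have [C [C0 HC]] := pp_pow_exp (m + n) k0.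
have P x : pp x ^+ m * expR (- (k * V x)) <= C * \prod_(i < n) (1 + x ord0 i ^+ 2)^-1.
  rewrite expRN ler_pdivrMr ?expR_gt0// -mulrA mulrCA prodfV mulrC ler_pdivlMr; last first.
    by apply: prodr_gt0 => i _; rewrite ltr_pwDl ?sqr_ge0.
  rewrite mulrC; apply: le_trans (HC x).
  rewrite exprD mulrC ler_wpM2l//; last exact: prod_le_pp.
  by rewrite exprn_ge0//; exact/ltW/pp_gt0.
have mf : measurable_fun setT (fun x : 'rV[R]_n => pp x ^+ m * expR (- (k * V x))).
  apply: m_mul; first by apply: m_exp; apply: measurable_pp; mes.
  by mes; apply: measurable_Vf; mes.
have mq : measurable_fun setT (fun x : R => (1 + x ^+ 2)^-1).
  exact: continuous_measurable_fun (@continuous_oneDsqrV R).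
have q0 (x : R) : 0 <= (1 + x ^+ 2)^-1 by rewrite invr_ge0 addr_ge0 ?sqr_ge0.
apply: (@itg_dom _ _ _ _ (fun x => C * \prod_(i < n) (1 + x ord0 i ^+ 2)^-1)) => //; last first.
  by move=> x; rewrite ger0_norm// mulr_ge0 ?expR_ge0// exprn_ge0//; exact/ltW/pp_gt0.
apply: itgZ; apply: (@itg_le _ _ _ _ _ (pi ^+ n)).
- apply: (@measurable_prod _ _ _ _ _ _ _) => i _.
  by apply: (m_comp mq); exact: measurable_coor.
- by move=> x; apply: prodr_ge0.
rewrite (ge0_integral_rV_prod (f := fun _ (z : R) => (1 + z ^+ 2)^-1))//.
rewrite -[in leRHS](card_ord n) -prodr_const -prodEFin.
suff /andP[] : (0 <= \prod_(i < n) \int[@lebesgue_measure R]_z ((1 + z ^+ 2)^-1)%:E <= \prod_(i in 'I_n) (@pi R)%:E)%E by [].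
apply: (big_ind2 (fun u v : \bar R => (0 <= u <= v)%E)) => [|u1 v1 u2 v2 /andP[p1 q1] /andP[p2 q2]|i _].
- by rewrite lee_fin ler01 lexx.
- by rewrite mule_ge0//= lee_pmul.
- by rewrite int_cauchy andbT integral_ge0// => z _; rewrite lee_fin.
Qed.

Lemma itg_pp_eV m : itg lam (fun x => pp x ^+ m * eV x).
Proof.
have := itg_pp_exp m ltr01; rewrite (_ : (fun x => _) = (fun x => pp x ^+ m * eV x))//.
by apply/funext => x; rewrite mul1r.
Qed.

End integrability.

Lemma Rint_cancel d (T : measurableType d) (R : realType) (mu : {measure set T -> \bar R}) (Q q Q' q' : T -> R) (c : R) :
  itg mu Q -> itg mu q -> itg mu Q' -> itg mu q' ->
  \int[mu]_x (c * (Q' x + q' x)) = \int[mu]_x (Q x + q x) ->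
  \int[mu]_x (c * q' x) = \int[mu]_x q x -> \int[mu]_x (c * Q' x) = \int[mu]_x Q x.
Proof.
move=> iQ iq iQ' iq'; rewrite RintD// !RintZ//; last exact: itgD.
by rewrite RintD// mulrDr => + E2; rewrite E2 => /addIr.
Qed.

Lemma is_derive_quad {R : realType} (f : R -> R) (l d C : R) :
  (forall e, `|f (l + e) - f l - e * d| <= C * e ^+ 2) -> is_derive l 1 f d.
Proof.
move=> H; have C0 : 0 <= C by have := H 1; rewrite expr1n mulr1; exact: le_trans.
have L : (fun e => e^-1 *: (f (e *: 1 + l) - f l)) @ 0^' --> d.
  apply/cvgrPdist_le => e e0; near=> z.
  have z0 : z != 0 by near: z; exact: nbhs_dnbhs_neq.
  rewrite -[d](mulKf z0) -[_ *: _]/(_ * _) -mulrBr normrM normfV.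
  rewrite ler_pdivrMl ?normr_gt0// distrC [z *: 1]mulr1 (addrC z).
  apply: (le_trans (H z)); rewrite -real_normK ?num_real// expr2 mulrCA ler_wpM2l//.
  have zl : `|z| <= e / (C + 1) by near: z; apply: dnbhs0_le; rewrite divr_gt0// ltr_wpDl.
  apply: (@le_trans _ _ ((C + 1) * `|z|)); first by rewrite ler_wpM2r// lerDl.
  by rewrite mulrC -ler_pdivlMr// ltr_wpDl.
apply: DeriveDef; first by apply/cvg_ex; exists d.
exact/cvg_lim.
Unshelve. all: by end_near.
Qed.

Lemma derive1_const_pos {R : realType} (phi : R -> R) (c : R) :
  (forall l, 0 < l -> phi l = c) -> (phi^`())%classic 1 = 0.
Proof.
move=> H; rewrite derive1E; apply/cvg_lim => //.
apply: (@cvg_trans _ ((fun=> 0 : R) @ (0 : R)^')); last exact: cvg_cst.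
apply: near_eq_cvg; near=> h.
have h1 : `|h| <= 4^-1 by near: h; apply: dnbhs0_le.
have h0 : 0 < h + 1 by move: h1; rewrite ler_norml => /andP[? ?]; lra.
by rewrite /= -[h%:A]/(h * 1) mulr1 !H// subrr scaler0.
Unshelve. all: by end_near.
Qed.

Section lyapunov.
Context {R : realType} {n : nat}.
Variables (a : R) (a0 : 0 < a) (a1 : a < 1) (n0 : (0 < n)%N).
Local Notation lam := (@lebesgue_rV R n).
Local Notation V := (V_alpha n a).
Local Notation eV := (@eV R n a).
Implicit Types (x y : 'rV[R]_n).
Variables (t : R) (t0 : 0 < t) (f : 'rV[R]_n -> R) (B b : R).
Hypothesis (mf : measurable_fun setT f) (f0 : forall x, 0 <= f x) (fB : forall x, f x <= B).
Hypothesis (b0 : 0 <= b) (bB : b <= B).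
Local Notation g := (gsm t f).
Local Notation Gm := (ggrad t f).

(* [YV x] is the drift x . grad V(x), of mean [n] under pi; psi times x is the
   vector field of the Lyapunov argument. *)
Definition YV x : R := a * sqn x * V x / pp x.
Definition psi x : R := (YV x - n%:R) / (2 * pp x).
(** The radial derivative x . grad psi(x), as [drv_psi] shows. *)
Definition dpsi x : R :=
  (YV x * (1 - (1 - a / 2) * (sqn x / pp x)) - (YV x - n%:R) * (sqn x / pp x)) / pp x.
Definition Qd x : R := psi x * (g x - b) ^+ 2 * eV x.
(* The divergence of [x * Qd x]. *)
Definition Ed x : R :=
  (n%:R * psi x * (g x - b) ^+ 2 + dpsi x * (g x - b) ^+ 2 +
   2 * psi x * (g x - b) * dotp (Gm x) x - psi x * YV x * (g x - b) ^+ 2) * eV x.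

Lemma sqn_pp x : 0 <= sqn x / pp x <= 1.
Proof. by rewrite divr_ge0 ?sqn_ge0 ?(ltW (pp_gt0 x))//= ler_pdivrMr ?pp_gt0// mul1r lerDr. Qed.

Lemma YV_bounds x : 0 <= YV x <= V x.
Proof.
have [s0 s1] := andP (sqn_pp x); have V0 : 0 <= V x by apply: le_trans (V_ge1 a0 x).
have -> : YV x = V x * (a * (sqn x / pp x)) by rewrite /YV; ring.
have ha : 0 <= a * (sqn x / pp x) <= 1.
  by rewrite mulr_ge0// ?(ltW a0)//= mulr_ile1// ltW.
by have [h1 h2] := andP ha; rewrite mulr_ge0//= ler_piMr.
Qed.

Lemma YV_le_pp x : YV x <= pp x.
Proof. by have [_ h] := andP (YV_bounds x); exact: le_trans h (V_le_pp a1 x). Qed.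

Lemma psi_bound x : `|psi x| <= 1 + n%:R.
Proof.
have [y0 _] := andP (YV_bounds x); have y1 := YV_le_pp x; have p1 := pp_ge1 x.
have nR : 0 <= n%:R :> R by [].
rewrite /psi normrM normfV (gtr0_norm (_ : 0 < 2 * pp x)) ?mulr_gt0 ?pp_gt0//.
rewrite ler_pdivrMr ?mulr_gt0 ?pp_gt0//.
move: (n%:R) nR (pp x) p1 (YV x) y0 y1 => m m0 p p1 Y Y0 Y1.
rewrite ler_norml; apply/andP; split; nra.
Qed.

Lemma dpsi_bound x : `|dpsi x| <= 3 + n%:R.
Proof.
have [y0 _] := andP (YV_bounds x); have y1 := YV_le_pp x; have p1 := pp_ge1 x.
have nR : 0 <= n%:R :> R by [].
have [s0 s1] := andP (sqn_pp x); have ? := a0; have ? := a1.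
rewrite /dpsi normrM normfV (gtr0_norm (pp_gt0 x)) ler_pdivrMr ?pp_gt0//.
have hc : 0 <= (1 - a / 2) * (sqn x / pp x) <= 1.
  by apply/andP; split; [apply: mulr_ge0|apply: mulr_ile1]; lra.
have [c0 c1] := andP hc.
move: ((1 - a / 2) * (sqn x / pp x)) c0 c1 {hc} => q q0 q1.
move: (n%:R) nR (pp x) p1 (YV x) y0 y1 (sqn x / pp x) s0 s1 => m m0 p p1 Y Y0 Y1 s s0 s1.
have A1 : 0 <= Y * (1 - q) <= p by rewrite mulr_ge0 ?subr_ge0//= (le_trans _ Y1)// ler_piMr//; lra.
have A2 : - (m * p) - p <= (Y - m) * s <= p.
  apply/andP; split.
    apply: (@le_trans _ _ (- (m * s))); first by nra.
    by rewrite mulrBl lerBrDr addNr mulr_ge0.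
  by rewrite mulrBl (@le_trans _ _ (Y * s)) ?lerBlDr ?lerDl ?mulr_ge0//; nra.
have [? ?] := andP A1; have [? ?] := andP A2.
rewrite ler_norml; apply/andP; split; nra.
Qed.


Implicit Types (l r : R).

Let drvV (F : R -> R) l d : is_derive l 1 F d -> F l != 0 -> is_derive l 1 (fun r => (F r)^-1) (- (F l) ^- 2 * d).
Proof. by move=> dF Fl; exact: is_deriveV. Qed.

Lemma drv_sqn x l : 0 < l -> is_derive l 1 (fun r => sqn (r *: x)) (2 * sqn (l *: x) / l).
Proof.
move=> l0; rewrite (_ : (fun r => _) = (fun r => r ^+ 2 * sqn x)); last by apply/funext => r; rewrite sqnZ.
by eapply drv_eq; [drv|rewrite sqnZ; field; rewrite gt_eqF].
Qed.

Lemma drv_pp x l : 0 < l -> is_derive l 1 (fun r => pp (r *: x)) (2 * sqn (l *: x) / l).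
Proof. by move=> l0; eapply drv_eq; [apply: (drvD (drvc _ _) (drv_sqn x l0))|rewrite add0r]. Qed.

Lemma drv_V x l : 0 < l -> is_derive l 1 (fun r => V (r *: x)) (YV (l *: x) / l).
Proof.
move=> l0; rewrite (_ : (fun r => _) = (fun r => pp (r *: x) `^ (a / 2))); last by apply/funext => r; rewrite V_alphaE.
eapply drv_eq; [apply: (drvpow _ (drv_pp x l0)); exact: pp_gt0|].
rewrite /YV V_alphaE powRB ?powRr1 ?(ltW (pp_gt0 _))//; last first.
  by apply/implyP => _; rewrite gt_eqF ?pp_gt0.
by field; rewrite !gt_eqF// pp_gt0.
Qed.

Lemma drv_YV x l : 0 < l -> is_derive l 1 (fun r => YV (r *: x))
  (2 * YV (l *: x) * (1 - (1 - a / 2) * (sqn (l *: x) / pp (l *: x))) / l).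
Proof.
move=> l0; have P0 : pp (l *: x) != 0 by rewrite gt_eqF ?pp_gt0.
eapply drv_eq.
  apply: (drvM (drvM (drvM (drvc l a) (drv_sqn x l0)) (drv_V x l0)) (drvV (drv_pp x l0) P0)).
by rewrite /YV; field; rewrite P0 gt_eqF.
Qed.

Lemma drv_psi x l : 0 < l -> is_derive l 1 (fun r => psi (r *: x)) (dpsi (l *: x) / l).
Proof.
move=> l0; have P0 : pp (l *: x) != 0 by rewrite gt_eqF ?pp_gt0.
have P2 : 2 * pp (l *: x) != 0 by rewrite gt_eqF// mulr_gt0 ?pp_gt0.
eapply drv_eq.
  apply: (drvM (drvD (drv_YV x l0) (drvc l (- n%:R))) (drvV (drvM (drvc l 2) (drv_pp x l0)) P2)).
by rewrite /dpsi; field; rewrite P0 gt_eqF.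
Qed.

Lemma drv_gsm x l : is_derive l 1 (fun r => g (r *: x)) (dotp (Gm (l *: x)) x).
Proof.
have H e : `|(fun r => g (r *: x)) (l + e) - (fun r => g (r *: x)) l - e * dotp (Gm (l *: x)) x| <= (@gsm_C R n t B * sqn x) * e ^+ 2.
  have := gsm_taylor n0 t0 mf f0 fB (l *: x) (e *: x).
  by rewrite scalerDl dotpZr sqnZ -mulrA (mulrC (sqn x)).
exact: (is_derive_quad H).
Qed.

Lemma drv_Qd x l : 0 < l ->
  is_derive l 1 (fun r => r ^+ n * Qd (r *: x)) (l ^+ n.-1 * Ed (l *: x)).
Proof.
move=> l0; rewrite -{1}(prednK n0); eapply drv_eq.
  apply: (drvM (drvX n.-1 (drvid l)) (drvM (drvM (drv_psi x l0)
    (drvX 1 (drvD (drv_gsm x l) (drvc l (- b))))) (drvexp (drvN (drv_V x l0))))).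
have ln : l ^+ n = l * l ^+ n.-1 by rewrite -exprS prednK.
have eVl : eV (l *: x) = expR (- V (l *: x)) by [].
rewrite /Qd /Ed dotpZr (prednK n0) ln eVl.
set y := l *: x; set d := dotp _ _.
by field; rewrite gt_eqF.
Qed.


Definition Ed_max : R :=
  (n%:R * (1 + n%:R) + (3 + n%:R) + (1 + n%:R)) * B ^+ 2 + 2 * (1 + n%:R) * B * ggrad_max t B.

Lemma Ed_bound x : `|Ed x| <= Ed_max * (pp x ^+ 1 * eV x).
Proof.
have B0 : 0 <= B by exact: le_trans b0 bB.
have nR : 0 <= n%:R :> R by [].
have [y0 _] := andP (YV_bounds x); have y1 := YV_le_pp x; have p1 := pp_ge1 x.
have F1 : `|g x - b| <= B by apply: norm_sub_le => //; [exact: gsm_ge0|exact: (gsm_le t0 mf f0 fB)].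
have F2 : `|(g x - b) ^+ 2| <= B ^+ 2 by rewrite normrX; apply: lerXn2r; rewrite ?nnegrE.
have D1 : `|dotp (Gm x) x| <= ggrad_max t B * pp x.
  apply: (le_trans (dotp_le _ _)); apply: ler_pM; rewrite ?enorm_ge0//.
    exact: (ggrad_bounded n0 t0 mf f0 fB x).
  have := sqr_ge0 (enorm x - 1); have := sqr_ge0 (enorm x); rewrite /pp -enormK; move: (enorm x) => z; lra.
have G0 : 0 <= ggrad_max t B by exact: sqrtr_ge0.
rewrite expr1 mulrA normrM (ger0_norm (eV_ge0 _ _)); apply: ler_wpM2r; first exact: eV_ge0.
have T1 : `|n%:R * psi x * (g x - b) ^+ 2| <= n%:R * (1 + n%:R) * B ^+ 2 * pp x.
  rewrite normrM (normrM n%:R) (ger0_norm nR); apply: (@le_trans _ _ (n%:R * (1 + n%:R) * B ^+ 2)).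
    by apply: ler_pM => //; rewrite ler_wpM2l// psi_bound.
  by rewrite ler_peMr// mulr_ge0 ?sqr_ge0// mulr_ge0// addr_ge0.
have T2 : `|dpsi x * (g x - b) ^+ 2| <= (3 + n%:R) * B ^+ 2 * pp x.
  rewrite normrM; apply: (@le_trans _ _ ((3 + n%:R) * B ^+ 2)).
    by apply: ler_pM => //; exact: dpsi_bound.
  by rewrite ler_peMr// mulr_ge0 ?sqr_ge0// addr_ge0.
have T3 : `|2 * psi x * (g x - b) * dotp (Gm x) x| <= 2 * (1 + n%:R) * B * (ggrad_max t B * pp x).
  rewrite normrM; apply: ler_pM => //; rewrite normrM; apply: ler_pM => //.
  by rewrite normrM (ger0_norm (ler0n R 2)) ler_pM2l// psi_bound.
have T4 : `|psi x * YV x * (g x - b) ^+ 2| <= (1 + n%:R) * pp x * B ^+ 2.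
  rewrite normrM; apply: ler_pM => //; rewrite normrM (ger0_norm y0); apply: ler_pM => //; exact: psi_bound.
apply: (le_trans (ler_normB _ _)); apply: (le_trans (lerD (ler_normD _ _) (lexx _))).
apply: (le_trans (lerD (lerD (ler_normD _ _) (lexx _)) (lexx _))).
apply: (le_trans (lerD (lerD (lerD T1 T2) T3) T4)).
by rewrite /Ed_max le_eqVlt; apply/orP; left; apply/eqP; ring.
Qed.

Lemma pp_half x l : 0 <= l <= 2 -> pp (l *: x) <= 4 * pp x.
Proof.
move=> /andP[l0 l2]; rewrite /pp sqnZ; have := sqn_ge0 x; move: (sqn x) => s s0.
have : l ^+ 2 <= 4 by rewrite (_ : 4 = 2 ^+ 2); [apply: lerXn2r; rewrite ?nnegrE|ring].
nra.
Qed.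

Lemma eV_half x l : 2^-1 <= l -> eV (l *: x) <= eV (2^-1 *: x).
Proof.
move=> l1; rewrite ler_expR lerN2 !V_alphaE; apply: ge0_ler_powR.
- by rewrite divr_ge0// ltW.
- by rewrite nnegrE ltW ?pp_gt0.
- by rewrite nnegrE ltW ?pp_gt0.
rewrite /pp lerD2l !sqnZ ler_wpM2r ?sqn_ge0//; apply: lerXn2r; rewrite ?nnegrE ?invr_ge0//.
by apply: le_trans l1; rewrite invr_ge0.
Qed.

Lemma itg_scale (F : 'rV[R]_n -> R) l : measurable_fun setT F -> (forall x, 0 <= F x) -> l != 0 ->
  itg lam F -> itg lam (fun x => F (l *: x)).
Proof.
move=> mF F0 l0 iF; apply: (@itg_le _ _ _ _ _ ((`|l| ^+ n)^-1 * \int[lam]_x F x)).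
- exact: (m_comp mF (measurable_scale l)).
- by move=> x; exact: F0.
have L0 : 0 < `|l| ^+ n by rewrite exprn_gt0// normr_gt0.
rewrite EFinM (itgK iF) (ge0_integral_rV_affine 0 l0 (F := fun x => (F x)%:E)); first last.
- by move=> x; rewrite lee_fin.
- exact: m_EFin.
rewrite muleA -EFinM mulVf ?gt_eqF// mul1e.
by under [X in (_ <= X)%E]eq_integral do rewrite addr0.
Qed.


Let mg : measurable_fun setT g. Proof. exact: measurable_gsm. Qed.
Let mG : measurable_fun setT Gm. Proof. exact: measurable_ggrad. Qed.
Let mV : measurable_fun setT V. Proof. exact: measurable_V_alpha. Qed.
Let mP : measurable_fun setT (@pp R n). Proof. by apply: measurable_pp; mes. Qed.

Let minv (F : 'rV[R]_n -> R) : measurable_fun setT F -> (forall x, 0 < F x) -> measurable_fun setT (fun x => (F x)^-1).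
Proof.
move=> mF F0; rewrite (_ : (fun x => _) = (fun x => F x `^ (-1))); first by mes.
by apply/funext => x; rewrite powR_inv1// ltW.
Qed.

Lemma measurable_YV : measurable_fun setT YV.
Proof.
apply: m_mul; last exact: (minv mP (@pp_gt0 _ _)).
by apply: m_mul mV; mes.
Qed.

Lemma measurable_psi : measurable_fun setT psi.
Proof.
apply: m_mul; first by apply: m_add measurable_YV _; mes.
apply: minv; first by apply: m_mul mP; mes.
by move=> x; rewrite mulr_gt0 ?pp_gt0.
Qed.

Lemma measurable_dpsi : measurable_fun setT dpsi.
Proof.
have ms : measurable_fun setT (fun x : 'rV[R]_n => sqn x / pp x).
  by apply: m_mul; [apply: measurable_sqn; mes|exact: (minv mP (@pp_gt0 _ _))].
apply: m_mul; last exact: (minv mP (@pp_gt0 _ _)).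
apply: m_add.
  by apply: m_mul measurable_YV _; apply: m_add; [mes|apply: m_opp; apply: m_mul ms; mes].
by apply: m_opp; apply: m_mul ms; apply: m_add measurable_YV _; mes.
Qed.

Let mF2 : measurable_fun setT (fun x => (g x - b) ^+ 2).
Proof. by apply: m_exp; apply: m_add mg _; mes. Qed.

Lemma measurable_Qd : measurable_fun setT Qd.
Proof. by apply: m_mul; [exact: (m_mul measurable_psi mF2)|exact: measurable_eV]. Qed.

Lemma measurable_Ed : measurable_fun setT Ed.
Proof.
apply: m_mul; last exact: measurable_eV.
apply: m_add; last first.
  by apply: m_opp; apply: m_mul mF2; exact: (m_mul measurable_psi measurable_YV).
apply: m_add; last first.
  apply: m_mul; last by apply: measurable_dotp mG _; mes.
  apply: m_mul; last by apply: m_add mg _; mes.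
  by apply: m_mul measurable_psi; mes.
apply: m_add; last exact: (m_mul measurable_dpsi mF2).
by apply: m_mul mF2; apply: m_mul measurable_psi; mes.
Qed.

Let B0 : 0 <= B. Proof. exact: le_trans b0 bB. Qed.

Lemma Qd_bound x : `|Qd x| <= (1 + n%:R) * B ^+ 2 * eV x.
Proof.
rewrite normrM (ger0_norm (eV_ge0 _ _)); apply: ler_wpM2r; first exact: eV_ge0.
rewrite normrM; apply: ler_pM => //; first exact: psi_bound.
rewrite normrX; apply: lerXn2r; rewrite ?nnegrE//.
by apply: norm_sub_le => //; [exact: gsm_ge0|exact: (gsm_le t0 mf f0 fB)].
Qed.

Lemma itg_eV : itg lam eV.
Proof.
have := @itg_pp_eV R n a a0 0; rewrite (_ : (fun x => _) = eV)//.
by apply/funext => x; rewrite expr0 mul1r.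
Qed.

Lemma itg_Ed : itg lam Ed.
Proof.
apply: (itg_dom measurable_Ed (G := fun x => Ed_max * (pp x ^+ 1 * eV x))); last exact: Ed_bound.
by apply: itgZ; exact: itg_pp_eV.
Qed.

Lemma itg_Qd l : l != 0 -> itg lam (fun x => Qd (l *: x)).
Proof.
move=> l0; apply: (@itg_dom _ _ _ _ (fun x => (1 + n%:R) * B ^+ 2 * eV (l *: x))).
- exact: (m_comp measurable_Qd (measurable_scale l)).
- by apply: itgZ; apply: itg_scale => //; [exact: measurable_eV|exact: eV_ge0|exact: itg_eV].
- by move=> x; exact: Qd_bound.
Qed.

Lemma Rint_scale l : 0 < l -> \int[lam]_x (l ^+ n * Qd (l *: x)) = \int[lam]_x Qd x.
Proof.
move=> l0; have P (F : 'rV[R]_n -> R) : measurable_fun setT F -> (forall x, 0 <= F x) ->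
    itg lam F -> itg lam (fun x => F (l *: x)) ->
    \int[lam]_x (l ^+ n * F (l *: x)) = \int[lam]_x F x.
  move=> mF F0 iF iFl; apply/EFin_inj; rewrite RintZ// EFinM !itgK//.
  rewrite [RHS](ge0_integral_rV_affine 0 (lt0r_neq0 l0) (F := fun x => (F x)%:E)); first last.
  - by move=> x; rewrite lee_fin.
  - exact: m_EFin.
  rewrite (gtr0_norm l0); congr (_ * _)%E.
  by apply: eq_integral => x _; rewrite addr0.
have le1 : l != 0 by rewrite gt_eqF.
(* [Qd] has no sign, while the scaling identity [P] is for nonnegative functions: it is used for
   [Qd + C * eV] and for [C * eV], and the two are subtracted. *)
pose C := (1 + n%:R) * B ^+ 2.
have mq : measurable_fun setT (fun x => C * eV x).
  by apply: m_mul; [mes|exact: measurable_eV].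
have C0 : 0 <= C by rewrite mulr_ge0 ?sqr_ge0// addr_ge0.
have q0 x : 0 <= C * eV x by rewrite mulr_ge0// eV_ge0.
have iq : itg lam (fun x => C * eV x) by apply: itgZ; exact: itg_eV.
have iql := itg_scale mq q0 le1 iq.
have mq2 : measurable_fun setT (fun x => Qd x + C * eV x) by exact: (m_add measurable_Qd mq).
have iQ : itg lam Qd.
  exact: (itg_dom measurable_Qd iq Qd_bound).
have iQl := itg_Qd le1.
have q20 x : 0 <= Qd x + C * eV x.
  by have := Qd_bound x; rewrite -/C ler_norml => /andP[h _]; lra.
have E1 := P _ mq2 q20 (itgD iQ iq) (itgD iQl iql).
have E2 := P _ mq q0 iq iql.
exact: (Rint_cancel iQ iq iQl iql E1 E2).
Qed.

Lemma Ed_int0 : \int[lam]_x Ed x = 0.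
Proof.
pose F (l : R) x := l ^+ n * Qd (l *: x).
(* Dominates the derivative for all dilations l in ]1/2, 2[: l^(n-1) <= 2^n, [pp] grows at most by
   4, and exp(-V) decreases along rays. *)
pose Gd x := 2 ^+ n * (Ed_max * (4 * pp x ^+ 1 * eV (2^-1 *: x))).
have h2 : (0 : R) < 2^-1 by [].
have I1 : `]2^-1, 2[%classic (1 : R) by rewrite /= in_itv/= invf_lt1 ?ltr1n// ltr1n.
have Ip l : `]2^-1, 2[%classic l -> 0 < l by rewrite /= in_itv/= => /andP[h _]; exact: lt_trans h.
have iF l : `]2^-1, 2[%classic l -> itg lam (F l).
  by move=> /Ip l0; apply: itgZ; apply: itg_Qd; rewrite gt_eqF.
have dF l x : 0 < l -> is_derive l 1 (F ^~ x) (l ^+ n.-1 * Ed (l *: x)) by exact: drv_Qd.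
have dF1 l x : `]2^-1, 2[%classic l -> setT x -> derivable (F ^~ x) l 1.
  by move=> /Ip l0 _; have [] := dF l x l0.
have p1 l x : 0 < l -> partial1of2 F l x = l ^+ n.-1 * Ed (l *: x).
  by move=> l0; rewrite partial1of2E; have [] := dF l x l0.
have Em0 : 0 <= Ed_max.
  have G0 : 0 <= ggrad_max t B by exact: sqrtr_ge0.
  by rewrite /Ed_max addr_ge0 ?mulr_ge0 ?sqr_ge0 ?addr_ge0 ?mulr_ge0 ?ler0n ?addr_ge0.
have G0 x : 0 <= Gd x.
  have ? := eV_ge0 a (2^-1 *: x); have ? := ltW (pp_gt0 x).
  by rewrite /Gd expr1 !mulr_ge0// exprn_ge0.
have iG : itg lam Gd.
  apply: itgZ; apply: itgZ; apply: (@itg_dom _ _ _ _ (fun x => 16 * (pp (2^-1 *: x) ^+ 1 * eV (2^-1 *: x)))).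
  - apply: m_mul; first by apply: m_mul; [mes|exact: m_exp].
    exact: (m_comp (@measurable_eV R n a) (measurable_scale _)).
  - apply: itgZ; apply: (itg_scale (F := fun x => pp x ^+ 1 * eV x)) => //.
    + by apply: m_mul; [exact: m_exp|exact: measurable_eV].
    + by move=> x; rewrite mulr_ge0 ?eV_ge0// exprn_ge0// ltW ?pp_gt0.
    + exact: itg_pp_eV.
  move=> x; rewrite ger0_norm; last by rewrite mulr_ge0 ?eV_ge0// mulr_ge0// expr1 ltW ?pp_gt0.
  rewrite mulrA; apply: ler_wpM2r; first exact: eV_ge0.
  rewrite !expr1; have := sqn_ge0 x; rewrite /pp sqnZ; move: (sqn x) => s s0.
  have -> : (2^-1 : R) ^+ 2 = 4^-1 by field.
  by lra.
have Gub l x : `]2^-1, 2[%classic l -> setT x -> `|partial1of2 F l x| <= Gd x.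
  move=> Il _; have l0 := Ip _ Il; move: Il; rewrite /= in_itv/= => /andP[/ltW l1 /ltW l2].
  rewrite (p1 _ _ l0) normrM; apply: ler_pM => //.
    rewrite normrX (gtr0_norm l0); apply: (@le_trans _ _ (2 ^+ n.-1)).
      by apply: lerXn2r; rewrite ?nnegrE// ltW.
    by apply: ler_weXn2l; [rewrite ler1n|exact: leq_pred].
  apply: (le_trans (Ed_bound _)); apply: (ler_wpM2l Em0).
  rewrite !expr1; apply: (ler_pM (ltW (pp_gt0 _)) (eV_ge0 _ _)); last exact: eV_half l1.
  by apply: pp_half; rewrite (ltW l0) l2.
have D := differentiation_under_integral measurableT I1 iF dF1 G0 iG Gub.
have -> : \int[lam]_x Ed x = \int[lam]_x (partial1of2 F 1 x).
  by apply: eq_Rint => x; rewrite p1// expr1n mul1r scale1r.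
rewrite -D; apply: (derive1_const_pos (c := \int[lam]_x Qd x)) => l l0.
exact: (Rint_scale l0).
Qed.

(** The Lyapunov weight: positive once [YV] deviates from its mean [n] by more than sqrt(72 n), then
    quadratic in the deviation. Only the shell where it may be negative needs a separate
    argument. *)
Definition wly x : R := ((YV x - n%:R) ^+ 2 / 8 - 9 * n%:R) / pp x.

(** Young's inequality removes the gradient term. With z = YV - n, the coefficient of (g - b)^2 is
    then bounded by (-1/2 + 1/4 + 1/8) z^2 + n + 2 over [pp]: the first term is psi (n - YV), the
    second psi^2 |x|^2, the third a part of [dpsi]. *)
Lemma Ed_le x : Ed x <= sqn (Gm x) * eV x - wly x * (g x - b) ^+ 2 * eV x.
Proof.
rewrite -mulrBl; apply: ler_wpM2r; first exact: eV_ge0.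
have m1 : 1 <= n%:R :> R by rewrite ler1n.
have [y0 _] := andP (YV_bounds x); have p0 := pp_gt0 x.
have [th0 th1] := andP (sqn_pp x).
have S : 2 * psi x * (g x - b) * dotp (Gm x) x <= psi x ^+ 2 * (g x - b) ^+ 2 * sqn x + sqn (Gm x).
  have := sqn_ge0 (Gm x - (psi x * (g x - b)) *: x).
  by rewrite sqnD sqnN sqnZ !dotpE exprMn; lra.
have T : n%:R * psi x + dpsi x - psi x * YV x + psi x ^+ 2 * sqn x + wly x <= 0.
  rewrite (_ : _ + wly x = (- (YV x - n%:R) ^+ 2 / 2 +
      (YV x * (1 - (1 - a / 2) * (sqn x / pp x)) - (YV x - n%:R) * (sqn x / pp x)) +
      (YV x - n%:R) ^+ 2 * (sqn x / pp x) / 4 + ((YV x - n%:R) ^+ 2 / 8 - 9 * n%:R)) / pp x); last first.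
    by rewrite /wly /dpsi /psi; field; rewrite gt_eqF.
  rewrite ler_pdivrMr// mul0r.
  have k0 : 0 <= YV x * ((1 - a / 2) * (sqn x / pp x)).
    by apply: mulr_ge0 => //; apply: mulr_ge0 => //; have ? := a1; lra.
  move: k0 y0; rewrite (mulrBr (YV x)) mulr1; move: (YV x * _) => k k0 y0.
  move: (sqn x / pp x) th0 th1 => th th0 th1.
  set z := YV x - n%:R; have zE : YV x = z + n%:R by rewrite /z; ring.
  rewrite zE; have h1 : z ^+ 2 * th <= z ^+ 2 by rewrite ler_piMr ?sqr_ge0.
  have h2 : z * (1 - th) <= z ^+ 2 / 8 + 2.
    have := sqr_ge0 (z - 4 * (1 - th)); have : (1 - th) ^+ 2 <= 1 by rewrite expr_le1//; lra.
    by lra.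
  by move: h1 h2; lra.
have F0 : 0 <= (g x - b) ^+ 2 by exact: sqr_ge0.
have := ler_wpM2l F0 T; rewrite mulr0 => T'.
by move: S T'; lra.
Qed.

Lemma measurable_wly : measurable_fun setT wly.
Proof.
apply: m_mul; last exact: (minv mP (@pp_gt0 _ _)).
apply: m_add; last by mes.
by apply: m_mul; [apply: m_exp; apply: m_add measurable_YV _; mes|mes].
Qed.

Lemma itg_sqnG : itg lam (fun x => sqn (Gm x) * eV x).
Proof.
apply: (@itg_dom _ _ _ _ (fun x => ggrad_max t B ^+ 2 * eV x)).
- by apply: m_mul; [apply: measurable_sqn; exact: mG|exact: measurable_eV].
- by apply: itgZ; exact: itg_eV.
move=> x; rewrite normrM (ger0_norm (eV_ge0 _ _)) (ger0_norm (sqn_ge0 _)); apply: ler_wpM2r; first exact: eV_ge0.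
by rewrite -enormK; apply: lerXn2r; rewrite ?nnegrE ?enorm_ge0 ?sqrtr_ge0//; exact: (ggrad_bounded n0 t0 mf f0 fB x).
Qed.

Lemma itg_wly : itg lam (fun x => wly x * (g x - b) ^+ 2 * eV x).
Proof.
pose C := (1 + n%:R) ^+ 2 + 9 * n%:R : R.
have nR : 0 <= n%:R :> R by [].
apply: (@itg_dom _ _ _ _ (fun x => C * B ^+ 2 * (pp x ^+ 1 * eV x))).
- by apply: m_mul; [exact: (m_mul measurable_wly mF2)|exact: measurable_eV].
- by apply: itgZ; exact: itg_pp_eV.
move=> x; rewrite expr1 mulrA normrM (ger0_norm (eV_ge0 _ _)); apply: ler_wpM2r; first exact: eV_ge0.
rewrite normrM mulrAC; apply: ler_pM => //; last first.
  rewrite normrX; apply: lerXn2r; rewrite ?nnegrE//.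
  by apply: norm_sub_le => //; [exact: gsm_ge0|exact: (gsm_le t0 mf f0 fB)].
have [y0 _] := andP (YV_bounds x); have y1 := YV_le_pp x; have p1 := pp_ge1 x.
have p0 := pp_gt0 x.
rewrite /wly normrM normfV (gtr0_norm p0) ler_pdivrMr// -mulrA /C.
move: (n%:R) nR (pp x) p1 {p0} (YV x) y0 y1 => m m0 p p1 Y Y0 Y1.
have pp1 : p <= p * p by rewrite ler_peMl//; lra.
have h1 : (Y - m) ^+ 2 <= ((1 + m) * p) ^+ 2.
  rewrite -[leLHS]real_normK ?num_real//; apply: lerXn2r; rewrite ?nnegrE ?mulr_ge0//; try lra.
  by rewrite ler_norml; apply/andP; split; nra.
have h2 : m <= m * (p * p) by rewrite ler_peMr//; lra.
have h3 := sqr_ge0 (Y - m); have h4 : 0 <= (1 + m) ^+ 2 * (p * p).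
  by rewrite mulr_ge0 ?sqr_ge0//; apply: mulr_ge0; lra.
move: h1; rewrite exprMn (expr2 p) => h1.
rewrite mulrDl -mulrA ler_norml; apply/andP; split; lra.
Qed.

Lemma lyapunov_ineq :
  \int[lam]_x (wly x * (g x - b) ^+ 2 * eV x) <= \int[lam]_x (sqn (Gm x) * eV x).
Proof.
rewrite -subr_ge0 -RintB; [|exact: itg_sqnG|exact: itg_wly].
rewrite -[leLHS]Ed_int0; apply: le_Rint; [exact: itg_Ed|by apply: itgB; [exact: itg_sqnG|exact: itg_wly]|exact: Ed_le].
Qed.

End lyapunov.

(** * A weak Poincare inequality for smoothed functions *)

Section weak_poincare.
Context {R : realType}.
Variables (a : R) (a0 : 0 < a) (a1 : a < 1).

Let e : R := 2 / a.
Let e2 : 2 <= e. Proof. by rewrite /e ler_pdivlMr// ler_piMr// ltW. Qed.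
Let ae : a * e = 2. Proof. by rewrite /e mulrC divfK// gt_eqF. Qed.

(** A quadratic bound for the distance between r^e and its tangent at 1. The range up to 14 = 1 + 13
    is the one met in [eV_le_tg], where (r - 1)^2 <= 169. *)
Lemma powR_quad (r : R) : 0 < r -> r <= 14 -> (r `^ e - 1) / e - (r - 1) <= (e - 1) * 14 `^ e * (r - 1) ^+ 2.
Proof.
move=> r0 r14; have ep : 0 < e by apply: lt_le_trans e2.
have T1 : r `^ e - 1 <= e * r `^ (e - 1) * (r - 1).
  have := @powR_tangent R 1 r e ler01 r0 (le_trans (ler1n R 2) e2).
  by rewrite powR1; lra.
have big : 1 <= 14 `^ e by rewrite -[leLHS](powRr0 14); apply: ler_powR; rewrite ?ler1n// ltW.
have T2 : (r - 1) * (r `^ (e - 1) - 1) <= (e - 1) * 14 `^ e * (r - 1) ^+ 2.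
  have e1 : 1 <= e - 1 by move: e2; lra.
  have [r1|r1] := leP 1 r.
    have := @powR_tangent R 1 r (e - 1) ler01 r0 e1; rewrite powR1 => H.
    have H2 : r `^ (e - 1 - 1) <= 14 `^ e.
      apply: (@le_trans _ _ (r `^ e)); first by apply: ler_powR => //; lra.
      by apply: ge0_ler_powR; rewrite ?nnegrE// ltW.
    have H3 : r `^ (e - 1) - 1 <= (e - 1) * 14 `^ e * (r - 1).
      apply: (@le_trans _ _ ((e - 1) * r `^ (e - 1 - 1) * (r - 1))); first by move: H; lra.
      apply: ler_wpM2r; first by lra.
      by apply: ler_wpM2l => //; lra.
    rewrite expr2 mulrA mulrC; apply: ler_wpM2r => //; lra.
  have := @powR_tangent R r 1 (e - 1) (ltW r0) ltr01 e1; rewrite !powR1 mulr1 => H.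
  have H3 : (1 - r) * (1 - r `^ (e - 1)) <= (1 - r) * ((e - 1) * (1 - r)).
    by apply: ler_wpM2l; lra.
  have H4 : (e - 1) * (r - 1) ^+ 2 <= (e - 1) * 14 `^ e * (r - 1) ^+ 2.
    by apply: ler_wpM2r; rewrite ?sqr_ge0// ler_peMr//; lra.
  by move: H3 H4; lra.
apply: (le_trans _ T2).
have : (r `^ e - 1) / e <= r `^ (e - 1) * (r - 1) by rewrite ler_pdivrMr//; move: T1; lra.
by lra.
Qed.

Context {n : nat} (n0 : (0 < n)%N).
Local Notation lam := (@lebesgue_rV R n).
Local Notation V := (V_alpha n a).
Local Notation eV := (@eV R n a).
Implicit Types (x y : 'rV[R]_n).
Let m1 : 1 <= n%:R :> R. Proof. by rewrite ler1n. Qed.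
Let m0 : 0 < n%:R :> R. Proof. by rewrite ltr0n. Qed.

(* V = pp^(a/2) is concave in pp; [tg] is exp(-V) with V replaced by its tangent at
   the radius [pp x = pm] where x . grad V(x) is of order n, hence a multiple of the
   Gaussian [gaus sg], below exp(-V) everywhere and comparable to it near [pm]. *)
Definition vm : R := n%:R / a.
Definition pm : R := vm `^ e.
Definition tg x : R := expR (- (vm + vm / e * (pp x / pm - 1))).
Definition sg : R := pm / (2 * a * vm).
(** The relaxation scale of the bulk: up to constants it is the parameter [sg] of the tangent
    Gaussian ([sgE]), and it bounds 1 / [wly] off the shell as long as V <= 4n/a. *)
Definition N1 : R := n%:R `^ (e - 1).
Definition cG : R := expR ((e - 1) * 14 `^ e * (169 / a)).
Definition cP : R := 9 * 676 `^ e.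
Definition cO : R := 256 * (4 / a) `^ e.
(** Bounds 1 / [wly] off the shell where [pp x <= P]. Far out, [wly] is at least of order V^2 / pp =
    pp^(a - 1), whence the power of [P]. *)
Definition be (P : R) : R := cO * (N1 + P `^ (1 - a)).

Let vm0 : 0 < vm. Proof. by rewrite divr_gt0. Qed.
Let pm0 : 0 < pm. Proof. exact: powR_gt0. Qed.
Let sg0 : 0 < sg. Proof. by rewrite /sg divr_gt0// mulr_gt0// mulr_gt0. Qed.
Let e0 : 0 < e. Proof. by apply: lt_le_trans e2. Qed.

Lemma pp_V x : pp x = V x `^ e.
Proof.
rewrite V_alphaE -powRrM /e (_ : a / 2 * (2 / a) = 1); last by field; rewrite gt_eqF.
by rewrite powRr1// ltW// pp_gt0.
Qed.

Lemma tg_le x : tg x <= eV x.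
Proof.
rewrite ler_expR lerN2.
have V0 : 0 <= V x by apply: le_trans (V_ge1 a0 x).
have := @powR_tangent R (V x) vm e V0 vm0 (le_trans (ler1n R 2) e2).
rewrite -pp_V -/pm powRB; last by apply/implyP => _; rewrite gt_eqF.
rewrite -/pm powRr1 ?(ltW vm0)// => H.
have : e * (pm / vm) * (V x - vm) <= pp x - pm by move: H; lra.
have k0 : 0 < e * (pm / vm) by rewrite mulr_gt0// divr_gt0.
rewrite (_ : vm / e * (pp x / pm - 1) = (pp x - pm) / (e * (pm / vm))); last by field; rewrite !gt_eqF.
by move=> H2; rewrite -lerBlDl ler_pdivlMr// mulrC.
Qed.

Lemma tgE : exists k : R, 0 < k /\ forall x, tg x = k * gaus sg x.
Proof.
pose pk : R := normal_peak (Num.sqrt (2 * sg)) ^+ n.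
have pk0 : 0 < pk.
  by apply: exprn_gt0; apply: normal_peak_gt0; rewrite gt_eqF// sqrtr_gt0 mulr_gt0.
exists (expR (- (vm + vm / e * (pm^-1 - 1))) / pk); split; first by rewrite divr_gt0// expR_gt0.
move=> x; rewrite gausE// -/pk mulrA divfK ?gt_eqF// -expRD; congr expR.
rewrite /pp /sg -[a](mulfK (lt0r_neq0 e0)) ae; field.
by rewrite !gt_eqF.
Qed.

(** On the shell V = vm r with (r - 1)^2 <= 169/n, so the gap between V and its tangent, quadratic
    in r - 1, is at most a constant times vm * 169/n = 169/a: it does not grow with the
    dimension. *)
Lemma eV_le_tg x : (YV a x - n%:R) ^+ 2 <= 144 * n%:R -> eV x <= cG * tg x.
Proof.
move=> W; rewrite /cG /tg -expRD ler_expR.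
suff : vm + vm / e * (pp x / pm - 1) - (e - 1) * 14 `^ e * (169 / a) <= V x by lra.
have V1 := V_ge1 a0 x; have V0 : 0 < V x by apply: lt_le_trans V1.
pose r := V x / vm; have r0 : 0 < r by rewrite divr_gt0.
(* [a * V x] exceeds [YV a x] by at most 1, hence (12 sqrt n + 1)^2 <= 169 n. *)
have rn : (a * V x - n%:R) ^+ 2 <= 169 * n%:R.
  have YE : a * V x = YV a x + a * (V x / pp x).
    by rewrite /YV (_ : sqn x = pp x - 1); [field; rewrite gt_eqF ?pp_gt0|rewrite /pp; ring].
  have q1 : 0 <= a * (V x / pp x) <= 1.
    have q0 : 0 <= V x / pp x by rewrite divr_ge0 ?(ltW V0)// ltW ?pp_gt0.
    rewrite mulr_ge0 ?(ltW a0)//= mulr_ile1 ?(ltW a0) ?(ltW a1)//.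
    by rewrite ler_pdivrMr ?pp_gt0// mul1r V_le_pp.
  rewrite YE; have [q2 q3] := andP q1; move: (a * (V x / pp x)) q2 q3 => q q2 q3 {q1 YE}.
  move: W; rewrite (_ : YV a x + q - n%:R = (YV a x - n%:R) + q); last by ring.
  move: (n%:R) m1 (YV a x - n%:R) => m mm z W.
  have := sqr_ge0 (z - 12 * q); have : q ^+ 2 <= 1 by rewrite expr_le1.
  by lra.
have rE : r - 1 = (a * V x - n%:R) / n%:R by rewrite /r /vm; field; rewrite !gt_eqF.
have r13 : (r - 1) ^+ 2 <= 169 / n%:R.
  by rewrite rE expr_div_n ler_pdivrMr ?exprn_gt0// expr2 mulrA divfK ?gt_eqF.
have r14 : r <= 14.
  have h : (r - 1) ^+ 2 <= 169.
    by apply: (le_trans r13); rewrite ler_pdivrMr// ler_peMr.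
  rewrite leNgt; apply/negP => h2; move: h; rewrite leNgt => /negP; apply.
  have : 0 < (r - 14) * (r + 12) by rewrite mulr_gt0; lra.
  by lra.
have Q := powR_quad r0 r14.
have rp : pp x / pm = r `^ e.
  have Vr : V x = vm * r by rewrite /r mulrC divfK// gt_eqF.
  by rewrite pp_V Vr powRM ?(ltW vm0) ?(ltW r0)// mulrC mulKf// gt_eqF.
rewrite rp.
have -> : vm + vm / e * (r `^ e - 1) - (e - 1) * 14 `^ e * (169 / a) = vm * (1 + (r `^ e - 1) / e - (e - 1) * 14 `^ e * (169 / n%:R)).
  by rewrite /vm; field; rewrite !gt_eqF.
have -> : V x = vm * r by rewrite /r mulrC divfK// gt_eqF.
rewrite ler_pM2l//.
have C0 : 0 <= (e - 1) * 14 `^ e by rewrite mulr_ge0 ?powR_ge0//; move: e2; lra.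
have := ler_wpM2l C0 r13; move: Q; lra.
Qed.

Let N1_ge1 : 1 <= N1.
Proof. by rewrite /N1 -[leLHS](powRr0 n%:R); apply: ler_powR => //; move: e2; lra. Qed.

Let N1E : n%:R `^ e = n%:R * N1.
Proof.
rewrite /N1 powRB; last by apply/implyP => _; rewrite gt_eqF.
by rewrite powRr1 ?(ltW m0)// mulrC divfK// gt_eqF.
Qed.

Let cO0 : 0 < cO.
Proof. by apply: mulr_gt0; [exact: (ltr0Sn R 255)|apply: powR_gt0; rewrite divr_gt0]. Qed.

Let b4 : (4 / a) ^+ 2 <= (4 / a) `^ e.
Proof.
rewrite -powR_mulrn; last by rewrite divr_ge0// ltW.
by apply: ler_powR => //; rewrite ler_pdivlMr//; have := a1; lra.
Qed.

Lemma wly_off x (P : R) : 1 <= P -> 144 * n%:R < (YV a x - n%:R) ^+ 2 -> pp x <= P ->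
  1 <= be P * wly a x.
Proof.
move=> P1 W pP; have p0 := pp_gt0 x; have p1 := pp_ge1 x.
have V1 := V_ge1 a0 x; have V0 : 0 < V x by apply: lt_le_trans V1.
have P0 : 0 <= P `^ (1 - a) by exact: powR_ge0.
have wl : (YV a x - n%:R) ^+ 2 / (16 * pp x) <= wly a x.
  rewrite /wly ler_pdivrMr ?mulr_gt0// (mulrC 16) mulrA divfK ?gt_eqF//.
  by move: W; lra.
have be0 : 0 < be P by rewrite /be mulr_gt0// ltr_pwDl// (lt_le_trans ltr01).
apply: (le_trans _ (ler_wpM2l (ltW be0) wl)).
rewrite mulrA ler_pdivlMr ?mulr_gt0// mul1r.
have [VK|VK] := leP (V x) (4 / a * n%:R).
  have pb : pp x <= (4 / a) `^ e * (n%:R * N1).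
    rewrite pp_V -N1E -powRM ?(ltW m0)//; last by rewrite divr_ge0// ltW.
    apply: ge0_ler_powR; rewrite ?(ltW e0)// nnegrE ?(ltW V0)//.
    by rewrite mulr_ge0// ?(ltW m0)// divr_ge0// ltW.
  have h1 : cO * N1 * (144 * n%:R) <= be P * (YV a x - n%:R) ^+ 2.
    apply: ler_pM; rewrite ?(ltW W)//.
    - by rewrite mulr_ge0 ?(ltW cO0)// ltW// (lt_le_trans ltr01).
    - by rewrite /be ler_wpM2l ?(ltW cO0)// lerDl.
  apply: (le_trans _ h1); apply: (le_trans (ler_wpM2l _ pb)) => //.
  have X0 : 0 <= (4 / a) `^ e * (n%:R * N1).
    by apply: mulr_ge0; [exact: powR_ge0|apply: mulr_ge0; [exact: ltW|exact: le_trans N1_ge1]].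
  rewrite /cO; move: X0; move: ((4 / a) `^ e) N1 (n%:R) => A N m X0; lra.
(* In the far region [YV >= 3/4 a V] and [n < a V / 4], so the deviation of [YV] from [n] is at
   least [a V / 2]. *)
have V4 : 4 < V x.
  apply: (le_lt_trans _ VK); rewrite mulrAC ler_pdivlMr// ler_pM2l//.
  by apply: (le_trans _ m1); exact: ltW.
have Vp := V_le_pp a1 x.
have YE : YV a x = a * V x * (1 - (pp x)^-1).
  by rewrite /YV (_ : sqn x = pp x - 1); [field; rewrite gt_eqF|rewrite /pp; ring].
have iv : (pp x)^-1 <= 4^-1 by rewrite lef_pV2 ?posrE//; lra.
have aV : 4 * n%:R < a * V x by move: VK; rewrite mulrAC ltr_pdivrMr// (mulrC (V x)).
have Yb : a * V x * (3 / 4) <= YV a x.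
  by rewrite YE; apply: ler_wpM2l; [rewrite mulr_ge0// ltW|lra].
have z1 : (a * V x / 2) ^+ 2 <= (YV a x - n%:R) ^+ 2.
  apply: lerXn2r; rewrite ?nnegrE; move: Yb aV m1; lra.
have hP : pp x = V x ^+ 2 * pp x `^ (1 - a).
  rewrite -powR_mulrn ?(ltW V0)// V_alphaE -powRrM -powRD; last by apply/implyP => _; rewrite gt_eqF.
  by rewrite (_ : a / 2 * 2%:R + (1 - a) = 1) ?powRr1 ?(ltW p0)//; field.
have hP2 : pp x <= V x ^+ 2 * P `^ (1 - a).
  rewrite {1}hP ler_wpM2l ?sqr_ge0//; apply: ge0_ler_powR; rewrite ?nnegrE ?(ltW p0)//.
  - by have := a1; lra.
  - exact: le_trans ler01 P1.
have h1 : cO * P `^ (1 - a) * (a * V x / 2) ^+ 2 <= be P * (YV a x - n%:R) ^+ 2.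
  apply: ler_pM => //; rewrite ?sqr_ge0//.
  - by rewrite mulr_ge0 ?(ltW cO0).
  - by rewrite /be ler_wpM2l ?(ltW cO0)// lerDr (le_trans ler01).
apply: (le_trans _ h1).
apply: (@le_trans _ _ (16 * (V x ^+ 2 * P `^ (1 - a)))); first by rewrite ler_pM2l.
rewrite (_ : cO * P `^ (1 - a) * (a * V x / 2) ^+ 2 = (cO * a ^+ 2 / 4) * (V x ^+ 2 * P `^ (1 - a))); last by field.
apply: ler_wpM2r; first by rewrite mulr_ge0 ?sqr_ge0.
have : 16 <= (4 / a) `^ e * a ^+ 2.
  apply: (@le_trans _ _ ((4 / a) ^+ 2 * a ^+ 2)); last by rewrite ler_wpM2r ?sqr_ge0.
  by rewrite -exprMn divfK ?gt_eqF// -natrX.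
by rewrite /cO; lra.
Qed.


Lemma wly_on x : (YV a x - n%:R) ^+ 2 <= 144 * n%:R -> - (cP / N1) <= wly a x.
Proof.
move=> W; have p0 := pp_gt0 x; have p1 := pp_ge1 x; have N0 : 0 < N1 by apply: lt_le_trans N1_ge1.
apply: (@le_trans _ _ (- (9 * n%:R / pp x))); last first.
  by rewrite /wly -mulNr; apply: ler_wpM2r; [rewrite invr_ge0 ltW|have := sqr_ge0 (YV a x - n%:R); lra].
rewrite lerN2 ler_pdivrMr// mulrAC ler_pdivlMr// -mulrA -N1E /cP -mulrA ler_pM2l//.
have [n6|n6] := leP n%:R (676 : R).
  apply: (@le_trans _ _ (676 `^ e)); first by apply: (ge0_ler_powR (ltW e0)); rewrite ?nnegrE ?ler0n.
  exact: (ler_peMr (powR_ge0 _ _) p1).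
have V1 := V_ge1 a0 x; have V0 : 0 < V x by apply: lt_le_trans V1.
have [y0 yV] := andP (@YV_bounds R n a a0 a1 x).
have Yn : n%:R / 2 <= YV a x.
  rewrite leNgt; apply/negP => h; move: W; rewrite leNgt => /negP; apply.
  have : 0 < (n%:R / 2 - YV a x) * (3 * n%:R / 2 - YV a x) by rewrite mulr_gt0; move: h n6; lra.
  have h6 : 0 < n%:R - 676 :> R by rewrite subr_gt0.
  have := mulr_gt0 h6 m0.
  by lra.
have c0 : (0 : R) <= 676 := ler0n R 676.
rewrite pp_V -(powRM _ c0 (ltW V0)).
apply: (ge0_ler_powR (ltW e0)); rewrite ?nnegrE; [exact: ltW|exact: mulr_ge0 c0 (ltW V0)|].
by move: yV Yn; lra.
Qed.

Variables (t : R) (t0 : 0 < t) (f : 'rV[R]_n -> R) (B : R).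
Hypothesis (mf : measurable_fun setT f) (f0 : forall x, 0 <= f x) (fB : forall x, f x <= B).
Local Notation g := (gsm t f).
Local Notation Gm := (ggrad t f).

(** Off the shell the Lyapunov weight dominates; on it the tangent Gaussian does, and also
    compensates the negative part of [wly]; beyond [P] only the tail is left. Multiplied by (g -
    b)^2 and integrated, the three terms are bounded by [lyapunov_ineq], [gaussian_poincare] and the
    sup norm. *)
Lemma eV_split (P : R) x : 1 <= P ->
  eV x <= be P * (wly a x * eV x) + (1 + be P * (cP / N1)) * cG * tg x + (if P < pp x then eV x else 0).
Proof.
move=> P1; have N0 : 0 < N1 by apply: lt_le_trans N1_ge1.
have be0 : 0 <= be P by rewrite /be mulr_ge0 ?(ltW cO0)// addr_ge0 ?powR_ge0// ltW.
have cP0 : 0 <= cP / N1 by rewrite divr_ge0 ?(ltW N0)// mulr_ge0 ?powR_ge0.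
have ev0 := eV_ge0 a x; have tg0 : 0 <= tg x by exact: expR_ge0.
have D0 : 0 <= (1 + be P * (cP / N1)) * cG * tg x.
  by rewrite !mulr_ge0 ?expR_ge0// addr_ge0// mulr_ge0.
have t0' : 0 <= (if P < pp x then eV x else 0) by case: ifP.
have [W|W] := leP ((YV a x - n%:R) ^+ 2) (144 * n%:R).
  have h1 := eV_le_tg W; have h2 := wly_on W.
  have h3 : - (be P * (cP / N1) * eV x) <= be P * (wly a x * eV x).
    rewrite -mulrA -mulrN; apply: ler_wpM2l => //; rewrite -mulNr; exact: ler_wpM2r.
  have h4 : (1 + be P * (cP / N1)) * eV x <= (1 + be P * (cP / N1)) * (cG * tg x).
    by apply: ler_wpM2l => //; rewrite addr_ge0// mulr_ge0.
  by rewrite -mulrA; move: h3 h4 t0'; lra.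
have w0 : 0 <= wly a x.
  by rewrite /wly divr_ge0 ?(ltW (pp_gt0 x))//; move: W m0; lra.
have b0 : 0 <= be P * (wly a x * eV x) by exact: (mulr_ge0 be0 (mulr_ge0 w0 ev0)).
case: ltP => Pp; first by move: b0 D0; lra.
have h := wly_off P1 W Pp.
have : 1 * eV x <= be P * wly a x * eV x by apply: ler_wpM2r.
by rewrite -mulrA; move: D0; lra.
Qed.

Definition cW : R := cO + 72 * cG * (a `^ (1 - e) / (2 * a)) * (1 + cP * cO).

Lemma sgE : sg = a `^ (1 - e) / (2 * a) * N1.
Proof.
rewrite /sg /pm /N1 /vm powRM ?(ltW m0) ?invr_ge0 ?(ltW a0)//.
rewrite -powR_inv1 ?(ltW a0)// -powRrM mulN1r (powRB (x := a)); last by apply/implyP => _; rewrite gt_eqF.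
rewrite (powRB (x := n%:R)); last by apply/implyP => _; rewrite gt_eqF.
rewrite !powRr1 ?(ltW a0) ?(ltW m0)// powRN powR_inv1 ?(ltW a0)//.
by field; rewrite !gt_eqF// powR_gt0.
Qed.

Definition tail (P : R) : \bar R := (\int[lam]_x (if (P < pp x)%R then eV x else 0)%:E)%E.

Lemma weak_poincare_gsm (P : R) : 1 <= P -> exists b, [/\ 0 <= b, b <= B &
  (\int[lam]_x ((g x - b) ^+ 2 * eV x)%:E <=
   (cW * (N1 + P `^ (1 - a)) * \int[lam]_x (sqn (Gm x) * eV x))%:E + (B ^+ 2)%:E * tail P)%E].
Proof.
(* The centre is the mean under the tangent Gaussian, as [gaussian_poincare] requires; the Lyapunov
   inequality holds for every centre between 0 and [B]. *)
move=> P1; pose b := \int[lam]_x (gaus sg x * g x).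
have mg : measurable_fun setT g by exact: measurable_gsm.
have mG : measurable_fun setT Gm by exact: measurable_ggrad.
have g0 x : 0 <= g x by exact: gsm_ge0.
have gB x : g x <= B by exact: (gsm_le t0 mf f0 fB).
have gs0 x : 0 <= gaus sg x := gaus_ge0 _ _.
have igs : itg lam (gaus sg) := @itg_gaus R n sg sg0.
have B0 : 0 <= B by exact: le_trans (g0 0) (gB 0).
have igg : itg lam (fun x => gaus sg x * g x).
  by apply: (@itg_weight _ _ _ lam (gaus sg) igs gs0 g B mg) => x; rewrite ger0_norm.
have b0 : 0 <= b by apply: Rint_ge0 => x; rewrite mulr_ge0.
have bB : b <= B.
  rewrite -[leRHS]mulr1 -(@Rint_gaus R n sg sg0) -(RintZ _ igs).
  apply: le_Rint => //; first exact: itgZ.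
  by move=> x; rewrite mulrC; exact: ler_wpM2r.
exists b; split => //.
have F2 x : 0 <= (g x - b) ^+ 2 by exact: sqr_ge0.
have FB x : (g x - b) ^+ 2 <= B ^+ 2.
  rewrite -[leLHS]real_normK ?num_real//; apply: lerXn2r; rewrite ?nnegrE//.
  exact: norm_sub_le.
have mF : measurable_fun setT (fun x => (g x - b) ^+ 2) by apply: m_exp; apply: m_add mg _; mes.
have mev := @measurable_eV R n a.
have [k [k0 tgk]] := tgE.
have iFt : itg lam (fun x => (g x - b) ^+ 2 * tg x).
  apply: (@itg_dom _ _ _ _ (fun x => k * (B ^+ 2 * gaus sg x))).
  - apply: m_mul mF _; rewrite (_ : tg = fun x => k * gaus sg x); last exact/funext.
    by apply: m_mul; [mes|exact: measurable_gaus].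
  - by apply: itgZ; exact: itgZ.
  move=> x; rewrite ger0_norm; last by rewrite tgk; apply: mulr_ge0 => //; exact: mulr_ge0 (ltW k0) (gs0 x).
  rewrite tgk mulrCA; apply: (ler_wpM2l (ltW k0)); exact: (ler_wpM2r (gs0 x) (FB x)).
have iw := itg_wly a0 a1 t0 mf f0 fB b0 bB.
have iS := itg_sqnG a0 n0 t0 mf f0 fB.
set D := \int[lam]_x (sqn (Gm x) * eV x).
have Lw := lyapunov_ineq a0 a1 n0 t0 mf f0 fB b0 bB; rewrite -/D in Lw.
have Lt : \int[lam]_x ((g x - b) ^+ 2 * tg x) <= 72 * sg * D.
  have gp := gaussian_poincare n0 t0 sg0 mf f0 fB; rewrite -/b in gp.
  have iFg : itg lam (fun x => gaus sg x * (g x - b) ^+ 2).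
    apply: (@itg_weight _ _ _ lam (gaus sg) igs gs0 (fun x => (g x - b) ^+ 2) (B ^+ 2) mF) => x.
    by rewrite ger0_norm.
  have -> : \int[lam]_x ((g x - b) ^+ 2 * tg x) = \int[lam]_x (k * (gaus sg x * (g x - b) ^+ 2)).
    by apply: eq_Rint => x; rewrite tgk; ring.
  rewrite RintZ//; apply: (le_trans (ler_wpM2l (ltW k0) gp)).
  rewrite mulrCA ler_wpM2l//; first by rewrite mulr_ge0// ltW.
  (* As [tg <= eV] everywhere, the Dirichlet integral of the tangent Gaussian is at most that of
     exp(-V), with no loss of constant. *)
  have iGg := itg_gaus_ggrad n0 t0 sg0 mf f0 fB.
  rewrite -RintZ//; apply: le_Rint => //; first exact: itgZ.
  by move=> x; rewrite mulrA -tgk mulrC; apply: ler_wpM2l; [exact: sqn_ge0|exact: tg_le].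
set bP := be P; set q := (1 + bP * (cP / N1)) * cG.
have N0 : 0 < N1 by apply: lt_le_trans N1_ge1.
have bP0 : 0 <= bP by apply: mulr_ge0 (ltW cO0) _; apply: addr_ge0 (ltW N0) (powR_ge0 _ _).
have cP0 : 0 <= cP by apply: mulr_ge0 (powR_ge0 _ _); exact: ler0n.
have cPN0 : 0 <= cP / N1 by exact: divr_ge0 cP0 (ltW N0).
have q0 : 0 <= q by apply: mulr_ge0 (expR_ge0 _); apply: addr_ge0 => //; exact: mulr_ge0.
have mtl : measurable_fun setT (fun x : 'rV[R]_n => if P < pp x then eV x else 0).
  apply: measurable_fun_if => //.
  - by apply: measurable_fun_ltr => //; apply: measurable_pp; mes.
  - exact: measurable_funS mev.
have tl0 x : 0 <= (if P < pp x then eV x else 0) by case: ifP => // _; exact: eV_ge0.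
have itl : itg lam (fun x => B ^+ 2 * (if P < pp x then eV x else 0)).
  apply: itgZ; apply: (itg_dom mtl (itg_eV a0)) => x.
  by case: ifP => _; rewrite ?normr0 ?eV_ge0// ger0_norm ?eV_ge0.
have -> : tail P = (\int[lam]_x (if P < pp x then eV x else 0))%:E.
  rewrite /tail itgK//; apply: (itg_dom mtl (itg_eV a0)) => x.
  by case: ifP => _; rewrite ?normr0 ?eV_ge0// ger0_norm ?eV_ge0.
have iF : itg lam (fun x => (g x - b) ^+ 2 * eV x).
  apply: (@itg_dom _ _ _ _ (fun x => B ^+ 2 * eV x)).
  - exact: m_mul mF mev.
  - by apply: itgZ; exact: itg_eV.
  - by move=> x; rewrite ger0_norm; [exact: ler_wpM2r (eV_ge0 _ _) _ _ (FB x)|exact: mulr_ge0 (F2 x) (eV_ge0 _ _)].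
rewrite -itgK// -EFinM -EFinD lee_fin.
have it0 : itg lam (fun x => if P < pp x then eV x else 0).
  apply: (itg_dom mtl (itg_eV a0)) => x.
  by case: ifP => _; rewrite ?normr0 ?eV_ge0// ger0_norm ?eV_ge0.
rewrite -(RintZ (B ^+ 2) it0).
have iA := itgZ bP iw; have iB := itgZ q iFt.
apply: (@le_trans _ _ (\int[lam]_x (bP * (wly a x * (g x - b) ^+ 2 * eV x) + q * ((g x - b) ^+ 2 * tg x) + B ^+ 2 * (if P < pp x then eV x else 0)))).
  apply: le_Rint => //; first by apply: itgD => //; exact: itgD.
  move=> x; have H := ler_wpM2l (F2 x) (eV_split x P1); rewrite -/bP -/q in H.
  apply: (le_trans H); rewrite !mulrDr.
  have h := ler_wpM2r (tl0 x) (FB x).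
  apply: lerD => //; rewrite le_eqVlt; apply/orP; left; apply/eqP; ring.
rewrite RintD//; last exact: itgD.
rewrite lerD2r RintD// !RintZ//.
have D0 : 0 <= D by apply: Rint_ge0 => x; apply: mulr_ge0; [exact: sqn_ge0|exact: eV_ge0].
have h1 := ler_wpM2l bP0 Lw; have h2 := ler_wpM2l q0 Lt.
apply: (le_trans (lerD h1 h2)).
rewrite (_ : q * (72 * sg * D) = q * (72 * sg) * D); last by ring.
rewrite -mulrDl; apply: (ler_wpM2r D0).
have c0 : 0 <= cG by exact: expR_ge0.
pose s0 := a `^ (1 - e) / (2 * a).
have s00 : 0 <= s0 by apply: divr_ge0; [exact: powR_ge0|rewrite mulr_ge0// ltW].
have -> : q * (72 * sg) = 72 * cG * s0 * (N1 + cP * bP).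
  by rewrite /q sgE -/s0; field; rewrite gt_eqF.
have Pa0 : 0 <= P `^ (1 - a) := powR_ge0 _ _.
have h3 : 0 <= 72 * cG * s0 * P `^ (1 - a).
  by apply: mulr_ge0 => //; apply: mulr_ge0 => //; apply: mulr_ge0.
rewrite /cW -/s0 /bP /be; move: h3.
move: cG (P `^ (1 - a)) N1 cO cP => c p N O C; lra.
Qed.

End weak_poincare.

(** * Decay of the q-th moment along LMC *)

Lemma Rint_rV_scale {R : realType} {n : nat} (l : R) (F : 'rV[R]_n -> R) : 0 < l ->
  (forall x, 0 <= F x) -> itg (lebesgue_rV n) F -> itg (lebesgue_rV n) (fun x => F (l *: x)) ->
  \int[lebesgue_rV n]_x F x = l ^+ n * \int[lebesgue_rV n]_x F (l *: x).
Proof.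
move=> l0 F0 iF iFl; apply/EFin_inj; rewrite EFinM !itgK//.
rewrite (ge0_integral_rV_affine 0 (lt0r_neq0 l0) (F := fun x => (F x)%:E)); first last.
- by move=> x; rewrite lee_fin.
- exact: m_EFin (itg_meas iF).
by rewrite (gtr0_norm l0); congr (_ * _)%E; apply: eq_integral => x _; rewrite addr0.
Qed.

(** The exponent q - 1 is the barycentre of q and 1 for the weights 1 - 1/(q-1) and 1/(q-1), and p
    -> u^p is convex. *)
Lemma powR_young {R : realType} (u q : R) : 0 <= u -> 2 <= q ->
  u `^ (q - 1) <= (1 - (q - 1)^-1) * u `^ q + (q - 1)^-1 * u.
Proof.
move=> u0 q2; have q1 : 0 < q - 1 by lra.
have s0 : 0 <= (q - 1)^-1 by rewrite invr_ge0 ltW.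
have s1 : (q - 1)^-1 <= 1 by rewrite invf_le1//; lra.
have [->|un] := eqVneq u 0.
  by rewrite powR0 ?gt_eqF// mulr0 addr0 mulr_ge0 ?powR_ge0// subr_ge0.
have up : 0 < u by rewrite lt_neqAle eq_sym un.
have E p : u `^ p = expR (p * ln u) by rewrite /powR gt_eqF.
rewrite -[X in _ + _ * X](powRr1 u0) !E; set l := ln u.
have T p : expR ((q - 1) * l) * (1 + (p - (q - 1)) * l) <= expR (p * l).
  rewrite (_ : p * l = (q - 1) * l + (p - (q - 1)) * l); last by ring.
  by rewrite expRD ler_pM2l ?expR_gt0// expR_ge1Dx.
have s1' : 0 <= 1 - (q - 1)^-1 by rewrite subr_ge0.
have := lerD (ler_wpM2l s1' (T q)) (ler_wpM2l s0 (T 1)).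
apply: le_trans; rewrite le_eqVlt; apply/orP; left; apply/eqP; field.
by rewrite gt_eqF.
Qed.

(** * The scalar recursion for the moment *)

Section recursion.
Context {R : realType}.
Implicit Types (k F g T eps c h S C m q x : R).

(** Half of the contraction rate [k] absorbs the part of the growth [g] proportional to F' - 1; the
    constant part of the growth and the tail [T] add up to k eps / 4. *)
Lemma recursion_step k F (F' : R) g T eps : 0 <= k -> eps <= 2^-1 -> 0 <= F' - 1 ->
  F - 1 + k * (F' - 1) <= g * F' - 1 + k * T -> T <= eps / 8 -> g <= 1 + k * eps / 8 -> 0 <= eps ->
  F - 1 <= (1 - k / 2) * (F' - 1) + k * (eps / 4).
Proof.
move=> k0 e1 F0 H T1 g1 e0.
have h1 := ler_wpM2l k0 T1; have F1 : 0 <= F' by lra.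
have h2 := ler_wpM2r F1 g1.
have h3 : k * eps / 8 * (F' - 1) <= k / 2 * (F' - 1).
  by apply: ler_wpM2r => //; have := ler_wpM2l k0 e1; lra.
by lra.
Qed.

Lemma recursion_sum (G : nat -> R) k eps N : 0 <= k -> k <= 1 -> 0 <= eps ->
  (forall j, (j < N)%N -> G j.+1 <= (1 - k / 2) * G j + k * (eps / 4)) ->
  forall j, (j <= N)%N -> G j <= (1 - k / 2) ^+ j * G 0%N + eps / 2.
Proof.
move=> k0 k1 e0 H; elim=> [_|j IH jN]; first by rewrite expr0 mul1r lerDl; lra.
apply: (le_trans (H _ jN)); have k2 : 0 <= 1 - k / 2 by lra.
have := ler_wpM2l k2 (IH (ltnW jN)); rewrite exprS -mulrA.
by move: (_ ^+ j * G 0%N) => w; lra.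
Qed.

Lemma eta_bound c h S C m q eps : 0 < h -> 0 < S -> 16 * (q - 1) * C * h * m ^+ 2 * S <= c * eps ->
  2 * (q - 1) * (C * h ^+ 2 * m ^+ 2) <= c * h / S * eps / 8.
Proof.
move=> h0 S0 H; rewrite (_ : c * h / S * eps / 8 = c * eps * h / (8 * S)); last by field; rewrite gt_eqF.
rewrite ler_pdivlMr ?mulr_gt0//; have := ler_wpM2r (ltW h0) H; lra.
Qed.

Lemma growth_bound (d : R) q x : 0 <= d -> 0 <= q - 1 -> 2 * (q - 1) * d <= x -> x <= 1 -> (1 + d) `^ (q - 1) <= 1 + x.
Proof.
move=> d0 q1 dx x1; set z := (q - 1) * d; have z0 : 0 <= z by rewrite mulr_ge0.
have zx : 2 * z <= x by move: dx; rewrite /z; lra.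
apply: (@le_trans _ _ (expR z)).
  have -> : expR z = expR d `^ (q - 1) by rewrite -expRM /z mulrC.
  by apply: (ge0_ler_powR q1); rewrite ?nnegrE ?expR_ge0 ?addr_ge0// expR_ge1Dx.
apply: (@le_trans _ _ (1 + 2 * z)); last by lra.
rewrite -[X in expR X]opprK expRN invf_ple ?posrE ?expR_gt0//; last by lra.
apply: (le_trans _ (expR_ge1Dx _)); rewrite -[_^-1]mul1r ler_pdivrMr; last by lra.
by nra.
Qed.
End recursion.

(** * Contraction of the q-th moment and its iteration *)

Section decay.
Context {R : realType} {n : nat}.
Variables (a : R) (a0 : 0 < a) (a1 : a < 1) (n0 : (0 < n)%N).
Local Notation lam := (@lebesgue_rV R n).
Local Notation V := (V_alpha n a).
Local Notation eV := (@eV R n a).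
Implicit Types (x y : 'rV[R]_n).

Definition ZV : R := \int[lam]_x eV x.

Let mev : measurable_fun setT eV. Proof. exact: measurable_eV. Qed.
Let iev : itg lam eV. Proof. exact: itg_eV. Qed.
Let ev0 x : 0 <= eV x. Proof. exact: eV_ge0. Qed.

Lemma ZV_gt0 : 0 < ZV.
Proof.
have [k [k0 tk]] := tgE a0 a1 n0.
have sg0 : 0 < sg a (n := n).
  have vm0 : 0 < vm a (n := n) by rewrite /vm divr_gt0// ltr0n.
  by rewrite /sg divr_gt0 ?powR_gt0// mulr_gt0// mulr_gt0.
apply: (lt_le_trans k0); rewrite -[k]mulr1 -(@Rint_gaus R n _ sg0) -RintZ; last exact: itg_gaus.
apply: le_Rint => //; first by apply: itgZ; exact: itg_gaus.
by move=> x; rewrite -tk; exact: tg_le.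
Qed.

Lemma itg_eVw (w : 'rV[R]_n -> R) (B : R) : measurable_fun setT w -> (forall x, `|w x| <= B) ->
  itg lam (fun x => eV x * w x).
Proof. exact: (itg_weight iev ev0). Qed.

(** The dilation by 2^(1/a) doubles |x|^a, and V lies between |x|^a and 1 + |x|^a: halving V thus
    costs the Jacobian 2^(n/a) and a factor e. *)
Lemma half_mass : \int[lam]_x expR (- (2^-1 * V x)) <= 2 `^ (n%:R / a) * expR 1 * ZV.
Proof.
pose l : R := 2 `^ a^-1; have l0 : 0 < l by exact: powR_gt0.
have ih : itg lam (fun x => expR (- (2^-1 * V x))).
  have := @itg_pp_exp R n a a0 2^-1 0; rewrite (_ : (fun x => _) = (fun x => expR (- (2^-1 * V x)))).
    by apply; rewrite invr_gt0.
  by apply/funext => x; rewrite expr0 mul1r.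
have mh : measurable_fun setT (fun x => expR (- (2^-1 * V x))) := itg_meas ih.
have ihl : itg lam (fun x => expR (- (2^-1 * V (l *: x)))).
  apply: (itg_scale (F := fun x => expR (- (2^-1 * V x)))) => //; by rewrite gt_eqF.
have -> : \int[lam]_x expR (- (2^-1 * V x)) = l ^+ n * \int[lam]_x expR (- (2^-1 * V (l *: x))).
  by apply: (Rint_rV_scale (F := fun x => expR (- (2^-1 * V x)))) => //; move=> x; exact: expR_ge0.
have -> : l ^+ n = 2 `^ (n%:R / a).
  by rewrite -powR_mulrn ?(ltW l0)// /l -powRrM mulrC.
rewrite -mulrA; apply: ler_wpM2l; first exact: powR_ge0.
rewrite -RintZ//; apply: le_Rint => //; first exact: itgZ.
move=> x; rewrite -expRD ler_expR.
have s0 := sqn_ge0 x; have c0 : 0 <= a / 2 by rewrite divr_ge0// ltW.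
have la : (l ^+ 2) `^ (a / 2) = 2.
  rewrite -powR_mulrn ?(ltW l0)// /l -!powRrM (_ : a^-1 * _ = 1) ?powRr1//.
  by field; rewrite gt_eqF.
have h1 : 2 * sqn x `^ (a / 2) <= V (l *: x).
  rewrite V_alphaE -[X in X * _]la -powRM ?sqr_ge0//.
  apply: (ge0_ler_powR c0); rewrite ?nnegrE; [by rewrite mulr_ge0 ?sqr_ge0|exact: ltW (pp_gt0 _)|].
  by rewrite /pp sqnZ lerDr.
have h2 : V x <= 1 + sqn x `^ (a / 2).
  rewrite V_alphaE /pp; have [->|sn] := eqVneq (sqn x) 0.
    by rewrite addr0 powR1 lerDl powR_ge0.
  have sp : 0 < sqn x by rewrite lt_neqAle eq_sym sn.
  have e0 (z : R) : 0 < z -> z `^ (a / 2) = z * z `^ (a / 2 - 1).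
    move=> z0; rewrite powRB; last by apply/implyP => _; rewrite gt_eqF.
    by rewrite powRr1 ?(ltW z0)// [RHS]mulrC divfK// gt_eqF.
  have s1 : 0 < 1 + sqn x by rewrite ltr_pwDl.
  have c1 : a / 2 - 1 <= 0 by have := a1; lra.
  rewrite e0// (e0 (sqn x))// mulrDl mul1r; apply: lerD.
    rewrite -[leRHS](powRr0 (1 + sqn x)); apply: ler_powR => //; lra.
  apply: ler_wpM2l => //.
  rewrite -[a / 2 - 1]opprK !(powRN _ (- _)) lef_pV2 ?posrE ?powR_gt0//.
  by apply: ge0_ler_powR; rewrite ?nnegrE ?oppr_ge0//; lra.
by lra.
Qed.

Definition tau (P : R) : R := expR (1 - P `^ (a / 2) / 2) * 2 `^ (n%:R / a).

(** A Chernoff bound: where V exceeds P^(a/2), half of exp(-V) is bounded by its value at this level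
    and [half_mass] integrates the other half. *)
Lemma tail_le (P : R) : 0 <= P -> (tail (n := n) a P <= (tau P * ZV)%:E)%E.
Proof.
move=> P0; set v := P `^ (a / 2).
have ih : itg lam (fun x => expR (- (2^-1 * V x))).
  have := @itg_pp_exp R n a a0 2^-1 0; rewrite (_ : (fun x => _) = (fun x => expR (- (2^-1 * V x)))).
    by apply; rewrite invr_gt0.
  by apply/funext => x; rewrite expr0 mul1r.
have mtl : measurable_fun setT (fun x : 'rV[R]_n => if P < pp x then eV x else 0).
  apply: measurable_fun_if => //.
  - by apply: measurable_fun_ltr => //; apply: measurable_pp; mes.
  - exact: measurable_funS mev.
apply: (le_trans (ge0_int_le lam mtl (itg_meas (itgZ (expR (- (v / 2))) ih)) _ _)).
- by move=> x; case: ifP.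
- move=> x; case: ltP => Px; last by rewrite mulr_ge0 ?expR_ge0.
  rewrite -expRD ler_expR; have : v <= V x.
    rewrite V_alphaE; apply: ge0_ler_powR; rewrite ?nnegrE ?(ltW (pp_gt0 _)) ?(ltW Px)//.
    by rewrite divr_ge0// ltW.
  by lra.
rewrite -itgK; last exact: itgZ.
rewrite lee_fin RintZ//; apply: (le_trans (ler_wpM2l (expR_ge0 _) half_mass)).
rewrite /tau -/v le_eqVlt; apply/orP; left; apply/eqP.
by rewrite expRD -mulNr; ring.
Qed.

Section one_step_decay.
Variables (q h : R) (q2 : 2 <= q) (h0 : 0 < h) (hn : h * n%:R <= 1).
Local Notation step := (step a h).
Local Notation dl := (@dl R n h).
Variables (u : 'rV[R]_n -> R) (M : R).
Hypothesis (mu : measurable_fun setT u) (u0 : forall x, 0 <= u x) (uM : forall x, u x <= M).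
Hypothesis (u1 : \int[lam]_x (eV x * u x) = ZV).
Local Notation h' := (h * n%:R / (n%:R + 1)).

Let q0 : 0 <= q. Proof. by move: q2; lra. Qed.
Let M0 : 0 <= M. Proof. exact: le_trans (u0 0) (uM 0). Qed.
Let f x := u x `^ (q / 2).
Let B := M `^ (q / 2).

Let mf : measurable_fun setT f. Proof. exact: measurable_powRf. Qed.
Let f0 x : 0 <= f x. Proof. exact: powR_ge0. Qed.
Let fB x : f x <= B.
Proof. by apply: ge0_ler_powR; rewrite ?nnegrE// divr_ge0. Qed.
Let h'0 : 0 < h'.
Proof. by rewrite divr_gt0// ?mulr_gt0 ?ltr0n// addr_gt0 ?ltr0n. Qed.
Let B2 : B ^+ 2 = M `^ q.
Proof. by rewrite /B -powR_mulrn ?powR_ge0// -powRrM; congr (_ `^ _); field. Qed.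
Let f2 x : f x ^+ 2 = u x `^ q.
Proof. by rewrite /f -powR_mulrn ?powR_ge0// -powRrM; congr (_ `^ _); field. Qed.
Let Mq x : u x `^ q <= M `^ q. Proof. by apply: ge0_ler_powR; rewrite ?nnegrE. Qed.
Let mgv : measurable_fun setT (gvar h' f). Proof. exact: measurable_gvar. Qed.
Let gv0 x : 0 <= gvar h' f x. Proof. exact: gvar_ge0. Qed.
Let igv : itg lam (fun x => eV x * gvar h' f x).
Proof.
apply: (itg_eVw (B := B ^+ 2) mgv) => x; rewrite ger0_norm//.
exact: (gvar_le h'0 mf f0 fB).
Qed.

Lemma step_int : \int[lam]_y (eV y * step u y `^ q) + expR (- (5 * q)) * \int[lam]_y (eV y * gvar h' f y) <=
  (1 + dl) `^ (q - 1) * \int[lam]_x (eV x * u x `^ q).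
Proof.
have muq : measurable_fun setT (fun x => u x `^ q) by exact: measurable_powRf.
have uq0 x : 0 <= u x `^ q by exact: powR_ge0.
have ms := measurable_step a h mu u0.
have su y : step u y <= (1 + dl) * M by exact: (step_le a0 a1 n0 h0 hn mu u0 uM).
have s0 y : 0 <= step u y by exact: step_ge0.
have isq : itg lam (fun y => eV y * step u y `^ q).
  apply: (itg_eVw (B := ((1 + dl) * M) `^ q)); first exact: measurable_powRf.
  move=> x; rewrite ger0_norm ?powR_ge0//; apply: ge0_ler_powR; rewrite ?nnegrE//.
  exact: le_trans (s0 x) (su x).
have msq := measurable_step a h muq uq0.
have isuq : itg lam (fun y => eV y * step (fun x => u x `^ q) y).
  apply: (itg_eVw (B := (1 + dl) * M `^ q) msq) => x.
  rewrite ger0_norm; last exact: step_ge0.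
  exact: (step_le a0 a1 n0 h0 hn muq uq0 Mq).
have iuq : itg lam (fun y => eV y * u y `^ q).
  by apply: (itg_eVw (B := M `^ q)) => // x; rewrite ger0_norm.
have E : \int[lam]_y (eV y * step (fun x => u x `^ q) y) = \int[lam]_x (eV x * u x `^ q).
  apply/EFin_inj; rewrite !itgK//.
  exact: (step_mass a0 a1 n0 h0 hn muq uq0 Mq).
rewrite -E -(RintZ _ igv) -(RintZ _ isuq) -RintD//; last exact: itgZ.
apply: le_Rint; [by apply: itgD => //; exact: itgZ|exact: itgZ|].
move=> y; have := step_pow a0 a1 n0 h0 hn mu u0 uM y q2; rewrite -/(step (fun x => u x `^ q) y) => H.
by have := ler_wpM2l (ev0 y) H; rewrite mulrDr mulrCA [X in _ <= X]mulrCA.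
Qed.


Let iuq : itg lam (fun y => eV y * u y `^ q).
Proof.
by apply: (itg_eVw (B := M `^ q)); [exact: measurable_powRf|move=> x; rewrite ger0_norm ?powR_ge0].
Qed.

Let ief : itg lam (fun y => eV y * f y).
Proof. by apply: (itg_eVw (B := B)) => // x; rewrite ger0_norm. Qed.

Let ieu : itg lam (fun y => eV y * u y).
Proof. by apply: (itg_eVw (B := M)) => // x; rewrite ger0_norm. Qed.

(* [u^(q/2) = u^(1/2) u^((q-1)/2)], then Cauchy-Schwarz and Young. *)
Lemma variance_lower b :
  (\int[lam]_x (eV x * u x `^ q) - ZV) / (q - 1) <= \int[lam]_x (eV x * (f x - b) ^+ 2).
Proof.
have Zp := ZV_gt0; have q1 : 0 < q - 1 by move: q2; lra.
set F := \int[lam]_x (eV x * u x `^ q); set m := \int[lam]_x (eV x * f x).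
have fB' x : `|f x| <= B by rewrite ger0_norm.
have := @weighted_var_min _ _ _ lam eV iev ev0 f B b mf fB' Zp.
rewrite -/m -/ZV (weighted_var iev ev0 (m / ZV) mf fB') -/m -/ZV.
have -> : \int[lam]_x (eV x * f x ^+ 2) = F by apply: eq_Rint => x; rewrite f2.
apply: le_trans.
have mq1 : measurable_fun setT (fun x => u x `^ (q - 1)) by exact: measurable_powRf.
have uq1 x : `|u x `^ (q - 1)| <= M `^ (q - 1).
  by rewrite ger0_norm ?powR_ge0//; apply: ge0_ler_powR; rewrite ?nnegrE// ltW.
have iq1 := itg_eVw mq1 uq1.
set I := \int[lam]_x (eV x * u x `^ (q - 1)).
have CS : m ^+ 2 <= ZV * I.
  have H (z : R) : 2 * z * m - z ^+ 2 * ZV <= I.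
    rewrite -u1 -!RintZ// -RintB; [|exact: itgZ|exact: itgZ].
    apply: le_Rint => //; first by apply: itgB; exact: itgZ.
    move=> x; rewrite mulrCA (mulrCA (z ^+ 2)) -mulrBr; apply: ler_wpM2l => //.
    have -> : f x = u x `^ 2^-1 * u x `^ ((q - 1) / 2).
      rewrite /f -powRD; last by apply/implyP => /eqP; move: q2; lra.
      by congr (_ `^ _); field.
    have p1 : (u x `^ 2^-1) ^+ 2 = u x.
      by rewrite -powR_mulrn ?powR_ge0// -powRrM mulVf ?powRr1// pnatr_eq0.
    have p2 : (u x `^ ((q - 1) / 2)) ^+ 2 = u x `^ (q - 1).
      by rewrite -powR_mulrn ?powR_ge0// -powRrM; congr (_ `^ _); field.
    by have := sqr_ge0 (z * u x `^ 2^-1 - u x `^ ((q - 1) / 2)); rewrite sqrrB exprMn p1 p2; lra.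
  have := H (m / ZV).
  have -> : 2 * (m / ZV) * m - (m / ZV) ^+ 2 * ZV = m ^+ 2 / ZV by field; rewrite gt_eqF.
  by rewrite (ler_pdivrMr _ _ Zp) mulrC.
have YI : I <= (1 - (q - 1)^-1) * F + (q - 1)^-1 * ZV.
  rewrite -u1 -!RintZ// -RintD; [|exact: itgZ|exact: itgZ].
  apply: le_Rint => //; first by apply: itgD; exact: itgZ.
  move=> x; rewrite mulrCA (mulrCA (q - 1)^-1) -mulrDr; apply: ler_wpM2l => //.
  exact: powR_young.
have : m ^+ 2 / ZV <= I by rewrite (ler_pdivrMr _ _ Zp) mulrC.
rewrite (_ : 2 * (m / ZV) * m = 2 * (m ^+ 2 / ZV)); last by field; rewrite gt_eqF.
rewrite (_ : (m / ZV) ^+ 2 * ZV = m ^+ 2 / ZV); last by field; rewrite gt_eqF.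
by rewrite mulrBl; move: YI; move: ((q - 1)^-1) => s h1 h2; lra.
Qed.


Definition Swp (P : R) : R := N1 a (n := n) + P `^ (1 - a).
(** The moment contracts in one step at rate [ck * h / Swp P]. The factors come from [step_pow],
    [smoothing_cost], [variance_lower] and [var_le]. *)
Definition ck : R := expR (- (5 * q) - 5) / ((q - 1) * (1 + 3 * cW a)).

Lemma cW_ge0 : 0 <= cW a.
Proof.
have c1 : 0 <= cO a by exact: mulr_ge0 (ler0n R 256) (powR_ge0 _ _).
have c2 : 0 <= cP a by exact: mulr_ge0 (ler0n R 9) (powR_ge0 _ _).
have c3 : 0 <= cG a by exact: expR_ge0.
have c4 : 0 <= a `^ (1 - 2 / a) / (2 * a) by apply: divr_ge0 (powR_ge0 _ _) _; rewrite mulr_ge0// ltW.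
apply: (addr_ge0 c1); apply: (mulr_ge0 (mulr_ge0 (mulr_ge0 (ler0n R 72) c3) c4)).
exact: (addr_ge0 ler01 (mulr_ge0 c2 c1)).
Qed.

Lemma Swp_ge1 P : 1 <= Swp P.
Proof.
rewrite /Swp; apply: (@le_trans _ _ (N1 a (n := n))); last by rewrite lerDl powR_ge0.
rewrite /N1 -[leLHS](powRr0 n%:R); apply: ler_powR; first by rewrite ler1n.
by rewrite subr_ge0 ler_pdivlMr// mul1r; have := a1; lra.
Qed.

(** [smoothing_cost] replaces f by its smoothing, the weak Poincare inequality bounds the latter by
    its gradient, and [ggrad_le] returns to the local variance with a factor 1/h. That local
    variance is what [step_int] gains in one step. *)
Lemma var_le (P : R) : 1 <= P -> exists b,
  expR (-5) * \int[lam]_x (eV x * (f x - b) ^+ 2) <=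
  (1 + 3 * cW a) * Swp P / h * \int[lam]_x (eV x * gvar h' f x) + M `^ q * (tau P * ZV).
Proof.
move=> P1; have [b [b0 bB W]] := weak_poincare_gsm a0 a1 n0 h'0 mf f0 fB P1; exists b.
have nR : 0 < n%:R :> R by rewrite ltr0n.
have n1 : 1 <= n%:R :> R by rewrite ler1n.
have h'h : h' <= h by rewrite ler_pdivrMr ?addr_gt0// mulrDr mulr1 lerDl ltW.
have h'2 : h <= 2 * h'.
  by rewrite mulrA ler_pdivlMr ?addr_gt0//; have := ler_wpM2l (ltW h0) n1; lra.
have h'n : h' * n%:R <= 1 by apply: le_trans hn; rewrite ler_pM2r.
have h1 : h <= 1 by apply: le_trans hn; rewrite ler_peMr// ltW.
have SC := @smoothing_cost R n a a0 a1 n0 h' h'0 h'n f B b mf f0 fB.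
have fB' x : `|f x - b| <= B by apply: norm_sub_le.
have i1 : itg lam (fun x => eV x * (f x - b) ^+ 2).
  apply: (itg_eVw (B := B ^+ 2)); first by apply: m_exp; apply: m_add mf _; mes.
  by move=> x; rewrite normrX; apply: lerXn2r; rewrite ?nnegrE// powR_ge0.
have B0 : 0 <= B by exact: powR_ge0.
have iS := itg_sqnG a0 n0 h'0 mf f0 fB.
have D2 : \int[lam]_x (sqn (ggrad h' f x) * eV x) <= 3 / (2 * h') * \int[lam]_x (eV x * gvar h' f x).
  rewrite -RintZ//; apply: le_Rint => //; first exact: itgZ.
  move=> x; rewrite mulrC mulrCA; apply: ler_wpM2l => //; exact: (ggrad_le n0 h'0 mf f0 fB).
rewrite -lee_fin EFinM itgK//.
have E1 : (\int[lam]_x (eV x * (f x - b) ^+ 2)%:E = \int[lam]_x ((f x - b) ^+ 2 * eV x)%:E)%E.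
  by apply: eq_int => x; rewrite mulrC.
rewrite E1; apply: (le_trans SC).
have E2 : (\int[lam]_y (gvar h' f y * eV y)%:E = (\int[lam]_x (eV x * gvar h' f x))%:E)%E.
  by rewrite itgK//; apply: eq_int => x; rewrite mulrC.
rewrite E2 -B2.
have TL := tail_le (le_trans ler01 P1).
apply: (@le_trans _ _ ((\int[lam]_x (eV x * gvar h' f x))%:E +
  ((cW a * Swp P * (3 / (2 * h') * \int[lam]_x (eV x * gvar h' f x)))%:E + (B ^+ 2)%:E * (tau P * ZV)%:E))%E).
  apply: leeD => //; apply: (le_trans W); apply: leeD.
    rewrite lee_fin; apply: ler_wpM2l => //; apply: mulr_ge0 cW_ge0 _.
    exact: le_trans (Swp_ge1 P).
  by apply: lee_wpmul2l TL; rewrite lee_fin sqr_ge0.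
rewrite -EFinM -!EFinD lee_fin addrA lerD2r.
set G := \int[lam]_x (eV x * gvar h' f x).
have G0 : 0 <= G by apply: Rint_ge0 => x; exact: mulr_ge0.
rewrite (_ : G + _ = (1 + cW a * Swp P * (3 / (2 * h'))) * G); last by ring.
apply: ler_wpM2r => //.
rewrite ler_pdivlMr// mulrDl mul1r.
have S1 := Swp_ge1 P; have cw := cW_ge0.
have h3 : cW a * Swp P * (3 / (2 * h')) * h <= 3 * cW a * Swp P.
  rewrite -mulrA (_ : 3 * cW a * Swp P = cW a * Swp P * 3); last by ring.
  apply: ler_wpM2l; first by apply: mulr_ge0 cw _; apply: le_trans S1.
  by rewrite mulrAC ler_pdivrMr ?mulr_gt0//; move: h'2; lra.
by move: h3 S1 h1; lra.
Qed.

Let F0 := \int[lam]_x (eV x * u x `^ q) / ZV.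
Let F1 := \int[lam]_x (eV x * step u x `^ q) / ZV.

Lemma one_step (P : R) : 1 <= P ->
  F1 - 1 + ck * h / Swp P * (F0 - 1) <= ((1 + dl) `^ (q - 1)) * F0 - 1 +
    ck * h / Swp P * ((q - 1) * expR 5 * M `^ q * tau P).
Proof.
move=> P1; have [b Vb] := var_le P1; have VL := variance_lower b.
have Zp := ZV_gt0; have SI := step_int.
set G := \int[lam]_x (eV x * gvar h' f x) in Vb SI.
set J := \int[lam]_x (eV x * (f x - b) ^+ 2) in Vb VL.
set I := \int[lam]_x (eV x * u x `^ q) in VL SI.
set I1 := \int[lam]_x (eV x * step u x `^ q) in SI.
have S1 := Swp_ge1 P; have S0 : 0 < Swp P by apply: lt_le_trans S1.
have cw := cW_ge0; have c1 : 0 < 1 + 3 * cW a by move: cw; lra.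
have q1 : 0 < q - 1 by move: q2; lra.
have ev := expR_gt0 (-5 : R); have ev' := expR_gt0 (- (5 * q) : R).
pose k := h / ((1 + 3 * cW a) * Swp P).
have k0 : 0 < k by rewrite divr_gt0// mulr_gt0.
(* [k G >= e^-5 J - M^q tau Z] rescaled *)
have L1 : k * (expR (-5) * ((I - ZV) / (q - 1))) <= G + k * (M `^ q * (tau P * ZV)).
  have H : expR (-5) * ((I - ZV) / (q - 1)) <= (1 + 3 * cW a) * Swp P / h * G + M `^ q * (tau P * ZV).
    by apply: le_trans Vb; rewrite ler_pM2l.
  have := ler_wpM2l (ltW k0) H; rewrite mulrDr (mulrA k _ G).
  by rewrite (_ : k * ((1 + 3 * cW a) * Swp P / h) = 1) ?mul1r// /k; field; rewrite !gt_eqF.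
have L2 := ler_wpM2l (ltW ev') L1.
have ckE : ck * h / Swp P = expR (- (5 * q)) * k * expR (-5) / (q - 1).
  by rewrite /ck /k expRD; field; rewrite !gt_eqF.
have e55 : expR (-5) * expR 5 = 1 :> R by rewrite -expRD addNr expR0.
have R1 : ck * h / Swp P * ((q - 1) * expR 5 * M `^ q * tau P) = expR (- (5 * q)) * (k * (M `^ q * tau P)).
  rewrite ckE (_ : _ / (q - 1) * _ = expR (- (5 * q)) * (k * (M `^ q * tau P)) * (expR (-5) * expR 5)); last by field; rewrite gt_eqF.
  by rewrite e55 mulr1.
rewrite R1 ckE /F1 /F0 -/I -/I1.
rewrite -(ler_pM2r Zp).
rewrite (_ : (_ + _) * ZV = I1 - ZV + expR (- (5 * q)) * (k * (expR (-5) * ((I - ZV) / (q - 1))))); last by field; rewrite !gt_eqF.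
rewrite [leRHS](_ : _ = (1 + dl) `^ (q - 1) * I - ZV + expR (- (5 * q)) * (k * (M `^ q * (tau P * ZV)))); last by field; rewrite gt_eqF.
by move: SI L2; lra.
Qed.

End one_step_decay.

Fixpoint iter_step (h : R) (u : 'rV[R]_n -> R) (j : nat) : 'rV[R]_n -> R :=
  if j is i.+1 then step a h (iter_step h u i) else u.

Section iteration.
Variables (q h eps r rho : R) (q2 : 2 <= q) (h0 : 0 < h) (hn : h * n%:R <= 1).
Hypothesis (eps0 : 0 < eps) (epsq : eps <= 2^-1) (r0 : 0 <= r).
Variables (u : 'rV[R]_n -> R).
Hypothesis (mu : measurable_fun setT u) (u0 : forall x, 0 <= u x) (uM : forall x, u x <= expR r).
Hypothesis (u1 : \int[lam]_x (eV x * u x) = ZV).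
Hypothesis (urho : \int[lam]_x (eV x * u x `^ q) <= expR ((q - 1) * rho) * ZV).
Variable N : nat.
Local Notation dl := (@dl R n h).
Local Notation un := (iter_step h u).
Hypothesis Ndl : N%:R * dl <= 1.

Lemma iter_stepP j : [/\ measurable_fun setT (un j), forall x, 0 <= un j x,
  forall x, un j x <= (1 + dl) ^+ j * expR r & \int[lam]_x (eV x * un j x) = ZV].
Proof.
elim: j => [|j [mj j0 jM j1]]; first by split => // x; rewrite expr0 mul1r.
split=> /=.
- exact: measurable_step.
- by move=> x; exact: step_ge0.
- by move=> x; rewrite exprS -mulrA; exact: (step_le a0 a1 n0 h0 hn mj j0 jM).
rewrite -j1; have M0 : 0 <= (1 + dl) ^+ j * expR r by exact: le_trans (j0 0) (jM 0).
have mB := measurable_step a h mj j0.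
have d0 : 0 <= dl by exact: dl_ge0.
apply/EFin_inj; rewrite !itgK.
- exact: (step_mass a0 a1 n0 h0 hn mj j0 jM).
- by apply: (itg_eVw mj) => x; rewrite ger0_norm.
apply: (itg_eVw mB (B := (1 + dl) * ((1 + dl) ^+ j * expR r))) => x.
rewrite ger0_norm; first exact: (step_le a0 a1 n0 h0 hn mj j0 jM).
exact: step_ge0.
Qed.

(** The excess masses compound to at most (1 + dl)^N <= exp(N dl) <= e. *)
Lemma iter_bound j x : (j <= N)%N -> un j x <= expR (1 + r).
Proof.
move=> jN; have [_ _ jM _] := iter_stepP j; apply: (le_trans (jM x)).
have d0 : 0 <= dl by exact: dl_ge0.
rewrite expRD; apply: ler_wpM2r; first exact: expR_ge0.
apply: (@le_trans _ _ (expR dl ^+ j)).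
  by apply: lerXn2r; rewrite ?nnegrE ?expR_ge0 ?addr_ge0// expR_ge1Dx.
rewrite -expRM_natr ler_expR mulrC; apply: le_trans Ndl.
by apply: ler_wpM2r => //; rewrite ler_nat.
Qed.

(* The level [V = vlev] beyond which the tail of pi is negligible even after
   multiplication by the q-th power of the sup norm of the density. *)
Definition vC : R := 2 * (q + ln (8 * (q - 1)) + 8 + a^-1).
Definition vlev : R := vC * (n%:R + r + ln eps^-1).
Definition Plev : R := vlev `^ (2 / a).
Definition Slev : R := Swp Plev.

Let q1 : 0 < q - 1. Proof. by move: q2; lra. Qed.
Let n1 : 1 <= n%:R :> R. Proof. by rewrite ler1n. Qed.
Let L0 : 0 <= ln eps^-1.
Proof. by rewrite ln_ge0// invf_ge1//; move: epsq; lra. Qed.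
Let lq0 : 0 <= ln (8 * (q - 1)). Proof. by rewrite ln_ge0//; move: q2; lra. Qed.
Let vC2 : 2 <= vC.
Proof. by rewrite /vC; have : 0 <= a^-1 by [rewrite invr_ge0 ltW]; move: q2 lq0; lra. Qed.
Let vl1 : 1 <= vlev.
Proof.
rewrite /vlev; have : 1 <= n%:R + r + ln eps^-1 by move: n1 r0 L0; lra.
by move: vC2; move: (n%:R + r + _) => z; nra.
Qed.
Let P1 : 1 <= Plev.
Proof.
rewrite /Plev -[leLHS](powRr0 vlev); apply: ler_powR => //.
by rewrite divr_ge0// ltW.
Qed.

(** The terms of [vC] are made for this: [q] pays for the sup norm to the power q, the logarithm for
    the prefactor, 8 for the constants and [ln eps^-1], and 1/a for 2^(n/a); the factor 2 in front
    compensates the half in [tau]. *)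
Lemma tau_small : (q - 1) * expR 5 * expR (1 + r) `^ q * tau Plev <= eps / 8.
Proof.
have Pv : Plev `^ (a / 2) = vlev.
  rewrite /Plev -powRrM (_ : 2 / a * (a / 2) = 1); last by field; rewrite gt_eqF.
  by rewrite powRr1// (le_trans ler01).
rewrite /tau Pv -expRM.
have e2 : 2 `^ (n%:R / a) <= expR (n%:R / a).
  have -> : expR (n%:R / a) = expR 1 `^ (n%:R / a) by rewrite -expRM mul1r.
  apply: ge0_ler_powR; rewrite ?nnegrE ?expR_ge0//.
    by rewrite divr_ge0// ltW.
  by have := @expR_ge1Dx R 1; rewrite -[1 + 1]/(2%:R).
have qe : q - 1 = expR (ln (8 * (q - 1))) / 8.
  by rewrite lnK ?posrE ?mulr_gt0// mulrC mulKf// pnatr_eq0.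
have ee : eps = expR (- ln eps^-1) by rewrite lnV ?posrE// opprK lnK.
apply: (@le_trans _ _ ((q - 1) * expR 5 * expR ((1 + r) * q) * (expR (1 - vlev / 2) * expR (n%:R / a)))).
  apply: ler_wpM2l; first by rewrite !mulr_ge0 ?expR_ge0// ltW.
  by apply: ler_wpM2l; first exact: expR_ge0.
rewrite {1}qe [X in _ <= X / 8]ee [leLHS](_ : _ = expR (ln (8 * (q - 1))) * (expR 5 * (expR ((1 + r) * q) * (expR (1 - vlev / 2) * expR (n%:R / a)))) / 8); last by ring.
rewrite ler_pM2r ?invr_gt0// -!expRD ler_expR.
have ai : 0 <= a^-1 by rewrite invr_ge0 ltW.
rewrite /vlev /vC.
move: (ln (8 * (q - 1))) lq0 (ln eps^-1) L0 (n%:R) n1 a^-1 ai => l l0 L LL m m1 b b0.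
have h1 : 0 <= (m - 1) * (q + l + 8) by rewrite mulr_ge0; move: q2 m1; lra.
have h2 : 0 <= r * (l + 8 + b) by rewrite mulr_ge0//; lra.
have h3 : 0 <= L * (q + l + 7 + b) by rewrite mulr_ge0//; move: q2; lra.
by move: h1 h2 h3 q2; lra.
Qed.

Hypothesis small_step : 16 * (q - 1) * CK * h * n%:R ^+ 2 * Slev <= ck q * eps.
Hypothesis long_time : 2 * (q + 1) / ck q * Slev * (rho + ln eps^-1) <= N%:R * h.
Hypothesis rho0 : 0 <= rho.

Lemma ck_gt0 : 0 < ck q.
Proof.
by rewrite /ck divr_gt0 ?expR_gt0// mulr_gt0// ltr_pwDl// mulr_ge0// cW_ge0.
Qed.

Let G j : R := \int[lam]_x (eV x * un j x `^ q) / ZV - 1.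

Let S1 : 1 <= Slev. Proof. exact: Swp_ge1. Qed.
Let S0 : 0 < Slev. Proof. exact: lt_le_trans S1. Qed.
Let h1 : h <= 1. Proof. by apply: le_trans hn; rewrite ler_peMr// ltW. Qed.

Lemma ck_le1 : ck q <= 1.
Proof.
have cw := cW_ge0; rewrite /ck ler_pdivrMr; last by rewrite mulr_gt0// ltr_pwDl// mulr_ge0.
rewrite mul1r; apply: (@le_trans _ _ 1); first by rewrite -[leRHS]expR0 ler_expR; move: q2; lra.
by rewrite -[leLHS]mulr1; apply: ler_pM => //; [move: q2; lra|rewrite lerDl mulr_ge0].
Qed.

Let kap : R := ck q * h / Slev.
Let kap0 : 0 < kap. Proof. by rewrite divr_gt0// mulr_gt0// ck_gt0. Qed.
Let kap1 : kap <= 1.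
Proof.
rewrite /kap ler_pdivrMr// mul1r; apply: le_trans S1.
by rewrite -[leRHS]mulr1; apply: ler_pM => //; [exact/ltW/ck_gt0|exact: ltW|exact: ck_le1].
Qed.

Let ke : kap * eps <= 1.
Proof. by rewrite -[leRHS]mulr1; apply: ler_pM; rewrite ?(ltW kap0) ?(ltW eps0)//; move: epsq; lra. Qed.

Let growth : (1 + dl) `^ (q - 1) <= 1 + kap * eps / 8.
Proof.
apply: growth_bound; [exact: dl_ge0|exact: ltW|exact: (eta_bound h0 S0 small_step)|].
by rewrite ler_pdivrMr// mul1r (le_trans ke)// ler1n.
Qed.

Let G_ge0 j : 0 <= G j.
Proof.
have Zp := ZV_gt0; have [mj j0 jM j1] := iter_stepP j.
rewrite /G subr_ge0 ler_pdivlMr// mul1r.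
have q0 : 0 <= q by move: q2; lra.
have iq : itg lam (fun x => eV x * un j x `^ q).
  apply: (itg_eVw (B := ((1 + dl) ^+ j * expR r) `^ q)); first exact: measurable_powRf.
  move=> x; rewrite ger0_norm ?powR_ge0//; apply: ge0_ler_powR; rewrite ?nnegrE//.
  exact: le_trans (j0 x) (jM x).
have iu : itg lam (fun x => eV x * un j x).
  by apply: (itg_eVw mj) => x; rewrite ger0_norm.
have -> : ZV = \int[lam]_x (q * (eV x * un j x) + (1 - q) * eV x).
  by rewrite RintD; [rewrite !RintZ// j1 -/ZV; ring|exact: itgZ|exact: itgZ].
apply: le_Rint => //; first by apply: itgD; exact: itgZ.
move=> x; have := @powR_tangent R (un j x) 1 q (j0 x) ltr01 (le_trans (ler1n R 2) q2).
rewrite !powR1 mulr1 => /(ler_wpM2l (ev0 x)); lra.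
Qed.

Lemma G_step j : (j < N)%N -> G j.+1 <= (1 - kap / 2) * G j + kap * (eps / 4).
Proof.
move=> jN; have [mj j0 _ j1] := iter_stepP j.
have jM x : un j x <= expR (1 + r) by apply: iter_bound; exact: ltnW.
exact: (recursion_step (ltW kap0) epsq (G_ge0 j) (one_step q2 h0 hn mj j0 jM j1 P1) tau_small growth (ltW eps0)).
Qed.

Theorem iter_decay : \int[lam]_x (eV x * un N x `^ q) <= (1 + eps) * ZV.
Proof.
have Zp := ZV_gt0.
suff : G N <= eps by rewrite /G lerBlDl ler_pdivrMr.
have I := recursion_sum (ltW kap0) kap1 (ltW eps0) G_step.
apply: (le_trans (I N (leqnn N))).
rewrite -[leRHS](addrNK (eps / 2)) lerD2r (_ : eps - eps / 2 = eps / 2); last by field.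
have G0 : G 0 <= expR ((q - 1) * rho).
  by rewrite /G lerBlDl ler_pdivrMr//; apply: (le_trans urho); rewrite ler_pM2r// lerDr.
have k2 : 0 <= 1 - kap / 2 by rewrite subr_ge0 ler_pdivrMr// mul1r (le_trans kap1)// ler1n.
apply: (@le_trans _ _ (expR (- (kap / 2)) ^+ N * expR ((q - 1) * rho))).
  apply: ler_pM => //; first exact: exprn_ge0.
  by apply: lerXn2r; rewrite ?nnegrE ?expR_ge0//; apply: (le_trans _ (expR_ge1Dx _)).
rewrite -expRM_natr -expRD.
(* Write q + 1 = (q - 1) + 2: the first part cancels the initial moment exp((q - 1) rho), the second
   leaves eps^2 <= eps / 2. *)
have K : (q + 1) * (rho + ln eps^-1) <= kap / 2 * N%:R.
  have c0 := ck_gt0; have k0 : 0 <= ck q / Slev / 2 := divr_ge0 (divr_ge0 (ltW c0) (ltW S0)) (ler0n R 2).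
  have := ler_wpM2r k0 long_time.
  rewrite [leLHS](_ : _ = (q + 1) * (rho + ln eps^-1)); last by field; rewrite !gt_eqF.
  by rewrite [leRHS](_ : _ = kap / 2 * N%:R)// /kap; ring.
apply: (@le_trans _ _ (expR (- ln eps^-1 * 2%:R))).
  rewrite ler_expR; have h3 : 0 <= (q - 1) * ln eps^-1 by rewrite mulr_ge0// ltW.
  by move: K rho0 h3; lra.
rewrite expRM_natr lnV ?posrE// opprK lnK ?posrE// expr2.
by apply: ler_wpM2l => //; exact: ltW.
Qed.

End iteration.
End decay.

(** * Densities and Renyi divergences *)

Section density.
Context {d : measure_display} {T : measurableType d} {R : realType}.
Variables (nu : {finite_measure set T -> \bar R}) (mu : {sigma_finite_measure set T -> \bar R}).
Variable w : T -> R.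
Hypothesis (mw : measurable_fun setT w) (w0 : forall x, 0 <= w x).
Hypothesis nuE : forall A, measurable A -> nu A = (\int[mu]_(x in A) (w x)%:E)%E.

Lemma density_dominates : nu `<< mu.
Proof.
apply/null_content_dominatesP => A mA A0; rewrite nuE//.
by apply: null_set_integral => //; apply: measurable_funTS; exact: m_EFin.
Qed.

Lemma density_int (F : T -> \bar R) : measurable_fun setT F -> (forall x, 0 <= F x)%E ->
  (\int[nu]_x F x = \int[mu]_x (F x * (w x)%:E))%E.
Proof.
move=> mF F0; have D := density_dominates.
rewrite -(Radon_Nikodym_SigmaFinite.change_of_variables D F0 measurableT mF).
have ig := Radon_Nikodym_SigmaFinite.f_integrable D.
apply: ae_eq_integral => //.
- by apply: emeasurable_funM => //; exact: measurable_int ig.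
- by apply: emeasurable_funM => //; exact: m_EFin.
have : ae_eq mu setT (Radon_Nikodym_SigmaFinite.f nu mu) (EFin \o w).
  apply: integral_ae_eq => //; first exact: m_EFin.
  by move=> E _ mE; rewrite -Radon_Nikodym_SigmaFinite.f_integral// nuE.
by apply: filterS => x H _; rewrite H.
Qed.

Lemma density_RN : ae_eq mu setT ('d (charge_of_finite_measure nu) '/d mu) (EFin \o w).
Proof.
have D := density_dominates.
apply: integral_ae_eq => //.
- exact: Radon_Nikodym_integrable.
- exact: m_EFin.
by move=> E _ mE; rewrite -Radon_Nikodym_integral//; exact: nuE.
Qed.
End density.

(** The unfolded form of [mnormalize], with the total mass abstracted into [m] so that the default
    branch is discarded by substitution. *)
Lemma normalize_eq {T : Type} {R : realType} (m : \bar R) (Z : R) (P f : set T -> \bar R) A : m = Z%:E -> 0 < Z ->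
  ((if (m == 0) || (m == +oo) then P else fun U => f U * ((fine m)^-1)%:E) A = f A * (Z^-1)%:E)%E.
Proof. by move=> -> Z0; rewrite eqe (gt_eqF Z0). Qed.

Section gibbs.
Context {R : realType} {n : nat}.
Variables (a : R) (a0 : 0 < a) (a1 : a < 1) (n0 : (0 < n)%N).
Local Notation lam := (@lebesgue_rV R n).
Local Notation eV := (@eV R n a).
Local Notation Z := (@ZV R n a).
Local Notation pi := (pi_alpha n a).
Implicit Types (x y : 'rV[R]_n).

Let Zp : 0 < Z. Proof. exact: ZV_gt0. Qed.
Let mev : measurable_fun setT eV. Proof. exact: measurable_eV. Qed.
Let iev : itg lam eV. Proof. exact: itg_eV. Qed.
Let ev0 x : 0 <= eV x. Proof. exact: eV_ge0. Qed.

Definition wpi x : R := eV x / Z.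

Lemma measurable_wpi : measurable_fun setT wpi.
Proof. by apply: m_mul mev _; mes. Qed.

Lemma piE A : measurable A -> pi A = (\int[lam]_(x in A) (wpi x)%:E)%E.
Proof.
move=> mA; have gT : gibbs_mass (V_alpha n a) setT = Z%:E by rewrite /gibbs_mass -itgK.
transitivity (gibbs_mass (V_alpha n a) A * (Z^-1)%:E)%E.
  exact: normalize_eq gT Zp.
rewrite /gibbs_mass; under [RHS]eq_integral do rewrite /wpi mulrC EFinM.
rewrite ge0_integralZl_EFin//.
- by rewrite muleC.
- by move=> x _; rewrite lee_fin.
- by apply: measurable_funTS; exact: m_EFin.
- by rewrite invr_ge0 ltW.
Qed.

Lemma pi_int (F : 'rV[R]_n -> \bar R) : measurable_fun setT F -> (forall x, 0 <= F x)%E ->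
  (\int[pi]_x F x = \int[lam]_x (F x * (wpi x)%:E))%E.
Proof. exact: (@density_int _ _ _ pi lam wpi measurable_wpi piE). Qed.

Lemma pi_intE (w : 'rV[R]_n -> R) (B : R) : measurable_fun setT w -> (forall x, 0 <= w x) ->
  (forall x, w x <= B) -> (\int[pi]_x (w x)%:E = (\int[lam]_x (eV x * w x) / Z)%:E)%E.
Proof.
move=> mw w0 wB; rewrite pi_int; [|exact: m_EFin|by move=> x; rewrite lee_fin].
have iw : itg lam (fun x => eV x * w x) by apply: (itg_eVw a0 mw (B := B)) => x; rewrite ger0_norm.
rewrite mulrC EFinM itgK// -ge0_intZl.
- by apply: eq_integral => x _; rewrite -EFinM /wpi; congr EFin; ring.
- exact: (itg_meas iw).
- by move=> x; rewrite mulr_ge0.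
- by rewrite invr_ge0 ltW.
Qed.

Lemma pi_set_int (w : 'rV[R]_n -> R) (A : set 'rV[R]_n) : measurable_fun setT w -> (forall x, 0 <= w x) ->
  measurable A -> (\int[pi]_(x in A) (w x)%:E = \int[lam]_x (\1_A x * (eV x * w x) / Z)%:E)%E.
Proof.
move=> mw w0 mA; rewrite integral_mkcond.
rewrite (_ : (EFin \o w) \_ A = (fun x => (\1_A x * w x)%:E)); last first.
  apply/funext => x; rewrite patchE indicE.
  by case: ifP => _; rewrite ?mul1r ?mul0r.
rewrite pi_int.
- by apply: eq_integral => x _; rewrite -EFinM /wpi; congr EFin; ring.
- by apply: m_EFin; apply: m_mul mw; exact: measurable_indic.
- by move=> x; rewrite lee_fin mulr_ge0.
Qed.

Section bounded_density.
Variables (rho : probability 'rV[R]_n R) (u : 'rV[R]_n -> R) (M : R).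
Hypothesis (mu : measurable_fun setT u) (u0 : forall x, 0 <= u x) (uM : forall x, u x <= M).
Hypothesis rhoE : forall A, measurable A -> rho A = (\int[pi]_(x in A) (u x)%:E)%E.

Lemma renyi_density (q : R) : 1 < q ->
  renyi rho pi q = ((q - 1)^-1%:E * lne (\int[lam]_x (eV x * u x `^ q) / Z)%:E)%E.
Proof.
move=> q1; have D : rho `<< pi by exact: (@density_dominates _ _ _ rho pi u mu rhoE).
have q0 : q != 0 by rewrite gt_eqF// (lt_trans ltr01).
rewrite /renyi asboolT// poweR_Lnorm//; congr (_ * lne _)%E.
have ae : ae_eq pi setT ('d (charge_of_finite_measure rho) '/d pi) (EFin \o u) by exact: density_RN.
transitivity (\int[pi]_x (u x `^ q)%:E)%E.
  apply: ae_eq_integral => //.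
  - by apply: (measurableT_comp (@measurable_poweR _ q)); exact: measurableT_comp.
  - by apply: m_EFin; exact: measurable_powRf.
  apply: filterS ae => x H _ /=; rewrite H//=.
  by rewrite ger0_norm.
rewrite (pi_intE (w := fun x => u x `^ q) (B := M `^ q))//.
- exact: measurable_powRf.
- by move=> x; exact: powR_ge0.
- move=> x; apply: ge0_ler_powR; rewrite ?nnegrE//; first by rewrite ltW// (lt_trans ltr01).
  exact: le_trans (u0 x) (uM x).
Qed.

Lemma density_mass : \int[lam]_x (eV x * u x) = Z.
Proof.
have := rhoE measurableT; rewrite probability_setT (pi_intE mu u0 uM) => -[H].
by rewrite -[LHS](divfK (lt0r_neq0 Zp)) -H mul1r.
Qed.

Lemma renyi_le (q e : R) : 2 <= q -> 0 <= e ->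
  \int[lam]_x (eV x * u x `^ q) <= (1 + e) * Z -> (renyi rho pi q <= e%:E)%E.
Proof.
move=> q2 e0 H; rewrite renyi_density; last by rewrite (lt_le_trans _ q2)// ltr1n.
have q1 : 0 < q - 1 by lra.
set X := _ / Z; have X1 : X <= 1 + e by rewrite ler_pdivrMr.
(* For a nonpositive argument [lne] is [-oo] and the bound is trivial, so no lower bound on the
   moment is required here. *)
have [X0|X0] := leP X 0.
  rewrite le0_lneNy ?lee_fin// gt0_muleNy; last by rewrite lte_fin invr_gt0.
  by rewrite leNye.
rewrite lne_EFin// -EFinM lee_fin mulrC ler_pdivrMr//.
apply: (@le_trans _ _ e); last by rewrite ler_peMr//; lra.
apply: (@le_trans _ _ (ln (1 + e))); first by rewrite ler_ln ?posrE//; lra.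
by have := le_ln1Dx (lt_le_trans (ltrN10 R) e0).
Qed.


Let itg_uq p : 0 <= p -> itg lam (fun x => eV x * u x `^ p).
Proof.
move=> p0; apply: (itg_eVw a0 (B := M `^ p)); first exact: measurable_powRf.
move=> x; rewrite ger0_norm ?powR_ge0//; apply: ge0_ler_powR; rewrite ?nnegrE//.
exact: le_trans (u0 x) (uM x).
Qed.

Let itg_u : itg lam (fun x => eV x * u x).
Proof. by apply: (itg_eVw a0 mu (B := M)) => x; rewrite ger0_norm. Qed.

Lemma powR_mass_ge p : 1 <= p -> Z <= \int[lam]_x (eV x * u x `^ p).
Proof.
move=> p1; have p0 : 0 <= p by apply: le_trans p1.
have -> : Z = \int[lam]_x (p * (eV x * u x) + (1 - p) * eV x).
  by rewrite RintD; [rewrite !RintZ// density_mass -[\int[lam]_x eV x]/Z; ring|exact: itgZ|exact: itgZ].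
apply: le_Rint; [by apply: itgD; exact: itgZ|exact: itg_uq|].
move=> x; have := @powR_tangent R (u x) 1 p (u0 x) ltr01 p1.
by rewrite !powR1 mulr1 => /(ler_wpM2l (ev0 x)); lra.
Qed.

Lemma Rq_density p : 1 < p -> \int[lam]_x (eV x * u x `^ p) = expR ((p - 1) * Rq a rho p) * Z.
Proof.
move=> p1; have p10 : 0 < p - 1 by rewrite subr_gt0.
have X1 : 1 <= \int[lam]_x (eV x * u x `^ p) / Z.
  by rewrite ler_pdivlMr// mul1r powR_mass_ge// ltW.
have X0 := lt_le_trans ltr01 X1.
rewrite /Rq renyi_density// lne_EFin//= mulrA mulfV ?gt_eqF// mul1r lnK ?posrE//.
by rewrite divfK// gt_eqF.
Qed.

Lemma Rq_ge0 p : 1 < p -> 0 <= Rq a rho p.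
Proof.
move=> p1; have p10 : 0 < p - 1 by rewrite subr_gt0.
have H := powR_mass_ge (ltW p1); rewrite Rq_density// in H.
have : expR 0 <= expR ((p - 1) * Rq a rho p) by rewrite expR0 -(ler_pM2r Zp) mul1r.
by rewrite ler_expR pmulr_rge0.
Qed.

Lemma Rq_le_log p : 1 < p -> 0 < M -> Rq a rho p <= ln M.
Proof.
move=> p1 M0; have p10 : 0 < p - 1 by rewrite subr_gt0.
rewrite -(ler_pM2l p10) -ler_expR -(ler_pM2r Zp) -Rq_density//.
have -> : expR ((p - 1) * ln M) = M `^ (p - 1) by rewrite /powR gt_eqF.
rewrite -density_mass -RintZ//; apply: le_Rint; [by apply: itg_uq; rewrite ltW// (lt_trans ltr01)|exact: itgZ|].
move=> x; rewrite mulrCA; apply: ler_wpM2l => //.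
have [->|ux] := eqVneq (u x) 0; first by rewrite powR0 ?mulr0// gt_eqF// (lt_trans ltr01).
have -> : u x `^ p = u x `^ (p - 1) * u x.
  by rewrite powRB ?powRr1// ?divfK//; apply/implyP.
by apply: ler_wpM2r => //; apply: ge0_ler_powR; rewrite ?nnegrE// ltW.
Qed.

(* Cauchy-Schwarz: [u^q = u^(1/2) u^(q-1/2)]. *)
Lemma Rq_le_2q1 q : 1 < q -> Rq a rho q <= Rq a rho (2 * q - 1).
Proof.
move=> q1; have q10 : 0 < q - 1 by rewrite subr_gt0.
have p1 : 1 < 2 * q - 1 by lra.
set m := \int[lam]_x (eV x * u x `^ q); set J := \int[lam]_x (eV x * u x `^ (2 * q - 1)).
have iq : itg lam (fun x => eV x * u x `^ q) by apply: itg_uq; lra.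
have ij : itg lam (fun x => eV x * u x `^ (2 * q - 1)) by apply: itg_uq; lra.
have H (z : R) : 2 * z * m - z ^+ 2 * Z <= J.
  rewrite -density_mass -!RintZ// -RintB; [|exact: itgZ|exact: itgZ].
  apply: le_Rint => //; first by apply: itgB; exact: itgZ.
  move=> x; rewrite mulrCA (mulrCA (z ^+ 2)) -mulrBr; apply: ler_wpM2l => //.
  have -> : u x `^ q = u x `^ 2^-1 * u x `^ (q - 2^-1).
    rewrite -powRD; last by apply/implyP => /eqP; lra.
    by congr (_ `^ _); field.
  have p1' : (u x `^ 2^-1) ^+ 2 = u x.
    by rewrite -powR_mulrn ?powR_ge0// -powRrM mulVf ?powRr1// pnatr_eq0.
  have p2 : (u x `^ (q - 2^-1)) ^+ 2 = u x `^ (2 * q - 1).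
    by rewrite -powR_mulrn ?powR_ge0// -powRrM; congr (_ `^ _); field.
  by have := sqr_ge0 (z * u x `^ 2^-1 - u x `^ (q - 2^-1)); rewrite sqrrB exprMn p1' p2; lra.
have := H (m / Z).
have -> : 2 * (m / Z) * m - (m / Z) ^+ 2 * Z = m ^+ 2 / Z by field; rewrite gt_eqF.
rewrite ler_pdivrMr// /m /J !Rq_density// exprMn -expRM_natr.
rewrite (_ : expR ((2 * q - 1 - 1) * Rq a rho (2 * q - 1)) * Z * Z = expR ((2 * q - 1 - 1) * Rq a rho (2 * q - 1)) * Z ^+ 2); last by ring.
rewrite ler_pM2r ?exprn_gt0//.
by rewrite ler_expR (_ : 2 * q - 1 - 1 = (q - 1) * 2%:R); [rewrite [leRHS]mulrAC ler_pM2r// ler_pM2l|ring].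
Qed.

End bounded_density.

Section initial_density.
Variable rho : probability 'rV[R]_n R.
Hypothesis fin : (renyi_infty rho pi < +oo)%E.

(** The kernel estimates need a bound at every point, whereas the Radon-Nikodym derivative is
    bounded only almost everywhere: a finite nonnegative version is truncated at the essential
    supremum [M]. As the total mass is 1, [M >= 1], so that [Rinf = ln M] is nonnegative. *)
Lemma initial_density : exists u : 'rV[R]_n -> R,
  [/\ measurable_fun setT u, forall x, 0 <= u x, forall x, u x <= expR (Rinf a rho),
      0 <= Rinf a rho &
      forall A, measurable A -> rho A = (\int[pi]_(x in A) (u x)%:E)%E].
Proof.
have : rho `<< pi.
  by move: fin; rewrite /renyi_infty; case: asboolP.
move=> D; set g := 'd (charge_of_finite_measure rho) '/d pi.
have ig : pi.-integrable setT g by exact: Radon_Nikodym_integrable.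
have mg : measurable_fun setT g := measurable_int _ ig.
pose E := ess_sup pi (abse \o g).
have RE : renyi_infty rho pi = lne E.
  rewrite /renyi_infty asboolT// unlock /= ifT//.
  by rewrite probability_setT lte01.
have Eoo : (E < +oo)%E.
  by rewrite ltey; apply/negP => /eqP E'; move: fin; rewrite RE E' /= ltxx.
have E0 : (0 <= E)%E.
  have pT : (0 < pi setT)%E by rewrite probability_setT lte01.
  by apply: (ess_sup_gee pT); apply: nearW => x; exact: abse_ge0.
pose M := fine E; have EM : E = M%:E by rewrite /M fineK// ge0_fin_numE.
have gae : \forall x \ae pi, (`|g x| <= M%:E)%E by rewrite -EM; exact: ess_sup_ge.
pose f0 := Radon_Nikodym_SigmaFinite.f rho pi.
have f00 := Radon_Nikodym_SigmaFinite.f_ge0 D; have f0f := Radon_Nikodym_SigmaFinite.f_fin_num D.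
have if0 := Radon_Nikodym_SigmaFinite.f_integrable D.
have mf0 : measurable_fun setT f0 := measurable_int _ if0.
have gf : ae_eq pi setT g f0.
  apply: integral_ae_eq => // F _ mF.
  by rewrite -Radon_Nikodym_integral// -Radon_Nikodym_SigmaFinite.f_integral.
pose u x := Num.min (fine (f0 x)) M.
have M0 : 0 <= M by rewrite /M fine_ge0.
have mu : measurable_fun setT u.
  by apply: measurable_minr => //; apply: measurableT_comp => //; exact: fine_measurable.
have u0 x : 0 <= u x by rewrite le_min M0 andbT fine_ge0// f00.
have uM x : u x <= M by rewrite ge_min lexx orbT.
have rhoE A : measurable A -> rho A = (\int[pi]_(x in A) (u x)%:E)%E.
  move=> mA; rewrite (Radon_Nikodym_SigmaFinite.f_integral D mA).
  apply: ae_eq_integral => //.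
  - exact: measurable_funTS.
  - by apply: measurable_funTS; exact: m_EFin.
  apply: filterS2 gf gae => x H1 H2 _; have := H1 I => H3; rewrite -/f0 -H3.
  rewrite -[LHS]fineK; last by rewrite H3 f0f.
  congr EFin; rewrite /u -H3 min_l//.
  rewrite -lee_fin fineK; last by rewrite H3 f0f.
  by apply: le_trans H2; exact: lee_abs.
have M1 : 1 <= M.
  have := rhoE _ measurableT; rewrite probability_setT (pi_intE mu u0 uM) => -[->].
  rewrite ler_pdivrMr// /ZV -RintZ//; apply: le_Rint; first by apply: (itg_eVw a0 mu (B := M)) => x; rewrite ger0_norm.
    exact: itgZ.
  by move=> x; rewrite mulrC; apply: ler_wpM2r.
have RM : Rinf a rho = ln M by rewrite /Rinf RE EM lne_EFin// (lt_le_trans ltr01).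
have eM : expR (Rinf a rho) = M by rewrite RM lnK// posrE (lt_le_trans ltr01).
by exists u; split => //; rewrite ?eM// RM ln_ge0.
Qed.

End initial_density.
End gibbs.

(** * The law of the LMC iterates *)

Section joint_law.
Context {R : realType} {n : nat} {d : measure_display} {Om : measurableType d}.
Variable P : probability Om R.
Implicit Types (A : set 'rV[R]_n) (C : 'I_n -> set R).

Definition rect C : set 'rV[R]_n := [set x | forall i, C i (x ord0 i)].

Lemma rectE C : rect C = \bigcap_(i in [set: 'I_n]) (@rV_coor R n i @^-1` C i).
Proof. by apply/seteqP; split => x H => [i _|i]; exact: H. Qed.

Lemma measurable_rect C : (forall i, measurable (C i)) -> measurable (rect C).
Proof.
move=> mC; rewrite rectE; apply: fin_bigcap_measurable => [|i _]; first exact: finite_finset.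
by rewrite -[X in measurable X]setTI; exact: (@measurable_coor R n i).
Qed.

Lemma rectI C C' : rect C `&` rect C' = rect (fun i => C i `&` C' i).
Proof.
apply/seteqP; split => x; first by move=> [h1 h2] i; split; [exact: h1|exact: h2].
by move=> h; split => i; have [] := h i.
Qed.

Definition rects : set (set ('rV[R]_n * 'rV[R]_n)) :=
  [set S | exists A C, [/\ measurable A, forall i, measurable (C i) & S = A `*` rect C]].

Lemma rects_gen (S : set ('rV[R]_n * 'rV[R]_n)) : measurable S -> <<s rects >> S.
Proof.
move=> mS; pose idr : g_sigma_algebraType rects -> 'rV[R]_n * 'rV[R]_n := id.
suff : measurable_fun setT idr by move=> /(_ measurableT _ mS); rewrite setTI.
have rT : rect (fun=> setT) = setT by apply/seteqP.
apply/measurable_fun_pairP; split.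
  move=> _ A mA; rewrite setTI; apply: sub_sigma_algebra.
  exists A, (fun=> setT); split => //; rewrite rT.
  by apply/seteqP; split => // -[x y] [].
apply/measurable_fun_coorP => i _ Y mY; rewrite setTI; apply: sub_sigma_algebra.
exists setT, (fun j => if j == i then Y else setT); split => //; first by move=> j; case: ifP.
apply/seteqP; split => -[x y] /=.
  by move=> H; split => // j; case: eqP => [->|].
by move=> [_ /(_ i)]; rewrite eqxx.
Qed.

(** Uniqueness of measures on a pi-system. In [chain_law], [E] is an event about the later noises
    and [c] its probability; the second factor is tested on rectangles only, because the noise is
    specified coordinatewise. *)
Lemma joint_law (X W : Om -> 'rV[R]_n) (E : set Om) (nu ga : probability 'rV[R]_n R) (c : {nonneg R}) :
  measurable_fun setT X -> measurable_fun setT W -> measurable E ->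
  (forall A C, measurable A -> (forall i, measurable (C i)) ->
    P ([set w | A (X w) /\ rect C (W w)] `&` E) = (c%:num%:E * (nu A * ga (rect C)))%E) ->
  forall S, measurable S -> P ([set w | S (X w, W w)] `&` E) = (c%:num%:E * (nu \x ga)%E S)%E.
Proof.
move=> mX mW mE H S mS.
have mZ : measurable_fun setT (fun w => (X w, W w)) by apply: m_pair.
pose m1 : {measure set ('rV[R]_n * 'rV[R]_n) -> \bar R} :=
  measure_function_pushforward__canonical__measure_function_Measure (mrestr P mE) mZ.
pose m2 : {measure set ('rV[R]_n * 'rV[R]_n) -> \bar R} := mscale c (nu \x ga)%E.
suff : m1 S = m2 S by [].
apply: (@g_sigma_algebra_measure_unique _ R _ rects _ (fun=> setT)) => //.
- by move=> _ [A [C [mA mC ->]]]; apply: measurableX => //; exact: measurable_rect.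
- move=> _; exists setT, (fun=> setT); split => //; apply/seteqP; split => //.
- by rewrite bigcup_const//; exists 0%N.
- move=> _ _ [A [C [mA mC ->]]] [A' [C' [mA' mC' ->]]].
  exists (A `&` A'), (fun i => C i `&` C' i); split; [exact: measurableI|by move=> i; exact: measurableI|].
  by rewrite -rectI setXI.
- move=> _ [A [C [mA mC ->]]].
  have -> : m2 (A `*` rect C) = (c%:num%:E * (nu A * ga (rect C)))%E.
    by rewrite /m2 /= /mscale /= product_measure1E//; exact: measurable_rect.
  exact: H.
- by move=> _; rewrite /m1 /= /pushforward preimage_setT /mrestr setTI (le_lt_trans (probability_le1 _ _))// ltry.
exact: rects_gen.
Qed.

End joint_law.

(** * The standard Gaussian law from its values on rectangles *)

Section gaussian_law.
Context {R : realType} {n : nat}.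
Local Notation lam := (@lebesgue_rV R n).
Implicit Types (C : 'I_n -> set R).

Definition rects1 : set (set 'rV[R]_n) :=
  [set S | exists C, (forall i, measurable (C i)) /\ S = rect C].

Lemma rects1_gen (S : set 'rV[R]_n) : measurable S -> <<s rects1 >> S.
Proof.
move=> mS; pose idr : g_sigma_algebraType rects1 -> 'rV[R]_n := id.
suff : measurable_fun setT idr by move=> /(_ measurableT _ mS); rewrite setTI.
apply/measurable_fun_coorP => i _ Y mY; rewrite setTI; apply: sub_sigma_algebra.
exists (fun j => if j == i then Y else setT); split; first by move=> j; case: ifP.
apply/seteqP; split => x /=.
  by move=> H j; case: eqP => [->|].
by move=> /(_ i); rewrite eqxx.
Qed.

Lemma rects1_unique (m1 m2 : {measure set 'rV[R]_n -> \bar R}) : (m1 setT < +oo)%E ->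
  (forall C, (forall i, measurable (C i)) -> m1 (rect C) = m2 (rect C)) ->
  forall S, measurable S -> m1 S = m2 S.
Proof.
move=> m1oo H S mS.
apply: (@g_sigma_algebra_measure_unique _ R _ rects1 _ (fun=> setT)) => //.
- by move=> _ [C [mC ->]]; exact: measurable_rect.
- by move=> _; exists (fun=> setT); split => //; apply/seteqP.
- by rewrite bigcup_const//; exists 0%N.
- move=> _ _ [C [mC ->]] [C' [mC' ->]].
  by exists (fun i => C i `&` C' i); split; [move=> i; exact: measurableI|rewrite rectI].
- by move=> _ [C [mC ->]]; exact: H.
exact: rects1_gen.
Qed.

Definition gmeas of unit : set 'rV[R]_n -> \bar R :=
  fun A => (\int[lam]_(x in A) (gaus 2^-1 x)%:E)%E.

Let gmeas0 : gmeas tt set0 = 0%E.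
Proof. exact: integral_set0. Qed.

Let gmeas_ge0 A : (0 <= gmeas tt A)%E.
Proof. by apply: integral_ge0 => x _; rewrite lee_fin gaus_ge0. Qed.

Let gmeas_sigma_additive : semi_sigma_additive (gmeas tt).
Proof.
apply: semi_sigma_additive_nng_induced => [|x]; last by rewrite lee_fin gaus_ge0.
by apply: m_EFin; exact: measurable_gaus.
Qed.

HB.instance Definition _ := isMeasure.Build _ _ _ (gmeas tt) gmeas0 gmeas_ge0 gmeas_sigma_additive.

Lemma gmeas_rect C : (forall i, measurable (C i)) ->
  gmeas tt (rect C) = (\prod_(i < n) normal_prob 0 1 (C i))%E.
Proof.
move=> mC; rewrite /gmeas integral_mkcond.
rewrite (_ : (fun x => (gaus 2^-1 x)%:E) \_ (rect C) =
  (fun x : 'rV[R]_n => (\prod_(i < n) (\1_(C i) (x ord0 i) * normal_pdf 0 1 (x ord0 i)))%:E)); last first.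
  apply/funext => x; rewrite patchE gaus_prod (_ : Num.sqrt (2 * 2^-1) = 1 :> R); last by rewrite mulfV// sqrtr1.
  case: ifPn => [|/negP] xC.
    rewrite inE in xC; congr EFin; apply: eq_bigr => i _.
    by rewrite indicE mem_set ?mul1r//; exact: xC.
  have [i Hi] : exists i, ~ C i (x ord0 i).
    by apply/existsNP => H; apply: xC; rewrite inE.
  by rewrite (bigD1 i)//= indicE memNset// mul0r mul0r.
rewrite (ge0_integral_rV_prod (f := fun i (z : R) => \1_(C i) z * normal_pdf 0 1 z)).
- apply: eq_bigr => i _; rewrite /normal_prob [RHS]integral_mkcond; apply: eq_integral => z _.
  by rewrite patchE indicE; case: ifP => _; rewrite ?mul1r ?mul0r.
- by move=> i; apply: m_mul; [exact: measurable_indic|exact: measurable_normal_pdf].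
- by move=> i z; rewrite mulr_ge0//; exact: normal_pdf_ge0.
Qed.

Lemma gauss_law (ga : probability 'rV[R]_n R) :
  (forall C, (forall i, measurable (C i)) -> ga (rect C) = (\prod_(i < n) normal_prob 0 1 (C i))%E) ->
  forall A, measurable A -> ga A = (\int[lam]_(x in A) (gaus 2^-1 x)%:E)%E.
Proof.
move=> H; apply: (@rects1_unique ga (gmeas tt)); first by rewrite (le_lt_trans (probability_le1 _ _))// ltry.
by move=> C mC; exact: etrans (H C mC) (esym (gmeas_rect mC)).
Qed.

Lemma gaus_scale (h : R) (w : 'rV[R]_n) : 0 < h -> Num.sqrt (2 * h) ^+ n * gaus h (Num.sqrt (2 * h) *: w) = gaus 2^-1 w.
Proof.
move=> h0; have h2 : 0 <= 2 * h by rewrite mulr_ge0// ltW.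
have hh : (0 : R) < 2^-1 by rewrite invr_gt0.
have E : normal_peak (Num.sqrt (2 * 2^-1)) = Num.sqrt (2 * h) * normal_peak (Num.sqrt (2 * h)) :> R.
  by rewrite (normal_peak_ratio hh h0); congr (Num.sqrt _ * _); field.
rewrite !gausE// E exprMn mulrA sqnZ sqr_sqrtr//; congr (_ * expR _).
by field; rewrite gt_eqF.
Qed.

End gaussian_law.

(** Reduces [grad] to the derivative of a function of one real variable, where the tactic [drv]
    applies. *)
Lemma derive_line {R : realType} {n : nat} (f : 'rV[R]_n -> R) (x v : 'rV[R]_n) :
  'D_v f x = 'D_1 (fun l : R => f (l *: v + x)) (0 : R).
Proof.
have E : (fun l : R => l^-1 *: ((f \o shift x) (l *: v) - f x)) =
    (fun l : R => l^-1 *: (((fun l : R => f (l *: v + x)) \o shift 0) (l *: (1 : R)) -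
      (fun l : R => f (l *: v + x)) 0)).
  by apply/funext => l /=; rewrite addr0 scale0r add0r [l *: 1]mulr1.
by rewrite /derive E.
Qed.

Lemma prode_le1 {R : realType} (I : Type) (r : seq I) (Q : pred I) (F : I -> \bar R) :
  (forall i, Q i -> (0 <= F i <= 1)%E) -> (0 <= \prod_(i <- r | Q i) F i <= 1)%E.
Proof.
move=> H; apply: (big_ind (fun z : \bar R => (0 <= z <= 1)%E)) => //.
  by rewrite lee_fin ler01 lexx.
by move=> y z /andP[y0 y1] /andP[z0 z1]; rewrite mule_ge0//= -[leRHS]mule1 lee_pmul.
Qed.

(** * Densities of the laws of the iterates *)

Section lmc_law.
Context {R : realType} {n : nat}.
Variables (a : R) (a0 : 0 < a) (a1 : a < 1) (n0 : (0 < n)%N).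
Local Notation lam := (@lebesgue_rV R n).
Local Notation eV := (@eV R n a).
Local Notation Z := (@ZV R n a).
Local Notation pi := (pi_alpha n a).
Implicit Types (x y : 'rV[R]_n).

Lemma grad_V x : grad (V_alpha n a) x = gV a x.
Proof.
apply/rowP => i; rewrite !mxE /partial.
set v := delta_mx ord0 i : 'rV[R]_n.
rewrite derive_line.
suff H : is_derive (0 : R) 1 (fun l : R => V_alpha n a (l *: v + x)) (a * pp x `^ (a / 2 - 1) * x ord0 i) by rewrite derive_val.
have sv l : pp (l *: v + x) = pp x + 2 * l * x ord0 i + l ^+ 2 * sqn v.
  by rewrite /pp sqnD !sqnZ !dotpE (dotpC v x) dotp_delta; ring.
rewrite (_ : (fun l => _) = (fun l : R => (pp x + 2 * l * x ord0 i + l ^+ 2 * sqn v) `^ (a / 2))); last first.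
  by apply/funext => l; rewrite V_alphaE sv.
eapply drv_eq; first by drv; rewrite /= mulr0 mul0r expr0n/= mul0r !addr0 pp_gt0.
by rewrite /= !mulr0 !mul0r expr0n/= mul0r !addr0; field.
Qed.

Variables (h : R) (h0 : 0 < h) (hn : h * n%:R <= 1).
Local Notation S1 := (fun x => x - h *: gV a x).

Definition move (p : 'rV[R]_n * 'rV[R]_n) : 'rV[R]_n := S1 p.1 + Num.sqrt (2 * h) *: p.2.

Lemma measurable_S1 : measurable_fun setT S1.
Proof. by mes; apply: measurable_gV; mes. Qed.

Lemma measurable_move : measurable_fun setT move.
Proof.
apply: measurable_add; last by mes.
by apply: (m_comp measurable_S1); mes.
Qed.

Section one_law.
Variables (nu ga : probability 'rV[R]_n R) (u : 'rV[R]_n -> R) (M : R).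
Hypothesis (mu : measurable_fun setT u) (u0 : forall x, 0 <= u x) (uM : forall x, u x <= M).
Hypothesis nuE : forall A, measurable A -> nu A = (\int[pi]_(x in A) (u x)%:E)%E.
Hypothesis gaE : forall A, measurable A -> ga A = (\int[lam]_(x in A) (gaus 2^-1 x)%:E)%E.

Lemma noise_law A x : measurable A ->
  (ga [set w | A (move (x, w))] = \int[lam]_y (\1_A y * gaus h (y - S1 x))%:E)%E.
Proof.
move=> mA; set s := Num.sqrt (2 * h); have s0 : 0 < s by rewrite sqrtr_gt0 mulr_gt0.
have mB : measurable [set w | A (move (x, w))].
  have m : measurable_fun setT (fun w : 'rV[R]_n => S1 x + s *: w) by mes.
  by have := m measurableT _ mA; rewrite setTI.
rewrite gaE// integral_mkcond.
rewrite (ge0_integral_rV_affine (S1 x) (lt0r_neq0 s0) (F := fun y => (\1_A y * gaus h (y - S1 x))%:E)); first last.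
- by move=> y; rewrite lee_fin mulr_ge0 ?gaus_ge0.
- by apply: m_EFin; apply: m_mul; [exact: measurable_indic|apply: (m_comp (measurable_gaus h)); mes].
rewrite (gtr0_norm s0) -ge0_intZl; first last.
- by rewrite exprn_ge0// ltW.
- by move=> y; rewrite mulr_ge0 ?gaus_ge0.
- apply: m_mul.
    by apply: (m_comp (g := fun y => s *: y + S1 x) (measurable_indic mA)); mes.
  by apply: (m_comp (measurable_gaus h)); mes.
apply: eq_integral => w _; rewrite patchE addrK mulrCA gaus_scale// addrC indicE.
rewrite (_ : (w \in [set w0 | A (move (x, w0))]) = (S1 x + s *: w \in A)); last by apply/idP/idP; rewrite !inE.
by case: ifP => _; rewrite ?mul1r ?mul0r.
Qed.

(** Conditioning on the position gives a Gaussian integral over A ([noise_law]); [step_adjoint] with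
    the indicator of A moves it back to the density. *)
Lemma step_law A : measurable A ->
  ((nu \x ga) (move @^-1` A) = \int[pi]_(x in A) (step a h u x)%:E)%E.
Proof.
move=> mA.
have mstep := measurable_step a h mu u0.
have st0 y : 0 <= step a h u y by exact: step_ge0.
rewrite pi_set_int//.
pose Phi x : \bar R := (\int[lam]_y (\1_A y * gaus h (y - S1 x))%:E)%E.
have Phi0 x : (0 <= Phi x)%E by apply: integral_ge0 => y _; rewrite lee_fin mulr_ge0 ?gaus_ge0.
have mPhi : measurable_fun setT Phi.
  apply: (@m_eint R n n (fun p => \1_A p.2 * gaus h (p.2 - S1 p.1))).
    apply: m_mul; first by apply: (m_comp (measurable_indic mA)); mes.
    apply: (m_comp (measurable_gaus h)); apply: measurable_add; first by mes.
    by apply: measurable_opp; apply: (m_comp measurable_S1); mes.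
  by move=> p; rewrite mulr_ge0 ?gaus_ge0.
transitivity (\int[nu]_x Phi x)%E.
  rewrite /product_measure1; apply: eq_integral => x _ /=.
  by rewrite /Phi -noise_law//; congr (ga _); apply/seteqP; split => w; rewrite /xsection /= inE.
rewrite (@density_int _ _ _ nu pi u mu nuE)//.
have mPu : measurable_fun setT (fun x => Phi x * (u x)%:E)%E.
  by apply: emeasurable_funM => //; exact: m_EFin.
rewrite pi_int//; last by move=> x; rewrite mule_ge0// lee_fin.
have Zi : 0 <= Z^-1 by rewrite invr_ge0 ltW// ZV_gt0.
have mi : measurable_fun setT (\1_A : 'rV[R]_n -> R) by exact: measurable_indic.
have i0 x : 0 <= \1_A x :> R by [].
have mR : measurable_fun setT (fun y => \1_A y * (eV y * step a h u y)).
  by apply: (m_mul mi); apply: m_mul mstep; exact: measurable_eV.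
have r0 y : 0 <= \1_A y * (eV y * step a h u y) by rewrite mulr_ge0// mulr_ge0// eV_ge0.
transitivity ((Z^-1)%:E * \int[lam]_y (\1_A y * (eV y * step a h u y))%:E)%E; last first.
  by rewrite -(ge0_intZl lam mR r0 Zi); apply: eq_int => y; ring.
rewrite (step_adjoint a0 a1 n0 h0 hn mu u0 uM mi i0).
have me : measurable_fun setT (fun x => (eV x * u x)%:E).
  by apply: m_EFin; apply: m_mul mu; exact: measurable_eV.
rewrite -ge0_integralZl_EFin//.
- apply: eq_integral => x _; rewrite -/(Phi x) -muleA -EFinM muleC [RHS]muleA -EFinM.
  by congr (_%:E * _)%E; rewrite /wpi; ring.
- by move=> x _; apply: mule_ge0; [rewrite lee_fin mulr_ge0// eV_ge0|exact: Phi0].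
- exact: emeasurable_funM.
Qed.

End one_law.

Section chain.
Context {d : measure_display} {Om : measurableType d} (P : probability Om R).
Variables (mu0 : probability 'rV[R]_n R) (xi x : nat -> {RV P >-> 'rV[R]_n}).
Hypothesis lmc : langevin_monte_carlo (V_alpha n a) h mu0 xi x.
Variables (u : 'rV[R]_n -> R) (M : R).
Hypothesis (mu : measurable_fun setT u) (u0 : forall x, 0 <= u x) (uM : forall x, u x <= M).
Hypothesis mu0E : forall A, measurable A -> mu0 A = (\int[pi]_(x in A) (u x)%:E)%E.
Local Notation un := (iter_step a h u).

Let iterP k : [/\ measurable_fun setT (un k), forall x, 0 <= un k x & exists M, forall x, un k x <= M].
Proof.
elim: k => [|k [mk k0 [Mk kM]]]; first by split => //; exists M.
split; [exact: measurable_step|by move=> y; exact: step_ge0|].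
by exists ((1 + @dl R n h) * Mk) => y; exact: (step_le a0 a1 n0 h0 hn mk k0 kM).
Qed.

Definition noise_event k m (C : nat -> 'I_n -> set R) : set Om :=
  [set w | forall j, (j < m)%N -> rect (C j) (xi (k + j) w)].

Lemma measurable_noise_event k m C : (forall j i, measurable (C j i)) -> measurable (noise_event k m C).
Proof.
move=> mC; rewrite (_ : noise_event k m C = \bigcap_(j < m) (xi (k + j) @^-1` (rect (C j)))); last first.
  by apply/seteqP; split => w H j; exact: H.
apply: fin_bigcap_measurable => [|j _]; first exact: finite_II.
by rewrite -[X in measurable X]setTI; apply: measurable_funPT => //; exact: measurable_rect.
Qed.

Lemma xi_law k (C : 'I_n -> set R) : (forall i, measurable (C i)) ->
  distribution P (xi k) (rect C) = (\prod_(i < n) normal_prob 0 1 (C i))%E.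
Proof.
move=> mC; have [_ H _] := lmc.
have := H k.+1 setT (fun j => if j == ord_max then C else fun=> setT) measurableT.
rewrite probability_setT mul1e big_ord_recr/= eqxx [X in (X * _)%E]big1; last first.
  move=> j _; rewrite big1// => i _.
  by rewrite (_ : (_ == _) = false) ?probability_setT//; apply/negbTE; rewrite -val_eqE /= ltn_eqF.
rewrite mul1e => <-; last by move=> j i; case: ifP.
congr (P _); apply/seteqP; split => w /=.
  by move=> Hw; split => // j i; case: eqP => // ->; exact: Hw.
by move=> [_ Hw] i; have := Hw ord_max i; rewrite eqxx.
Qed.

(** The induction must carry independence of [x k] from the noises still to come, so [m] of them are
    kept in the event. The statement at [k] with [m.+1] noises yields that at [k.+1] with [m], the
    first noise being consumed by the step. *)
Lemma chain_law k m A C : measurable A -> (forall j i, measurable (C j i)) ->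
  P ([set w | A (x k w)] `&` noise_event k m C) =
  ((\int[pi]_(y in A) (un k y)%:E) * \prod_(j < m) \prod_(i < n) normal_prob 0 1 (C j i))%E.
Proof.
have [Hlaw Hj Hx] := lmc.
elim: k m A C => [|k IH] m A C mA mC.
  rewrite /= -mu0E// -(Hj m A (fun j => C j) mA) => [|j i]; last exact: mC.
  congr (P _); apply/seteqP; split => w /=; first by move=> [h1 h2]; split => // j i; exact: h2.
  by move=> [h1 h2]; split => // j jm i; exact: (h2 (Ordinal jm) i).
pose E := noise_event k.+1 m C.
have mE : measurable E by exact: measurable_noise_event.
set c := (\prod_(j < m) _)%E.
have c0 : (0 <= c)%E by apply: prode_ge0 => j _; apply: prode_ge0.
have c1 : (c < +oo)%E.
  suff /andP[_ /le_lt_trans] : (0 <= c <= 1)%E by apply; rewrite ltry.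
  by apply: prode_le1 => j _; apply: prode_le1 => i _; rewrite measure_ge0 probability_le1//; exact: mC.
have [mk k0 [Mk kM]] := iterP k.
pose cn : {nonneg R} := NngNum (fine_ge0 c0).
have cE : cn%:num%:E = c by rewrite /= fineK// ge0_fin_numE.
have lawk B : measurable B -> distribution P (x k) B = (\int[pi]_(y in B) (un k y)%:E)%E.
  move=> mB; have := IH 0%N B (fun _ _ => setT) mB (fun _ _ => measurableT).
  by rewrite big_ord0 mule1 => <-; congr (P _); apply/seteqP; split => w //= [].
have J := @joint_law R n _ _ P (x k) (xi k) E (distribution P (x k)) (distribution P (xi k)) cn
  (@measurable_funPT _ _ _ _ (x k)) (@measurable_funPT _ _ _ _ (xi k)) mE.
have {}J : forall S, measurable S -> P ([set w | S (x k w, xi k w)] `&` E) =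
    (c * (distribution P (x k) \x distribution P (xi k)) S)%E.
  move=> S mS; rewrite -cE; apply: J => // B D mB mD.
  rewrite cE; transitivity (c * ((\int[pi]_(y in B) (un k y)%:E) * \prod_(i < n) normal_prob 0 1 (D i)))%E; last first.
    by congr (_ * (_ * _))%E; [exact: esym (lawk B mB)|exact: esym (xi_law k mD)].
  have := IH m.+1 B (fun j => if j is j'.+1 then C j' else D) mB.
  rewrite big_ord_recl /= => H.
  rewrite [RHS]muleCA (muleC c) -H//; last by move=> [|j] i; [exact: mD|exact: mC].
  congr (P _); apply/seteqP; split => w /=.
    move=> [[h1 h2] h3]; split => // -[_|j jm]; first by rewrite addn0.
    by rewrite addnS -addSn; exact: h3.
  move=> [h1 h2]; split; first by split => //; have := h2 0%N isT; rewrite addn0.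
  by move=> j jm; have := h2 j.+1 jm; rewrite addnS -addSn.
rewrite (_ : [set w | A (x k.+1 w)] = [set w | (move @^-1` A) (x k w, xi k w)]); last first.
  by apply/seteqP; split => w /=; rewrite Hx /move /= grad_V.
rewrite J; last by rewrite -[X in measurable X]setTI; exact: measurable_move.
rewrite (@step_law (distribution P (x k)) (distribution P (xi k)) (un k) Mk)//; first by rewrite muleC.
by apply: gauss_law => D mD; exact: xi_law.
Qed.

Lemma lmc_law k A : measurable A -> distribution P (x k) A = (\int[pi]_(y in A) (un k y)%:E)%E.
Proof.
move=> mA; have := @chain_law k 0 A (fun _ _ => setT) mA (fun _ _ => measurableT).
by rewrite big_ord0 mule1 => <-; congr (P _); apply/seteqP; split => w //= [].
Qed.

End chain.

End lmc_law.

(** * Complexity of LMC *)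

Section numeric.
Context {R : realType}.

Lemma expR1_le4 : expR 1 <= 4 :> R.
Proof.
have h : expR 2^-1 <= 2 :> R.
  rewrite -[2^-1]opprK expRN invf_ple ?posrE ?expR_gt0//.
  by apply: le_trans (expR_ge1Dx _); lra.
have -> : expR 1 = expR 2^-1 ^+ 2 :> R by rewrite -expRM_natr mulVf// pnatr_eq0.
have -> : 4 = 2 ^+ 2 :> R by ring.
by apply: lerXn2r; rewrite ?nnegrE ?expR_ge0.
Qed.

Lemma ln4_ge1 : 1 <= ln 4 :> R.
Proof. by rewrite -[leLHS]expRK ler_ln ?posrE ?expR_gt0// expR1_le4. Qed.

Lemma ln2_ge : 2^-1 <= ln 2 :> R.
Proof.
have -> : ln 2 = ln 4 / 2 :> R.
  rewrite (_ : 4 = 2 ^+ 2 :> R); last by ring.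
  by rewrite lnXn//; field.
by rewrite -[leLHS]mul1r ler_pM2r ?invr_gt0// ln4_ge1.
Qed.

Lemma powR_sum (x y p : R) : 0 <= x -> 0 <= y -> 0 <= p -> (x + y) `^ p <= 2 `^ p * (x `^ p + y `^ p).
Proof.
move=> x0 y0 p0.
wlog xy : x y x0 y0 / x <= y.
  by move=> H; have [xy|/ltW xy] := leP x y; [exact: H|rewrite addrC (addrC (x `^ p)); exact: H].
apply: (@le_trans _ _ ((2 * y) `^ p)).
  by apply: ge0_ler_powR; rewrite ?nnegrE ?addr_ge0 ?mulr_ge0//; lra.
by rewrite powRM// ler_wpM2l ?powR_ge0// lerDr powR_ge0.
Qed.

Lemma le1_powR (x p : R) : 1 <= x -> 0 <= p -> 1 <= x `^ p.
Proof. by move=> x1 p0; rewrite -[leLHS](powRr0 x); exact: ler_powR. Qed.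
End numeric.

Section complexity.
Context {R : realType} {n : nat}.
Variables (a q eps r rho : R) (a0 : 0 < a) (a1 : a < 1) (n0 : (0 < n)%N) (q2 : 2 <= q).
Hypothesis (eps0 : 0 < eps) (epsq : eps <= 2^-1) (r0 : 0 <= r) (rho0 : 0 <= rho).
Local Notation m := (n%:R : R).
Local Notation L := (ln eps^-1).
Local Notation e := (2 / a).
Local Notation S := (@Slev R n a q eps r).
Local Notation vc := (@vC R a q).
Local Notation c := (@ck R a q).

Let m1 : 1 <= m. Proof. by rewrite ler1n. Qed.
Let m0 : 0 < m. Proof. by rewrite ltr0n. Qed.
Let e2 : 2 <= e. Proof. by rewrite ler_pdivlMr// ler_piMr// ltW. Qed.
Let c0 : 0 < c. Proof. exact: ck_gt0. Qed.
Let c1 : c <= 1. Proof. exact: ck_le1. Qed.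
Let S1 : 1 <= S. Proof. exact: Swp_ge1. Qed.
Let q1 : 0 < q - 1. Proof. by move: q2; lra. Qed.
Let CK0 : 0 <= CK :> R. Proof. by rewrite /CK mulr_ge0 ?expR_ge0// sqr_ge0. Qed.

Lemma L_ge : 2^-1 <= L.
Proof.
apply: (le_trans (@ln2_ge R)); rewrite ler_ln ?posrE ?invr_gt0//.
by rewrite -[leLHS]invrK lef_pV2 ?posrE ?invr_gt0.
Qed.

Lemma vc_ge : 2 <= vc.
Proof.
have h1 : 0 <= ln (8 * (q - 1)) by rewrite ln_ge0//; move: q2; lra.
have h2 : 0 <= a^-1 by rewrite invr_ge0 ltW.
by rewrite /vC; move: q2; lra.
Qed.

(** Each of the two terms of [Slev], multiplied by n, is at most (n + r)^(2/a) up to logarithms.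
    Squared, this is the origin of the power 4/a. *)
Lemma S_le (LF : R) : 1 <= LF -> L <= LF ->
  S * m <= 2 * (2 * vc * LF) `^ e * (m + r) `^ e.
Proof.
move=> LF1 LLF; have L0 := L_ge; have v2 := vc_ge.
set z := m + r; have z1 : 1 <= z by move: m1 r0; rewrite /z; lra.
set w := 2 * vc * LF; have w1 : 1 <= w.
  by rewrite /w; have : 1 * 1 <= vc * LF by [apply: ler_pM => //; lra]; lra.
have z0 : 0 <= z by apply: le_trans z1. have w0 : 0 <= w by apply: le_trans w1.
have v0 : 0 <= vlev (n := n) a q eps r by rewrite /vlev mulr_ge0; move: v2 m1 r0 L0; lra.
have vl : vlev (n := n) a q eps r <= w * z.
  rewrite /vlev /w (_ : 2 * vc * LF * z = vc * (2 * (LF * z))); last by ring.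
  apply: ler_wpM2l; first by lra.
  rewrite /z; have h1 : m + r <= LF * (m + r) by rewrite ler_peMl.
  have h2 : LF <= LF * (m + r) by rewrite ler_peMr// (le_trans _ LF1).
  by lra.
have wz : 1 <= w `^ e * z `^ e by rewrite -[leLHS]mulr1; apply: ler_pM => //; apply: le1_powR => //; move: e2; lra.
rewrite /Slev /Swp mulrDl -mulrA mulr2n mulrDl !mul1r; apply: lerD.
  rewrite /N1 -[X in _ * X](powRr1 (ltW m0)) -powRD; last by apply/implyP => _; rewrite gt_eqF.
  rewrite subrK; apply: (@le_trans _ _ (z `^ e)).
    have e0 : 0 <= e by move: e2; lra.
    by apply: (ge0_ler_powR e0); [rewrite nnegrE ltW|rewrite nnegrE|rewrite /z lerDl].
  by rewrite ler_peMl ?powR_ge0// le1_powR//; move: e2; lra.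
have P1 : Plev (n := n) a q eps r `^ (1 - a) = vlev (n := n) a q eps r `^ (e - 2).
  by rewrite /Plev -powRrM; congr (_ `^ _); field; rewrite gt_eqF.
rewrite P1; apply: (@le_trans _ _ ((w * z) `^ (e - 2) * (w * z))).
  apply: ler_pM; rewrite ?powR_ge0 ?(ltW m0)//.
    have e20 : 0 <= e - 2 by rewrite subr_ge0.
    by apply: (ge0_ler_powR e20); rewrite ?nnegrE// mulr_ge0.
  by apply: (@le_trans _ _ z); [rewrite /z lerDl|rewrite ler_peMl].
have wz1 : 1 <= w * z by rewrite -[leLHS]mulr1; apply: ler_pM.
have wz0 : 0 <= w * z by apply: le_trans wz1.
rewrite -[X in _ * X](powRr1 wz0) -powRD; last by apply/implyP => _; rewrite gt_eqF// (lt_le_trans ltr01).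
by rewrite -powRM//; apply: ler_powR => //; lra.
Qed.

Definition T0 : R := 2 * (q + 1) / c * S * (rho + L).
(** One summand for each smallness condition: the bias of a step, the accumulated excess mass, and h
    n <= 1. *)
Definition Cm : R := 16 * (q - 1) * CK / c + CK + 1.

Let qc : 2 <= 2 * (q + 1) / c.
Proof. by rewrite ler_pdivlMr//; move: c0 c1 q2; lra. Qed.

Lemma S_le_T0 : S <= T0.
Proof.
rewrite /T0 (mulrAC _ S) -[leLHS]mul1r; apply: ler_wpM2r; first by apply: le_trans S1.
rewrite -[leLHS](_ : 2 * 2^-1 = 1); last by field.
by apply: ler_pM => //; have := L_ge; move: rho0; lra.
Qed.

Let T0_ge1 : 1 <= T0. Proof. exact: le_trans S1 S_le_T0. Qed.
Let T0p : 0 < T0. Proof. exact: lt_le_trans T0_ge1. Qed.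

Let Cm_ge : [/\ 1 <= Cm, CK <= Cm & 16 * (q - 1) * CK / c <= Cm].
Proof.
have h : 0 <= 16 * (q - 1) * CK / c by rewrite divr_ge0 ?(ltW c0)// mulr_ge0// mulr_ge0// ltW.
by rewrite /Cm; set u := 16 * (q - 1) * CK / c in h *; split; move: h CK0; lra.
Qed.

(** With h = T0 / N every condition becomes a lower bound on N. The condition on the bias asks for
    T0 S n^2 / eps, and S <= T0. *)
Lemma step_choice (N : nat) : Cm * (T0 ^+ 2 * m ^+ 2 / eps) <= N%:R ->
  [/\ 0 < T0 / N%:R, T0 / N%:R * m <= 1, N%:R * @dl R n (T0 / N%:R) <= 1,
      16 * (q - 1) * CK * (T0 / N%:R) * m ^+ 2 * S <= c * eps & T0 <= N%:R * (T0 / N%:R)].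
Proof.
move=> HN; have [C1 C2 C3] := Cm_ge.
set X := T0 ^+ 2 * m ^+ 2 / eps in HN.
have tm : 1 <= T0 * m by rewrite -[leLHS]mulr1; apply: ler_pM.
have tm2 : T0 * m <= T0 ^+ 2 * m ^+ 2 by rewrite -exprMn expr2 ler_peMl// (le_trans ler01).
have X1 : T0 ^+ 2 * m ^+ 2 <= X.
  by rewrite /X ler_pdivlMr//; apply: ler_piMr; [rewrite mulr_ge0 ?sqr_ge0|move: epsq; lra].
have X0 : 0 <= X by apply: le_trans X1; rewrite mulr_ge0 ?sqr_ge0.
have XN : X <= N%:R by apply: le_trans HN; rewrite ler_peMl.
have N0 : 0 < N%:R :> R by apply: (lt_le_trans _ XN); apply: (lt_le_trans _ X1); apply: (lt_le_trans _ tm2); exact: lt_le_trans tm.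
split.
- by rewrite divr_gt0.
- by rewrite mulrAC ler_pdivrMr// mul1r (le_trans tm2)// (le_trans X1).
- rewrite /dl (_ : N%:R * _ = CK * (T0 ^+ 2 * m ^+ 2) / N%:R); last by field; rewrite gt_eqF.
  rewrite ler_pdivrMr// mul1r; apply: (le_trans _ HN); apply: ler_pM => //.
  by rewrite mulr_ge0 ?sqr_ge0.
- rewrite (_ : _ * S = (16 * (q - 1) * CK / c * (T0 * m ^+ 2 * S / eps)) / N%:R * (c * eps)); last by field; rewrite !gt_eqF.
  rewrite ler_piMl//; first by rewrite mulr_ge0// ltW.
  rewrite ler_pdivrMr// mul1r; apply: (le_trans _ HN); apply: ler_pM => //.
  + by rewrite divr_ge0 ?(ltW c0)// mulr_ge0// mulr_ge0// ltW.
  + by rewrite divr_ge0 ?(ltW eps0)// mulr_ge0 ?(le_trans ler01 S1)// mulr_ge0 ?sqr_ge0// ltW.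
  rewrite /X ler_pM2r ?invr_gt0// expr2 mulrAC; apply: ler_wpM2r; first by rewrite sqr_ge0.
  by apply: ler_wpM2l; [exact: ltW|exact: S_le_T0].
- by rewrite mulrC divfK// gt_eqF.
Qed.

Section order.
Variables (rho' R2 : R) (rr : rho <= rho') (R21 : 1 <= R2).
Definition LFr : R := ln (m + eps^-1 + r + rho' + R2).
Definition Ar : R := (m `^ (4 / a) + r `^ (4 / a)) * Num.max 1 rho' ^+ 2 * m / eps *
  Num.max 1 (Num.sqrt (eps * R2) / m).

Let ei : 2 <= eps^-1. Proof. by rewrite -[leLHS]invrK lef_pV2 ?posrE ?invr_gt0. Qed.

Lemma LFr_ge1 : 1 <= LFr.
Proof.
apply: (le_trans (@ln4_ge1 R)); rewrite ler_ln ?posrE//; move: m1 ei r0 rho0 rr R21; lra.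
Qed.

Lemma L_le_LFr : L <= LFr.
Proof. by rewrite ler_ln ?posrE ?invr_gt0//; move: m1 ei r0 rho0 rr R21; lra. Qed.

(** An integer above 4/a + 2: the weight [S] brings the power 4/a of the logarithm, and the factor
    rho + L the power 2, after squaring. *)
Definition pw : nat := (Num.truncn (4 / a + 2)).+1.
Definition KC : R := 4 * (2 * (q + 1) / c) ^+ 2 * (4 * ((2 * vc) `^ e) ^+ 2 * 2 `^ (4 / a)).

Lemma KC_ge0 : 0 <= KC.
Proof. exact: mulr_ge0 (mulr_ge0 (ler0n R 4) (sqr_ge0 _)) (mulr_ge0 (mulr_ge0 (ler0n R 4) (sqr_ge0 _)) (powR_ge0 _ _)). Qed.

Lemma Ar_ge1 : 1 <= Ar.
Proof.
have p4 : 0 <= 4 / a by rewrite divr_ge0// ltW.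
have ha : 1 <= m `^ (4 / a) + r `^ (4 / a) by rewrite (le_trans (le1_powR m1 p4))// lerDl powR_ge0.
have hb : 1 <= Num.max 1 rho' ^+ 2 by rewrite exprn_ege1// le_max lexx.
have hc : 1 <= Num.max 1 (Num.sqrt (eps * R2) / m) by rewrite le_max lexx.
have hd : 1 <= eps^-1 by move: ei; lra.
by rewrite /Ar -[leLHS]mulr1 -[X in X * _]mulr1 -[X in X * _ * _]mulr1 -[X in X * _ * _ * _]mulr1; do !apply: ler_pM => //; rewrite !mulr_ge0.
Qed.

(** The bound on (T0 n)^2 uses only the first two factors of [Ar]; the dimension and the last
    maximum in [Ar] are at least 1 and remain as slack. *)
Lemma time_le : T0 ^+ 2 * m ^+ 2 / eps <= KC * LFr ^+ pw * Ar.
Proof.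
have LF1 := LFr_ge1; have LL := L_le_LFr; have LF0 : 0 < LFr by apply: lt_le_trans LF1.
have p4 : 0 <= 4 / a by rewrite divr_ge0// ltW.
have e0 : 0 <= e by move: e2; lra.
have v2 := vc_ge.
have Sm := S_le LF1 LL.
set Rh := Num.max 1 rho'; have Rh1 : 1 <= Rh by rewrite le_max lexx.
have hr : rho + L <= 2 * Rh * LFr.
  have h1 : rho <= Rh by apply: (le_trans rr); rewrite le_max lexx orbT.
  have h2 : Rh <= Rh * LFr by rewrite ler_peMr// (le_trans ler01).
  have h3 : LFr <= Rh * LFr by rewrite ler_peMl// ltW.
  by move: LL; lra.
have z0 : 0 <= m + r by rewrite addr_ge0.
have Tm : T0 * m <= 2 * (q + 1) / c * (2 * Rh * LFr) * (2 * ((2 * vc) `^ e * LFr `^ e) * (m + r) `^ e).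
  rewrite -powRM ?(ltW LF0)//; last by rewrite mulr_ge0//; move: v2; lra.
  rewrite /T0 (_ : _ * m = 2 * (q + 1) / c * (rho + L) * (S * m)); last by ring.
  apply: ler_pM => //.
  - by rewrite mulr_ge0//; [apply: le_trans qc|have := L_ge; move: rho0; lra].
  - by rewrite mulr_ge0// (le_trans ler01).
  by apply: ler_wpM2l => //; apply: le_trans qc.
have T2 : (T0 * m) ^+ 2 <= KC * (LFr ^+ 2 * LFr `^ (4 / a)) * (m `^ (4 / a) + r `^ (4 / a)) * Rh ^+ 2.
  apply: (@le_trans _ _ ((2 * (q + 1) / c * (2 * Rh * LFr) * (2 * ((2 * vc) `^ e * LFr `^ e) * (m + r) `^ e)) ^+ 2)).
    have t0 : 0 <= T0 * m by rewrite mulr_ge0// ltW.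
    by apply: lerXn2r; rewrite ?nnegrE//; exact: le_trans t0 Tm.
  have sq (x : R) : 0 <= x -> (x `^ e) ^+ 2 = x `^ (4 / a).
    by move=> x0; rewrite -powR_mulrn ?powR_ge0// -powRrM; congr (_ `^ _); field; rewrite gt_eqF.
  have zz := powR_sum (ltW m0) r0 p4.
  rewrite [leLHS](_ : _ = 4 * (2 * (q + 1) / c) ^+ 2 * (4 * ((2 * vc) `^ e) ^+ 2) * (LFr ^+ 2 * (LFr `^ e) ^+ 2) * Rh ^+ 2 * ((m + r) `^ e) ^+ 2); last by ring.
  rewrite (sq _ z0) (sq _ (ltW LF0)) /KC.
  set Q := 4 * (2 * (q + 1) / c) ^+ 2 * _ * _ * _.
  have Q0 : 0 <= Q.
    by apply: mulr_ge0 (mulr_ge0 (mulr_ge0 (mulr_ge0 (ler0n R 4) (sqr_ge0 _)) (mulr_ge0 (ler0n R 4) (sqr_ge0 _))) (mulr_ge0 (sqr_ge0 _) (powR_ge0 _ _))) (sqr_ge0 _).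
  apply: (le_trans (ler_wpM2l Q0 zz)); rewrite le_eqVlt; apply/orP; left; apply/eqP.
  by rewrite /Q; ring.
have LFp : LFr ^+ 2 * LFr `^ (4 / a) <= LFr ^+ pw.
  rewrite -!powR_mulrn ?(ltW LF0)// -powRD; last by apply/implyP => _; rewrite gt_eqF.
  by apply: ler_powR => //; rewrite addrC ltW// /pw truncnS_gt.
have KC0 := KC_ge0.
have A0 : 0 <= m `^ (4 / a) + r `^ (4 / a) by rewrite addr_ge0 ?powR_ge0.
rewrite -exprMn ler_pdivrMr//.
apply: (le_trans T2).
have hc : 1 <= Num.max 1 (Num.sqrt (eps * R2) / m) by rewrite le_max lexx.
have H : (m `^ (4 / a) + r `^ (4 / a)) * Rh ^+ 2 <= Ar * eps.
  rewrite /Ar -/Rh; set A1 := (_ + _) * Rh ^+ 2; set mx := Num.max 1 _ in hc *.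
  rewrite (_ : A1 * m / eps * mx * eps = A1 * (m * mx)); last by field; rewrite gt_eqF.
  rewrite ler_peMr//; first by rewrite /A1 mulr_ge0// sqr_ge0.
  by rewrite -[leLHS]mulr1; apply: ler_pM.
rewrite -mulrA -[leRHS]mulrA; apply: ler_pM => //.
- by rewrite mulr_ge0// mulr_ge0 ?sqr_ge0 ?powR_ge0.
- by rewrite mulr_ge0// sqr_ge0.
by apply: ler_wpM2l.
Qed.

(** [same_order] also asks for a lower bound on N, so N is taken at the full order of [Ar]; more
    steps over the same time only make h smaller. In the constant, the first 1 makes [X] at least
    [Ar], the second absorbs the rounding. *)
Lemma order_choice : exists N : nat, Cm * (T0 ^+ 2 * m ^+ 2 / eps) <= N%:R /\
  same_order (Cm * KC + 2) LFr pw N%:R Ar.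
Proof.
have A1 := Ar_ge1; have LF1 := LFr_ge1.
have KC0 := KC_ge0.
have [C1 _ _] := Cm_ge; have CK0' : 0 <= Cm * KC by rewrite mulr_ge0// (le_trans ler01).
set X := (Cm * KC + 1) * LFr ^+ pw * Ar.
have LA : 1 <= LFr ^+ pw * Ar by rewrite -[leLHS]mulr1; apply: ler_pM => //; rewrite exprn_ege1.
have X0 : 0 <= X by rewrite /X -mulrA mulr_ge0 ?addr_ge0// (le_trans ler01).
exists (Num.truncn X).+1.
have N1 : X <= (Num.truncn X).+1%:R by apply: ltW; exact: truncnS_gt.
have N2 : (Num.truncn X).+1%:R <= X + 1 by rewrite -natr1 lerD2r truncn_le.
split.
  apply: (le_trans _ N1); apply: (le_trans (ler_wpM2l (le_trans ler01 C1) time_le)).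
  rewrite (_ : Cm * _ = Cm * KC * (LFr ^+ pw * Ar)); last by ring.
  rewrite (_ : X = Cm * KC * (LFr ^+ pw * Ar) + LFr ^+ pw * Ar); last by rewrite /X; ring.
  by rewrite lerDl (le_trans ler01 LA).
split.
  apply: (le_trans N2); rewrite /X -!mulrA; move: LA; move: (LFr ^+ pw * Ar) (Cm * KC) => w v; lra.
have k0 : 0 <= LFr ^+ pw by rewrite exprn_ge0// (le_trans ler01).
apply: (@le_trans _ _ X).
  rewrite /X -mulrA; have : 0 <= (Cm * KC) * (LFr ^+ pw * Ar) by rewrite mulr_ge0// (le_trans ler01 LA).
  move: LA; have : Ar <= LFr ^+ pw * Ar by rewrite ler_peMl ?(le_trans ler01)// exprn_ege1.
  by move: (LFr ^+ pw * Ar) => w; lra.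
apply: (le_trans N1); rewrite ler_peMl//.
rewrite -[leLHS]mulr1; apply: ler_pM => //; last by rewrite exprn_ege1.
by move: CK0'; lra.
Qed.

End order.
End complexity.

Section part_ii.
Context {R : realType}.
Variables (a q : R) (a0 : 0 < a) (a1 : a < 1) (q2 : 2 <= q).

Lemma lmc_complexity (Ca : R) (n : nat) (eps : R) (mu0 : probability 'rV[R]_n R) :
  (0 < n)%N -> 0 < eps -> eps <= q^-1 ->
  (renyi_infty mu0 (pi_alpha n a) < +oo)%E ->
  (1 <= R2_hat a q eps Ca mu0)%E -> (R2_hat a q eps Ca mu0 < +oo)%E ->
  exists (h : R) (N : nat),
    [/\ 0 < h,
        same_order (Cm a q * KC a q + 2) (log_factor a q eps Ca mu0) (pw a)
          N%:R (lmc_order a q eps Ca mu0) &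
        forall (d : measure_display) (Omega : measurableType d)
          (P : probability Omega R) (xi x : nat -> {RV P >-> 'rV[R]_n}),
          langevin_monte_carlo (V_alpha n a) h mu0 xi x ->
          (renyi (distribution P (x N)) (pi_alpha n a) q <= eps%:E)%E].
Proof.
move=> n0 eps0 epsq fin R21 R2oo.
have epsh : eps <= 2^-1 by apply: (le_trans epsq); rewrite lef_pV2 ?posrE//; move: q2; lra.
have [u [mu u0 uM r0 uE]] := initial_density a0 a1 n0 fin.
have q1 : 1 < q by move: q2; lra.
have u1 := density_mass a0 a1 n0 mu u0 uM uE.
have uq := Rq_density a0 a1 n0 mu u0 uM uE q1.
have rho0 := Rq_ge0 a0 a1 n0 mu u0 uM uE q1.
have rr := Rq_le_2q1 a0 a1 n0 mu u0 uM uE q1.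
have R2 : 1 <= fine (R2_hat a q eps Ca mu0).
  by rewrite -lee_fin fineK// ge0_fin_numE// (le_trans _ R21).
have [N [HN ord]] := order_choice a0 a1 n0 q2 eps0 epsh r0 rho0 rr R2.
have [h0 hn Nd small long] := step_choice a0 a1 n0 q2 eps0 epsh rho0 HN.
exists (T0 a q eps (Rinf a mu0) (Rq a mu0 q) (n := n) / N%:R), N; split => // d Om P xi x lmc.
have [mN uN0 _ _] := iter_stepP a0 a1 n0 h0 hn mu u0 uM u1 N.
have uNM := iter_bound a0 a1 n0 h0 hn mu u0 uM u1 Nd.
apply: (renyi_le a0 a1 n0 mN uN0 (fun y => uNM N y (leqnn N)) _ q2 (ltW eps0)) => [A mA|].
  exact: (lmc_law a0 a1 n0 h0 hn lmc mu u0 uM uE).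
apply: (iter_decay a0 a1 n0 q2 h0 hn eps0 epsh r0 mu u0 uM u1 _ Nd small long rho0).
by rewrite uq.
Qed.

End part_ii.

(** * The Euler scheme of the diffusion *)

Section independence.
Context {R : realType} {d : measure_display} {Om : measurableType d}.
Variable P : probability Om R.

(** The events independent of [F] form a Dynkin system, and [G] is a pi-system. *)
Lemma independent_generated (F : set Om) (G : set (set Om)) :
  measurable F -> setI_closed G -> G `<=` measurable ->
  (forall E, G E -> P (F `&` E) = P F * P E)%E ->
  forall E, <<s G >> E -> (P (F `&` E) = P F * P E)%E.
Proof.
move=> mF GI mG HG E sE.
suff : <<s G >> `<=` [set E | measurable E /\ (P (F `&` E) = P F * P E)%E] by move=> /(_ _ sE)[].
have PF : P F \is a fin_num by exact: fin_num_measure.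
apply: lambda_system_subset => //; last by move=> B GB; split; [exact: mG|exact: HG].
apply/dynkin_lambda_system; split => /=.
- by split; [exact: measurableT|rewrite setIT probability_setT mule1].
- move=> B [mB PB]; split; first exact: measurableC.
  have -> : F `&` ~` B = F `\` (F `&` B) by rewrite setDE setCI setIUr setICr set0U.
  rewrite measureD//; [|exact: measurableI|by rewrite ltey_eq PF].
  transitivity (P F - P (F `&` B))%E; first by rewrite setIA setIid.
  rewrite PB probability_setC// muleBr ?mule1//.
- move=> A tA HA; have mA k : measurable (A k) by have [] := HA k.
  split; first exact: bigcup_measurable.
  rewrite setI_bigcupr measure_bigcup//; last 2 first.
  + by move=> k _; exact: measurableI.
  + by apply: trivIset_setIl.
  rewrite measure_bigcup//; have -> : P F = (fine (P F))%:E by rewrite fineK.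
  rewrite -nneseriesZl//.
  by apply: eq_eseriesr => k _; rewrite fineK//; have [] := HA k.
Qed.

Lemma normal_prob_scale (s : R) (C : set (measurableTypeR R)) : 0 < s -> measurable C ->
  normal_prob 0 s [set y : R | C (s^-1 * y)] = normal_prob 0 1 C.
Proof.
move=> s0 mC; rewrite /normal_prob integral_mkcond.
have mD : measurable [set y : R | C (s^-1 * y)].
  by rewrite -[X in measurable X]setTI; exact: (@mulrl_measurable R setT s^-1).
set F : R -> \bar R := (_ \_ _).
have mF : measurable_fun setT F.
  apply/(measurable_restrictT _ mD)/measurable_EFinP.
  by apply: measurable_funTS; exact: measurable_normal_pdf.
rewrite (@lebesgue_integral_affine _ s 0 F) ?gt_eqF//; last first.
- by move=> x; rewrite /F patchE; case: ifP => // _; rewrite lee_fin normal_pdf_ge0.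
rewrite -ge0_integralZl//; last 2 first.
- apply: (m_comp (g := fun x => s * x + 0) mF).
  by apply: measurable_funD => //; exact: (@mulrl_measurable R setT s).
- by move=> x _; rewrite /F patchE; case: ifP => // _; rewrite lee_fin normal_pdf_ge0.
rewrite [RHS]integral_mkcond; apply: eq_integral => x _.
rewrite /F !patchE addr0 [s * x \in _](_ : _ = (x \in C)); last first.
  by apply/idP/idP; rewrite !inE /= mulKf ?gt_eqF.
case: ifP => _; last by rewrite mule0.
rewrite -EFinM; congr EFin.
rewrite !normal_pdfE ?gt_eqF ?oner_eq0// /normal_peak /normal_fun !subr0 gtr0_norm//.
rewrite mulrA; congr (_ * expR _); last by field; rewrite gt_eqF.
rewrite expr1n mul1r -mulrnAr sqrtrM ?sqr_ge0// sqrtr_sqr gtr0_norm// invfM mulrA divff ?gt_eqF//.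
by rewrite mul1r.
Qed.

Definition mk_rv {n} (f : Om -> 'rV[R]_n) (mf : measurable_fun setT f) : {RV P >-> 'rV[R]_n} :=
  HB.pack f (isMeasurableFun.Build _ _ _ _ f mf).

End independence.

Section euler.
Context {R : realType} {n : nat} {d : measure_display} {Om : measurableType d}.
Variables (P : probability Om R) (a : R) (rho0 : probability 'rV[R]_n R).
Variables (B X : R -> {RV P >-> 'rV[R]_n}).
Hypothesis LD : langevin_diffusion (V_alpha n a) rho0 B X.
Variables (h : R) (h0 : 0 < h).

Definition noise (k : nat) (w : Om) : 'rV[R]_n :=
  (Num.sqrt h)^-1 *: (B (k.+1%:R * h) w - B (k%:R * h) w).

Fixpoint euler (k : nat) (w : Om) : 'rV[R]_n :=
  if k is j.+1 then euler j w - h *: gV a (euler j w) + Num.sqrt (2 * h) *: noise j w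
  else X 0 w.

Lemma noiseE k w i : noise k w ord0 i = (Num.sqrt h)^-1 * (B (k.+1%:R * h) w - B (k%:R * h) w) ord0 i.
Proof. by rewrite [LHS]mxE. Qed.

Lemma measurable_noise k : measurable_fun setT (noise k).
Proof.
apply: measurable_scalerV => //; apply: measurable_add; first exact: measurable_funPT.
by apply: measurable_opp; exact: measurable_funPT.
Qed.

Lemma measurable_euler k : measurable_fun setT (euler k).
Proof.
elim: k => [|k IH] /=; first exact: measurable_funPT.
apply: measurable_add; last by apply: measurable_scalerV => //; exact: measurable_noise.
apply: measurable_add => //; apply: measurable_opp; apply: measurable_scalerV => //.
by apply: measurableT_comp IH; exact: measurable_gV.
Qed.

(** Independence of [X 0] is given only for values of B at finitely many times, while the noises are
    increments. It passes to them through the sigma-algebra generated by those values. *)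
Lemma euler_lmc : langevin_monte_carlo (V_alpha n a) h rho0
  (fun k => mk_rv P (measurable_noise k)) (fun k => mk_rv P (measurable_euler k)).
Proof.
have [[_ Bincr _] X0 ind _ _] := LD; have sh : 0 < Num.sqrt h by rewrite sqrtr_gt0.
split => //; last by move=> k w; rewrite /= grad_V.
move=> k A C mA mC.
pose D j i := [set y : R | C j i ((Num.sqrt h)^-1 * y)].
have mD j i : measurable (D j i).
  by rewrite -[X in measurable X]setTI; exact: (@mulrl_measurable R setT (Num.sqrt h)^-1).
pose E := [set w | forall j i, C j i (noise j w ord0 i)].
have PE : P E = (\prod_(j < k) \prod_(i < n) normal_prob 0 1 (C j i))%E.
  have := Bincr k (fun j => j%:R * h) D; rewrite mul0r => /(_ (lexx 0)) H.
  transitivity (P [set w | forall j i, D j i ((B (j.+1%:R * h) w - B (j%:R * h) w) ord0 i)]).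
    congr (P _); apply/seteqP; split => w /= Hw j i; have := Hw j i.
      by rewrite noiseE.
    by rewrite /D /= -noiseE.
  have tlt j : j%:R * h < j.+1%:R * h by rewrite ltr_pM2r// ltr_nat.
  rewrite (H tlt mD).
  apply: eq_bigr => j _; apply: eq_bigr => i _.
  have -> : j.+1%:R * h - j%:R * h = h by rewrite -natr1; ring.
  exact: (normal_prob_scale sh (mC j i)).
rewrite -PE -X0//.
rewrite [X in P X](_ : _ = [set w | A (X 0 w)] `&` E); last by [].
(* The first k noises involve k + 1 times, 0 included. *)
pose t (j : 'I_k.+1) : R := j%:R * h.
pose G := [set S | exists F : 'I_k.+1 -> set 'rV[R]_n,
  (forall j, measurable (F j)) /\ S = [set w | forall j, F j (B (t j) w)]].
have mpre (F : set 'rV[R]_n) (s : R) : measurable F -> measurable [set w | F (B s w)].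
  by move=> mF; rewrite -[X in measurable X]setTI; exact: (@measurable_funPT _ _ _ _ (B s)).
apply: (@independent_generated _ _ _ P _ G).
- by rewrite -[X in measurable X]setTI; exact: (@measurable_funPT _ _ _ _ (X 0)).
- move=> _ _ [F [mF ->]] [F' [mF' ->]]; exists (fun j => F j `&` F' j); split => [j|].
    exact: measurableI.
  apply/seteqP; split => w /=; first by move=> [h1 h2] j; split.
  by move=> H; split => j; have [] := H j.
- move=> _ [F [mF ->]]; rewrite (_ : mkset _ = \bigcap_(j in [set: 'I_k.+1]) [set w | F j (B (t j) w)]).
    by apply: fin_bigcap_measurable => // j _; exact: mpre.
  by apply/seteqP; split => w /= H j; [move=> _|]; exact: H.
- move=> _ [F [mF ->]]; have t0 j : 0 <= t j by rewrite mulr_ge0// ltW.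
  exact: (ind _ _ _ _ t0 mA mF).
have mB (j : 'I_k.+1) : measurable_fun setT (B (t j) : g_sigma_algebraType G -> 'rV[R]_n).
  move=> _ F mF; rewrite setTI; apply: sub_sigma_algebra.
  exists (fun i => if i == j then F else setT); split => [i|]; first by case: ifP.
  apply/seteqP; split => w /=; first by move=> H i; case: eqP => [->|].
  by move=> /(_ j); rewrite eqxx.
have mW (j : 'I_k) : measurable_fun setT (noise j : g_sigma_algebraType G -> 'rV[R]_n).
  apply: measurable_scalerV => //; apply: measurable_add.
    exact: (mB (lift ord0 j)).
  by apply: measurable_opp; exact: (mB (widen_ord (leqnSn k) j)).
suff : measurable (E : set (g_sigma_algebraType G)) by [].
rewrite (_ : E = \bigcap_(j in [set: 'I_k]) (noise j @^-1` rect (C j))).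
  apply: fin_bigcap_measurable => // j _.
  by rewrite -[X in measurable X]setTI; apply: mW => //; exact: measurable_rect.
by apply/seteqP; split => w /= H j; [move=> _|]; exact: H.
Qed.

End euler.

(** * Pathwise convergence of the Euler scheme *)

Section paths.
Context {R : realType}.
Local Notation mu := (@lebesgue_measure R).

(** Heine's theorem, from the covering form of compactness. *)
Lemma segment_unif_continuous (f : R -> R) (T : R) : {within `[0, T], continuous f} ->
  forall eta, 0 < eta -> \forall dl \near 0^'+, forall s t : R, s \in `[0, T] -> t \in `[0, T] ->
    `|s - t| < dl -> `|f s - f t| <= eta.
Proof.
move=> fc eta eta0.
have /compact_near_coveringP H := @segment_compact R 0 T.
pose Q (dl s : R) := forall t : R, s \in `[0, T] -> t \in `[0, T] -> `|s - t| < dl -> `|f s - f t| <= eta.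
suff : \forall dl \near 0^'+, `[0, T]%classic `<=` Q dl.
  by apply: filterS => dl Hd s t sT tT; exact: Hd.
apply: H => /= x xT.
have /subspace_continuousP/(_ x xT)/cvgrPdist_le/(_ (eta / 2)) := fc.
rewrite divr_gt0// => /(_ isT); rewrite nearE /within /=.
move=> /nbhs_ballP[r /= r0 Hr].
have r20 : 0 < r / 2 by rewrite divr_gt0.
exists (ball x (r / 2), [set dl | dl < r / 2]) => /=.
  split; first exact: nbhsx_ballx.
  exact: nbhs_right_lt.
move=> [y dl] /= [xy dlr] t yT tT yt.
rewrite /ball /= in xy.
have hx : `|f x - f y| <= eta / 2 by apply: Hr => //; rewrite /ball /=; move: xy; lra.
have hy : `|f x - f t| <= eta / 2.
  apply: Hr => //; rewrite /ball /= (_ : x - t = (x - y) + (y - t)); last by ring.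
  by rewrite (le_lt_trans (ler_normD _ _))//; move: xy yt; lra.
rewrite (_ : f y - f t = (f x - f t) - (f x - f y)); last by ring.
by rewrite (le_trans (ler_normB _ _))//; lra.
Qed.

Lemma integral_increment (g : R -> R) (T t t' c eta : R) : {within `[0, T], continuous g} ->
  0 <= t -> t <= t' -> t' <= T -> (forall s, s \in `[t, t'] -> `|g s - c| <= eta) ->
  `|\int[mu]_(s in `[0, t']) g s - \int[mu]_(s in `[0, t]) g s - (t' - t) * c| <= eta * (t' - t).
Proof.
move=> gc t0 tt tT H.
have sub u v : 0 <= u -> v <= T -> `[u, v]%classic `<=` `[0, T].
  move=> u0 vT x /=; rewrite !in_itv /= => /andP[xu xv].
  by rewrite (le_trans u0 xu) (le_trans xv vT).
have ig u v : 0 <= u -> v <= T -> mu.-integrable `[u, v] (EFin \o g).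
  move=> u0 vT; apply: continuous_compact_integrable; first exact: segment_compact.
  exact: (continuous_subspaceW (sub _ _ u0 vT)).
rewrite Rintegral_itvB ?bnd_simp//; last by apply: ig.
have sub1 : `]t, t']%classic `<=` `[t, t'] by move=> z /=; rewrite !in_itv /= => /andP[/ltW -> ->].
have io : mu.-integrable `]t, t'] (EFin \o g).
  by apply: integrableS (ig _ _ t0 tT) => //.
have moo : (mu `]t, t']%classic = (t' - t)%:E)%E.
  rewrite lebesgue_measure_itv /= lte_fin; case: ltP => // h.
  by rewrite (_ : t' = t) ?subrr//; apply/le_anti/andP.
have ik (k : R) : mu.-integrable `]t, t'] (EFin \o (fun=> k)).
  have ik0 : mu.-integrable `[t, t'] (EFin \o (fun=> k)).
    apply: continuous_compact_integrable; first exact: segment_compact.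
    by apply: continuous_subspaceT => z; exact: cvg_cst.
  by apply: integrableS ik0.
have ic := ik c; have ie := ik eta.
have cE k : \int[mu]_(s in `]t, t']) k = k * (t' - t).
  by rewrite Rintegral_cst//; congr (_ * _); exact: (congr1 fine moo).
rewrite (mulrC _ c) -(cE c).
rewrite -RintegralB//.
have id : mu.-integrable `]t, t'] (EFin \o (fun s => g s - c)).
  have := @integrableB _ _ _ mu _ (measurable_itv `]t, t']) _ _ io ic.
  by apply: eq_integrable.
apply: (le_trans (le_normr_Rintegral _ id)) => //.
apply: (@le_trans _ _ (\int[mu]_(s in `]t, t']) eta)); last by rewrite cE.
apply: le_Rintegral => //; first by have := integrable_abse id.
by move=> x xt; apply: H; exact: sub1.
Qed.

(** A discrete Gronwall inequality; 3 is the Lipschitz constant of the drift in [gV_lipschitz]. *)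
Lemma gronwall_sum (D : nat -> R) (h eta : R) N : 0 <= h -> 0 <= eta -> D 0%N <= 0 ->
  (forall k, (k < N)%N -> D k.+1 <= (1 + 3 * h) * D k + h * eta) ->
  D N <= N%:R * h * eta * expR (3 * (N%:R * h)).
Proof.
move=> h0 e0 D0 H.
have P k : (k <= N)%N -> D k <= k%:R * (h * eta) * (1 + 3 * h) ^+ k.
  elim: k => [|k IH] kN; first by rewrite !mul0r.
  apply: (le_trans (H k kN)).
  have := ler_wpM2l (_ : 0 <= 1 + 3 * h) (IH (ltnW kN)); rewrite addr_ge0 ?mulr_ge0// => /(_ isT) h1.
  have h2 : 1 <= (1 + 3 * h) ^+ k.+1 by rewrite exprn_ege1// lerDl mulr_ge0.
  have h3 : h * eta <= h * eta * (1 + 3 * h) ^+ k.+1 by rewrite ler_peMr// mulr_ge0.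
  rewrite (_ : k.+1%:R * _ * _ = k%:R * (h * eta) * (1 + 3 * h) ^+ k.+1 + h * eta * (1 + 3 * h) ^+ k.+1); last by rewrite -natr1; ring.
  apply: lerD => //.
  by apply: (le_trans h1); rewrite exprS le_eqVlt; apply/orP; left; apply/eqP; ring.
apply: (le_trans (P N (leqnn N))); rewrite [N%:R * (h * eta)]mulrA; apply: ler_wpM2l; first by rewrite !mulr_ge0.
rewrite (_ : 3 * (N%:R * h) = (3 * h) * N%:R); last by ring.
rewrite expRM_natr lerXn2r ?nnegrE ?expR_ge0 ?addr_ge0 ?mulr_ge0//.
exact: expR_ge1Dx.
Qed.

End paths.

(** * Lipschitz drift and convergence of the Euler paths *)

Section drift.
Context {R : realType} {n : nat}.
Variables (a : R) (a0 : 0 < a) (a1 : a < 1).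
Implicit Types x y : 'rV[R]_n.

Lemma enorm_le_coord x (c : R) : 0 <= c -> (forall i, `|x ord0 i| <= c) -> enorm x <= n%:R * c.
Proof.
move=> c0 H; rewrite enorm_le_sqn ?mulr_ge0//.
apply: (@le_trans _ _ (\sum_(i < n) c ^+ 2)).
  by apply: ler_sum => i _; rewrite -expr2 -real_normK ?num_real// lerXn2r ?nnegrE.
rewrite sumr_const card_ord -[leLHS]mulr_natl exprMn ler_wpM2r ?sqr_ge0//.
by case: n => [|m]; [rewrite sqr_ge0|rewrite expr2 ler_peMl// ler1n].
Qed.

Lemma coord_le_enorm x i : `|x ord0 i| <= enorm x.
Proof.
rewrite enorm_sqn -[leLHS]normr_id -sqrtr_sqr ler_wsqrtr// real_normK ?num_real//.
by rewrite /sqn /dotp (bigD1 i)//= -expr2 lerDl sumr_ge0// => j _; rewrite -expr2 sqr_ge0.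
Qed.

(* With p(y) <= p(x), the ratio bound (p(y)/p(x))^(1-c) >= p(y)/p(x) replaces a
   derivative of the weight. *)
Lemma gV_lipschitz x y : enorm (gV a x - gV a y) <= 3 * enorm (x - y).
Proof.
wlog xy : x y / enorm y <= enorm x.
  move=> H; have [xy|/ltW xy] := leP (enorm y) (enorm x); first exact: H.
  by rewrite enormB (enormB x); exact: H.
set c := a / 2; have c1 : c - 1 <= 0 by rewrite /c; move: a1; lra.
have px := pp_gt0 x; have py := pp_gt0 y; have px1 := pp_ge1 x; have py1 := pp_ge1 y.
have pyx : pp y <= pp x by rewrite /pp lerD2l -!enormK lerXn2r ?nnegrE ?enorm_ge0.
pose A := a * pp x `^ (c - 1); pose B := a * pp y `^ (c - 1).
have pw1 z : pp z `^ (c - 1) <= 1.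
  by rewrite -[leRHS](powRr0 (pp z)); apply: ler_powR => //; exact: pp_ge1.
have pw0 z : 0 <= pp z `^ (c - 1) by exact: powR_ge0.
have A01 : 0 <= A <= 1.
  rewrite mulr_ge0 ?(ltW a0)//=; apply: (@le_trans _ _ (1 * 1)); last by rewrite mulr1.
  by apply: ler_pM => //; exact: ltW.
have -> : gV a x - gV a y = A *: (x - y) - (B - A) *: y.
  by apply/rowP => i; rewrite !mxE -/c -/A -/B; ring.
have h1 : enorm (A *: (x - y)) <= enorm (x - y).
  by case/andP: A01 => A0 A1; rewrite enormZ ger0_norm// ler_piMl ?enorm_ge0.
suff h2 : enorm ((B - A) *: y) <= 2 * enorm (x - y).
  apply: (le_trans (enormD _ _)); rewrite enormN; move: h1 h2; lra.
have rat : pp y / pp x <= (pp y / pp x) `^ (1 - c).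
  have r1 : pp y / pp x <= 1 by rewrite ler_pdivrMr// mul1r.
  have r0 : 0 < pp y / pp x by rewrite divr_gt0.
  have r01 : 0 < pp y / pp x <= 1 by rewrite r0 r1.
  have c1' : 1 - c <= 1 by rewrite /c; move: a0; lra.
  have := ger_powR r01 c1'.
  by rewrite (powRr1 (ltW r0)).
have pE : pp x `^ (c - 1) = pp y `^ (c - 1) * (pp y / pp x) `^ (1 - c).
  rewrite powRM ?invr_ge0 ?ltW// -powR_inv1 ?ltW// -powRrM mulN1r opprB.
  rewrite mulrA -powRD; last by apply/implyP => _; rewrite gt_eqF.
  by rewrite (_ : c - 1 + (1 - c) = 0) ?powRr0 ?mul1r//; ring.
have BA : 0 <= B - A <= 1 - pp y / pp x.
  rewrite subr_ge0 /A pE; set r := (pp y / pp x) `^ (1 - c) in rat *.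
  have r1 : r <= 1.
    have one : 1 `^ (1 - c) = 1 :> R by rewrite powR1.
    rewrite /r -[leRHS]one; apply: ge0_ler_powR; rewrite ?nnegrE//.
    - by rewrite /c; move: a1; lra.
    - by rewrite divr_ge0// ltW.
    - by rewrite ler_pdivrMr// mul1r.
  have B0 : 0 <= B by rewrite mulr_ge0// ltW.
  have B1 : B <= 1.
    by apply: (@le_trans _ _ (1 * 1)); [apply: ler_pM => //; exact: ltW|rewrite mulr1].
  rewrite mulrA -/B; apply/andP; split; first by rewrite ler_piMr.
  have : B * (1 - r) <= 1 * (1 - r) by rewrite ler_wpM2r// subr_ge0.
  by move: rat; lra.
rewrite enormZ ger0_norm; last by case/andP: BA.
apply: (@le_trans _ _ ((1 - pp y / pp x) * enorm x)).
  by apply: ler_pM; rewrite ?enorm_ge0//; case/andP: BA.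
rewrite (_ : 1 - pp y / pp x = (enorm x ^+ 2 - enorm y ^+ 2) / pp x); last first.
  by rewrite !enormK /pp; field; rewrite gt_eqF.
have tri : enorm x - enorm y <= enorm (x - y).
  by have := enormD (x - y) y; rewrite subrK; lra.
have sx : enorm x ^+ 2 <= pp x by rewrite enormK /pp lerDr.
rewrite mulrAC ler_pdivrMr// subr_sqr.
have ey := enorm_ge0 y; have d0 := enorm_ge0 (x - y); have ex := enorm_ge0 x.
move: tri sx xy ey d0 ex; set X := enorm x; set Y := enorm y; set D := enorm (x - y); set p := pp x.
move=> tri sx xy ey d0 ex.
apply: (@le_trans _ _ (D * (2 * X) * X)).
  apply: ler_wpM2r => //; apply: ler_pM => //; lra.
have : D * X ^+ 2 <= D * p by rewrite ler_wpM2l.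
by rewrite expr2; lra.
Qed.

Section convergence.
Variables (x b : R -> 'rV[R]_n) (T : R) (T0 : 0 < T).
Hypothesis xc : {within [set t | 0 <= t], continuous x}.
Hypothesis xE : forall (t : R) (i : 'I_n), 0 <= t ->
  x t ord0 i = x 0 ord0 i - \int[lebesgue_measure]_(s in `[0, t]) gV a (x s) ord0 i + Num.sqrt 2 * b t ord0 i.

Let g (i : 'I_n) (s : R) : R := gV a (x s) ord0 i.

Lemma drift_continuous i : {within `[0, T], continuous (g i)}.
Proof.
apply/subspace_continuousP => s sT.
have xs : x @ within `[0, T] (nbhs s) --> x s.
  move/(@continuous_subspaceW _ _ `[0, T]%classic) : xc => /(_ _)/subspace_continuousP; apply => //.
  by move=> t /=; rewrite in_itv /= => /andP[].
have xsi j : (fun t => x t ord0 j) @ within `[0, T] (nbhs s) --> x s ord0 j.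
  apply: (@cvg_comp _ _ _ x (fun M : 'rV[R]_n => M ord0 j : R) _ _ _ xs).
  exact: coord_continuous.
apply/cvgrPdist_le => e e0.
have n1 : 0 < 3 * (n%:R + 1) :> R by rewrite mulr_gt0// ltr_wpDl.
have e1 : 0 < e / (3 * (n%:R + 1)) by rewrite divr_gt0.
have F : \forall t \near within `[0, T] (nbhs s), forall j, `|x s ord0 j - x t ord0 j| <= e / (3 * (n%:R + 1)).
  by apply: filter_forall => j; have /cvgrPdist_le := xsi j; apply.
apply: filterS F => t Ht.
have gE : g i s - g i t = (gV a (x s) - gV a (x t)) ord0 i by rewrite [RHS]mxE [X in _ = _ + X]mxE.
change (`|g i s - g i t| <= e); rewrite gE (le_trans (coord_le_enorm _ i))// (le_trans (gV_lipschitz _ _))//.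
have : enorm (x s - x t) <= n%:R * (e / (3 * (n%:R + 1))).
  by apply: enorm_le_coord => [|j]; [exact: ltW|rewrite !mxE].
move=> H1; apply: (@le_trans _ _ (3 * (n%:R * (e / (3 * (n%:R + 1)))))); first by rewrite ler_pM2l.
rewrite (_ : 3 * _ = e * (n%:R / (n%:R + 1))); last by field; rewrite gt_eqF// ltr_wpDl.
by rewrite ler_piMr ?(ltW e0)// ler_pdivrMr ?ltr_wpDl// mul1r lerDl.
Qed.

(** The noise is additive and cancels between scheme and solution, so the error obeys a
    deterministic recursion on each path. Its defect per step is controlled by uniform continuity of
    the drift along the path, and [gronwall_sum] concludes; no moment of the solution is
    involved. *)
Lemma euler_path (e : nat -> nat -> 'rV[R]_n) :
  (forall N, e N 0%N = x 0) ->
  (forall N k, e N k.+1 = e N k - (T / N.+1%:R) *: gV a (e N k) +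
    Num.sqrt 2 *: (b (k.+1%:R * (T / N.+1%:R)) - b (k%:R * (T / N.+1%:R)))) ->
  forall eta, 0 < eta -> \forall N \near \oo, enorm (e N N.+1 - x T) <= eta.
Proof.
move=> e0 eS eta eta0.
(* Divides by the Gronwall factor and by the passage from coordinates to the norm; [n + 1] instead
   of [n] keeps the denominator positive. *)
pose eta1 := eta / (T * expR (3 * T) * (n%:R + 1)).
have n1 : 0 < n%:R + 1 :> R by rewrite ltr_wpDl.
have ET : 0 < T * expR (3 * T) * (n%:R + 1) by rewrite !mulr_gt0 ?expR_gt0.
have eta10 : 0 < eta1 by rewrite divr_gt0.
have F : \forall dl \near 0^'+, forall i (s t : R), s \in `[0, T] -> t \in `[0, T] ->
    `|s - t| < dl -> `|g i s - g i t| <= eta1.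
  apply: filter_forall => i; have H := segment_unif_continuous (@drift_continuous i) eta10.
  exact: H.
have [dl [dl0 Hdl]] : exists dl : R, 0 < dl /\ forall i (s t : R), s \in `[0, T] -> t \in `[0, T] ->
    `|s - t| < dl -> `|g i s - g i t| <= eta1.
  near (0 : R)^'+ => dl; exists dl; split; first by near: dl; exact: nbhs_right_gt.
  by near: dl.
exists (Num.truncn (T / dl)) => // N /= HN.
pose h := T / N.+1%:R.
have h0 : 0 < h by rewrite divr_gt0.
have hd : h < dl.
  rewrite /h ltr_pdivrMr// mulrC -ltr_pdivrMr//; apply: (lt_le_trans (truncnS_gt _)).
  by rewrite ler_nat ltnS.
have Nh : N.+1%:R * h = T by rewrite /h mulrC divfK.
pose D k := enorm (e N k - x (k%:R * h)).
have DN : D N.+1 <= N.+1%:R * h * (n%:R * eta1) * expR (3 * (N.+1%:R * h)).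
  have e10 : 0 <= n%:R * eta1 by apply: mulr_ge0; [exact: ler0n|exact: ltW].
  apply: (gronwall_sum (ltW h0) e10).
    by rewrite /D mul0r e0 subrr enorm0.
  move=> k kN; set t := k%:R * h; set t' := k.+1%:R * h.
  have tt : t' - t = h by rewrite /t' /t -natr1; ring.
  have t0 : 0 <= t by rewrite mulr_ge0 ?(ltW h0).
  have ltt : t <= t' by rewrite -subr_ge0 tt ltW.
  have t'T : t' <= T by rewrite -Nh ler_pM2r// ler_nat.
  pose r : 'rV[R]_n := x t' - x t - Num.sqrt 2 *: (b t' - b t) + h *: gV a (x t).
  have rE : enorm r <= n%:R * (eta1 * h).
    apply: enorm_le_coord => [|i]; first by rewrite mulr_ge0 ?ltW.
    have H := @integral_increment _ (g i) T t t' (g i t) eta1 (@drift_continuous i) t0 ltt t'T.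
    rewrite (_ : r ord0 i = - (\int[lebesgue_measure]_(s in `[0, t']) g i s - \int[lebesgue_measure]_(s in `[0, t]) g i s - (t' - t) * g i t)).
      rewrite normrN -tt; apply: H => s; rewrite in_itv /= => /andP[s1 s2].
      apply: Hdl; rewrite ?in_itv /=.
      - by rewrite (le_trans t0 s1) (le_trans s2 t'T).
      - by rewrite t0 (le_trans ltt t'T).
      by rewrite ger0_norm ?subr_ge0//; move: tt hd s2; lra.
    have -> : r ord0 i = x t' ord0 i - x t ord0 i - Num.sqrt 2 * (b t' ord0 i - b t ord0 i) + h * g i t.
      by rewrite /r /g; move: (gV a (x t)) (x t') (x t) => G u v; rewrite !mxE.
    by rewrite (xE i t0) (xE i (le_trans t0 ltt)) tt /g; ring.
  rewrite /D -/t -/t'; have -> : e N k.+1 - x t' = (e N k - x t) - h *: (gV a (e N k) - gV a (x t)) - r.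
    rewrite eS -/h -/t -/t' /r; apply/rowP => i; rewrite !mxE; ring.
  apply: (le_trans (enormD _ _)); rewrite enormN; apply: lerD; last first.
    by apply: (le_trans rE); rewrite le_eqVlt; apply/orP; left; apply/eqP; ring.
  apply: (le_trans (enormD _ _)); rewrite enormN enormZ gtr0_norm// mulrDl mul1r lerD2l.
  rewrite (mulrC 3) -[leRHS]mulrA; apply: (ler_wpM2l (ltW h0)); exact: gV_lipschitz.
rewrite /D Nh in DN; apply: (le_trans DN).
rewrite /eta1 (_ : _ * expR _ = eta * (n%:R / (n%:R + 1))); last first.
  by field; rewrite !gt_eqF ?expR_gt0.
by rewrite ler_piMr ?(ltW eta0)// ler_pdivrMr// mul1r lerDl.
Unshelve. all: by end_near. Qed.

End convergence.
End drift.

(** * Limits of laws with bounded densities *)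

Section bounded_functions.
Context {d : measure_display} {T : measurableType d} {R : realType}.
Implicit Types (f : T -> R) (C : R).

Definition bounded_nonneg C f := measurable_fun setT f /\ forall x, 0 <= f x <= C.

Lemma bn_itg (mu : probability T R) C f : bounded_nonneg C f -> itg mu f.
Proof.
move=> [mf fC]; apply: (@itg_le _ _ _ _ _ C) => // [x|]; first by have /andP[] := fC x.
apply: (@le_trans _ _ (\int[mu]_x C%:E)%E).
  apply: ge0_int_le => // x; have /andP[] := fC x => //.
by rewrite integral_cst// [X in (_ * X)%E](probability_setT mu) mule1.
Qed.

Lemma bn_dominated (mu : probability T R) C (f_ : nat -> T -> R) f :
  (forall k, bounded_nonneg C (f_ k)) -> bounded_nonneg C f ->
  {ae mu, forall x, f_ k x @[k --> \oo] --> f x} ->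
  (fun k => \int[mu]_x `|f_ k x - f x|) @ \oo --> (0 : R).
Proof.
move=> f_C fC cv.
have C0 (x : T) : 0 <= C by have [_ /(_ x)/andP[/le_trans h /h]] := fC.
have := @dominated_convergence _ T R mu setT measurableT (fun k => EFin \o f_ k) (EFin \o f) (fun=> C%:E).
case=> //.
- by move=> k; apply/measurable_EFinP; have [] := f_C k.
- by apply/measurable_EFinP; have [] := fC.
- by apply: filterS cv => x Hx _ /=; apply/fine_cvgP; split => //; exact: nearW.
- by apply: finite_measure_integrable_cst.
- apply: nearW => x k _ /=; have [_ /(_ x)/andP[h1 h2]] := f_C k.
  by rewrite lee_fin ger0_norm.
move=> _ /fine_cvgP[_]; rewrite /= => H _.
exact: H.
Qed.

Lemma bn_cvg (mu : probability T R) C (f_ : nat -> T -> R) f :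
  (forall k, bounded_nonneg C (f_ k)) -> bounded_nonneg C f ->
  {ae mu, forall x, f_ k x @[k --> \oo] --> f x} ->
  (fun k => \int[mu]_x f_ k x) @ \oo --> \int[mu]_x f x.
Proof.
move=> f_C fC cv; have H := bn_dominated f_C fC cv.
apply/cvgrPdist_le => e e0; have /cvgrPdist_le/(_ e e0) := H.
apply: filterS => k; rewrite sub0r normrN => Hk.
have i1 := bn_itg mu (f_C k); have i2 := bn_itg mu fC.
rewrite distrC -RintB//; apply: (le_trans (norm_Rint_le (G := fun x => `|f_ k x - f x|) _ _ _)) => //.
- exact: itgB.
- exact: itg_norm (itgB i1 i2).
- exact: le_trans (ler_norm _) Hk.
Qed.

Lemma Rint_indic (mu : probability T R) (A : set T) : measurable A -> \int[mu]_x \1_A x = fine (mu A).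
Proof. by move=> mA; rewrite /Rintegral integral_indic// setIT. Qed.

Lemma bn_indic (A : set T) : measurable A -> bounded_nonneg 1 (\1_A : T -> R).
Proof.
move=> mA; split; first exact: measurable_indic.
by move=> x; rewrite indicE; case: (_ \in _); rewrite ?lexx ?ler01.
Qed.

End bounded_functions.

(** The sum counts the natural numbers below [y], which is its ceiling. In [limits_all] it writes a
    uniform approximation of a function as a finite sum of indicators of level sets. *)
Lemma ceil_sum {R : realType} (y : R) (j : nat) : 0 <= y -> y <= j%:R ->
  y <= \sum_(m < j) ((m%:R < y)%R : nat)%:R <= y + 1.
Proof.
move=> y0.
have H : (y <= j%:R -> y <= \sum_(m < j) ((m%:R < y)%R : nat)%:R <= y + 1) /\
  (j%:R <= y -> \sum_(m < j) ((m%:R < y)%R : nat)%:R = j%:R :> R).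
  elim: j => [|j [IH1 IH2]].
    by rewrite big_ord0; split => // h; rewrite h addr_ge0.
  rewrite big_ord_recr/= -natr1; split => h.
    have [yj|jy] := leP y j%:R; first by rewrite addr0; exact: IH1.
    by rewrite (IH2 (ltW jy)) h lerD2r ltW.
  have jy : j%:R < y by move: h; lra.
  by rewrite jy (IH2 (ltW jy)).
by case: H => H _; exact: H.
Qed.

(** * Setwise limits of uniformly dominated laws *)

Section weak_limit.
Context {d : measure_display} {T : measurableType d} {R : realType}.
Variables (pi : probability T R) (nu_ : nat -> probability T R) (nu : probability T R).
Variables (u_ : nat -> T -> R) (M : R).
Hypothesis u_b : forall N, bounded_nonneg M (u_ N).
Hypothesis nuE : forall N A, measurable A -> nu_ N A = (\int[pi]_(x in A) (u_ N x)%:E)%E.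

Let M0 : 0 <= M.
Proof.
have [x _] : [set: T] !=set0.
  apply/set0P/eqP => T0; have := probability_setT pi.
  by rewrite T0 measure0 => /esym/eqP; rewrite onee_eq0.
by have [_ /(_ x)/andP[/le_trans h /h]] := u_b 0.
Qed.

Definition limits f := (exists C, bounded_nonneg C f) /\ (fun N => \int[nu_ N]_x f x) @ \oo --> \int[nu]_x f x.

Lemma dominated_int N C f : bounded_nonneg C f -> \int[nu_ N]_x f x <= M * \int[pi]_x f x.
Proof.
move=> fC; have [mf f0] := fC; have [mu u0] := u_b N.
have f00 x : 0 <= f x by have /andP[] := f0 x.
have u00 x : 0 <= u_ N x by have /andP[] := u0 x.
have ip := bn_itg pi fC; have inu := bn_itg (nu_ N) fC.
rewrite -lee_fin itgK// EFinM itgK//.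
have := @density_int _ _ _ (nu_ N) pi (u_ N) mu (@nuE N) (EFin \o f).
move=> -> //=; last by exact/measurable_EFinP.
rewrite -ge0_integralZl_EFin//; last 2 first.
- by move=> x _; rewrite lee_fin.
- exact/measurable_EFinP.
under [leLHS]eq_integral do rewrite -EFinM.
under [leRHS]eq_integral do rewrite -EFinM.
apply: ge0_int_le => //.
- exact: m_mul.
- by apply: m_mul => //; exact: measurable_cst.
- by move=> x; rewrite mulr_ge0.
by move=> x; rewrite mulrC ler_wpM2r//; have /andP[] := u0 x.
Qed.

(** The domination of every [nu_ N] by [M * pi] makes the approximation of f by [f_ k] uniform in N,
    so the two limits may be exchanged. *)
Lemma limits_lim C (f_ : nat -> T -> R) f : (forall k, bounded_nonneg C (f_ k)) ->
  (forall k, limits (f_ k)) -> bounded_nonneg C f -> (forall x, f_ k x @[k --> \oo] --> f x) -> limits f.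
Proof.
move=> f_C f_l fC cv; split; first by exists C.
have H1 : (fun k => \int[nu]_x `|f_ k x - f x|) @ \oo --> (0 : R).
  by apply: bn_dominated => //; exact: nearW.
have H2 : (fun k => \int[pi]_x `|f_ k x - f x|) @ \oo --> (0 : R).
  by apply: bn_dominated => //; exact: nearW.
have itgd (mu : probability T R) k : itg mu (fun x => `|f_ k x - f x|).
  by apply: itg_norm; apply: itgB; [exact: bn_itg (f_C k)|exact: bn_itg fC].
have db k : bounded_nonneg C (fun x => `|f_ k x - f x|).
  have [m1 b1] := f_C k; have [m2 b2] := fC; split.
    by apply: measurable_normrf; apply: m_add => //; exact: m_opp.
  move=> x; rewrite normr_ge0/= ler_norml.
  by have /andP[] := b1 x; have /andP[] := b2 x; lra.
have dist (mu : probability T R) k : `|\int[mu]_x f x - \int[mu]_x f_ k x| <= \int[mu]_x `|f_ k x - f x|.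
  have i1 := bn_itg mu (f_C k); have i2 := bn_itg mu fC.
  by rewrite distrC -RintB//; apply: norm_Rint_le => //; exact: itgB.
apply/cvgrPdist_le => e e0.
have e3 : 0 < e / 3 by rewrite divr_gt0.
have e3M : 0 < e / (3 * (M + 1)) by rewrite divr_gt0 ?mulr_gt0// ltr_wpDl.
near \oo => k.
have Hk1 : \int[nu]_x `|f_ k x - f x| <= e / 3.
  near: k; have /cvgrPdist_le/(_ _ e3) := H1; apply: filterS => k; rewrite sub0r normrN.
  exact: le_trans (ler_norm _).
have Hk2 : \int[pi]_x `|f_ k x - f x| <= e / (3 * (M + 1)).
  near: k; have /cvgrPdist_le/(_ _ e3M) := H2; apply: filterS => k; rewrite sub0r normrN.
  exact: le_trans (ler_norm _).
have [_ /cvgrPdist_le/(_ _ e3)] := f_l k; apply: filterS => N HN.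
have HN2 : \int[nu_ N]_x `|f_ k x - f x| <= e / 3.
  apply: (le_trans (dominated_int N (db k))); apply: (le_trans (ler_wpM2l M0 Hk2)).
  rewrite (_ : M * _ = e / 3 * (M / (M + 1))); last by field; rewrite gt_eqF// ltr_wpDl.
  by rewrite ler_piMr ?(ltW e3)// ler_pdivrMr ?ltr_wpDl// mul1r lerDl.
have d1 := dist nu k; have d2 := dist (nu_ N) k.
rewrite (_ : \int[nu]_x f x - \int[nu_ N]_x f x = (\int[nu]_x f x - \int[nu]_x f_ k x) + (\int[nu]_x f_ k x - \int[nu_ N]_x f_ k x)
   - (\int[nu_ N]_x f x - \int[nu_ N]_x f_ k x)); last by ring.
apply: (le_trans (ler_normB _ _)); have := ler_normD (\int[nu]_x f x - \int[nu]_x f_ k x) (\int[nu]_x f_ k x - \int[nu_ N]_x f_ k x).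
lra.
Unshelve. all: by end_near. Qed.

Definition lim_set (A : set T) := measurable A /\ (fun N => fine (nu_ N A)) @ \oo --> fine (nu A).

Lemma limits_indic A : measurable A -> limits (\1_A) -> lim_set A.
Proof.
move=> mA [_]; rewrite Rint_indic// => H; split => //.
by under eq_fun do rewrite -Rint_indic//.
Qed.

Lemma lim_set_indic A : lim_set A -> limits (\1_A).
Proof.
move=> [mA H]; split; first by exists 1; exact: bn_indic.
by rewrite Rint_indic//; under eq_fun do rewrite Rint_indic//.
Qed.

(** The sets on which the probabilities converge form a Dynkin system. Stability under increasing
    unions is the point where uniform domination enters, through [limits_lim]. *)
Lemma lim_set_generated (G : set (set T)) : setI_closed G -> (forall A, measurable A -> <<s G >> A) ->
  G `<=` lim_set -> forall A, measurable A -> lim_set A.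
Proof.
move=> GI sG GL A mA.
suff : <<s G >> `<=` lim_set by apply; exact: sG.
apply: lambda_system_subset => //; split => //.
- split => //; under eq_fun do rewrite probability_setT.
  by rewrite probability_setT; exact: cvg_cst.
- move=> B C CB [mB HB] [mC HC]; split; first exact: measurableD.
  have D (mu : probability T R) : fine (mu (B `\` C)) = fine (mu B) - fine (mu C).
    rewrite measureD//; last by rewrite ltey_eq fin_num_measure.
    by rewrite setIidr// fineB//; exact: fin_num_measure.
  by rewrite D; under eq_fun do rewrite D; exact: cvgB.
- move=> F ndF HF; have mF k : measurable (F k) by have [] := HF k.
  have mU : measurable (\bigcup_k F k) by exact: bigcup_measurable.
  apply: limits_indic => //; apply: (@limits_lim 1 (fun k => \1_(F k))).
  + by move=> k; exact: bn_indic.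
  + by move=> k; exact: lim_set_indic.
  + exact: bn_indic.
  move=> x; apply: cvg_near_cst.
  have [[k _ Fk]|nF] := pselect ((\bigcup_k F k) x).
    exists k => // j /= kj; rewrite !indicE !mem_set//; first by exists k.
    by move: (ndF _ _ kj) => /subsetPset; apply.
  apply: nearW => k; rewrite !indicE !memNset// => Fk; apply: nF; by exists k.
Qed.

Hypothesis all_sets : forall A, measurable A -> lim_set A.

Lemma limit_dominated A : measurable A -> (nu A <= M%:E * pi A)%E.
Proof.
move=> mA; have [_ H] := all_sets mA.
have pE : (M%:E * pi A)%E = (M * fine (pi A))%:E by rewrite EFinM fineK// fin_num_measure.
rewrite pE -[nu A]fineK ?fin_num_measure// lee_fin.
apply: (cvgr_to_le H); apply: nearW => N.
have := dominated_int N (bn_indic mA); rewrite !Rint_indic//.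
Qed.

Lemma limits_all C f : bounded_nonneg C f -> limits f.
Proof.
move=> fC; have [mf f0] := fC.
pose Cn := (Num.truncn C).+1.
have CCn : C <= Cn%:R by apply: ltW; exact: truncnS_gt.
pose S k m := [set x | m%:R < k.+1%:R * f x].
have mS k m : measurable (S k m).
  rewrite (_ : S k m = setT `&` (fun x => m%:R < k.+1%:R * f x) @^-1` [set true]); last first.
    by rewrite setTI; apply/seteqP; split.
  apply: (@measurable_fun_ltr _ T R setT (fun=> m%:R) (fun x => k.+1%:R * f x)) => //.
  by apply: m_mul => //; exact: measurable_cst.
(* This is the ceiling of (k + 1) f(x) divided by k + 1, hence within 1/(k + 1) of f, and it is a
   finite combination of indicators. *)
pose f_ k x : R := k.+1%:R^-1 * \sum_(m < k.+1 * Cn) \1_(S k m) x.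
have f_E k x : f x <= f_ k x <= f x + k.+1%:R^-1.
  have /andP[fx0 fxC] := f0 x.
  have k0 : 0 < k.+1%:R :> R by [].
  have y0 : 0 <= k.+1%:R * f x by rewrite mulr_ge0.
  have yC : k.+1%:R * f x <= (k.+1 * Cn)%:R by rewrite natrM ler_pM2l// (le_trans fxC).
  have /andP[h1 h2] := ceil_sum y0 yC.
  rewrite /f_ (_ : \sum_(m < _) _ = \sum_(m < k.+1 * Cn) (((m%:R < k.+1%:R * f x)%R : nat)%:R : R)); last first.
    by apply: eq_bigr => m _; rewrite indicE /S; congr (nat_of_bool _)%:R; apply/idP/idP; rewrite inE.
  apply/andP; split; first by rewrite ler_pdivlMl.
  by rewrite ler_pdivrMl// mulrDr mulfV// gt_eqF.
have f_b k : bounded_nonneg (C + 1) (f_ k).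
  split.
    apply: m_mul; first exact: measurable_cst.
    by apply: m_sum => m; exact: measurable_indic.
  move=> x; have /andP[h1 h2] := f_E k x; have /andP[fx0 fxC] := f0 x.
  rewrite (le_trans fx0 h1)/= (le_trans h2)// lerD//.
  by rewrite invf_le1// ler1n.
apply: (@limits_lim (C + 1) f_) => //.
- move=> k; split; first by exists (C + 1).
  have iS (mu : probability T R) m : itg mu (\1_(S k m)) by exact: bn_itg (bn_indic (mS k m)).
  have E (mu : probability T R) : \int[mu]_x f_ k x = k.+1%:R^-1 * \sum_(m < k.+1 * Cn) fine (mu (S k m)).
    have iSum j : itg mu (fun x => \sum_(m < j) \1_(S k m) x) /\
        \int[mu]_x (\sum_(m < j) \1_(S k m) x) = \sum_(m < j) fine (mu (S k m)).
      elim: j => [|j [IH1 IH2]].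
        split; first by under eq_fun do rewrite big_ord0; exact: finite_measure_integrable_cst.
        by under eq_Rintegral do rewrite big_ord0; rewrite big_ord0 Rintegral_cst// mul0r.
      have e x : \sum_(m < j.+1) \1_(S k m) x = \sum_(m < j) \1_(S k m) x + \1_(S k j) x :> R.
        by rewrite big_ord_recr.
      split; first by rewrite (funext e); exact: itgD.
      by rewrite (eq_Rint _ e) RintD// IH2 Rint_indic// big_ord_recr.
    by rewrite RintZ; have [i1 i2] := iSum (k.+1 * Cn)%N; rewrite ?i2.
  rewrite E; under eq_fun do rewrite E.
  apply: cvgMr; apply: cvg_big => [|m _].
    by move=> [p q]; exact: cvgD cvg_fst cvg_snd.
  by have [_] := all_sets (mS k m).
- split => // x; have /andP[-> fxC] := f0 x; by rewrite (le_trans fxC)// lerDl.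
move=> x; apply/cvgrPdist_le => e e0.
have H := @cvg_harmonic R; move/cvgrPdist_le : H => /(_ e e0); apply: filterS => k.
rewrite sub0r normrN ger0_norm ?invr_ge0// => He.
rewrite distrC ger0_norm; last by have /andP[h _] := f_E k x; rewrite subr_ge0.
by apply: le_trans He; have /andP[_ h] := f_E k x; rewrite lerBlDl.
Qed.

(** Setwise convergence preserves domination by [M * pi], so the sets where the Radon-Nikodym
    density is at least M + 1/(k + 1) are null; truncation at [M] then gives a version bounded at
    every point. *)
Lemma limit_density : exists v, [/\ bounded_nonneg M v &
  forall A, measurable A -> nu A = (\int[pi]_(x in A) (v x)%:E)%E].
Proof.
have D : nu `<< pi.
  apply/null_content_dominatesP => A mA pA; apply/eqP; rewrite eq_le measure_ge0 andbT.
  by rewrite (le_trans (limit_dominated mA))// pA mule0.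
pose f0 := Radon_Nikodym_SigmaFinite.f nu pi.
have f00 := Radon_Nikodym_SigmaFinite.f_ge0 D; have f0f := Radon_Nikodym_SigmaFinite.f_fin_num D.
have if0 := Radon_Nikodym_SigmaFinite.f_integrable D.
have mf0 : measurable_fun setT f0 := measurable_int _ if0.
pose S k := [set x | ((M + k.+1%:R^-1)%:E <= f0 x)%E].
have mS k : measurable (S k).
  rewrite -[S k]setTI; apply: emeasurable_fun_c_infty => //.
have S0 k : pi (S k) = 0%E.
  have h1 := limit_dominated (mS k).
  have h2 : ((M + k.+1%:R^-1)%:E * pi (S k) <= nu (S k))%E.
    rewrite (Radon_Nikodym_SigmaFinite.f_integral D (mS k)) -integral_cst//.
    apply: ge0_le_integral => //.
    - by move=> x _; rewrite lee_fin addr_ge0.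
    - exact: measurable_funTS.
  have := le_trans h2 h1; rewrite -[pi (S k)]fineK ?fin_num_measure// -!EFinM lee_fin mulrDl gerDl => h3.
  have h4 : 0 <= fine (pi (S k)) by rewrite fine_ge0.
  congr EFin; apply/le_anti; rewrite h4 andbT.
  by move: h3; rewrite pmulr_rle0// invr_gt0.
have fM : {ae pi, forall x, (f0 x <= M%:E)%E}.
  have : \forall x \ae pi, forall k, ~ S k x.
    by apply: ae_foralln => k; exists (S k); split; [exact: mS|exact: S0|move=> x /= /contrapT].
  apply: filterS => x H; apply/lee_addgt0Pr => e e0.
  have [k Hk] : exists k, k.+1%:R^-1 <= e.
    exists (Num.truncn e^-1); rewrite -[leRHS]invrK lef_pV2 ?posrE ?invr_gt0//.
    by apply: ltW; exact: truncnS_gt.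
  have /negP := H k; rewrite -ltNge => /ltW h; apply: (le_trans h).
  by rewrite -EFinD lee_fin lerD2l.
pose v x := Num.min (fine (f0 x)) M.
have mv : measurable_fun setT v.
  by apply: measurable_minr => //; apply: measurableT_comp => //; exact: fine_measurable.
have v0 x : 0 <= v x by rewrite le_min M0 andbT fine_ge0// f00.
exists v; split.
  by split => // x; rewrite v0 ge_min lexx orbT.
move=> A mA; rewrite (Radon_Nikodym_SigmaFinite.f_integral D mA).
apply: ae_eq_integral => //.
- exact: measurable_funTS.
- by apply: measurable_funTS; exact: m_EFin.
apply: filterS fM => x H _; rewrite -/f0 -[LHS]fineK ?f0f//.
by congr EFin; rewrite /v min_l// -lee_fin fineK// f0f.
Qed.

End weak_limit.

(** * The law of the diffusion *)

Section orthants.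
Context {R : realType} {n : nat}.
Implicit Types (c : 'I_n -> R) (x : 'rV[R]_n).

(** Open orthants form a generating pi-system, and the strict inequalities make their indicators
    pointwise limits of products of continuous ramps, so no boundary has to be shown null. *)
Definition orthant c : set 'rV[R]_n := [set x | forall i, x ord0 i < c i].

Lemma orthant_rect c : orthant c = rect (fun i => `]-oo, c i[%classic).
Proof. by apply/seteqP; split => x /= H i; move: (H i); rewrite /= in_itv. Qed.

Lemma measurable_orthant c : measurable (orthant c).
Proof. by rewrite orthant_rect; apply: measurable_rect => i; exact: measurable_itv. Qed.

Lemma orthants_generate A : measurable A -> <<s range orthant >> A.
Proof.
move=> mA; pose idr : g_sigma_algebraType (range orthant) -> 'rV[R]_n := id.
suff : measurable_fun setT idr by move=> /(_ measurableT _ mA); rewrite setTI.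
apply/measurable_fun_coorP => i.
apply: (@measurability _ _ _ (measurableTypeR R) setT _ _ (RGenInftyO.measurableE R)) => _ [_ [c ->] <-]; rewrite setTI.
rewrite (_ : _ @^-1` _ = \bigcup_k orthant (fun j => if j == i then c else k%:R)).
  apply: bigcup_measurable => k _; apply: sub_sigma_algebra.
  by exists (fun j => if j == i then c else k%:R).
apply/seteqP; split => x /=; rewrite in_itv /= /rV_coor.
  move=> xc; exists (Num.truncn (\sum_(j < n) `|x ord0 j|)).+1 => // j /=.
  case: eqP => [->//|_]; apply: (le_lt_trans _ (truncnS_gt _)).
  by rewrite (bigD1 j)//= (le_trans (ler_norm _))// lerDl sumr_ge0.
by move=> [k _ /(_ i)]; rewrite eqxx.
Qed.

Definition ramp (k : nat) (t : R) : R := Num.min 1 (Num.max 0 (k%:R * t)).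

Lemma ramp_bnd k t : 0 <= ramp k t <= 1.
Proof. by rewrite le_min ler01 le_max lexx /= ge_min lexx. Qed.

Lemma continuous_ramp k : continuous (ramp k).
Proof.
move=> t; pose g : R -> R^o := (fun=> 0) \max (fun y : R => k%:R * y).
apply: (@continuous_min _ _ (fun=> 1) g t); first exact: cvg_cst.
apply: (@continuous_max _ _ (fun=> 0) (fun y : R => k%:R * y) t); first exact: cvg_cst.
exact: mulrl_continuous.
Qed.

Lemma ramp_cvg t : ramp k t @[k --> \oo] --> (((0 < t)%R : nat)%:R : R).
Proof.
apply: cvg_near_cst; have [t0|t0] := ltP 0 t; last first.
  by apply: nearW => k; rewrite /ramp max_l ?min_r// mulr_ge0_le0.
exists (Num.truncn t^-1).+1 => // k /= kt.
have h : 1 <= k%:R * t.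
  by rewrite -ler_pdivrMr// mul1r (le_trans (ltW (truncnS_gt _)))// ler_nat.
by rewrite /ramp max_r ?min_l// (le_trans ler01).
Qed.

Section determine.
Variables (pi : probability 'rV[R]_n R) (nu_ : nat -> probability 'rV[R]_n R) (nu : probability 'rV[R]_n R).
Variables (u_ : nat -> 'rV[R]_n -> R) (M : R).
Hypothesis u_b : forall N, bounded_nonneg M (u_ N).
Hypothesis nuE : forall N A, measurable A -> nu_ N A = (\int[pi]_(x in A) (u_ N x)%:E)%E.
Hypothesis prod_cvg : forall F : 'I_n -> R -> R, (forall i, continuous (F i)) -> (forall i t, 0 <= F i t <= 1) ->
  (fun N => \int[nu_ N]_x \prod_(i < n) F i (x ord0 i)) @ \oo --> \int[nu]_x \prod_(i < n) F i (x ord0 i).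

Lemma lim_orthant c : lim_set nu_ nu (orthant c).
Proof.
apply: limits_indic; first exact: measurable_orthant.
pose f_ k (x : 'rV[R]_n) : R := \prod_(i < n) ramp k (c i - x ord0 i).
have cF k i : continuous (fun t => ramp k (c i - t)).
  move=> t; apply: (@cvg_comp _ _ _ (fun t => c i - t)); last exact: continuous_ramp.
  by apply: cvgB; [exact: cvg_cst|exact: cvg_id].
have f_b k : bounded_nonneg 1 (f_ k).
  split.
    apply: (m_prod (h := fun i (x : 'rV[R]_n) => ramp k (c i - x ord0 i))) => i.
    exact: (measurableT_comp (continuous_measurable_fun (cF k i)) (measurable_coor i)).
  move=> x; apply/andP; split.
    by apply: prodr_ge0 => i _; have /andP[] := ramp_bnd k (c i - x ord0 i).
  by apply: prodr_ile1 => i _; exact: ramp_bnd.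
apply: (@limits_lim _ _ _ pi nu_ nu u_ M u_b nuE 1 f_) => //.
- move=> k; split; first by exists 1.
  apply: (prod_cvg (F := fun i t => ramp k (c i - t))) => // i t; exact: ramp_bnd.
- by apply: bn_indic; exact: measurable_orthant.
move=> x; rewrite (_ : \1_(orthant c) x = \prod_(i < n) ((0 < c i - x ord0 i)%R : nat)%:R).
  apply: cvg_big => [|i _]; last exact: ramp_cvg.
  by move=> [p q]; exact: cvgM cvg_fst cvg_snd.
rewrite indicE; have [xo|xo] := pselect (orthant c x).
  by rewrite mem_set// big1// => i _; move: (xo i); rewrite -subr_gt0 => ->.
rewrite memNset//; have /existsNP[i Hi] := xo.
by rewrite (bigD1 i)//= subr_gt0 (negbTE (introN idP Hi)) mul0r.
Qed.

Lemma lim_all A : measurable A -> lim_set nu_ nu A.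
Proof.
apply: (@lim_set_generated _ _ _ pi nu_ nu u_ M u_b nuE (range orthant)).
- move=> _ _ [c _ <-] [c' _ <-]; exists (fun i => Num.min (c i) (c' i)) => //.
  apply/seteqP; split => x /=.
    by move=> H; split => i; have := H i; rewrite lt_min => /andP[].
  by move=> [h1 h2] i; rewrite lt_min h1 h2.
- exact: orthants_generate.
by move=> _ [c _ <-]; exact: lim_orthant.
Qed.
End determine.

Lemma ae_limit_prod {d : measure_display} {Om : measurableType d} (P : probability Om R)
    (Y_ : nat -> {RV P >-> 'rV[R]_n}) (Y : {RV P >-> 'rV[R]_n}) (F : 'I_n -> R -> R) :
  {ae P, forall w, forall i, Y_ N w ord0 i @[N --> \oo] --> Y w ord0 i} ->
  (forall i, continuous (F i)) -> (forall i t, 0 <= F i t <= 1) ->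
  (fun N => \int[distribution P (Y_ N)]_x \prod_(i < n) F i (x ord0 i)) @ \oo -->
    \int[distribution P Y]_x \prod_(i < n) F i (x ord0 i).
Proof.
move=> YY cF F01; pose phi (x : 'rV[R]_n) : R := \prod_(i < n) F i (x ord0 i).
have pb : bounded_nonneg 1 phi.
  split.
    apply: (m_prod (h := fun i (x : 'rV[R]_n) => F i (x ord0 i))) => i.
    exact: (measurableT_comp (continuous_measurable_fun (cF i)) (measurable_coor i)).
  by move=> x; rewrite prodr_ge0 ?prodr_ile1//= => i _; have /andP[] := F01 i (x ord0 i).
have pbY (Z : {RV P >-> 'rV[R]_n}) : bounded_nonneg 1 (phi \o Z).
  by have [m b] := pb; split; [apply: measurableT_comp|move=> w; exact: b].
have E (Z : {RV P >-> 'rV[R]_n}) : \int[distribution P Z]_x phi x = \int[P]_w phi (Z w).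
  rewrite /Rintegral integral_distribution//; first by apply/measurable_EFinP; have [] := pb.
  exact: bn_itg (pbY Z).
rewrite -/phi (E Y); under eq_fun do rewrite -/phi E.
apply: (bn_cvg (fun k => pbY (Y_ k)) (pbY Y)).
apply: filterS YY => w Hw; rewrite /= /phi.
apply: cvg_big => [|i _]; first by move=> [p q]; exact: cvgM cvg_fst cvg_snd.
by apply: (@cvg_comp _ _ _ (fun N => Y_ N w ord0 i)); [exact: Hw|exact: cF].
Qed.

End orthants.

Section limit_moment.
Context {R : realType} {n : nat}.
Variables (a q e M : R) (a0 : 0 < a) (a1 : a < 1) (n0 : (0 < n)%N) (q2 : 2 <= q) (e0 : 0 <= e).
Local Notation lam := (@lebesgue_rV R n).
Local Notation eV := (@eV R n a).
Local Notation Z := (@ZV R n a).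
Local Notation pi := (pi_alpha n a).
Variables (nu_ : nat -> probability 'rV[R]_n R) (nu : probability 'rV[R]_n R).
Variables (u_ : nat -> 'rV[R]_n -> R).
Hypothesis u_b : forall N, bounded_nonneg M (u_ N).
Hypothesis nuE : forall N A, measurable A -> nu_ N A = (\int[pi]_(x in A) (u_ N x)%:E)%E.
Hypothesis all_sets : forall A, measurable A -> lim_set nu_ nu A.
Hypothesis moment : forall N, \int[lam]_x (eV x * u_ N x `^ q) <= (1 + e) * Z.

(* Lower semicontinuity of the q-th moment: test the convergence against
   [v ^ (q - 1)] and apply Young's inequality. *)
Lemma limit_renyi : (renyi nu pi q <= e%:E)%E.
Proof.
have [v [vb vE]] := limit_density u_b nuE all_sets.
have [mv v0M] := vb; have v0 x : 0 <= v x by have /andP[] := v0M x.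
have vM x : v x <= M by have /andP[] := v0M x.
apply: (renyi_le a0 a1 n0 mv v0 vM vE q2 e0).
have q0 : 0 < q by move: q2; lra.
have q1 : 0 <= q - 1 by move: q2; lra.
have Zp : 0 < Z by apply: ZV_gt0.
have M0 : 0 <= M by have := vM 0; apply: le_trans.
pose phi x := v x `^ (q - 1); pose K := M `^ (q - 1).
have phib : bounded_nonneg K phi.
  split; first exact: measurable_powRf.
  by move=> x; rewrite powR_ge0; apply: ge0_ler_powR; rewrite ?nnegrE.
have [mphi phi01] := phib; have phi0 x : 0 <= phi x by exact: powR_ge0.
have [_ H] := limits_all u_b nuE all_sets phib.
have intE (rho : probability 'rV[R]_n R) w : bounded_nonneg M w ->
    (forall A, measurable A -> rho A = (\int[pi]_(x in A) (w x)%:E)%E) ->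
    \int[rho]_x phi x = (\int[lam]_x (eV x * (phi x * w x))) / Z.
  move=> [mw w0] rhoE; apply/EFin_inj; rewrite itgK; last exact: (bn_itg rho phib).
  have w00 x : 0 <= w x by have /andP[] := w0 x.
  have -> := @density_int _ _ _ rho pi w mw rhoE (EFin \o phi).
  - rewrite -(pi_intE a0 a1 n0 (w := fun x => phi x * w x) (B := K * M)).
    + exact: eq_int.
    + exact: m_mul.
    + by move=> x; rewrite mulr_ge0.
    by move=> x; apply: ler_pM => //; [have /andP[] := phi01 x|have /andP[] := w0 x].
  - exact/measurable_EFinP.
  - by move=> x; rewrite lee_fin.
pose I := \int[lam]_x (eV x * v x `^ q).
have iw (w : 'rV[R]_n -> R) (B : R) : measurable_fun setT w -> (forall x, `|w x| <= B) -> itg lam (fun x => eV x * w x).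
  by move=> mw wB; exact: (itg_eVw a0 mw wB).
have iq w : bounded_nonneg M w -> itg lam (fun x => eV x * w x `^ q).
  move=> [mw w0]; apply: (iw _ (M `^ q)); first exact: measurable_powRf.
  move=> x; rewrite ger0_norm ?powR_ge0//; have /andP[h1 h2] := w0 x.
  by apply: ge0_ler_powR; rewrite ?nnegrE// ltW.
have young N : \int[lam]_x (eV x * (phi x * u_ N x)) <= q^-1 * ((1 + e) * Z) + (1 - q^-1) * I.
  have [mu u0M] := u_b N.
  apply: (@le_trans _ _ (\int[lam]_x (q^-1 * (eV x * u_ N x `^ q) + (1 - q^-1) * (eV x * v x `^ q)))).
    apply: le_Rint.
    - apply: (iw _ (K * M)); first exact: m_mul.
      move=> x; have /andP[h1 h2] := u0M x; rewrite ger0_norm ?mulr_ge0//.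
      by apply: ler_pM => //; have /andP[] := phi01 x.
    - by apply: itgD; apply: itgZ; exact: iq.
    move=> x; have /andP[h1 h2] := u0M x.
    have q1q : 0 < q / (q - 1) by rewrite divr_gt0//; move: q2; lra.
    have := @conjugate_powR R (u_ N x) (phi x) q (q / (q - 1)) h1 (phi0 x) q0 q1q.
    have q1n : q - 1 != 0 by rewrite gt_eqF//; move: q2; lra.
    have -> : q^-1 + (q / (q - 1))^-1 = 1 by field; rewrite q1n gt_eqF.
    move=> /(_ erefl); rewrite /phi -powRrM (_ : (q - 1) * (q / (q - 1)) = q); last by field.
    rewrite (_ : (q / (q - 1))^-1 = 1 - q^-1); last by field; rewrite q1n gt_eqF.
    move=> Y; have eV0 : 0 <= eV x by exact: expR_ge0.
    rewrite mulrCA [X in _ <= X + _]mulrC.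
    have := ler_wpM2l eV0 Y; rewrite -/phi; lra.
  rewrite RintD ?RintZ; try exact: iq; last 2 first.
  - by apply: itgZ; exact: iq.
  - by apply: itgZ; exact: iq.
  by rewrite lerD2r ler_wpM2l// invr_ge0 ltW.
have Iv : \int[lam]_x (eV x * (phi x * v x)) = I.
  apply: eq_Rint => x; congr (_ * _); rewrite /phi.
  by have := v0 x; rewrite le_eqVlt => /predU1P[<-|vx]; rewrite ?mulr0 ?powR0 ?gt_eqF// -[X in _ * X]powRr1// -powRD ?subrK// gt_eqF ?implybT.
have : \int[nu]_x phi x <= (q^-1 * ((1 + e) * Z) + (1 - q^-1) * I) / Z.
  apply: (cvgr_to_le H); apply: nearW => N.
  rewrite (intE _ _ (u_b N) (@nuE N)); apply: ler_wpM2r; first by rewrite invr_ge0 ltW.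
  exact: young.
rewrite (intE _ _ vb vE) Iv ler_pM2r ?invr_gt0// => HI.
have : q^-1 * I <= q^-1 * ((1 + e) * Z) by move: HI; lra.
by rewrite ler_pM2l// invr_gt0.
Qed.

End limit_moment.

(** * The divergence bound for the diffusion *)

Section diffusion.
Context {R : realType} {n : nat}.
Variables (a q eps : R) (a0 : 0 < a) (a1 : a < 1) (n0 : (0 < n)%N) (q2 : 2 <= q).
Hypothesis (eps0 : 0 < eps) (epsq : eps <= 2^-1).
Variables (rho0 : probability 'rV[R]_n R).
Hypothesis fin : (renyi_infty rho0 (pi_alpha n a) < +oo)%E.
Context {d : measure_display} {Om : measurableType d} (P : probability Om R).
Variables (B X : R -> {RV P >-> 'rV[R]_n}) (T : R).
Hypothesis LD : langevin_diffusion (V_alpha n a) rho0 B X.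
Hypothesis T0 : 0 < T.
Hypothesis long : 2 * (q + 1) / ck a q * @Slev R n a q eps (Rinf a rho0) * (Rq a rho0 q + ln eps^-1) <= T.

Local Notation Y N := (mk_rv P (measurable_euler (n := n) a B X (T / N.+1%:R) N.+1)).

Lemma euler_cvg : {ae P, forall w, forall i, Y N w ord0 i @[N --> \oo] --> X T w ord0 i}.
Proof.
have [_ _ _ Xc XE] := LD.
apply: filterS2 Xc XE => w wc wE i.
have wE2 t j : 0 <= t -> X t w ord0 j = X 0 w ord0 j
    - \int[lebesgue_measure]_(s in `[0, t]) gV a (X s w) ord0 j + Num.sqrt 2 * B t w ord0 j.
  move=> t0; rewrite (wE t j t0); congr (_ - _ + _); apply: eq_Rintegral => s _.
  by rewrite grad_V.
have eS N k : euler a B X (T / N.+1%:R) k.+1 w = euler a B X (T / N.+1%:R) k w -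
    (T / N.+1%:R) *: gV a (euler a B X (T / N.+1%:R) k w) +
    Num.sqrt 2 *: (B (k.+1%:R * (T / N.+1%:R)) w - B (k%:R * (T / N.+1%:R)) w).
  rewrite /=; congr (_ + _); rewrite /noise scalerA; congr (_ *: _).
  have h0 : 0 < T / N.+1%:R by rewrite divr_gt0.
  by rewrite sqrtrM// mulfK// gt_eqF// sqrtr_gt0.
have H := euler_path a0 a1 (x := X ^~ w) (b := B ^~ w) T0 wc wE2
  (e := fun N k => euler a B X (T / N.+1%:R) k w) (fun N => erefl) eS.
apply/cvgrPdist_le => eta eta0; have := H _ eta0.
apply: filterS => N HN; rewrite distrC; apply: le_trans HN.
have := coord_le_enorm (euler a B X (T / N.+1%:R) N.+1 w - X T w) i.
by rewrite [X in `|X| <= _]mxE [X in `|_ + X| <= _]mxE.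
Qed.

Lemma diffusion_renyi : (renyi (distribution P (X T)) (pi_alpha n a) q <= eps%:E)%E.
Proof.
have [u [mu u0 uM r0 uE]] := initial_density a0 a1 n0 fin.
have q1 : 1 < q by move: q2; lra.
have u1 := density_mass a0 a1 n0 mu u0 uM uE.
have uq := Rq_density a0 a1 n0 mu u0 uM uE q1.
have Rq0 := Rq_ge0 a0 a1 n0 mu u0 uM uE q1.
pose S := @Slev R n a q eps (Rinf a rho0).
have c0 : 0 < ck a q by exact: ck_gt0.
have S0 : 0 <= S by apply: (le_trans ler01); exact: Swp_ge1.
have CK0 : 0 <= CK :> R by rewrite /CK mulr_ge0 ?expR_ge0// sqr_ge0.
(* The thresholds on the number of steps for h n <= 1, for the accumulated excess mass and, in [c3],
   for the bias. The sequence is shifted by [N0] so that all three hold for every index. *)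
pose c1 : R := T * n%:R; pose c2 : R := CK * T ^+ 2 * n%:R ^+ 2.
pose c3 : R := 16 * (q - 1) * CK * T * n%:R ^+ 2 * S / (ck a q * eps).
have c10 : 0 <= c1 by apply: mulr_ge0; [exact: ltW|exact: ler0n].
have c20 : 0 <= c2 by apply: mulr_ge0 (mulr_ge0 CK0 (sqr_ge0 _)) (sqr_ge0 _).
have c30 : 0 <= c3.
  apply: divr_ge0; last by apply: mulr_ge0; exact: ltW.
  apply: mulr_ge0 => //; apply: mulr_ge0 (sqr_ge0 _); apply: mulr_ge0 (ltW T0); apply: mulr_ge0 => //.
  by apply: mulr_ge0; [exact: ler0n|move: q2; lra].
pose N0 := Num.truncn (c1 + c2 + c3).
have HN N : (N0 <= N)%N -> [/\ 0 < T / N.+1%:R, T / N.+1%:R * n%:R <= 1, N.+1%:R * @dl R n (T / N.+1%:R) <= 1,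
    16 * (q - 1) * CK * (T / N.+1%:R) * n%:R ^+ 2 * S <= ck a q * eps & T <= N.+1%:R * (T / N.+1%:R)].
  move=> NN; have HH : c1 + c2 + c3 <= N.+1%:R.
    by apply: (le_trans (ltW (truncnS_gt _))); rewrite ler_nat ltnS.
  have N1 : 0 < N.+1%:R :> R by [].
  split.
  - by rewrite divr_gt0.
  - by rewrite mulrAC ler_pdivrMr// mul1r -/c1; move: HH c20 c30; lra.
  - rewrite /dl (_ : N.+1%:R * _ = c2 / N.+1%:R); last by rewrite /c2; field; rewrite gt_eqF.
    by rewrite ler_pdivrMr// mul1r; move: HH c10 c30; lra.
  - rewrite (_ : _ * S = c3 / N.+1%:R * (ck a q * eps)); last first.
      by rewrite /c3; field; rewrite !gt_eqF.
    apply: ler_piMl; first by apply: mulr_ge0; exact: ltW.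
    by rewrite ler_pdivrMr// mul1r; move: HH c10 c20; lra.
  - by rewrite mulrC divfK// gt_eqF.
pose h N := T / (N0 + N).+1%:R.
pose w N := iter_step a (h N) u (N0 + N).+1.
have HN' N := HN _ (leq_addr N N0).
have lmc N := euler_lmc LD (let: And5 h0 _ _ _ _ := HN' N in h0).
have wb N : bounded_nonneg (expR (1 + Rinf a rho0)) (w N).
  have [h0 hn Nd _ _] := HN' N.
  have [mw w0 _ _] := iter_stepP a0 a1 n0 h0 hn mu u0 uM u1 (N0 + N).+1.
  split => // x; rewrite w0 /=.
  exact: (iter_bound a0 a1 n0 h0 hn mu u0 uM u1 Nd).
have wE N A : measurable A -> distribution P (Y (N0 + N)) A = (\int[pi_alpha n a]_(x in A) (w N x)%:E)%E.
  have [h0 hn _ _ _] := HN' N.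
  exact: (lmc_law a0 a1 n0 h0 hn (lmc N) mu u0 uM uE).
apply: (limit_renyi (nu_ := fun N => distribution P (Y (N0 + N))) a0 a1 n0 q2 (ltW eps0) wb wE).
  apply: (lim_all wb wE) => F cF F01.
  apply: (ae_limit_prod (Y_ := fun N => Y (N0 + N))) => //.
  apply: filterS euler_cvg => om Hom i; have := Hom i.
  move=> /cvgrPdist_le H; apply/cvgrPdist_le => e e0; have [K _ HK] := H e e0.
  by exists K => // N /= KN; apply: HK => /=; exact: (leq_trans KN (leq_addl _ _)).
move=> N; have [h0 hn Nd small Nh] := HN' N.
apply: (iter_decay a0 a1 n0 q2 h0 hn eps0 epsq r0 mu u0 uM u1 _ Nd small _ Rq0); first by rewrite uq.
exact: (le_trans long Nh).
Qed.

End diffusion.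

(** * The diffusion time *)

Section diffusion_time.
Context {R : realType}.

Lemma powR_le_add (x p s : R) : 0 <= x -> 0 <= p -> p <= s -> x `^ p <= 1 + x `^ s.
Proof.
move=> x0 p0 ps; have [x1|/ltW x1] := leP 1 x.
  by apply: (le_trans (ler_powR x1 ps)); rewrite lerDr.
apply: (@le_trans _ _ 1); last by rewrite lerDl powR_ge0.
have one : 1 `^ p = 1 :> R by rewrite powR1.
by rewrite -[leRHS]one; apply: ge0_ler_powR; rewrite ?nnegrE.
Qed.

Lemma powR_sum3 (x y z p : R) : 0 <= x -> 0 <= y -> 0 <= z -> 0 <= p ->
  (x + y + z) `^ p <= 3 `^ p * (x `^ p + y `^ p + z `^ p).
Proof.
move=> x0 y0 z0 p0; pose w := Num.max x (Num.max y z).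
have [wx wy wz] : [/\ x <= w, y <= w & z <= w] by rewrite !le_max !lexx !orbT.
have w0 : 0 <= w by apply: le_trans wx.
apply: (@le_trans _ _ ((3 * w) `^ p)).
  by apply: ge0_ler_powR; rewrite ?nnegrE ?addr_ge0 ?mulr_ge0//; move: wx wy wz; lra.
rewrite powRM// ler_wpM2l ?powR_ge0//.
have [xp yp zp] : [/\ 0 <= x `^ p, 0 <= y `^ p & 0 <= z `^ p] by split; exact: powR_ge0.
have : w = x \/ w = y \/ w = z.
  by rewrite /w; case: (leP y z) => _; case: leP => _; auto.
by move=> [->|[->|->]]; move: xp yp zp; lra.
Qed.

(** Here p = 2/a - 2, while s and t are the exponents attached to some gamma and exceed p and p + 1.
    The only mixed term is L^p (rho + L): if L <= rho then L^p <= r^p since rho <= r, and otherwise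
    the term is at most 2 L^(p + 1). The lower bound on L lets additive constants be absorbed. *)
Lemma time_bound (K0 p s t m r L rho : R) : 0 <= p -> p <= s -> 1 <= m -> 0 <= r -> 2^-1 <= L ->
  0 <= rho -> rho <= r -> p + 1 <= t ->  0 <= K0 ->
  (m `^ (p + 1) + K0 * (m `^ p + r `^ p + L `^ p)) * (rho + L) <=
  6 * (1 + K0) * ((m `^ t + r `^ s) * (rho + L) + L `^ (s + 1)).
Proof.
move=> p0 ps m1 r0 L2 rho0 rr pt K00.
have L0 : 0 < L by move: L2; lra.
pose v := rho + L; have v0 : 0 <= v by rewrite /v; move: rho0 L2; lra.
set M := m `^ t.
have M1 : 1 <= M by apply: le1_powR => //; move: p0 pt; lra.
have mp1 : m `^ (p + 1) <= M by exact: ler_powR.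
have mp : m `^ p <= M by apply: ler_powR => //; move: pt; lra.
have rp : r `^ p <= M + r `^ s.
  by apply: (le_trans (powR_le_add r0 p0 ps)); rewrite lerD2r.
have rs0 : 0 <= r `^ s by exact: powR_ge0.
have Lp0 : 0 <= L `^ p by exact: powR_ge0.
have Ls0 : 0 <= L `^ (s + 1) by exact: powR_ge0.
set E := (M + r `^ s) * v + L `^ (s + 1).
have Mv0 : 0 <= M * v by rewrite mulr_ge0// (le_trans ler01).
have rv0 : 0 <= r `^ s * v by rewrite mulr_ge0.
have LpE : L `^ p * v <= 4 * E.
  have [Lr|/ltW rL] := leP L rho.
    have h : L `^ p <= r `^ p.
      by apply: ge0_ler_powR; rewrite ?nnegrE ?(ltW L0)//; exact: le_trans rr.
    have := ler_wpM2r v0 (le_trans h rp); rewrite /E; move: Mv0 rv0 Ls0; lra.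
  have h1 : L `^ (p + 1) <= 1 + L `^ (s + 1).
    by apply: powR_le_add; rewrite ?(ltW L0)//; move: p0 ps; lra.
  have h2 : 1 <= 2 * (M * v).
    have : 2^-1 <= v by rewrite /v; move: L2 rho0; lra.
    have : v <= M * v by rewrite ler_peMl.
    lra.
  have h3 : L `^ p * L = L `^ (p + 1).
    by rewrite powRD ?powRr1 ?(ltW L0)//; apply/implyP => _; rewrite gt_eqF.
  have h4 : L `^ p * v <= L `^ p * (2 * L) by rewrite ler_wpM2l// /v; move: rL; lra.
  rewrite /E; move: h1 h2 h3 h4 rv0 Ls0 Mv0; lra.
have h1 : (M + r `^ s) * v <= E by rewrite /E lerDl.
have E0 : 0 <= E by apply: le_trans h1; rewrite mulrDl addr_ge0.
have h2 : (m `^ p + r `^ p + L `^ p) * v <= 6 * E.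
  have a1 := ler_wpM2r v0 mp; have a2 := ler_wpM2r v0 rp.
  by rewrite !mulrDl; move: a1 a2 LpE h1 rv0 Mv0; rewrite mulrDl; lra.
have h3 : m `^ (p + 1) * v <= E.
  by apply: (le_trans (ler_wpM2r v0 mp1)); apply: le_trans h1; rewrite mulrDl lerDl.
rewrite -/v mulrDl -mulrA.
have := ler_wpM2l K00 h2; move: h3 E0; lra.
Qed.

Variables (a q : R) (a0 : 0 < a) (a1 : a < 1) (q2 : 2 <= q).

Definition Kp : R := (3 * vC a q) `^ (2 / a - 2).
Definition Cdiff : R := 2 * (q + 1) / ck a q * (6 * (1 + Kp)).

Lemma Cdiff_gt0 : 0 < Cdiff.
Proof.
have c0 : 0 < ck a q by exact: ck_gt0.
have k0 : 0 <= Kp by exact: powR_ge0.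
have p1 : 0 < 2 * (q + 1) / ck a q by rewrite divr_gt0//; move: q2; lra.
have p2 : 0 < 6 * (1 + Kp) by move: k0; lra.
by rewrite /Cdiff (mulr_gt0 p1 p2).
Qed.

Lemma diffusion_time_ge (n : nat) (eps : R) (rho0 : probability 'rV[R]_n R) :
  (0 < n)%N -> 0 < eps -> eps <= 2^-1 -> 0 <= Rinf a rho0 -> 0 <= Rq a rho0 q -> Rq a rho0 q <= Rinf a rho0 ->
  2 * (q + 1) / ck a q * @Slev R n a q eps (Rinf a rho0) * (Rq a rho0 q + ln eps^-1) <=
  Cdiff * diffusion_time a q eps rho0.
Proof.
move=> n0 eps0 epsq r0 Rq0 Rqr.
set r := Rinf a rho0 in r0 Rqr *; set rho := Rq a rho0 q in Rq0 Rqr *; set L := ln eps^-1.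
have L2 : 2^-1 <= L by exact: L_ge.
have c0 : 0 < ck a q by exact: ck_gt0.
have m1 : 1 <= n%:R :> R by rewrite ler1n.
have v2 : 2 <= vC a q by exact: vc_ge.
have e2 : 2 <= 2 / a by rewrite ler_pdivlMr// ler_piMr// ltW.
have k0 : 0 <= Kp by exact: powR_ge0.
pose p := 2 / a - 2; have p0 : 0 <= p by rewrite subr_ge0.
have Sle : @Slev R n a q eps r <= n%:R `^ (p + 1) + Kp * (n%:R `^ p + r `^ p + L `^ p).
  rewrite /Slev /Swp /N1; apply: lerD.
    by rewrite (_ : 2 / a - 1 = p + 1)//; rewrite /p; ring.
  have -> : Plev (n := n) a q eps r `^ (1 - a) = vlev (n := n) a q eps r `^ p.
    by rewrite /Plev -powRrM; congr (_ `^ _); rewrite /p; field; rewrite gt_eqF.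
  have v0 : 0 <= vC a q by move: v2; lra.
  have L0 : 0 <= L by move: L2; lra.
  have s0 : 0 <= n%:R + r + L by rewrite !addr_ge0.
  rewrite /vlev -/L (powRM _ v0 s0) /Kp (powRM _ (ler0n R 3) v0) (mulrC (3 `^ _)) -mulrA.
  by apply: ler_wpM2l; [exact: powR_ge0|exact: powR_sum3].
have H g : 0 < g -> g <= 2 * a -> @Slev R n a q eps r * (rho + L) <=
  6 * (1 + Kp) * ((n%:R `^ (2 / g * (2 - 2 * a + g)) + r `^ ((2 - 2 * a + g) / a)) * (rho + L)
    + L `^ ((2 - a + g) / a)).
  move=> g0 g2.
  have v0 : 0 <= rho + L by move: Rq0 L2; lra.
  apply: (le_trans (ler_wpM2r v0 Sle)).
  have -> : (2 - a + g) / a = (2 - 2 * a + g) / a + 1 by field; rewrite gt_eqF.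
  apply: time_bound => //.
    rewrite /p (_ : (2 - 2 * a + g) / a = 2 / a - 2 + g / a); last by field; rewrite gt_eqF.
    by rewrite lerDl divr_ge0// ltW.
  rewrite (_ : 2 / g * (2 - 2 * a + g) = 2 + 2 * (2 - 2 * a) / g); last by field; rewrite gt_eqF.
  have : (2 - 2 * a) / a <= 2 * (2 - 2 * a) / g.
    rewrite ler_pdivlMr// mulrAC ler_pdivrMr//.
    have := ler_wpM2l (_ : 0 <= 2 - 2 * a) g2; rewrite subr_ge0 ler_piMr ?(ltW a1)// => /(_ isT); lra.
  rewrite (_ : (2 - 2 * a) / a = p); first lra.
  by rewrite /p; field; rewrite gt_eqF.
have Cg := Cdiff_gt0.
rewrite -ler_pdivrMl//; apply: lb_le_inf.
  (* A bound for every gamma passes to the infimum only over a nonempty set; the endpoint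
     [g = 2 * a] is a witness. *)
  exists (((n%:R `^ (2 / (2 * a) * (2 - 2 * a + 2 * a)) + r `^ ((2 - 2 * a + 2 * a) / a)) * (rho + L)
    + L `^ ((2 - a + 2 * a) / a))).
  by exists (2 * a) => //=; rewrite in_itv /= lexx andbT mulr_gt0.
move=> _ [g /= + <-]; rewrite in_itv /= => /andP[g0 g2].
rewrite ler_pdivrMl// /Cdiff -mulrA -[leRHS]mulrA; apply: ler_wpM2l; last exact: H.
by rewrite divr_ge0 ?(ltW c0)//; move: q2; lra.
Qed.

End diffusion_time.

Theorem corollary6 (R : realType) (a q : R) :
  0 < a -> a < 1 -> 2 <= q ->
  (exists C : R, 0 < C /\
    forall (n : nat) (eps : R) (rho0 : probability 'rV[R]_n R),
      (0 < n)%N -> 0 < eps -> eps <= q^-1 ->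
      (renyi_infty rho0 (pi_alpha n a) < +oo)%E ->
      forall T : R, C * diffusion_time a q eps rho0 <= T ->
      forall (d : measure_display) (Omega : measurableType d)
        (P : probability Omega R) (B X : R -> {RV P >-> 'rV[R]_n}),
        langevin_diffusion (V_alpha n a) rho0 B X ->
        (renyi (distribution P (X T)) (pi_alpha n a) q <= eps%:E)%E)
  /\
  (forall Ca : R, 0 < Ca ->
    (forall n, (0 < n)%N -> weak_poincare_weight (pi_alpha n a) (beta a Ca n)) ->
    exists (K : R) (p : nat), 0 < K /\
    forall (n : nat) (eps : R) (mu0 : probability 'rV[R]_n R),
      (0 < n)%N -> 0 < eps -> eps <= q^-1 ->
      (renyi_infty mu0 (pi_alpha n a) < +oo)%E ->
      1 <= m_alpha n a -> 1 <= T_lmc a q eps Ca mu0 ->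
      (1 <= R2_hat a q eps Ca mu0)%E -> (R2_hat a q eps Ca mu0 < +oo)%E ->
      exists (h : R) (N : nat),
        [/\ 0 < h,
            same_order K (log_factor a q eps Ca mu0) p
              N%:R (lmc_order a q eps Ca mu0) &
            forall (d : measure_display) (Omega : measurableType d)
              (P : probability Omega R) (xi x : nat -> {RV P >-> 'rV[R]_n}),
              langevin_monte_carlo (V_alpha n a) h mu0 xi x ->
              (renyi (distribution P (x N)) (pi_alpha n a) q <= eps%:E)%E]).
Proof.
move=> a0 a1 q2; split.
  exists (Cdiff a q); split; first exact: Cdiff_gt0.
  move=> n eps rho0 n0 eps0 epsq fin T CT d Om P B X LD.
  have epsh : eps <= 2^-1 by apply: (le_trans epsq); rewrite lef_pV2 ?posrE//; lra.
  have [u [mu u0 uM r0 uE]] := initial_density a0 a1 n0 fin.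
  have q1 : 1 < q by lra.
  have Rq0 := Rq_ge0 a0 a1 n0 mu u0 uM uE q1.
  have Rqr := Rq_le_log a0 a1 n0 mu u0 uM uE q1 (expR_gt0 _); rewrite expRK in Rqr.
  have long := le_trans (diffusion_time_ge a0 a1 q2 n0 eps0 epsh r0 Rq0 Rqr) CT.
  apply: (diffusion_renyi a0 a1 n0 q2 eps0 epsh fin LD _ long).
  (* Positivity of T follows from the lower bound on it: the weight [Slev] is at least 1 and
     [ln eps^-1] at least 1/2. *)
  apply: lt_le_trans long; rewrite mulr_gt0//.
    rewrite mulr_gt0//; first by rewrite divr_gt0 ?ck_gt0//; lra.
    by apply: (lt_le_trans ltr01); exact: Swp_ge1.
  by have := L_ge eps0 epsh; lra.
move=> Ca _ _; exists (Cm a q * KC a q + 2), (pw a); split.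
  have c0 : 0 < ck a q by exact: ck_gt0.
  have h1 : 0 <= Cm a q.
    rewrite /Cm addr_ge0// addr_ge0//; last by rewrite /CK mulr_ge0 ?expR_ge0// sqr_ge0.
    rewrite divr_ge0 ?(ltW c0)// mulr_ge0//; first by rewrite mulr_ge0//; lra.
    by rewrite /CK mulr_ge0 ?expR_ge0// sqr_ge0.
  have h2 : 0 <= Cm a q * KC a q by rewrite mulr_ge0// KC_ge0.
  by move: h2; lra.
move=> n eps mu0 n0 eps0 epsq fin _ _ R21 R2oo.
exact: lmc_complexity.
Qed.
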